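(* Let $(X,G,\omega,\mu)$ be a Hamiltonian Kähler manifold and $\mathcal{M}=\mu^{-1}(0)$. For every point $x\in\mathcal{M}$ there exist an open $G$-stable neighborhood $Y$ of $x$ in $X$ and a $G$-invariant potential $\rho:Y\to\mathbb{R}$ by which $\omega|_Y$ and $\mu|_Y$ are given; that is, $\rho$ is a smooth $G$-invariant strictly plurisubharmonic function on $Y$ with $\omega|_Y=dd^c\rho$ and $\mu^v|_Y=-\imath_{\tilde v}d^c\rho$ for every $v\in\mathrm{Lie}(G)$.
   Context: Hamiltonian Kähler manifold $(X,G,\omega,\mu)$: $(X,\omega)$ is a Kähler manifold, $G$ is a closed Lie subgroup of the group of holomorphic isometries of the Kähler structure (so $G$ acts properly on $X$ by holomorphic transformations preserving $\omega$), and $\mu:X\to \mathrm{Lie}(G)^*$ is a momentum map, i.e. a $G$-equivariant smooth map ($\mathrm{Lie}(G)^*$ carrying the coadjoint action) such that for every $v\in \mathrm{Lie}(G)$ the component function $\mu^v(x)=\mu(x)(v)$ satisfies $d\mu^v=\imath_{\tilde v}\omega$, where $\tilde v$ is the vector field on $X$ induced by $v$ through the $G$-action. Convention: $d^c=\frac{1}{2i}(\partial-\bar\partial)$, so that $dd^c=i\partial\bar\partial$. *)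

(* Defs.v *)
From HB Require Import structures.
From mathcomp Require Import all_boot all_order all_algebra.
From mathcomp Require Import all_classical all_reals all_analysis.
From mathcomp Require Import complex.
Set Implicit Arguments.
Unset Strict Implicit.
Unset Printing Implicit Defensive.
Import Order.TTheory GRing.Theory Num.Theory.
Import numFieldNormedType.Exports.
Local Open Scope classical_set_scope.
Local Open Scope ring_scope.

#[short(type="topGroupType")]
HB.structure Definition TopGroup := {G of Topological G & Group G}.

(** On an open subset [A] of a finite-dimensional space, [C_k] is equivalent to
    the existence and continuity on [A] of all iterated directional derivatives
    of order at most [k]. Values of [f] outside [A] are irrelevant. *)
Fixpoint C_k (R : realType) (V W : normedModType R) (k : nat) (A : set V)
    (f : V -> W) : Prop :=
  (forall u, A u -> {for u, continuous f}) /\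
  (if k is k'.+1 then
     forall v, (forall u, A u -> derivable f u v) /\
               C_k k' A (fun u => 'D_v f u)
   else True).

Definition smooth_on (R : realType) (V W : normedModType R) (A : set V)
    (f : V -> W) : Prop := forall k, C_k k A f.

(** An atlas indexed by the points of [X], the chart of index [a] being defined
    near [a]. [chart M a] is meaningful on [chart_dom M a] only, and [ichart M a]
    (its inverse) on the image [chart_im M a] only.

    The tangent space at [x] is identified with ['rV[R]_m] through the chart of
    index [x]; this is the meaning of the vector arguments of all differentials
    and differential forms below. *)
Record charts (R : realType) (m : nat) (X : topologicalType) := Charts {
  chart_dom : X -> set X;
  chart : X -> X -> 'rV[R]_m;
  ichart : X -> 'rV[R]_m -> X }.

Definition chart_im (R : realType) (m : nat) (X : topologicalType)
    (M : charts R m X) (a : X) : set 'rV[R]_m :=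
  chart M a @` chart_dom M a.

Record is_manifold (R : realType) (m : nat) (X : topologicalType)
    (M : charts R m X) : Prop := {
  manifold_hausdorff : hausdorff_space X;
  manifold_second_countable : @second_countable X;
  chart_dom_center : forall a, chart_dom M a a;
  chart_dom_open : forall a, open (chart_dom M a);
  chart_im_open : forall a, open (chart_im M a);
  chartK : forall a x, chart_dom M a x -> ichart M a (chart M a x) = x;
  chart_continuous : forall a x, chart_dom M a x ->
    {for x, continuous (chart M a)};
  ichart_continuous : forall a u, chart_im M a u ->
    {for u, continuous (ichart M a)};
  transition_smooth : forall a b,
    smooth_on (chart M a @` (chart_dom M a `&` chart_dom M b))
              (chart M b \o ichart M a) }.

Definition prod_charts (R : realType) (m p : nat) (X Y : topologicalType)
    (M : charts R m X) (N : charts R p Y) : charts R (m + p) (X * Y)%type :=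
  {| chart_dom := fun a => chart_dom M a.1 `*` chart_dom N a.2;
     chart := fun a z => row_mx (chart M a.1 z.1) (chart N a.2 z.2);
     ichart := fun a u => (ichart M a.1 (lsubmx u), ichart N a.2 (rsubmx u)) |}.

Definition smooth_map (R : realType) (m p : nat) (X Y : topologicalType)
    (M : charts R m X) (N : charts R p Y) (F : X -> Y) : Prop :=
  continuous F /\
  forall a b, smooth_on (chart M a @` (chart_dom M a `&` F @^-1` chart_dom N b))
                        (chart N b \o F \o ichart M a).

(** The differential [T_x X -> T_(F x) Y]. *)
Definition tdiff (R : realType) (m p : nat) (X Y : topologicalType)
    (M : charts R m X) (N : charts R p Y) (F : X -> Y) (x : X)
    (v : 'rV[R]_m) : 'rV[R]_p :=
  'D_v (chart N (F x) \o F \o ichart M x) (chart M x x).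

Section forms.
Variables (R : realType) (m : nat) (X : topologicalType) (M : charts R m X).
Implicit Types (f : X -> R) (x a : X) (u v w : 'rV[R]_m).

Definition form1 := X -> 'rV[R]_m -> R.
Definition form2 := X -> 'rV[R]_m -> 'rV[R]_m -> R.

Definition smooth_fun_on (Y : set X) f : Prop :=
  forall a, smooth_on (chart M a @` (chart_dom M a `&` Y)) (f \o ichart M a).

Definition d0 f : form1 := fun x v => 'D_v (f \o ichart M x) (chart M x x).

(** The element of the tangent space at [ichart M a u] with coordinates [v] in
    the chart of index [a]. *)
Definition tvec a u v : 'rV[R]_m := 'D_v (chart M (ichart M a u) \o ichart M a) u.

(** The coefficients of a form in the chart of index [a]. *)
Definition coef1 (al : form1) a v u : R := al (ichart M a u) (tvec a u v).
Definition coef2 (om : form2) a v w u : R :=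
  om (ichart M a u) (tvec a u v) (tvec a u w).

(** Exterior derivatives, computed at [x] in the chart of index [x] by extending
    the arguments to vector fields with constant coefficients, whose brackets
    vanish; normalized by [d al (V, W) = V (al W) - W (al V) - al [V, W]]. *)
Definition d1 (al : form1) : form2 := fun x v w =>
  'D_v (coef1 al x w) (chart M x x) - 'D_w (coef1 al x v) (chart M x x).

Definition d2 (om : form2) x v1 v2 v3 : R :=
  'D_v1 (coef2 om x v2 v3) (chart M x x)
  - 'D_v2 (coef2 om x v1 v3) (chart M x x)
  + 'D_v3 (coef2 om x v1 v2) (chart M x x).

Record is_smooth_form2 (om : form2) : Prop := {
  form2_linear : forall x v, linear (om x v : 'rV[R]_m -> R^o);
  form2_antisym : forall x v w, om x w v = - om x v w;
  form2_smooth : forall a v w, smooth_on (chart_im M a) (coef2 om a v w) }.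

End forms.

(** Multiplication by [i] on [C^n = R^n + i R^n]. *)
Definition mul_i (R : realType) (n : nat) (v : 'rV[R]_(n + n)) : 'rV[R]_(n + n) :=
  row_mx (- rsubmx v) (lsubmx v).

Section complex_manifolds.
Variables (R : realType) (n : nat) (X : topologicalType).
Variable M : charts R (n + n) X.
Implicit Types (f : X -> R) (x : X) (v w : 'rV[R]_(n + n)).

Record is_complex_manifold : Prop := {
  complex_manifold_manifold : is_manifold M;
  transition_holomorphic : forall a b u v,
    (chart M a @` (chart_dom M a `&` chart_dom M b)) u ->
    'D_(mul_i v) (chart M b \o ichart M a) u =
    mul_i ('D_v (chart M b \o ichart M a) u) }.

Definition holomorphic_map (F : X -> X) : Prop :=
  smooth_map M M F /\
  forall x v, tdiff M M F x (mul_i v) = mul_i (tdiff M M F x v).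

(** The (1,0)- and (0,1)-parts of [d f]. *)
Definition del f x v : R[i] :=
  ((d0 M f x v)%:C - 'i * (d0 M f x (mul_i v))%:C)%C / 2%:R.
Definition delbar f x v : R[i] :=
  ((d0 M f x v)%:C + 'i * (d0 M f x (mul_i v))%:C)%C / 2%:R.

(** The value under [complex.Re] is real, see [dcE]. *)
Definition dc f : form1 R (n + n) X := fun x v =>
  complex.Re ((2%:R * 'i%C)^-1 * (del f x v - delbar f x v)).

Definition ddc f : form2 R (n + n) X := d1 M (dc f).

Lemma dcE f x v :
  (2%:R * 'i%C)^-1 * (del f x v - delbar f x v) =
  (- (2%:R^-1 * d0 M f x (mul_i v)))%:C%C.
Proof.
rewrite /del /delbar; set a := (d0 M f x v)%:C%C.
set b := d0 M f x (mul_i v).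
have i0 : 'i%C != 0 :> R[i] by rewrite eq_complex /= oner_eq0 andbF.
have two0 : 2%:R != 0 :> R[i] by rewrite pnatr_eq0.
have -> : (a - 'i%C * b%:C%C) / 2%:R - (a + 'i%C * b%:C%C) / 2%:R
          = - ('i%C * b%:C%C).
  rewrite -mulrBl opprD addrACA subrr add0r -opprD -mulr2n mulNr.
  by congr (- _); rewrite -[X in X / _]mulr_natr mulfK.
rewrite mulrN invfM -mulrA mulKf //.
by rewrite rmorphN rmorphM fmorphV rmorph_nat.
Qed.

Definition strictly_psh_on (Y : set X) f : Prop :=
  smooth_fun_on M Y f /\
  forall y v, Y y -> v != 0 -> 0 < ddc f y v (mul_i v).

Record is_kahler (om : form2 R (n + n) X) : Prop := {
  kahler_complex : is_complex_manifold;
  kahler_form : is_smooth_form2 M om;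
  kahler_closed : forall x v1 v2 v3, d2 M om x v1 v2 v3 = 0;
  kahler_mul_i : forall x v w, om x (mul_i v) (mul_i w) = om x v w;
  kahler_pos : forall x v, v != 0 -> 0 < om x v (mul_i v) }.

Definition kahler_metric (om : form2 R (n + n) X) : form2 R (n + n) X :=
  fun x v w => om x v (mul_i w).

Definition holomorphic_isometries (om : form2 R (n + n) X) : set (X -> X) :=
  [set F | holomorphic_map F /\
     (exists F', [/\ cancel F F', cancel F' F & holomorphic_map F']) /\
     forall x v w,
       kahler_metric om (F x) (tdiff M M F x v) (tdiff M M F x w) =
       kahler_metric om x v w].

End complex_manifolds.

Record is_lie_group (R : realType) (k : nat) (G : topGroupType)
    (MG : charts R k G) : Prop := {
  lie_group_manifold : is_manifold MG;
  lie_group_mul : smooth_map (prod_charts MG MG) MG (fun p => (p.1 * p.2)%g);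
  lie_group_inv : smooth_map MG MG (fun g => (g^-1)%g) }.

Section hamiltonian.
Variables (R : realType) (n k : nat) (X : topologicalType).
Variables (M : charts R (n + n) X) (om : form2 R (n + n) X).
Variables (G : topGroupType) (MG : charts R k G) (act : G -> X -> X).

(** [act] identifies the Lie group [G] with a subgroup of the holomorphic
    isometries, closed for the compact-open topology and carrying the induced
    topology. *)
Record is_closed_lie_subgroup : Prop := {
  closed_subgroup_lie : is_lie_group MG;
  act_one : act 1%g = id;
  act_mul : forall g h, act (g * h)%g = act g \o act h;
  act_inj : injective act;
  act_isometry : forall g, holomorphic_isometries M om (act g);
  act_induced : forall U : set G, open U <->
    exists2 V : set {compact-open, X -> X}, open V & U = act @^-1` V;
  act_closed : exists2 C : set {compact-open, X -> X}, closed C &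
    range act = C `&` holomorphic_isometries M om;
  act_smooth : smooth_map (prod_charts MG M) M (fun p => act p.1 p.2);
  act_proper : forall K : set (X * X)%type, compact K ->
    compact ((fun p : G * X => (act p.1 p.2, p.2)) @^-1` K) }.

(** [Lie(G)] is the tangent space ['rV[R]_k] of [G] at [1]. *)
Definition induced_field (v : 'rV[R]_k) (x : X) : 'rV[R]_(n + n) :=
  tdiff MG M (fun g => act g x) 1%g v.

Definition Ad (g : G) (v : 'rV[R]_k) : 'rV[R]_k :=
  tdiff MG MG (fun h => g * h * g^-1)%g 1%g v.

Record is_momentum_map (mu : X -> {linear 'rV[R]_k -> R^o}) : Prop := {
  momentum_smooth : forall v, smooth_fun_on M setT (fun x => mu x v : R);
  momentum_equivariant : forall g x v, mu (act g x) v = mu x (Ad (g^-1)%g v);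
  momentum_diff : forall v x w,
    d0 M (fun x => mu x v : R) x w = om x (induced_field v x) w }.

Record hamiltonian_kahler (mu : X -> {linear 'rV[R]_k -> R^o}) : Prop := {
  hamiltonian_is_kahler : is_kahler M om;
  hamiltonian_group : is_closed_lie_subgroup;
  hamiltonian_momentum : is_momentum_map mu }.

Definition zero_level (mu : X -> {linear 'rV[R]_k -> R^o}) : set X :=
  [set x | forall v, mu x v = 0].

Record is_invariant_potential (mu : X -> {linear 'rV[R]_k -> R^o})
    (Y : set X) (rho : X -> R) : Prop := {
  potential_psh : strictly_psh_on M Y rho;
  potential_invariant : forall g y, Y y -> rho (act g y) = rho y;
  potential_form : forall y v w, Y y -> om y v w = ddc M rho y v w;
  potential_momentum : forall v y, Y y ->
    mu y v = - dc M rho y (induced_field v y) }.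

End hamiltonian.

(* Main.v *)
(** Near [x] the form is [dd^c rho0]: the Poincare lemma gives a primitive of [om], and the
    dbar-equation in one variable, solved coordinate by coordinate with the Cauchy kernel,
    turns it into [d^c rho0] up to an exact form. A pluriharmonic quadratic correction makes
    [rho0] critical at [x] with Hessian of type (1,1), and averaging over the compact
    stabilizer [K] of [x] makes it [K]-invariant.

    For [v] in Lie(G) put [p_v = - v~ rho0] and [q_v = 2 mu^v - (J v~) rho0]; then
    [p_v - i q_v] is holomorphic, and one looks for a pluriharmonic [r] with [v~ r = p_v] and
    [(J v~) r = q_v], so that [rho = rho0 + r] is annihilated by all [v~] and induces [mu].
    Both functions vanish if [v] lies in Lie(K). As [mu] vanishes at [x], the orbit of [x] is
    isotropic, and the Hessian of [rho0] is therefore nondegenerate in the complexified orbit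
    directions: the functions [p_v], [q_v], for [v] in a complement of Lie(K), are transverse
    to the corresponding fields. Along these fields the equations are solved by an explicit
    alternating series of iterated derivatives, convergent by the Cauchy estimates; the
    bracket relations put the remaining defect in every power of the ideal generated by the
    [p_v] and [q_v], so that it has a vanishing Taylor series at [x], hence is zero.

    After a second average over [K] the function is constant along the pieces of orbits near
    [x], by properness of the action, and extends to the saturation of a small ball. *)
Require Import Defs.
From HB Require Import structures.
From mathcomp Require Import all_boot all_order all_algebra.
From mathcomp Require Import all_classical all_reals all_analysis.
From mathcomp Require Import ring lra.
Set Implicit Arguments.
Unset Strict Implicit.
Unset Printing Implicit Defensive.
Import Order.TTheory GRing.Theory Num.Theory.
Import numFieldNormedType.Exports.
Local Open Scope classical_set_scope.
Local Open Scope ring_scope.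

(** * Smooth functions on open sets *)

(** Holomorphic functions are pairs of real functions with the Cauchy-Riemann equations, and no
    power series is expanded. Analyticity enters only through Cauchy estimates along complex lines:
    m of them on radii proportional to 1/m cost m^m, which the m! of a Taylor remainder or of an
    exponential series absorbs. The obstacle is that the fields v~ need not commute and that their
    rank may jump at x, so that in general no coordinates straighten the orbits. Their substitute is
    the ideal of the transverse functions z, together with a field E in the span of the v~ and J v~
    such that E z = z. The equation along E alone is solved by a sum of z_i R_i, where R_i is
    formally the integral over s in [0, 1] of exp(- s T) h_i, and T is E with its coefficients z
    frozen to independent variables y. The other equations follow: E acts on the m-th power of the
    ideal as m modulo the next power, while the brackets make it act on the defects as -1 or 0.
    Neither an exponential map of G nor a Haar measure is constructed: powers of elements close to 1
    and averages over finite lists take their place. *)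

Section Ck.
Context {R : realType} {V W : normedModType R}.
Implicit Types (f g : V -> W) (A B : set V).

Lemma open_near A u (P : V -> Prop) : open A -> A u ->
  (forall y, A y -> P y) -> \forall y \near u, P y.
Proof. by move=> oA Au AP; apply: filterS (open_nbhs_nbhs (conj oA Au)). Qed.

Lemma C_k_eq k A f g : open A -> (forall u, A u -> f u = g u) ->
  C_k k A f -> C_k k A g.
Proof.
move=> oA; elim: k f g => [|k IH] f g fg /= [fc fd].
  split=> // u Au; have fgn := open_near oA Au fg.
  have gc : f y @[y --> u] --> g u by rewrite -(fg u Au); apply: fc.
  by apply: cvg_trans gc; apply: near_eq_cvg.
split=> [u Au|v].
  have fgn := open_near oA Au fg.
  have gc : f y @[y --> u] --> g u by rewrite -(fg u Au); apply: fc.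
  by apply: cvg_trans gc; apply: near_eq_cvg.
have [fd1 fd2] := fd v; split=> [u Au|].
  exact: near_eq_derivable (open_near oA Au fg) (fd1 u Au).
apply: IH fd2 => u Au; apply: near_eq_derive; exact: open_near fg.
Qed.

Lemma C_k_sub k A B f : B `<=` A -> C_k k A f -> C_k k B f.
Proof.
move=> BA; elim: k f => [|k IH] f /= [fc fd]; split=> //.
- by move=> u /BA; apply: fc.
- by move=> u /BA; apply: fc.
- by move=> v; have [d1 d2] := fd v; split=> [u /BA|]; [apply: d1|apply: IH].
Qed.

Lemma C_k_continuous k A f u : C_k k A f -> A u -> {for u, continuous f}.
Proof. by case: k => [|k] [fc _]; apply: fc. Qed.

Lemma C_kS k A f : C_k k.+1 A f -> C_k k A f.
Proof.
elim: k f => [|k IH] f [fc fd]; split=> // v.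
by have [d1 d2] := fd v; split=> //; apply: IH.
Qed.

(** [C_k] tests, at the points of [A] only, functions and derivatives that live on the whole space,
    so it is a conjunction over points. *)
Lemma C_k_pointwise k A f : (forall u, A u -> C_k k [set u] f) -> C_k k A f.
Proof.
elim: k f => [|k IH] f fA; split=> //.
- by move=> u Au; have [fc _] := fA u Au; apply: fc.
- by move=> u Au; have [fc _] := fA u Au; apply: fc.
- move=> v; split=> [u Au|].
    by have [_ fd] := fA u Au; have [d1 _] := fd v; apply: d1.
  by apply: IH => u Au; have [_ fd] := fA u Au; have [] := fd v.
Qed.

Lemma C_k_cst k A (c : W) : C_k k A (fun=> c).
Proof.
elim: k c => [|k IH] c; split=> //; try by move=> u _; apply: cst_continuous.
move=> v; split=> [u _|]; first exact: derivable_cst.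
by rewrite (_ : 'D_v _ = fun=> 0) //; apply/funext => u; rewrite derive_cst.
Qed.

Lemma C_kD k A f g : open A -> C_k k A f -> C_k k A g ->
  C_k k A (fun u => f u + g u).
Proof.
move=> oA; elim: k f g => [|k IH] f g [fc fd] [gc gd]; split=> //.
- by move=> u Au; apply: cvgD; [apply: fc|apply: gc].
- by move=> u Au; apply: cvgD; [apply: fc|apply: gc].
- move=> v; have [f1 f2] := fd v; have [g1 g2] := gd v; split=> [u Au|].
    by apply: derivableD; [apply: f1|apply: g1].
  apply: C_k_eq oA _ (IH _ _ f2 g2) => u Au.
  by rewrite -deriveD //; [apply: f1|apply: g1].
Qed.

Lemma C_kZ k A f (c : R) : open A -> C_k k A f -> C_k k A (fun u => c *: f u).
Proof.
move=> oA; elim: k f => [|k IH] f [fc fd]; split=> //.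
- by move=> u Au; apply: cvgZl_tmp; exact: fc.
- by move=> u Au; apply: cvgZl_tmp; exact: fc.
- move=> v; have [f1 f2] := fd v; split=> [u Au|].
    by apply: derivableZ; apply: f1.
  apply: (C_k_eq oA _ (IH _ f2)) => u Au.
  by have := deriveZ c (f1 u Au) => /= <-.
Qed.

Lemma C_k_linear k A f : linear f -> continuous f -> C_k k A f.
Proof.
move=> fl fc; pose fL : {linear V -> W} :=
  HB.pack f (GRing.isLinear.Build _ _ _ _ f fl).
case: k => [|k]; split=> //; try by move=> u _; apply: fc.
have df u : differentiable f u by apply: (@linear_differentiable _ V W fL).
move=> v; split=> [u _|]; first exact: diff_derivable.
rewrite (_ : 'D_v f = fun=> f v); first exact: C_k_cst.
apply/funext => u; rewrite deriveE //.
by have /(congr1 (fun h => h v)) := (@diff_lin _ V W fL u fc).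
Qed.

Lemma smooth_eq A f g : open A -> (forall u, A u -> f u = g u) ->
  smooth_on A f -> smooth_on A g.
Proof. by move=> oA fg sf k; apply: C_k_eq (sf k). Qed.

Lemma smooth_sub A B f : B `<=` A -> smooth_on A f -> smooth_on B f.
Proof. by move=> BA sf k; apply: C_k_sub (sf k). Qed.

Lemma smooth_pointwise A f : (forall u, A u -> smooth_on [set u] f) ->
  smooth_on A f.
Proof. by move=> fA k; apply: C_k_pointwise => u Au; apply: fA. Qed.

Lemma smooth_local A f : (forall u, A u ->
  exists B, [/\ B u & smooth_on B f]) -> smooth_on A f.
Proof.
move=> fA; apply: smooth_pointwise => u /fA[B [Bu]].
by apply: smooth_sub => _ ->.
Qed.

Lemma smooth_continuous A f u : smooth_on A f -> A u -> {for u, continuous f}.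
Proof. by move=> sf; apply: C_k_continuous (sf 0%N). Qed.

Lemma smooth_derivable A f u v : smooth_on A f -> A u -> derivable f u v.
Proof. by move=> /(_ 1%N)[_ /(_ v)[d _]]; apply: d. Qed.

Lemma smooth_derive A f v : smooth_on A f -> smooth_on A ('D_v f).
Proof. by move=> sf k; have [_ /(_ v)[]] := sf k.+1. Qed.

Lemma smooth_cst A (c : W) : smooth_on A (fun=> c).
Proof. by move=> k; apply: C_k_cst. Qed.

Lemma smoothD A f g : open A -> smooth_on A f -> smooth_on A g ->
  smooth_on A (fun u => f u + g u).
Proof. by move=> oA sf sg k; apply: C_kD. Qed.

Lemma smoothZ A f (c : R) : open A -> smooth_on A f ->
  smooth_on A (fun u => c *: f u).
Proof. by move=> oA sf k; apply: C_kZ. Qed.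

Lemma smoothN A f : open A -> smooth_on A f -> smooth_on A (fun u => - f u).
Proof.
by move=> oA /(smoothZ (-1) oA); apply: smooth_eq => // u _; rewrite scaleN1r.
Qed.

Lemma smoothB A f g : open A -> smooth_on A f -> smooth_on A g ->
  smooth_on A (fun u => f u - g u).
Proof. by move=> oA sf sg; apply: smoothD => //; apply: smoothN. Qed.

Lemma smooth_sum A (I : Type) (s : seq I) (P : pred I) (F : I -> V -> W) :
  open A -> (forall i, P i -> smooth_on A (F i)) ->
  smooth_on A (fun u => \sum_(i <- s | P i) F i u).
Proof.
move=> oA sF; elim: s => [|i s IH].
  by apply: smooth_eq oA _ (smooth_cst A 0) => u _; rewrite big_nil.
have [Pi|Pi] := boolP (P i).
  apply: smooth_eq oA _ (smoothD oA (sF i Pi) IH) => u _.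
  by rewrite big_cons Pi.
by apply: smooth_eq oA _ IH => u _; rewrite big_cons (negbTE Pi).
Qed.

Lemma smooth_linear A f : linear f -> continuous f -> smooth_on A f.
Proof. by move=> fl fc k; apply: C_k_linear. Qed.

End Ck.

Lemma cvg_sumr {R : realType} {V : normedModType R} {T : Type}
    (F : set_system T) {FF : Filter F} (I : Type) (s : seq I) (f : I -> T -> V)
    (l : I -> V) : (forall i, f i x @[x --> F] --> l i) ->
  \sum_(i <- s) f i x @[x --> F] --> \sum_(i <- s) l i.
Proof.
move=> fl; elim: s => [|i s IH].
  by under eq_fun do rewrite big_nil; rewrite big_nil; apply: cvg_cst.
by under eq_fun do rewrite big_cons; rewrite big_cons; apply: cvgD.
Qed.

Section derive_line.
Context {R : realType} {V W : normedModType R}.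

Lemma derive_line_quotient (f : V -> W) x v (t : R) :
  (fun h : R => h^-1 *: (((fun s : R => f (x + s *: v)) \o shift t) (h *: 1)
     - f (x + t *: v))) =
  (fun h => h^-1 *: ((f \o shift (x + t *: v)) (h *: v) - f (x + t *: v))).
Proof.
apply/funext => h /=; congr (_ *: (f _ - _)).
by rewrite [h *: 1]mulr1 scalerDl addrCA.
Qed.

Lemma derivable_line (f : V -> W) x v (t : R) :
  derivable f (x + t *: v) v <-> derivable (fun s : R => f (x + s *: v)) t 1.
Proof. by rewrite /derivable derive_line_quotient. Qed.

Lemma derive_line (f : V -> W) x v (t : R) :
  'D_1 (fun s : R => f (x + s *: v)) t = 'D_v f (x + t *: v).
Proof. by rewrite /derive derive_line_quotient. Qed.

End derive_line.

(** Only a directional derivative of [f] is at hand, so the one-variable chain rule is applied to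
    the restriction of [f] to the line through [u] in direction [v]. *)
Lemma is_derive_comp1 {R : realType} {V : normedModType R}
    (phi : R -> R) (f : V -> R) u v : derivable f u v ->
  derivable phi (f u) 1 ->
  is_derive u v (fun u => phi (f u)) ('D_1 phi (f u) * 'D_v f u).
Proof.
have fE (g : V -> R) : derivable g u v <-> derivable (fun s : R => g (u + s *: v)) 0 1.
  by rewrite -derivable_line scale0r addr0.
have dE (g : V -> R) : 'D_v g u = 'D_1 (fun s : R => g (u + s *: v)) 0.
  by rewrite derive_line scale0r addr0.
move=> /fE df dp; set g := (fun s : R => f (u + s *: v)) in df.
have dp' : derivable phi (g 0) 1 by rewrite /g scale0r addr0.
have E := @derive1_comp R g phi 0 df dp'.
apply: DeriveDef.
  apply/fE; have := @differentiable_comp R R R R g phi 0.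
  by move=> dc; apply/derivable1_diffP; apply: dc; apply/derivable1_diffP.
rewrite [LHS]dE [X in _ * X]dE -!derive1E.
by move: E; rewrite /g /= scale0r addr0; apply.
Qed.

Section Ck_real.
Context {R : realType} {V : normedModType R}.
Implicit Types (f g : V -> R) (A : set V).

Lemma C_kM k A f g : open A -> C_k k A f -> C_k k A g ->
  C_k k A (fun u => f u * g u).
Proof.
move=> oA; elim: k f g => [|k IH] f g Cf Cg.
  by have [fc _] := Cf; have [gc _] := Cg; split=> // u Au;
    apply: cvgM; [apply: fc|apply: gc].
have [fc fd] := Cf; have [gc gd] := Cg.
split=> [u Au|v]; first by apply: cvgM; [apply: fc|apply: gc].
have [f1 f2] := fd v; have [g1 g2] := gd v; split=> [u Au|].
  by apply: derivableM; [apply: f1|apply: g1].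
apply: C_k_eq oA _ (C_kD oA (IH _ _ (C_kS Cf) g2) (IH _ _ f2 (C_kS Cg))) => u Au.
rewrite (deriveM (f1 u Au) (g1 u Au)) /=.
by rewrite /GRing.scale /= [X in _ = _ + X]mulrC.
Qed.

Lemma smoothM A f g : open A -> smooth_on A f -> smooth_on A g ->
  smooth_on A (fun u => f u * g u).
Proof. by move=> oA sf sg k; apply: C_kM. Qed.

Lemma C_kV k A f : open A -> (forall u, A u -> f u != 0) -> C_k k A f ->
  C_k k A (fun u => (f u)^-1).
Proof.
move=> oA f0; elim: k => [|k IH] Cf.
  by have [fc _] := Cf; split=> // u Au; apply: cvgV; [exact: f0|apply: fc].
have [fc fd] := Cf; have Ci := IH (C_kS Cf).
split=> [u Au|v]; first by apply: cvgV; [exact: f0|apply: fc].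
have [f1 f2] := fd v; split=> [u Au|].
  by apply: derivableV; [exact: f0|apply: f1].
apply: C_k_eq oA _ (C_kZ (-1) oA (C_kM oA (C_kM oA Ci Ci) f2)) => u Au.
rewrite (deriveV (f0 u Au) (f1 u Au)) scaleNr scale1r /GRing.scale /=.
by rewrite mulNr -exprVn expr2.
Qed.

Lemma smoothV A f : open A -> (forall u, A u -> f u != 0) -> smooth_on A f ->
  smooth_on A (fun u => (f u)^-1).
Proof. by move=> oA f0 sf k; apply: C_kV. Qed.

Lemma smooth_prod A (I : Type) (s : seq I) (P : pred I) (F : I -> V -> R) :
  open A -> (forall i, P i -> smooth_on A (F i)) ->
  smooth_on A (fun u => \prod_(i <- s | P i) F i u).
Proof.
move=> oA sF; elim: s => [|i s IH].
  by apply: smooth_eq oA _ (smooth_cst A (1 : R)) => u _; rewrite big_nil.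
have [Pi|Pi] := boolP (P i).
  apply: smooth_eq oA _ (smoothM oA (sF i Pi) IH) => u _.
  by rewrite big_cons Pi.
by apply: smooth_eq oA _ IH => u _; rewrite big_cons (negbTE Pi).
Qed.

Lemma C_k_comp1 k A (B : set R) (phi : R -> R) f : open A ->
  (forall u, A u -> B (f u)) -> C_k k B phi -> C_k k A f ->
  C_k k A (fun u => phi (f u)).
Proof.
move=> oA AB; elim: k phi => [|k IH] phi Cp Cf.
  by have [fc _] := Cf; have [pc _] := Cp; split=> // u Au;
    apply: continuous_comp; [apply: fc|apply: pc; apply: AB].
have [fc fd] := Cf; have [pc pd] := Cp.
split=> [u Au|v]; first by apply: continuous_comp; [apply: fc|apply: pc; apply: AB].
have [p1 p2] := pd 1; have [f1 f2] := fd v.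
have E u : A u -> is_derive u v (fun u => phi (f u)) ('D_1 phi (f u) * 'D_v f u).
  by move=> Au; apply: is_derive_comp1; [apply: f1|apply/p1/AB].
split=> [u Au|]; first by case: (E u Au).
apply: C_k_eq oA _ (C_kM oA (IH _ p2 (C_kS Cf)) f2) => u Au.
by case: (E u Au) => _ <-.
Qed.

Lemma smooth_comp1 A (B : set R) (phi : R -> R) f : open A ->
  (forall u, A u -> B (f u)) -> smooth_on B phi -> smooth_on A f ->
  smooth_on A (fun u => phi (f u)).
Proof. by move=> oA AB sp sf k; apply: C_k_comp1 AB _ _. Qed.

End Ck_real.

(** * Continuous partial derivatives imply differentiability *)

Section differentiable.
Context {R : realType} {m : nat}.
Local Notation V := 'rV[R]_m.
Implicit Types (f : V -> R) (A : set V) (u v w : V).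

Local Notation "''e_' i" := (delta_mx 0 i : V) (at level 8, format "''e_' i").

Lemma rV_norm_le u (e : R) : 0 <= e -> (forall i, `|u 0 i| <= e) -> `|u| <= e.
Proof.
move=> e0 ue; rewrite [`|u|]/Num.Def.normr /= mx_normrE; apply/bigmax_leP; split=> //=.
by case=> i j _ /=; rewrite ord1.
Qed.

Lemma rV_norm_coord u i : `|u 0 i| <= `|u|.
Proof.
rewrite [`|u|]/Num.Def.normr /= mx_normrE.
exact: (le_bigmax _ (fun ij : 'I_1 * 'I_m => `|u ij.1 ij.2|) (0, i)).
Qed.

Lemma rV_norm_lt u (e : R) : 0 < e -> (forall i, `|u 0 i| < e) -> `|u| < e.
Proof.
move=> e0 ue; rewrite [`|u|]/Num.Def.normr /= mx_normrE; apply/bigmax_ltP; split=> //=.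
by case=> i j _ /=; rewrite ord1.
Qed.

(* The increment of [f] is telescoped along the coordinates. *)
Lemma C1_estimate f A u : open A -> A u -> C_k 1 A f -> forall e : R, 0 < e ->
  \forall h \near (0 : V),
    `|f (u + h) - f u - \sum_i h 0 i * 'D_'e_i f u| <= e * `|h|.
Proof.
move=> oA Au [_ fd] e e0.
(* Each of the [m] coordinate steps costs at most [e' * |h|]; the denominator [m.+1] is also nonzero
   for [m = 0]. *)
pose e' := e / m.+1%:R; have e'0 : 0 < e' by rewrite divr_gt0.
have H : \forall y \near u, A y /\ forall i, `|'D_'e_i f y - 'D_'e_i f u| < e'.
  apply: filterI; first exact: (open_nbhs_nbhs (conj oA Au)).
  have Hi i : \forall y \near u, `|'D_'e_i f y - 'D_'e_i f u| < e'.
    have [_ [dc _]] := fd 'e_i; have /cvgrPdist_lt /(_ _ e'0) := dc u Au.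
    by apply: filterS => y; rewrite distrC.
  exact: (filter_forall _ Hi).
have /nbhs_ballP[r /= r0 Hr] := H.
apply/nbhs_ballP; exists r => //= h; rewrite -ball_normE /= sub0r normrN => hr.
pose T k : V := \row_i (if (i < k)%N then h 0 i else 0).
have TS (k : 'I_m) : T k.+1 = T k + h 0 k *: 'e_k.
  apply/rowP => i; rewrite !mxE eqxx /= ltnS leq_eqVlt (inj_eq val_inj).
  have [->|] := eqVneq i k; first by rewrite ltnn mulr1 add0r.
  by move=> _ /=; rewrite mulr0 addr0.
have T0 : T 0%N = 0 by apply/rowP => i; rewrite !mxE.
have Tm : T m = h by apply/rowP => i; rewrite !mxE ltn_ord.
have step (k : 'I_m) : `|f (u + T k.+1) - f (u + T k) - h 0 k * 'D_'e_k f u|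
    <= e' * `|h|.
  pose g (s : R) := f (u + T k + s *: 'e_k).
  have bd (s : R) : `|s| <= `|h| -> ball u r (u + T k + s *: 'e_k).
    move=> sh; rewrite -ball_normE /= -addrA opprD addNKr normrN.
    apply: rV_norm_lt => // i; rewrite !mxE eqxx /=.
    have [ik|ik] := ltnP i k.
      rewrite (_ : i == k = false) ?mulr0 ?addr0; last first.
        by apply/negbTE; rewrite -(inj_eq val_inj) neq_ltn ik.
      exact: le_lt_trans (rV_norm_coord _ _) hr.
    rewrite add0r; case: eqP => _; rewrite ?mulr1 ?mulr0 ?normr0 //.
    exact: le_lt_trans hr.
  have dg (s : R) : `|s| <= `|h| -> is_derive s 1 g ('D_'e_k f (u + T k + s *: 'e_k)).
    move=> /bd /Hr[Ay _]; have [fd1 _] := fd 'e_k.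
    by apply: DeriveDef; [apply/derivable_line/fd1|rewrite derive_line].
  have hk := rV_norm_coord h k.
  have key (a b c : R) : c \in `[a, b]%R -> `|a| <= `|h| -> `|b| <= `|h| -> `|c| <= `|h|.
    rewrite in_itv /= !ler_norml => /andP[ac cb] /andP[a1 a2] /andP[b1 b2].
    by rewrite (le_trans a1 ac) (le_trans cb b2).
  have h00 : `|0 : R| <= `|h| by rewrite normr0.
  have [c ch E] : exists2 c : R, `|c| <= `|h| & g (h 0 k) - g 0 =
      'D_'e_k f (u + T k + c *: 'e_k) * h 0 k.
    have [hp|hn] := leP 0 (h 0 k).
      have [||c cI ->] := MVT_segment hp
          (df := fun s => 'D_'e_k f (u + T k + s *: 'e_k)) (f := g).
      - move=> s /subset_itv_oo_cc sI; apply: dg; exact: key sI _ _.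
      - apply: derivable_within_continuous => s sI.
        by have [] := dg s (key _ _ _ sI h00 hk).
      by exists c; [exact: key cI _ _|rewrite subr0].
    have [||c cI E] := MVT_segment (ltW hn)
          (df := fun s => 'D_'e_k f (u + T k + s *: 'e_k)) (f := g).
    - move=> s /subset_itv_oo_cc sI; apply: dg; exact: key sI _ _.
    - apply: derivable_within_continuous => s sI.
      by have [] := dg s (key _ _ _ sI hk h00).
    exists c; first exact: key cI _ _.
    by rewrite -opprB E sub0r mulrN opprK.
  have -> : f (u + T k.+1) - f (u + T k) = g (h 0 k) - g 0.
    by rewrite /g TS scale0r addr0 addrA.
  rewrite E mulrC -mulrBr normrM mulrC ler_pM //.
  by have [_ /(_ k)/ltW] := Hr _ (bd c ch).
have -> : f (u + h) - f u - \sum_i h 0 i * 'D_'e_i f u =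
    \sum_(k < m) (f (u + T k.+1) - f (u + T k) - h 0 k * 'D_'e_k f u).
  rewrite sumrB; congr (_ - _).
  rewrite -(big_mkord xpredT (fun k => f (u + T k.+1) - f (u + T k))).
  by rewrite telescope_sumr // T0 Tm addr0.
apply: le_trans (ler_norm_sum _ _ _) _.
apply: le_trans (ler_sum _ (fun k _ => step k)) _.
rewrite sumr_const card_ord -[leLHS]mulr_natl mulrA ler_wpM2r // /e' mulrCA.
by rewrite ger_pMr // ler_pdivrMr // mul1r ler_nat.
Qed.

Lemma C1_differentiable f A u : open A -> A u -> C_k 1 A f -> differentiable f u.
Proof.
move=> oA Au Cf; have est := C1_estimate oA Au Cf.
pose L (h : V) : R := \sum_i h 0 i * 'D_'e_i f u.
have Ll : linear L.
  move=> a x y; rewrite /L scaler_sumr -big_split /=; apply: eq_bigr => i _.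
  by rewrite !mxE mulrDl /GRing.scale /= mulrA.
pose LL : {linear V -> R} := HB.pack L (GRing.isLinear.Build _ _ _ _ L Ll).
have Lc : continuous LL.
  move=> x; rewrite /= /L; apply: (@cvg_sumr _ _ _ _ (nbhs_filter x)) => i; apply: cvgM; last exact: cvg_cst.
  exact: coord_continuous.
have E : f \o shift u = cst (f u) + LL +o_ (0 : V) id.
  apply/eqaddoP => _ /posnumP[e].
  apply: filterS (est e%:num _) => // h.
  by rewrite -[(_ - _) h]/(f (h + u) - (f u + L h)) opprD addrA [h + u]addrC.
apply/diff_locallyP; rewrite (diff_unique Lc E); split => //.
Qed.

Lemma smooth_differentiable f A u : open A -> A u -> smooth_on A f ->
  differentiable f u.
Proof. by move=> oA Au /(_ 1%N); apply: C1_differentiable. Qed.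

Lemma derive_coord f u v : differentiable f u ->
  'D_v f u = \sum_i v 0 i * 'D_'e_i f u.
Proof.
move=> df; rewrite deriveE // [in LHS](row_sum_delta v) linear_sum /=.
by apply: eq_bigr => i _; rewrite linearZ /= deriveE.
Qed.

End differentiable.

Section smooth_vector.
Context {R : realType} {m p : nat}.
Local Notation V := 'rV[R]_m.
Local Notation W := 'rV[R]_p.
Implicit Types (f : W -> R) (g : V -> W) (A : set V) (B : set W) (u v : V).
Local Notation "''e_' i" := (delta_mx 0 i) (at level 8, format "''e_' i").

Lemma continuous_coordP {T : topologicalType} (g : T -> W) t :
  {for t, continuous g} <-> forall i, {for t, continuous (fun x => g x 0 i)}.
Proof.
split=> [gc i|gc].
  apply: (@continuous_comp _ _ _ g (fun w : W => w 0 i)) => //.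
  exact: coord_continuous.
apply/cvgrPdist_lt => e e0.
have H i : \forall x \near t, `|g t 0 i - g x 0 i| < e.
  by have /cvgrPdist_lt/(_ e e0) := gc i.
apply: filterS (filter_forall _ H) => x gx.
by apply: rV_norm_lt => // i; rewrite !mxE.
Qed.

Lemma derive_coordE g u v i : derivable g u v ->
  'D_v (fun x => g x 0 i) u = ('D_v g u) 0 i.
Proof. by move=> dg; rewrite (derive_mx dg) mxE. Qed.

Lemma C_k_coordP k A g : open A -> C_k k A g <-> forall i, C_k k A (fun x => g x 0 i).
Proof.
move=> oA; elim: k g => [|k IH] g.
  split=> [[gc _] i|gC]; split=> // u Au; first exact: (continuous_coordP _ _).1 (gc u Au) i.
  by apply/continuous_coordP => i; have [gc _] := gC i; apply: gc.
split=> [[gc gd] i|gC]; split=> //.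
- by move=> u Au; apply: (continuous_coordP _ _).1 (gc u Au) i.
- move=> v; have [g1 g2] := gd v; split=> [u Au|].
    by have /derivable_mxP := g1 u Au; apply.
  move/IH : g2 => /(_ i); apply: C_k_eq => // u Au.
  by rewrite derive_coordE //; apply: g1.
- by move=> u Au; apply/continuous_coordP => i; have [gc _] := gC i; apply: gc.
- have g1 u v : A u -> derivable g u v.
    move=> Au; apply/derivable_mxP => i j; rewrite ord1.
    by have [_ /(_ v)[d _]] := gC j; apply: d.
  move=> v; split=> [u Au|]; first exact: g1.
  apply/IH => i; have [_ /(_ v)[_]] := gC i; apply: C_k_eq => // u Au.
  by rewrite derive_coordE //; apply: g1.
Qed.

Lemma smooth_coordP A g : open A ->
  smooth_on A g <-> forall i, smooth_on A (fun x => g x 0 i).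
Proof.
move=> oA; split=> [sg i k|sg k]; last by apply/C_k_coordP => // i; apply: sg.
by apply: (C_k_coordP k g oA).1.
Qed.

Lemma differentiable_coordP g u :
  (forall i, differentiable (fun x => g x 0 i) u) -> differentiable g u.
Proof.
move=> dg; rewrite (_ : g = \sum_i (fun y => g y 0 i *: ('e_i : W))).
  by apply: differentiable_sum => i; apply: differentiableZl.
by apply/funext => x; rewrite fct_sumE {1}(row_sum_delta (g x)).
Qed.

Lemma smooth_differentiableV g A u : open A -> A u -> smooth_on A g ->
  differentiable g u.
Proof.
move=> oA Au /(smooth_coordP _ oA) sg; apply: differentiable_coordP => i.
by apply: smooth_differentiable oA Au _; apply: sg.
Qed.

Lemma derive_compE (U : normedModType R) (f : W -> U) g u v : differentiable g u ->
  differentiable f (g u) -> 'D_v (fun x => f (g x)) u = 'D_('D_v g u) f (g u).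
Proof.
move=> dg df; rewrite deriveE; last exact: (differentiable_comp dg df).
have := diff_comp dg df => /(congr1 (fun h => h v)) /= ->.
by rewrite !deriveE.
Qed.

Lemma derivable_comp (U : normedModType R) (f : W -> U) g u v : differentiable g u ->
  differentiable f (g u) -> derivable (fun x => f (g x)) u v.
Proof. by move=> dg df; apply/diff_derivable/(differentiable_comp dg df). Qed.

Lemma C_k_comp k A B f g : open A -> open B -> (forall u, A u -> B (g u)) ->
  C_k k B f -> C_k k A g -> C_k k A (fun u => f (g u)).
Proof.
move=> oA oB AB; elim: k f => [|k IH] f Cf Cg.
  have [fc _] := Cf; have [gc _] := Cg; split=> // u Au.
  by apply: continuous_comp; [apply: gc|apply/fc/AB].
have [fc fd] := Cf; have [gc gd] := Cg.
have C1 (X : normedModType R) (Z : set X) (Y : normedModType R) (h : X -> Y) :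
    C_k k.+1 Z h -> C_k 1 Z h.
  by elim: (k) h => // j IHj h /C_kS; apply: IHj.
have dg u : A u -> differentiable g u.
  move=> Au; apply: differentiable_coordP => i; apply: (C1_differentiable oA Au).
  exact: (C_k_coordP 1 g oA).1 (C1 _ _ _ _ Cg) i.
have df w : B w -> differentiable f w.
  by move=> Bw; apply: (C1_differentiable oB Bw); apply: C1 Cf.
split=> [u Au|v]; first by apply: continuous_comp; [apply: gc|apply/fc/AB].
split=> [u Au|]; first by apply: derivable_comp; [apply: dg|apply/df/AB].
have [g1 g2] := gd v.
(* The chain rule writes the derivative of the composite as a finite sum of products whose factors
   are of class [k], by hypothesis on [g] and by induction for the partial derivatives of [f]. *)
suff : C_k k A (fun u => \sum_i ('D_v g u) 0 i * 'D_('e_i : W) f (g u)).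
  apply: C_k_eq => // u Au; rewrite derive_compE; [|exact: dg|exact/df/AB].
  by rewrite [RHS]derive_coord //; apply/df/AB.
pose F i u := ('D_v g u) 0 i * 'D_('e_i : W) f (g u).
have CF i : C_k k A (F i).
  apply: C_kM => //; first exact: (C_k_coordP k _ oA).1 g2 i.
  by have [_ f2] := fd 'e_i; exact: (IH _ f2 (C_kS Cg)).
rewrite -[X in C_k k A X]/(fun u => \sum_i F i u).
elim: (index_enum _) => [|i s IHs].
  by under eq_fun do rewrite big_nil; apply: C_k_cst.
by under eq_fun do rewrite big_cons; apply: C_kD.
Qed.

Lemma smooth_comp A B f g : open A -> open B -> (forall u, A u -> B (g u)) ->
  smooth_on B f -> smooth_on A g -> smooth_on A (fun u => f (g u)).
Proof. by move=> oA oB AB sf sg k; apply: C_k_comp AB _ _. Qed.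


End smooth_vector.

Lemma cont_at_dist {R : realType} {V W : normedModType R} (f : V -> W) u :
  (forall e : R, 0 < e -> \forall y \near u, `|f u - f y| <= e) ->
  {for u, continuous f}.
Proof. by move=> H; apply/cvgrPdist_le. Qed.

(** * Mean value theorem and symmetry of second derivatives *)

Section derive_affine.
Context {R : realType} {V V' W : normedModType R}.
Variables (F : V' -> W) (L : V -> V') (u v : V) (w : V').
Hypothesis Lh : forall h : R, L (h *: v + u) = h *: w + L u.

Lemma derive_affine_quotient : (fun h : R => h^-1 *:
    (((fun y => F (L y)) \o shift u) (h *: v) - F (L u))) =
  (fun h : R => h^-1 *: ((F \o shift (L u)) (h *: w) - F (L u))).
Proof. by apply/funext => h /=; rewrite Lh. Qed.

(** The two difference quotients are equal functions, so this holds for an arbitrary [F]. It serves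
    to differentiate in one block of variables and to evaluate affine maps. *)
Lemma derive_affine : 'D_v (fun y => F (L y)) u = 'D_w F (L u).
Proof. by rewrite /derive derive_affine_quotient. Qed.

Lemma derivable_affine : derivable (fun y => F (L y)) u v <-> derivable F (L u) w.
Proof. by rewrite /derivable derive_affine_quotient. Qed.

End derive_affine.

Section derive_direction.
Context {R : realType} {V W : normedModType R}.
Implicit Types (f : V -> W) (u v w : V).

Lemma derive_dirD f u v w : differentiable f u ->
  'D_(v + w) f u = 'D_v f u + 'D_w f u.
Proof. by move=> df; rewrite !deriveE // linearD. Qed.

Lemma derive_dirZ f u v (a : R) : differentiable f u ->
  'D_(a *: v) f u = a *: 'D_v f u.
Proof. by move=> df; rewrite !deriveE // linearZ. Qed.

Lemma derive_dirN f u v : differentiable f u -> 'D_(- v) f u = - 'D_v f u.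
Proof. by move=> df; rewrite !deriveE // linearN. Qed.

Lemma derive_dir_sum f u (I : Type) (s : seq I) (v : I -> V) : differentiable f u ->
  'D_(\sum_(i <- s) v i) f u = \sum_(i <- s) 'D_(v i) f u.
Proof.
by move=> df; rewrite deriveE // linear_sum; apply: eq_bigr => i _; rewrite deriveE.
Qed.

End derive_direction.

Section mean_value.
Context {R : realType} {V : normedModType R}.
Implicit Types (f : V -> R) (u v w : V).

Lemma mvt_line f u v (h : R) : 0 <= h ->
  (forall s : R, 0 <= s <= h -> derivable f (u + s *: v) v) ->
  exists2 s : R, 0 <= s <= h & f (u + h *: v) - f u = h * 'D_v f (u + s *: v).
Proof.
move=> h0 fd; pose g (s : R) := f (u + s *: v).
have dg (s : R) : 0 <= s <= h -> is_derive s 1 g ('D_v f (u + s *: v)).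
  move=> sh; apply: DeriveDef; last by rewrite derive_line.
  by apply/derivable_line/fd.
have [||s sI E] := MVT_segment h0 (df := fun s => 'D_v f (u + s *: v)) (f := g).
- by move=> s; rewrite in_itv /= => /andP[s1 s2]; apply: dg; rewrite !ltW.
- apply: derivable_within_continuous => s; rewrite in_itv /= => /dg; by case.
- exists s; first by rewrite in_itv in sI.
  by move: E; rewrite /g scale0r addr0 subr0 mulrC.
Qed.

Lemma mvt_line_abs f u v (h : R) :
  (forall s : R, `|s| <= `|h| -> derivable f (u + s *: v) v) ->
  exists2 s : R, `|s| <= `|h| & f (u + h *: v) - f u = h * 'D_v f (u + s *: v).
Proof.
move=> fd; have [h0|h0] := leP 0 h.
  have [|s /andP[s0 s1] E] := @mvt_line f u v h h0; last first.
    by exists s => //; rewrite !ger0_norm.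
  by move=> s /andP[s0 s1]; apply: fd; rewrite !ger0_norm.
have nh : 0 <= - h by rewrite oppr_ge0 ltW.
have E s : u + h *: v + s *: v = u + (h + s) *: v by rewrite scalerDl addrA.
have n s : 0 <= s <= - h -> `|h + s| <= `|h|.
  move=> /andP[s0 s1]; rewrite [leRHS]ltr0_norm // ler0_norm ?opprD ?gerDl ?oppr_le0 //.
  by rewrite -(opprK h) addrC subr_le0.
have [|s sI] := @mvt_line f (u + h *: v) v (- h) nh.
  by move=> s sI; rewrite E; apply/fd/n.
rewrite !E subrr scale0r addr0 => D; exists (h + s); first exact: n.
by rewrite -opprB D mulNr opprK.
Qed.

(** The mean value theorem is used twice: along [v] for the increment [f (y + h w) - f y], then
    along [w] for ['D_v f]. *)
Lemma second_difference f u v w (h : R) (A : set V) : 0 < h ->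
  (forall s t : R, 0 <= s <= h -> 0 <= t <= h -> A (u + s *: v + t *: w)) ->
  (forall y, A y -> derivable f y v /\ derivable ('D_v f) y w) ->
  exists2 p : R * R, (0 <= p.1 <= h) && (0 <= p.2 <= h) &
    f (u + h *: v + h *: w) - f (u + h *: v) - (f (u + h *: w) - f u) =
    h * h * 'D_w ('D_v f) (u + p.1 *: v + p.2 *: w).
Proof.
move=> h0 hA fA; have hh : 0 <= h <= h by rewrite ltW //=.
have z0 : (0 : R) <= 0 <= h by rewrite lexx ltW.
pose F y := f (y + h *: w) - f y.
have dF y : A (y + h *: w) -> A y ->
    derivable F y v /\ 'D_v F y = 'D_v f (y + h *: w) - 'D_v f y.
  move=> A1 A2; have [d1 _] := fA _ A1; have [d2 _] := fA _ A2.
  have E (k : R) : k *: v + y + h *: w = k *: v + (y + h *: w) by rewrite addrA.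
  have d1' := (derivable_affine f (L := fun y => y + h *: w) E).2 d1.
  split; first exact: derivableB.
  have D := deriveB d1' d2; rewrite (derive_affine f (L := fun y => y + h *: w) E) in D.
  exact: D.
have Asv s : 0 <= s <= h -> A (u + s *: v) /\ A (u + s *: v + h *: w).
  by move=> hs; split; [have := hA s 0 hs z0; rewrite scale0r addr0|exact: hA].
have [|s sh E1] := @mvt_line F u v h (ltW h0).
  by move=> s /Asv[A1 A2]; have [] := dF _ A2 A1.
have [A1 A2] := Asv s sh; have [_ E2] := dF _ A2 A1.
have [|t th E3] := @mvt_line ('D_v f) (u + s *: v) w h (ltW h0).
  by move=> t th; have [] := fA _ (hA s t sh th).
exists (s, t); first by rewrite sh th.
rewrite -mulrA /= -E3 -E2 -E1 /F.
by rewrite -!addrA.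
Qed.

End mean_value.

Lemma dist_half {R : realType} (a b c e : R) :
  `|a - c| < e / 2 -> `|b - c| < e / 2 -> `|a - b| <= e.
Proof.
move=> n1 n2; rewrite (_ : a - b = (a - c) - (b - c)); last by ring.
by rewrite (le_trans (ler_normB _ _)) // [e]splitr lerD // ltW.
Qed.

Section schwarz.
Context {R : realType} {m : nat}.
Local Notation V := 'rV[R]_m.
Implicit Types (f : V -> R) (u v w : V) (A : set V).

Lemma small_parallelogram A u v w : open A -> A u ->
  exists2 h : R, 0 < h & forall s t : R, 0 <= s <= h -> 0 <= t <= h ->
    A (u + s *: v + t *: w).
Proof.
move=> oA Au; have /nbhs_ballP[e /= e0 eA] := open_nbhs_nbhs (conj oA Au).
pose D := `|v| + `|w| + 1; have D0 : 0 < D by rewrite ltr_wpDl // addr_ge0.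
exists (e / D); first by rewrite divr_gt0.
move=> s t /andP[s0 sh] /andP[t0 th]; apply: eA.
rewrite -ball_normE /= -addrA opprD addNKr normrN.
apply: le_lt_trans (ler_normD _ _) _; rewrite !normrZ !ger0_norm //.
have : s * `|v| + t * `|w| <= e / D * (`|v| + `|w|).
  by rewrite mulrDr lerD // ler_wpM2r.
move=> /le_lt_trans; apply; rewrite -mulrA gtr_pMr // mulrC.
by rewrite ltr_pdivrMr // mul1r /D ltrDl.
Qed.

(** The second difference over a small parallelogram is symmetric in [v] and [w], so both mixed
    derivatives, taken at suitable points of it, agree; continuity at [u] closes the gap. *)
Lemma schwarz f A u v w : open A -> A u -> smooth_on A f ->
  'D_v ('D_w f) u = 'D_w ('D_v f) u.
Proof.
move=> oA Au sf; apply/eqP; rewrite -subr_eq0 -normr_le0; apply/ler_addgt0Pl => e e0.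
rewrite addr0; pose e2 := e / 2; have e20 : 0 < e2 by rewrite divr_gt0.
have cvw (a b : V) : \forall y \near u, A y /\ `|'D_a ('D_b f) u - 'D_a ('D_b f) y| < e2.
  apply: filterI; first exact: open_nbhs_nbhs.
  have c := smooth_continuous (smooth_derive a (smooth_derive b sf)) Au.
  by have /cvgrPdist_lt/(_ _ e20) := c.
have H := @filterI _ _ (nbhs_filter u) _ _ (cvw v w) (cvw w v).
have /nbhs_ballP[r /= r0 rH] := H.
have [||h h0 hB] := @small_parallelogram (ball u r) u v w; [exact: ball_open|exact: ballxx|].
have fd a b y : ball u r y -> derivable f y a /\ derivable ('D_a f) y b.
  move=> /rH [[Ay _] _]; split; first exact: smooth_derivable Ay.
  exact: smooth_derivable (smooth_derive a sf) Ay.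
have [p /andP[p1 p2] E1] := second_difference h0 hB (fd v w).
have hB' s t : 0 <= s <= h -> 0 <= t <= h -> ball u r (u + s *: w + t *: v).
  by move=> hs ht; rewrite addrAC; apply: hB.
have [q /andP[q1 q2] E2] := second_difference h0 hB' (fd w v).
have E : 'D_w ('D_v f) (u + p.1 *: v + p.2 *: w) =
         'D_v ('D_w f) (u + q.1 *: w + q.2 *: v).
  apply: (mulfI (mulf_neq0 (lt0r_neq0 h0) (lt0r_neq0 h0))).
  have sw (a b c d : R) : a - b - (c - d) = a - c - (b - d) by ring.
  refine (etrans (esym E1) (etrans _ E2)).
  by rewrite [u + h *: w + _]addrAC; exact: sw.
have [_ [_ n1]] := rH _ (hB _ _ p1 p2).
have [[_ n2] _] := rH _ (hB' _ _ q1 q2).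
rewrite E in n1; exact: dist_half n2 n1.
Qed.

Lemma constant_ball f u (r : R) : (forall y v, ball u r y -> derivable f y v) ->
  (forall y v, ball u r y -> 'D_v f y = 0) -> forall y, ball u r y -> f y = f u.
Proof.
move=> fd f0 y yB; have bs s : 0 <= s <= 1 -> ball u r (u + s *: (y - u)).
  move=> /andP[s0 s1]; move: yB; rewrite -!ball_normE /= opprD addNKr normrN.
  apply: le_lt_trans; rewrite normrZ ger0_norm // -[leRHS]mul1r distrC.
  exact: ler_wpM2r.
have [|s sh] := @mvt_line R V f u (y - u) 1 ler01.
  by move=> s /bs; apply: fd.
rewrite f0; last exact: bs.
by rewrite scale1r mulr0 subrKC => /eqP; rewrite subr_eq0 => /eqP.
Qed.

End schwarz.

Section trigo_smooth.
Context {R : realType}.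

Lemma smooth_sin_cos : smooth_on setT (sin : R -> R) /\ smooth_on setT (cos : R -> R).
Proof.
have oT : open (setT : set R) by exact: openT.
have H k : C_k k setT (sin : R -> R) /\ C_k k setT (cos : R -> R).
  elim: k => [|k [IHs IHc]].
    by split; split=> // u _; [exact: continuous_sin|exact: continuous_cos].
  have dE (f : R -> R) (df : R -> R) (v : R) : (forall x : R, is_derive x 1 f (df x)) ->
      (forall u : R, derivable f u v) /\ forall u : R, 'D_v f u = v *: df u.
    move=> fd; have dfu (u : R) : differentiable f u.
      by apply/derivable1_diffP; have [] := fd u.
    split=> u; first exact: diff_derivable.
    rewrite -[v in LHS]mulr1 -[v * 1]/(v *: 1) derive_dirZ //.
    by have [_ ->] := fd u.
  split; (split=> [u _|v]).
  - exact: continuous_sin.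
  - have [d1 d2] := dE sin cos v (@is_derive_sin R); split=> // .
    by rewrite (_ : 'D_v _ = fun u => v *: cos u); [exact: C_kZ|apply/funext].
  - exact: continuous_cos.
  - have [d1 d2] := dE cos (- sin) v (@is_derive_cos R); split=> // .
    rewrite (_ : 'D_v _ = fun u => v *: ((-1) *: sin u)).
      by apply: C_kZ => //; apply: C_kZ.
    by apply/funext => u; rewrite d2 scaleN1r.
by split=> k; have [] := H k.
Qed.

End trigo_smooth.

(** * Differentiation under a mean over a compact parameter space *)

Definition cont_on {R : realType} {T : topologicalType} (C : set T) (f : T -> R) :=
  forall t, C t -> {for t, continuous f}.

(** The common part of the integral over a segment and of the invariant mean of a compact group:
    linearity and a sup bound are all that differentiation under the sign uses. *)
Record is_mean {R : realType} {T : topologicalType} (C : set T)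
    (Lam : (T -> R) -> R) (K : R) : Prop := {
  mean_linear : forall (a : R) (f g : T -> R), cont_on C f -> cont_on C g ->
    Lam (fun t => a * f t + g t) = a * Lam f + Lam g;
  mean_bound : forall (f : T -> R) (e : R), cont_on C f ->
    (forall t, C t -> `|f t| <= e) -> `|Lam f| <= K * e }.

Section mean.
Context {R : realType} {T : topologicalType} {m : nat}.
Local Notation V := 'rV[R]_m.
Variables (C : set T).
Implicit Types (A : set V) (f : T -> V -> R).

(** The analogue of [C_k] for a family: derivatives are taken in the second variable only, but
    continuity is joint, so that compactness of [C] makes it uniform in the parameter. *)
Fixpoint jC_k (k : nat) A f : Prop :=
  (forall t u, C t -> A u -> {for (t, u), continuous (fun p : T * V => f p.1 p.2)}) /\
  (if k is k'.+1 then forall v, (forall t u, C t -> A u -> derivable (f t) u v) /\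
     jC_k k' A (fun t u => 'D_v (f t) u) else True).

Lemma jC_k_continuous k A f t u : jC_k k A f -> C t -> A u ->
  {for (t, u), continuous (fun p : T * V => f p.1 p.2)}.
Proof. by case: k => [|k] [fc _]; apply: fc. Qed.

Lemma jC_kS k A f : jC_k k.+1 A f -> jC_k k A f.
Proof.
elim: k f => [|k IH] f [fc fd]; split=> // v.
by have [d1 d2] := fd v; split=> //; apply: IH.
Qed.

Lemma jC_k_cont_on k A f u : jC_k k A f -> A u -> cont_on C (fun t => f t u).
Proof.
move=> /jC_k_continuous fc Au t Ct; apply/cvgrPdist_lt => e e0.
have c1 := fc t u Ct Au; have /cvgrPdist_lt/(_ _ e0)[[P Q]/= [tP uQ] PQ] := c1.
by apply: filterS tP => t' Pt'; exact: (PQ (t', u) (conj Pt' (nbhs_singleton uQ))).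
Qed.

(** The tube lemma: joint continuity gives a product neighborhood at each [(t, u)], and compactness
    of [C] a common neighborhood of [u]. *)
Lemma jC_k_uniform k A f u (e : R) : compact C -> jC_k k A f -> A u -> 0 < e ->
  \forall y \near u, forall t, C t -> `|f t y - f t u| < e.
Proof.
move=> cC fc Au e0.
have /compact_near_coveringP/(_ _ (nbhs u)
  (fun y t => `|f t y - f t u| < e) (nbhs_filter u)) H := cC.
apply: filterS (H _) => [y yC t Ct|{H} t Ct]; first exact: yC.
have e20 : 0 < e / 2 by rewrite divr_gt0.
have c1 := jC_k_continuous fc Ct Au.
have /cvgrPdist_lt/(_ _ e20) H := c1.
have c2 := jC_k_cont_on fc Au Ct.
have /cvgrPdist_lt/(_ _ e20) H2 := c2.
case: H => [[P Q]] /= [tP uQ] PQ.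
exists (P `&` (fun t' => `|f t u - f t' u| < e / 2), Q) => /=.
  by split=> //; apply: filterI.
move=> [t' y] /= [[Pt' n2] Qy]; have /= n1 := PQ (t', y) (conj Pt' Qy).
rewrite (_ : f t' y - f t' u = (f t u - f t' u) - (f t u - f t' y)); last by ring.
by rewrite [e]splitr; apply: le_lt_trans (ler_normB _ _) _; apply: ltrD.
Qed.

Variables (Lam : (T -> R) -> R) (K : R).
Hypotheses (cC : compact C) (LamM : is_mean C Lam K) (K0 : 0 < K).

Lemma mean0 : Lam (fun=> 0) = 0.
Proof.
have z : cont_on C (fun=> 0 : R) by move=> t _; apply: cst_continuous.
have E := mean_linear LamM (-1) z z; rewrite mulN1r addNr in E.
by move: E; rewrite mulN1r addNr.
Qed.

Lemma meanZ a (f : T -> R) : cont_on C f -> Lam (fun t => a * f t) = a * Lam f.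
Proof.
have z : cont_on C (fun=> 0 : R) by move=> t _; apply: cst_continuous.
move=> fc; have := mean_linear LamM a fc z; rewrite mean0 addr0 => <-.
by congr Lam; apply/funext => t; rewrite addr0.
Qed.

Lemma meanD (f g : T -> R) : cont_on C f -> cont_on C g ->
  Lam (fun t => f t + g t) = Lam f + Lam g.
Proof.
move=> fc gc; have := mean_linear LamM 1 fc gc; rewrite mul1r => <-.
by congr Lam; apply/funext => t; rewrite mul1r.
Qed.

Lemma meanB (f g : T -> R) : cont_on C f -> cont_on C g ->
  Lam (fun t => f t - g t) = Lam f - Lam g.
Proof.
move=> fc gc; have := mean_linear LamM (-1) gc fc.
rewrite mulN1r addrC => <-; congr Lam.
by apply/funext => t; rewrite mulN1r addrC.
Qed.

Lemma mean_dist (f g : T -> R) e : cont_on C f -> cont_on C g ->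
  (forall t, C t -> `|f t - g t| <= e) -> `|Lam f - Lam g| <= K * e.
Proof.
move=> fc gc fg; rewrite -meanB //; apply: (mean_bound LamM) => // t Ct.
by apply: cvgB; [exact: fc|exact: gc].
Qed.

Lemma mean_continuous A f u : open A -> jC_k 0 A f -> A u ->
  {for u, continuous (fun y => Lam (fun t => f t y))}.
Proof.
move=> oA fc Au; apply: cont_at_dist => e e0.
have eK : 0 < e / K by rewrite divr_gt0.
near=> y.
have Ay : A y by near: y; exact: open_nbhs_nbhs.
rewrite -[leRHS](divfK (lt0r_neq0 K0)) mulrC.
apply: mean_dist; [exact: (jC_k_cont_on fc Au)|exact: (jC_k_cont_on fc Ay)|].
move=> t Ct; rewrite distrC ltW //; move: t Ct; near: y.
exact: jC_k_uniform fc Au eK.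
Unshelve. all: by end_near. Qed.

(** For each parameter the difference quotient is a value of ['D_v (f t)] on a short segment, by the
    mean value theorem; it is uniformly close to the value at [u], and [mean_bound] transports this
    through [Lam]. *)
Lemma is_derive_mean A f u v : open A -> jC_k 1 A f -> A u ->
  is_derive u v (fun y => Lam (fun t => f t y)) (Lam (fun t => 'D_v (f t) u)).
Proof.
move=> oA jf Au; have [fc fd] := jf; have [f1 f2] := fd v.
have Q : h^-1 *: (Lam (fun t => f t (h *: v + u)) - Lam (fun t => f t u))
    @[h --> 0^'] --> Lam (fun t => 'D_v (f t) u).
  apply/cvgrPdist_le => e e0; have eK : 0 < e / K by rewrite divr_gt0.
  have H := @filterI _ _ (nbhs_filter u) _ _ (open_nbhs_nbhs (conj oA Au))
    (@jC_k_uniform 0%N A (fun t u => 'D_v (f t) u) u _ cC f2 Au eK).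
  have /nbhs_ballP[r /= r0 rH] := H.
  have v1 : 0 < `|v| + 1 by rewrite ltr_wpDl.
  near=> h.
  have h0 : h != 0 by near: h; exact: nbhs_dnbhs_neq.
  have hr : `|h| < r / (`|v| + 1).
    by near: h; apply: dnbhs0_lt; rewrite divr_gt0.
  have bs (s : R) : `|s| <= `|h| -> ball u r (u + s *: v).
    move=> sh; rewrite -ball_normE /= opprD addNKr normrN normrZ.
    apply: (@le_lt_trans _ _ (`|h| * (`|v| + 1))); last by rewrite -ltr_pdivlMr.
    by apply: ler_pM => //; rewrite lerDl.
  have Aall y : ball u r y -> A y by move=> /rH[].
  have b1 : ball u r (u + h *: v).
    exact: bs.
  have hf y : A y -> cont_on C (fun t => f t y) by move=> Ay; exact: (jC_k_cont_on jf Ay).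
  have hfZ y : A y -> cont_on C (fun t => h^-1 * f t y).
    by move=> Ay t Ct; apply: cvgMl_tmp; apply: hf.
  have LZ y : A y -> Lam (fun t => h^-1 * f t y) = h^-1 * Lam (fun t => f t y).
    by move=> Ay; rewrite meanZ //; apply: hf.
  rewrite [h *: v + u]addrC /GRing.scale /= mulrBr -!LZ //; last exact: Aall.
  rewrite -meanB; [|exact/hfZ/Aall|exact: hfZ].
  rewrite -[leRHS](divfK (lt0r_neq0 K0)) mulrC.
  have c2 : cont_on C (fun t => 'D_v (f t) u).
    exact: (@jC_k_cont_on 0%N A (fun t u => 'D_v (f t) u)).
  apply: mean_dist => //; first by move=> t Ct; apply: cvgB; apply: hfZ => //; apply: Aall.
  move=> t Ct; rewrite -mulrBr.
  have [|s sI ->] := @mvt_line_abs R V (f t) u v h.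
    by move=> s /bs /Aall As; apply: f1.
  by rewrite mulKf // distrC ltW //; have [_] := rH _ (bs s sI); apply.
apply: DeriveDef; last exact: cvg_lim Q.
by apply/cvg_ex; eexists; exact: Q.
Unshelve. all: by end_near. Qed.

Lemma C_k_mean k A f : open A -> jC_k k A f ->
  C_k k A (fun y => Lam (fun t => f t y)).
Proof.
move=> oA; elim: k f => [|k IH] f jf.
  by split=> // u Au; apply: mean_continuous jf Au.
have dE v u (Au : A u) : derivable (fun y => Lam (fun t => f t y)) u v /\
    Lam (fun t => 'D_v (f t) u) = 'D_v (fun y => Lam (fun t => f t y)) u.
  have j1 : jC_k 1 A f by elim: (k) jf => // j IHj /jC_kS; apply: IHj.
  by case: (is_derive_mean v oA j1 Au) => d ->.
have j0 : jC_k 0 A f by have [] := jf.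
have [_ fd] := jf.
split=> [u Au|v]; first exact: (mean_continuous oA j0 Au).
split=> [u Au|]; first by have [] := dE v u Au.
have [_ f2] := fd v; apply: C_k_eq oA _ (IH _ f2) => u Au.
by have [_] := dE v u Au.
Qed.

Lemma smooth_mean A f : open A -> (forall k, jC_k k A f) ->
  smooth_on A (fun y => Lam (fun t => f t y)).
Proof. by move=> oA jf k; apply: C_k_mean. Qed.

End mean.

Section joint.
Context {R : realType} {T : topologicalType} {m q : nat}.
Local Notation V := 'rV[R]_m.
Variables (C : set T).
Implicit Types (A : set V).

Lemma continuous_row_mx (S : topologicalType) (f : S -> 'rV[R]_q) (g : S -> V) s :
  {for s, continuous f} -> {for s, continuous g} ->
  {for s, continuous (fun s => row_mx (f s) (g s))}.
Proof.
move=> fc gc; apply/continuous_coordP => i; case: (split_ordP i) => j ->.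
  rewrite (_ : (fun x => _) = fun x => f x 0 j).
    exact: (continuous_coordP _ _).1 fc j.
  by apply/funext => x; rewrite row_mxEl.
rewrite (_ : (fun x => _) = fun x => g x 0 j).
  exact: (continuous_coordP _ _).1 gc j.
by apply/funext => x; rewrite row_mxEr.
Qed.

Lemma derive_row_mx (F : 'rV[R]_(q + m) -> R) a (u v : V) :
  'D_v (fun y => F (row_mx a y)) u = 'D_(row_mx 0 v) F (row_mx a u) /\
  (derivable (fun y => F (row_mx a y)) u v <-> derivable F (row_mx a u) (row_mx 0 v)).
Proof.
have E (h : R) : row_mx a (h *: v + u) = h *: row_mx 0 v + row_mx a u.
  by rewrite scale_row_mx add_row_mx scaler0 add0r.
split; [exact: derive_affine E|exact: derivable_affine E].
Qed.

(* [f] is, locally in the parameter, a smooth function of finitely many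
    continuous coordinates. *)
Lemma jC_k_smooth k (A : set V) (f : T -> V -> R) : open A ->
  (forall t0 u0, C t0 -> A u0 -> exists (c : T -> 'rV[R]_q) (B : set 'rV[R]_(q + m))
    (F : 'rV[R]_(q + m) -> R),
    [/\ {for t0, continuous c}, open B, smooth_on B F, B (row_mx (c t0) u0) &
     \forall t \near t0, forall u, B (row_mx (c t) u) ->
        f t u = F (row_mx (c t) u)]) ->
  jC_k C k A f.
Proof.
move=> oA; elim: k f => [|k IH] f fF.
  split=> // t u Ct Au; have [c [B [F [cc oB sF Bt ft]]]] := fF t u Ct Au.
  have pc : {for (t, u), continuous (fun p : T * V => row_mx (c p.1) p.2)}.
    apply: continuous_row_mx; last exact: cvg_snd.
    by apply: (@continuous_comp _ _ _ fst c); [exact: cvg_fst|].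
  have Fc : {for (t, u), continuous (fun p : T * V => F (row_mx (c p.1) p.2))}.
    apply: (@continuous_comp _ _ _ (fun p : T * V => row_mx (c p.1) p.2) F) => //.
    exact: smooth_continuous sF Bt.
  have fE : f t u = F (row_mx (c t) u) by apply: (nbhs_singleton ft).
  have gc : F (row_mx (c p.1) p.2) @[p --> (t, u)] --> f t u by rewrite fE.
  apply: cvg_trans gc; apply: near_eq_cvg.
  have nB : \forall p \near (t, u), B (row_mx (c p.1) p.2).
    by apply: pc; apply: open_nbhs_nbhs.
  have n1 : \forall p \near (t, u), forall u, B (row_mx (c p.1) u) ->
      f p.1 u = F (row_mx (c p.1) u).
    by exists (fun t => forall u, B (row_mx (c t) u) -> f t u = F (row_mx (c t) u), setT);
      [split=> //; exact: filterT|case=> t' u' [/= ? _]].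
  by apply: filterS2 nB n1 => -[t' u'] /= Bp ->.
have fc := jC_k_continuous (IH f fF).
have dE t0 u0 (v : V) c (B : set 'rV[R]_(q + m)) F : open B -> smooth_on B F ->
    (forall u, B (row_mx (c : 'rV[R]_q) u) -> f t0 u = F (row_mx c u)) ->
    B (row_mx c u0) -> derivable (f t0) u0 v /\
    'D_v (f t0) u0 = 'D_(row_mx 0 v) F (row_mx c u0).
  move=> oB sF fE Bc; have n : \forall u \near u0, F (row_mx c u) = f t0 u.
    have uc : {for u0, continuous (fun u : V => row_mx c u)}.
      by apply: continuous_row_mx; [exact: cst_continuous|exact: cvg_id].
    have nB : \forall u \near u0, B (row_mx c u) by apply/uc/open_nbhs_nbhs.
    by apply: filterS nB => u /fE ->.
  have [D1 D2] := derive_row_mx F c u0 v; split.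
    by apply: near_eq_derivable n (D2.2 _); apply: smooth_derivable sF Bc.
  by rewrite -D1; apply: near_eq_derive; apply: filterS n => u ->.
split=> [//|v]; split=> [t u Ct Au|].
  have [c [B [F [cc oB sF Bt ft]]]] := fF t u Ct Au.
  by have [] := dE t u v (c t) B F oB sF (nbhs_singleton ft) Bt.
apply: IH => t0 u0 Ct Au; have [c [B [F [cc oB sF Bt ft]]]] := fF t0 u0 Ct Au.
exists c, B, ('D_(row_mx 0 v) F); split=> //; first exact: smooth_derive.
apply: filterS ft => t ft u Bu.
by have [] := dE t u v (c t) B F oB sF ft Bu.
Qed.

End joint.

(** * Parametric integrals and cutoff functions *)

Lemma smooth_id {R : realType} {V : normedModType R} (A : set V) : smooth_on A id.
Proof. by apply: smooth_linear => // x; exact: cvg_id. Qed.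

Section interval_integral.
Context {R : realType}.
Implicit Types (a b t : R) (f F : R -> R).

Definition iint a b f : R := \int[lebesgue_measure]_(x in `[a, b]) f x.

Lemma cont_on_within a b f : cont_on `[a, b]%classic f ->
  {within `[a, b], continuous f}.
Proof. by move=> fc; apply: continuous_in_subspaceT => t /set_mem; apply: fc. Qed.

Lemma cont_on_integrable a b f : cont_on `[a, b]%classic f ->
  lebesgue_measure.-integrable `[a, b] (EFin \o f).
Proof.
move=> fc; apply: continuous_compact_integrable; first exact: segment_compact.
exact: cont_on_within.
Qed.

Lemma cont_on_norm a b f : cont_on `[a, b]%classic f ->
  cont_on `[a, b]%classic (fun t => `|f t|).
Proof. by move=> fc t Ct; apply: cvg_norm; apply: fc. Qed.

Lemma iint_FTC a b f F : a < b -> cont_on `[a, b]%classic f ->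
  cont_on `[a, b]%classic F -> (forall t, a < t < b -> is_derive t 1 F (f t)) ->
  iint a b f = F b - F a.
Proof.
move=> ab fc Fc Fd; rewrite /iint /Rintegral (@continuous_FTC2 _ f F) //.
- exact: cont_on_within.
- split.
  + by move=> t; rewrite in_itv /= => /Fd[].
  + by apply: cvg_at_right_filter; apply: Fc; rewrite /= in_itv /= lexx ltW.
  + by apply: cvg_at_left_filter; apply: Fc; rewrite /= in_itv /= lexx ltW.
- by move=> t; rewrite in_itv /= => /Fd[_ <-]; rewrite derive1E.
Qed.

Lemma iint_mean a b : a < b -> is_mean `[a, b]%classic (iint a b) (b - a).
Proof.
move=> ab; have mab : measurable (`[a, b]%classic : set R) by exact: measurable_itv.
split=> [c f g fc gc|f e fc fe].
  have cf : cont_on `[a, b]%classic (fun t => c * f t).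
    by move=> t Ct; apply: cvgMl_tmp; apply: fc.
  rewrite /iint RintegralD //; try exact: cont_on_integrable.
  by rewrite RintegralZl //; exact: cont_on_integrable.
rewrite /iint; apply: (@le_trans _ _ (\int[lebesgue_measure]_(x in `[a, b]) `|f x|)).
  by apply: le_normr_Rintegral => //; exact: cont_on_integrable.
apply: (@le_trans _ _ (\int[lebesgue_measure]_(x in `[a, b]) (cst e x))).
  apply: le_Rintegral => //; try exact/cont_on_integrable/cont_on_norm.
  by apply: cont_on_integrable => t _; apply: cst_continuous.
have -> : \int[lebesgue_measure]_(x in `[a, b]) cst e x = e * b - e * a.
  apply: (@iint_FTC a b (cst e) (fun t => e * t)) => // t _.
  - exact: cst_continuous.
  - by apply: cvgMl_tmp; exact: cvg_id.
  - by apply: is_derive_eq; rewrite /GRing.scale /= mulr1.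
by rewrite -mulrBr mulrC.
Qed.

Lemma iint_eq a b f g : (forall t, a <= t <= b -> f t = g t) -> iint a b f = iint a b g.
Proof.
by move=> fg; apply: eq_Rintegral => t /set_mem /=; rewrite in_itv /=; apply: fg.
Qed.

Context {m : nat}.
Local Notation V := 'rV[R]_m.

(** The parameter becomes the first coordinate of a row vector, so that joint smoothness is
    smoothness on a space of row vectors. *)
Definition uncur (f : R -> V -> R) (w : 'rV[R]_(1 + m)) : R :=
  f (w 0 (lshift m 0)) (rsubmx w).

Lemma jC_k_uncur k (A : set V) (B : set 'rV[R]_(1 + m)) (f : R -> V -> R) a b :
  open A -> open B -> smooth_on B (uncur f) ->
  (forall t u, a <= t <= b -> A u -> B (row_mx (const_mx t) u)) ->
  jC_k `[a, b]%classic k A f.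
Proof.
move=> oA oB sf AB; apply: (@jC_k_smooth _ _ _ 1) => // t u /=; rewrite in_itv /= => tab Au.
exists (fun t => const_mx t), B, (uncur f); split=> //.
- apply/continuous_coordP => i.
  by rewrite (_ : (fun x => _) = id) //; apply/funext => x; rewrite mxE.
- exact: AB.
- by apply: (@filterE _ (nbhs t) (nbhs_filter t)) => s v _; rewrite /uncur row_mxEl row_mxKr mxE.
Qed.

Lemma smooth_iint (A : set V) (B : set 'rV[R]_(1 + m)) (f : R -> V -> R) a b :
  a < b -> open A -> open B -> smooth_on B (uncur f) ->
  (forall t u, a <= t <= b -> A u -> B (row_mx (const_mx t) u)) ->
  smooth_on A (fun u => iint a b (f^~ u)).
Proof.
move=> ab oA oB sf AB.
apply: (smooth_mean (segment_compact (a := a) (b := b)) (iint_mean ab)) => //.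
  by rewrite subr_gt0.
by move=> k; apply: jC_k_uncur oA oB sf AB.
Qed.

Lemma derive_iint (A : set V) (B : set 'rV[R]_(1 + m)) (f : R -> V -> R) a b u v :
  a < b -> open A -> open B -> smooth_on B (uncur f) ->
  (forall t u, a <= t <= b -> A u -> B (row_mx (const_mx t) u)) -> A u ->
  'D_v (fun u => iint a b (f^~ u)) u = iint a b (fun t => 'D_v (f t) u).
Proof.
move=> ab oA oB sf AB Au.
have ba : 0 < b - a by rewrite subr_gt0.
have := is_derive_mean (segment_compact (a := a) (b := b)) (iint_mean ab) ba v oA
  (jC_k_uncur 1 oA oB sf AB) Au.
by case.
Qed.

End interval_integral.

(** * A smooth plateau function *)

Section plateau.
Context {R : realType}.
Implicit Types (x t : R) (n : nat).

(** The functions x^(-n) exp(-1/x), extended by 0. The exponent is a parameter because the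
    derivative of one of them is a combination of others. *)
Definition flat n x : R := if 0 < x then x^-1 ^+ n * expR (- x^-1) else 0.

Lemma flat_ge0 n x : 0 <= flat n x.
Proof.
by rewrite /flat; case: ifP => // x0; rewrite mulr_ge0 ?expR_ge0 // exprn_ge0 // invr_ge0 ltW.
Qed.

(** With y = 1/x, the inequality exp(y) >= (y/(n+1))^(n+1) beats y^n by one power, which leaves the
    factor [|x|]. *)
Lemma flat_le n x : flat n x <= n.+1%:R ^+ n.+1 * `|x|.
Proof.
rewrite /flat; case: ifPn => x0; last by rewrite mulr_ge0 // exprn_ge0.
have y0 : 0 < x^-1 by rewrite invr_gt0.
rewrite (gtr0_norm x0) expRN ler_pdivrMr ?expR_gt0 //.
have h : (x^-1 / n.+1%:R) ^+ n.+1 <= expR x^-1.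
  rewrite -[x^-1 in leRHS](divfK (_ : n.+1%:R != 0)) ?pnatr_eq0 // [_ * n.+1%:R in leRHS]mulrC expRM_natl.
  rewrite ler_pXn2r ?nnegrE ?expR_ge0 //; last by rewrite divr_ge0 // ltW.
  by apply: le_trans (expR_ge1Dx _); rewrite lerDr.
have c0 : (0 : R) < n.+1%:R ^+ n.+1 by rewrite exprn_gt0.
apply: le_trans (_ : n.+1%:R ^+ n.+1 * x * (x^-1 / n.+1%:R) ^+ n.+1 <= _); last first.
  by rewrite ler_pM2l // mulr_gt0.
by rewrite expr_div_n mulrC mulrA divfK ?lt0r_neq0 // exprSr -mulrA mulVf ?mulr1 // lt0r_neq0.
Qed.

Lemma is_derive_flat n x :
  is_derive x 1 (flat n) (flat n.+2 x - n%:R * flat n.+1 x).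
Proof.
have [x0|x0|<-] := ltgtP 0 x.
- have nE : \forall y \near x, (fun y => y^-1 ^+ n * expR (- y^-1)) y = flat n y.
    near=> y; rewrite /flat ifT //; near: y; exact: lt_nbhsr.
  apply: near_eq_is_derive nE _.
  have xn0 : x != 0 by rewrite gt_eqF.
  rewrite /flat x0.
  have dV : is_derive x 1 (fun y : R => y^-1) (- x ^- 2).
    have d1 := @derivableV _ _ (fun y : R => y) x 1 xn0 (@derivable_id _ _ x 1).
    have d2 := @deriveV _ _ (fun y : R => y) x 1 xn0 (@derivable_id _ _ x 1).
    apply: DeriveDef => //; rewrite d2 (@derive_id _ _ x 1).
    by rewrite [LHS]mulr1.
  have dE : is_derive x 1 (fun y : R => expR (- y^-1)) (expR (- x^-1) * x ^- 2).
    have dN : is_derive x 1 (fun y : R => - y^-1) (x ^- 2).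
      by rewrite -[x ^- 2]opprK; apply: is_deriveN.
    have [dN1 dN2] := dN.
    have := is_derive_comp1 (phi := expR) dN1 (@ex_derive _ _ _ _ _ _ _ (is_derive_expR _)).
    by rewrite dN2 derive_val.
  have dX : is_derive x 1 (fun y : R => y^-1 ^+ n) (n%:R * x^-1 ^+ n.-1 * - x ^- 2).
    have [dV1 dV2] := dV.
    have := is_derive_comp1 (phi := fun z : R => z ^+ n) dV1 (@exprn_derivable _ n _ _).
    by rewrite dV2 exp_derive [_ *: 1]mulr1; apply.
  have := is_deriveM dX dE.
  set d := (X in is_derive x 1 _ X) => H.
  have -> : x^-1 ^+ n.+2 * expR (- x^-1) - n%:R * (x^-1 ^+ n.+1 * expR (- x^-1)) = d.
    rewrite /d /GRing.scale /= -!exprVn; case: (n) => [|j].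
      by rewrite !mul0r mulr0 subr0 addr0 expr0 mul1r mulrC.
    by rewrite !exprS /=; ring.
  exact: H.
- have nE : \forall y \near x, (fun=> 0) y = flat n y.
    near=> y; rewrite /flat ifN // -leNgt ltW //; near: y; exact: lt_nbhsl.
  apply: near_eq_is_derive nE _.
  have f0 k : flat k x = 0 by rewrite /flat ifN // -leNgt ltW.
  by rewrite !f0 mulr0 subr0; exact: is_derive_cst.
- have f0 k : flat k 0 = 0 by rewrite /flat ltxx.
  rewrite !f0 mulr0 subr0.
  have H : h^-1 *: ((flat n \o shift 0) (h *: 1) - flat n 0) @[h --> 0^'] --> (0 : R).
    apply/cvgrPdist_le => e e0; near=> h.
    rewrite /= sub0r normrN addr0 [h *: 1]mulr1 f0 subr0.
    (* Dividing by [h] turns [flat n] into [flat n.+1], which again tends to 0. *)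
    apply: le_trans (_ : flat n.+1 h <= _).
      rewrite /GRing.scale /= normrM /flat; case: ifPn => h0; last by rewrite normr0 mulr0.
      rewrite -normrM mulrA -exprS ger0_norm //.
      by rewrite mulr_ge0 ?expR_ge0 // exprn_ge0 // invr_ge0 ltW.
    apply: le_trans (flat_le _ _) _.
    rewrite mulrC -ler_pdivlMr ?exprn_gt0 // ltW //; near: h; apply: dnbhs0_lt.
    by rewrite divr_gt0 // exprn_gt0.
  by split; [apply/cvg_ex; eexists; exact: H|exact: cvg_lim H].
Unshelve. all: by end_near. Qed.

Lemma smooth_flat n : smooth_on setT (flat n).
Proof.
have oT : open (setT : set R) by exact: openT.
move=> k; elim: k n => [|k IH] n.
  split=> // x _; apply: differentiable_continuous.
  by apply/derivable1_diffP; have [] := is_derive_flat n x.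
split=> [x _|v]; first by apply: differentiable_continuous; apply/derivable1_diffP; have [] := is_derive_flat n x.
have df (x : R) : differentiable (flat n) x.
  by apply/derivable1_diffP; have [] := is_derive_flat n x.
split=> [x _|]; first exact: diff_derivable.
rewrite (_ : 'D_v _ = fun x => v *: (flat n.+2 x + - n%:R *: flat n.+1 x)).
  by apply: C_kZ => //; apply: C_kD => //; apply: C_kZ.
apply/funext => x; rewrite -[v in LHS]mulr1 -[v * 1]/(v *: 1) derive_dirZ //.
by have [_ ->] := is_derive_flat n x; rewrite scaleNr.
Qed.

Definition step x : R := flat 0 x / (flat 0 x + flat 0 (1 - x)).

Lemma flat_gt0 n x : 0 < x -> 0 < flat n x.
Proof. by move=> x0; rewrite /flat x0 mulr_gt0 ?expR_gt0 // exprn_gt0 // invr_gt0. Qed.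

Lemma step_den x : 0 < flat 0 x + flat 0 (1 - x).
Proof.
have [x0|x0] := ltP 0 x; first by rewrite ltr_wpDr ?flat_ge0 ?flat_gt0.
by rewrite ltr_wpDl ?flat_ge0 // flat_gt0 // subr_gt0 (le_lt_trans x0).
Qed.

Lemma smooth_step : smooth_on setT step.
Proof.
have oT : open (setT : set R) by exact: openT.
have s1 : smooth_on setT (fun x : R => flat 0 (1 - x)).
  apply: (smooth_comp1 oT (B := setT)) => //; first exact: smooth_flat.
  by apply: smoothB => //; [exact: smooth_cst|exact: smooth_id].
apply: smoothM => //; first exact: smooth_flat.
apply: smoothV => //; last by apply: smoothD => //; exact: smooth_flat.
by move=> x _; rewrite gt_eqF // step_den.
Qed.

Lemma step0 x : x <= 0 -> step x = 0.
Proof. by move=> x0; rewrite /step {1}/flat ltNge x0 mul0r. Qed.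

Lemma step1 x : 1 <= x -> step x = 1.
Proof.
move=> x1; rewrite /step [flat 0 (1 - x)]/flat subr_gt0 ltNge x1 addr0 divff //.
by rewrite gt_eqF // flat_gt0 // (lt_le_trans ltr01).
Qed.

(** The square, rather than the absolute value, keeps the function smooth at 0. *)
Definition plateau x : R := step (2 - x * x).

Lemma smooth_plateau : smooth_on setT plateau.
Proof.
have oT : open (setT : set R) by exact: openT.
apply: (smooth_comp1 oT (B := setT)) => //; first exact: smooth_step.
apply: smoothB => //; first exact: smooth_cst.
by apply: smoothM => //; apply: smooth_id.
Qed.

Lemma plateau1 x : `|x| <= 1 -> plateau x = 1.
Proof.
move=> x1; apply: step1; rewrite lerBrDr -lerBrDl.
have -> : (2 : R) - 1 = 1 by lra.
by rewrite -expr2 -real_normK ?num_real // exprn_ile1.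
Qed.

Lemma plateau0 x : 2 <= `|x| -> plateau x = 0.
Proof.
move=> x2; apply: step0; rewrite subr_le0 -expr2 -real_normK ?num_real //.
have h : (2 : R) ^+ 2 <= `|x| ^+ 2 by rewrite ler_pXn2r ?nnegrE.
by apply: le_trans h; rewrite expr2; lra.
Qed.

End plateau.

(** * Multiplication by i and the Poincare lemma *)

Section coordinates.
Context {R : realType} {m : nat}.
Local Notation V := 'rV[R]_m.
Implicit Types (A : set V) (u v : V).

Lemma smooth_coord A i : smooth_on A (fun u : V => u 0 i).
Proof. by apply: smooth_linear => [a x y|]; [rewrite !mxE|exact: coord_continuous]. Qed.

Lemma derive_coordinate u v i : 'D_v (fun u : V => u 0 i) u = v 0 i.
Proof.
have d : derivable (id : V -> V) u v by exact: derivable_id.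
by have := derive_coordE i d; rewrite derive_id.
Qed.

Lemma ball_rVP (u v : V) (e : R) : 0 < e ->
  ball u e v <-> forall i, `|u 0 i - v 0 i| < e.
Proof.
move=> e0; rewrite -ball_normE /=; split=> [uv i|uv].
  by apply: le_lt_trans uv; have := rV_norm_coord (u - v) i; rewrite !mxE.
by apply: rV_norm_lt => // i; rewrite !mxE.
Qed.

Lemma open_smooth_preimage {p} (g : V -> 'rV[R]_p) (B : set 'rV[R]_p) :
  open B -> smooth_on setT g -> open (g @^-1` B).
Proof.
by move=> oB sg; apply: open_comp => // u _; apply: smooth_continuous sg _.
Qed.

End coordinates.

Section mul_i.
Context {R : realType} {n : nat}.
Local Notation V := 'rV[R]_(n + n).
Implicit Types (v w : V).

Lemma mul_i_lE v (j : 'I_n) : (mul_i v : V) 0 (lshift n j) = - v 0 (rshift n j).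
Proof. by rewrite /mul_i row_mxEl !mxE. Qed.

Lemma mul_i_rE v (j : 'I_n) : (mul_i v : V) 0 (rshift n j) = v 0 (lshift n j).
Proof. by rewrite /mul_i row_mxEr !mxE. Qed.

Lemma mul_i_linear : linear (@mul_i R n).
Proof.
move=> a v w; apply/rowP => i.
transitivity (a * (mul_i v : V) 0 i + (mul_i w : V) 0 i); last first.
  by rewrite [RHS]mxE; congr (_ + _); rewrite [RHS]mxE.
case: (split_ordP i) => j ->; first by rewrite !mul_i_lE !mxE mulrN opprD.
by rewrite !mul_i_rE !mxE.
Qed.

HB.instance Definition _ := GRing.isLinear.Build R V V *:%R (@mul_i R n) mul_i_linear.

Lemma mul_iK v : mul_i (mul_i v) = - v.
Proof. by rewrite /mul_i row_mxKl row_mxKr -[in RHS](hsubmxK v) opp_row_mx. Qed.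

Lemma mul_i_lshift (j : 'I_n) :
  mul_i (delta_mx 0 (lshift n j) : V) = delta_mx 0 (rshift n j).
Proof.
apply/rowP => i; rewrite /mul_i; case: (split_ordP i) => l ->.
  by rewrite row_mxEl !mxE eq_rlshift eq_lrshift oppr0.
by rewrite row_mxEr !mxE eq_lshift eq_rshift.
Qed.

Lemma mul_i_rshift (j : 'I_n) :
  mul_i (delta_mx 0 (rshift n j) : V) = - delta_mx 0 (lshift n j).
Proof. by rewrite -mul_i_lshift mul_iK. Qed.

End mul_i.

Section poincare.
Context {R : realType} {m : nat}.
Local Notation V := 'rV[R]_m.
Implicit Types (u v w : V).
Local Notation "''e_' i" := (delta_mx 0 i : V) (at level 8, format "''e_' i").

Definition radial (u0 : V) (t : R) (u : V) : V := u0 + t *: (u - u0).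

Lemma radial_ball u0 e t u : 0 <= t <= 1 -> ball u0 e u -> ball u0 e (radial u0 t u).
Proof.
move=> /andP[t0 t1]; rewrite -!ball_normE /= /radial opprD addNKr normrN normrZ.
apply: le_lt_trans; rewrite ger0_norm // distrC -[leRHS]mul1r.
exact: ler_wpM2r.
Qed.

Lemma smooth_radial u0 : smooth_on setT
  (fun w : 'rV[R]_(1 + m) => radial u0 (w 0 (lshift m 0)) (rsubmx w)).
Proof.
have oT : open (setT : set 'rV[R]_(1 + m)) by exact: openT.
apply/(smooth_coordP _ oT) => i.
apply: smooth_eq oT _ (smoothD oT (smooth_cst _ (u0 0 i)) (smoothM oT (smooth_coord _
  (lshift m 0)) (smoothB oT (smooth_coord _ (rshift 1 i)) (smooth_cst _ (u0 0 i))))).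
by move=> w _; rewrite /radial !mxE.
Qed.

Variables (u0 : V) (e : R) (Om : V -> V -> V -> R).
Local Notation B := (ball u0 e).
Hypothesis e0 : 0 < e.
Hypothesis OmS : forall v w, smooth_on B (fun u => Om u v w).
Hypothesis OmL : forall u v, B u -> linear (Om u v : V -> R^o).
Hypothesis OmA : forall u v w, B u -> Om u w v = - Om u v w.
Hypothesis OmC : forall u v1 v2 v3, B u ->
  'D_v1 (fun u => Om u v2 v3) u - 'D_v2 (fun u => Om u v1 v3) u
  + 'D_v3 (fun u => Om u v1 v2) u = 0.

Let oB : open B. Proof. exact: ball_open. Qed.

Lemma form2_coord u v w : B u -> Om u v w = \sum_i v 0 i * Om u 'e_i w.
Proof.
move=> Bu; rewrite OmA // {1}(row_sum_delta v).
pose L : {linear V -> R^o} := HB.pack (Om u w) (GRing.isLinear.Build _ _ _ _ _ (OmL w Bu)).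
rewrite -[Om u w _]/(L _) linear_sum -sumrN; apply: eq_bigr => i _.
by rewrite linearZ /= /GRing.scale /= OmA // mulrN opprK.
Qed.

(** The homotopy operator of the Poincare lemma: the contraction of [Om] with the radial vector,
    integrated along the segment from [u0] to [u]. The weight [t] comes from pulling [w] back by the
    contraction. *)
Definition cone u w := iint 0 1 (fun t => t * \sum_i (u - u0) 0 i * Om (radial u0 t u) 'e_i w).

Let Bc : set 'rV[R]_(1 + m) := [set w : 'rV[R]_(1 + m) | B (radial u0 (w 0 (lshift m 0)) (rsubmx w))].

Let oBc : open Bc.
Proof. exact: open_smooth_preimage oB (smooth_radial u0). Qed.

Let sBc w : smooth_on Bc (uncur (fun t u =>
   t * \sum_i (u - u0) 0 i * Om (radial u0 t u) 'e_i w)).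
Proof.
rewrite /uncur; apply: smoothM => //; first exact: smooth_coord.
apply: smooth_sum => // i _; apply: smoothM => //.
  apply: smooth_eq oBc _ (smoothB oBc (smooth_coord _ (rshift 1 i)) (smooth_cst _ (u0 0 i))).
  by move=> x _; rewrite !mxE.
apply: (smooth_comp oBc oB _ (OmS 'e_i w)) => //.
exact: smooth_sub (smooth_radial u0).
Qed.

Let memBc t u : 0 <= t <= 1 -> B u -> Bc (row_mx (const_mx t) u).
Proof. by move=> ti Bu; rewrite /Bc /= row_mxEl row_mxKr mxE; apply: radial_ball. Qed.

Lemma smooth_cone w : smooth_on B (cone ^~ w).
Proof. exact: (smooth_iint ltr01 oB oBc (sBc w) memBc). Qed.

Lemma derive_radial (a : V -> R) t u v : B (radial u0 t u) -> smooth_on B a ->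
  is_derive u v (fun u => a (radial u0 t u)) (t * 'D_v a (radial u0 t u)).
Proof.
move=> Bt sa; have E (h : R) : radial u0 t (h *: v + u) = h *: (t *: v) + radial u0 t u.
  rewrite /radial -addrA scalerDr addrCA scalerA [t * h]mulrC -scalerA.
  by rewrite addrCA.
apply: DeriveDef.
  by apply: (derivable_affine a E).2; exact: smooth_derivable sa Bt.
by rewrite (derive_affine a E) derive_dirZ //; apply: smooth_differentiable oB Bt sa.
Qed.

Lemma derive_form2 y u v w : B u ->
  'D_v (fun z => Om z y w) u = \sum_i y 0 i * 'D_v (fun z => Om z 'e_i w) u.
Proof.
move=> Bu; have dM i : is_derive u v (fun z => y 0 i *: Om z 'e_i w)
    (y 0 i *: 'D_v (fun z => Om z 'e_i w) u).
  have d1 : is_derive u v (fun z => Om z 'e_i w) ('D_v (fun z => Om z 'e_i w) u).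
    by apply/derivableP/(smooth_derivable (OmS _ _) Bu).
  exact: is_deriveZ.
have [_ <-] := is_derive_sum dM.
apply: near_eq_derive; apply: (open_near oB Bu) => z Bz.
by rewrite fct_sumE form2_coord.
Qed.

Lemma derive_cone_integrand t u v w : 0 <= t <= 1 -> B u ->
  'D_v (fun u => t * \sum_i (u - u0) 0 i * Om (radial u0 t u) 'e_i w) u =
  t * Om (radial u0 t u) v w
  + t * (t * 'D_v (fun z => Om z (u - u0) w) (radial u0 t u)).
Proof.
move=> ti Bu; have Bt := radial_ball ti Bu.
have dy i : is_derive u v (fun u : V => (u - u0) 0 i) (v 0 i).
  have E : (fun u : V => (u - u0) 0 i) = (fun u => u 0 i - u0 0 i).
    by apply/funext => x; rewrite !mxE.
  have d1 : is_derive u v (fun u : V => u 0 i) (v 0 i).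
    apply: DeriveDef; last exact: derive_coordinate.
    exact: (smooth_derivable (smooth_coord setT i) (I : setT u)).
  have := is_deriveB d1 (is_derive_cst (u0 0 i) u v).
  by rewrite E subr0.
have dO i := derive_radial v Bt (OmS 'e_i w).
have dM i := is_deriveM (dy i) (dO i).
have dS : is_derive u v (\sum_i (fun u : V => (u - u0) 0 i * Om (radial u0 t u) 'e_i w))
   (\sum_i ((u - u0) 0 i *: (t * 'D_v (fun u => Om u 'e_i w) (radial u0 t u))
      + Om (radial u0 t u) 'e_i w *: v 0 i)).
  exact: is_derive_sum.
have := is_deriveZ t dS => -[_] E.
rewrite [LHS](_ : _ = t *: \sum_i ((u - u0) 0 i *: (t * 'D_v (fun u => Om u 'e_i w)
   (radial u0 t u)) + Om (radial u0 t u) 'e_i w *: v 0 i)); last first.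
  rewrite -E; congr (derive _ u v); apply/funext => x /=.
  by rewrite fct_sumE.
rewrite big_split /= scalerDr addrC; congr (_ + _).
  rewrite (form2_coord _ _ Bt); congr (_ * _); apply: eq_bigr => i _.
  by rewrite /GRing.scale /= mulrC.
congr (_ * _); rewrite derive_form2 // mulr_sumr.
by apply: eq_bigr => i _; rewrite /GRing.scale /= mulrCA.
Qed.

(** Closedness applied to [u - u0], [v], [w] turns the integrand of the left side into the
    derivative of t^2 [Om (radial u0 t u) v w], whose values at the ends are [Om u v w] and 0. *)
Lemma cone_primitive u v w : B u ->
  'D_v (cone ^~ w) u - 'D_w (cone ^~ v) u = Om u v w.
Proof.
move=> Bu; have D a b : 'D_a (cone ^~ b) u = iint 0 1 (fun t =>
    t * Om (radial u0 t u) a b + t * (t * 'D_a (fun z => Om z (u - u0) b) (radial u0 t u))).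
  rewrite /cone (derive_iint _ ltr01 oB oBc (sBc b) memBc) //.
  by apply: iint_eq => t ti; apply: derive_cone_integrand.
pose F a b t := t * Om (radial u0 t u) a b
  + t * (t * 'D_a (fun z => Om z (u - u0) b) (radial u0 t u)).
have rc t : 0 <= t <= 1 -> {for t, continuous (radial u0 ^~ u)}.
  move=> _; apply/continuous_coordP => i.
  rewrite (_ : (fun x => _) = fun x => u0 0 i + x * (u - u0) 0 i).
    by apply: cvgD; [exact: cvg_cst|apply: cvgMr_tmp; exact: cvg_id].
  by apply/funext => x; rewrite !mxE.
have sc (f : V -> R) : smooth_on B f ->
    cont_on (`[0, 1]%classic : set R) (fun t => f (radial u0 t u)).
  move=> sf t /=; rewrite in_itv /= => ti.
  apply: (@continuous_comp _ _ _ (fun t => radial u0 t u) f); first exact: rc.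
  by apply: smooth_continuous sf _; apply: radial_ball.
have sOm y b : smooth_on B (fun z => Om z y b).
  apply: smooth_eq oB _ (smooth_sum (index_enum _) (P := xpredT) oB
    (fun i _ => smoothM oB (smooth_cst B (y 0 i)) (OmS 'e_i b))) => z Bz.
  by rewrite [RHS]form2_coord.
have cid : cont_on (`[0, 1]%classic : set R) (id : R -> R) by move=> t _; exact: cvg_id.
have cF a b : cont_on (`[0, 1]%classic : set R) (F a b).
  move=> t ti; apply: cvgD; apply: cvgM; try exact: cid.
    exact: (sc (fun z => Om z a b)).
  apply: cvgM; first exact: cid.
  have c1 := sc _ (smooth_derive a (sOm (u - u0) b)) t ti.
  exact: c1.
rewrite !D -(meanB (iint_mean ltr01)) //; try exact: cF.
have -> : Om u v w = 1 * 1 * Om (radial u0 1 u) v w - 0 * 0 * Om (radial u0 0 u) v w.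
  by rewrite !mul0r subr0 !mul1r /radial scale1r addrC subrK.
pose f := (fun z => Om z v w).
have df (t : R) : 0 <= t <= 1 -> is_derive t 1 (fun t => f (radial u0 t u))
    ('D_(u - u0) f (radial u0 t u)).
  move=> ti; have Bt := radial_ball ti Bu.
  apply: DeriveDef; last exact: derive_line.
  exact/derivable_line/(smooth_derivable (sOm v w) Bt).
apply: (@iint_FTC _ 0 1 _ (fun t => t * t * f (radial u0 t u))) => //.
- by move=> t ti; apply: cvgB; exact: cF.
- move=> t ti; have c1 := sc f (sOm v w) t ti.
  by apply: cvgM; [apply: cvgM; exact: cid|exact: c1].
move=> t /andP[t0 t1]; have ti : 0 <= t <= 1 by rewrite !ltW.
have Bt := radial_ball ti Bu.
have d2 : is_derive t 1 (fun t : R => t * t) (t *: 1 + t *: 1).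
  by apply: is_deriveM; exact: is_derive_id.
apply: (is_derive_eq (is_deriveM d2 (df t ti))).
have := OmC (u - u0) v w Bt; rewrite -/f => C.
have -> : 'D_(u - u0) f (radial u0 t u) = 'D_v (fun u1 => Om u1 (u - u0) w) (radial u0 t u)
  - 'D_w (fun u1 => Om u1 (u - u0) v) (radial u0 t u).
  by apply/eqP; rewrite -subr_eq0 -C; apply/eqP; ring.
by rewrite /F /f (OmA v w) // /GRing.scale /=; ring.
Qed.

End poincare.

(** * The Cauchy kernel in polar coordinates *)

Lemma iint_cst {R : realType} (a b c : R) : a < b -> iint a b (fun=> c) = c * (b - a).
Proof.
move=> ab; rewrite mulrBr; apply: (@iint_FTC _ a b _ (fun t => c * t)) => // t _.
- exact: cst_continuous.
- by apply: cvgMl_tmp; exact: cvg_id.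
- by apply: is_derive_eq; rewrite /GRing.scale /= mulr1.
Qed.

Section polar.
Context {R : realType} {m : nat}.
Local Notation V := 'rV[R]_m.
Implicit Types (u v : V) (r th : R) (f : V -> R).
Variables (ex ey : V).

Definition ray th : V := cos th *: ex + sin th *: ey.

(** Convolution with k(th)/r over a disc in the plane of [ex] and [ey]: the area element r dr dth
    cancels the singularity at r = 0. For [cos] and [sin] these are, up to sign, the real and
    imaginary parts of the Cauchy kernel 1/(x + iy). *)
Definition polar (rho : R) (k : R -> R) f u : R :=
  iint 0 rho (fun r => iint 0 (2 * pi) (fun th => f (u - r *: ray th) * k th)).

(* [Z] is invariant under translations in the plane of [ex] and [ey]. *)
Variables (Z : set V) (rho : R).
Hypotheses (oZ : open Z) (rho0 : 0 < rho).
Hypothesis Zinv : forall u a b, Z u -> Z (u + a *: ex + b *: ey).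

Let pi2 : 0 < 2 * pi :> R. Proof. by rewrite mulr_gt0 // pi_gt0. Qed.

Lemma Z_ray u r th : Z u -> Z (u - r *: ray th).
Proof.
move=> Zu; rewrite /ray scalerDr opprD addrA !scalerA -!scaleNr.
exact: Zinv.
Qed.

Let shift_map (w : 'rV[R]_(1 + (1 + m))) : V :=
  rsubmx (rsubmx w) - (rsubmx w) 0 (lshift m 0) *: ray (w 0 (lshift _ 0)).

Let smooth_rsubmx p q : smooth_on setT (rsubmx : 'rV[R]_(p + q) -> 'rV[R]_q).
Proof.
apply/(smooth_coordP _ openT) => i.
apply: smooth_eq openT _ (smooth_coord _ (rshift p i)) => w _.
by rewrite mxE.
Qed.

Let smooth_shift_map : smooth_on setT shift_map.
Proof.
have [ss sc] := @smooth_sin_cos R.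
have oT q : open (setT : set 'rV[R]_q) by exact: openT.
apply/(smooth_coordP _ (oT _)) => i; rewrite /shift_map /ray.
have s0 : smooth_on setT (fun w : 'rV[R]_(1 + (1 + m)) => w 0 (lshift _ 0)).
  exact: smooth_coord.
apply: smooth_eq (oT _) _ (smoothB (oT _) (smooth_coord _ (rshift 1 (rshift 1 i)))
  (smoothM (oT _) (smooth_coord _ (rshift 1 (lshift m 0)))
    (smoothD (oT _) (smoothM (oT _) (smooth_comp1 (oT _) (B := setT) _ sc s0)
                       (smooth_cst _ (ex 0 i)))
       (smoothM (oT _) (smooth_comp1 (oT _) (B := setT) _ ss s0)
                       (smooth_cst _ (ey 0 i)))))) => // w _.
by rewrite !mxE.
Qed.

Let Z1 : set 'rV[R]_(1 + m) := [set w : 'rV[R]_(1 + m) | Z (rsubmx w)].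
Let oZ1 : open Z1. Proof. exact: open_smooth_preimage oZ (@smooth_rsubmx 1 m). Qed.
Let Z2 : set 'rV[R]_(1 + (1 + m)) := [set w : 'rV[R]_(1 + (1 + m)) | Z (rsubmx (rsubmx w))].
Let oZ2 : open Z2.
Proof. exact: open_smooth_preimage oZ1 (@smooth_rsubmx 1 (1 + m)). Qed.

Section kernel.
Variables (f : V -> R) (k : R -> R).
Hypotheses (sf : smooth_on Z f) (sk : smooth_on setT k).

Let inner (w : 'rV[R]_(1 + m)) : R :=
  iint 0 (2 * pi) (fun th => f (rsubmx w - (w 0 (lshift m 0)) *: ray th) * k th).

Let sZ2 : smooth_on Z2 (uncur (fun (th : R) (w : 'rV[R]_(1 + m)) =>
  f (rsubmx w - (w 0 (lshift m 0)) *: ray th) * k th)).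
Proof.
rewrite /uncur; apply: smoothM => //.
  apply: (smooth_comp (g := shift_map) oZ2 oZ _ sf); last exact: smooth_sub smooth_shift_map.
  by move=> w Zw; apply: Z_ray.
by apply: (smooth_comp1 oZ2 (B := setT)) => //; exact: smooth_coord.
Qed.

Let memZ2 th w : 0 <= th <= 2 * pi -> Z1 w -> Z2 (row_mx (const_mx th) w).
Proof. by move=> _ Zw; rewrite /Z2 /= row_mxKr. Qed.

Let smooth_inner : smooth_on Z1 inner.
Proof. exact: (smooth_iint pi2 oZ1 oZ2 sZ2 memZ2). Qed.

Let innerE r u : inner (row_mx (const_mx r) u) =
  iint 0 (2 * pi) (fun th => f (u - r *: ray th) * k th).
Proof. by rewrite /inner row_mxKr row_mxEl mxE. Qed.

Let memZ1 r u : 0 <= r <= rho -> Z u -> Z1 (row_mx (const_mx r) u).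
Proof. by move=> _ Zw; rewrite /Z1 /= row_mxKr. Qed.

Lemma smooth_polar : smooth_on Z (polar rho k f).
Proof. exact: (smooth_iint (B := Z1) rho0 oZ oZ1 smooth_inner memZ1). Qed.

Definition arc r u := iint 0 (2 * pi) (fun th => f (u - r *: ray th) * k th).

(** A joint direction, so that the derivative in the point ([a = 0]) and the one in the radius
    ([v = 0]) are both instances. *)
Let derive_inner a v w : Z1 w -> 'D_(row_mx (const_mx a) v) inner w =
  iint 0 (2 * pi) (fun th =>
    'D_(v - a *: ray th) f (rsubmx w - w 0 (lshift m 0) *: ray th) * k th).
Proof.
move=> Zw; rewrite /inner (derive_iint _ pi2 oZ1 oZ2 sZ2 memZ2) //.
apply: iint_eq => th _.
pose L (y : 'rV[R]_(1 + m)) := rsubmx y - y 0 (lshift m 0) *: ray th.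
have LE (h : R) : L (h *: row_mx (const_mx a) v + w) = h *: (v - a *: ray th) + L w.
  rewrite /L linearD linearZ /= row_mxKr !mxE -/(lshift m 0).
  case: splitP => // j _; rewrite ord1 mxE.
  by rewrite scalerBr scalerDl scalerA opprD addrACA.
have Zr : Z (L w) by apply: Z_ray.
have d1 := (derivable_affine f LE).2 (smooth_derivable sf Zr).
have d2 := derive_affine f LE.
have := deriveZ (k th) d1; rewrite d2 => E.
set g := (fun y => _); have -> : g = k th \*: (fun y => f (L y)).
  by apply/funext => y; rewrite /g mulrC.
by apply: etrans E _; rewrite mulrC.
Qed.

Lemma derive_polar u v : Z u -> 'D_v (polar rho k f) u = polar rho k ('D_v f) u.
Proof.
move=> Zu; rewrite /polar.
rewrite (@derive_iint _ _ Z Z1 _ 0 rho u v rho0 oZ oZ1 smooth_inner memZ1 Zu).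
apply: iint_eq => r ri.
have /= [E _] := derive_row_mx inner (const_mx r) u v.
under eq_fun do rewrite -innerE.
rewrite E -(_ : const_mx 0 = 0 :> 'rV_1); last by apply/rowP => j; rewrite !mxE.
rewrite derive_inner; last by rewrite /Z1 /= row_mxKr.
by apply: iint_eq => th _; rewrite row_mxKr row_mxEl mxE scale0r subr0.
Qed.

Lemma is_derive_arc r u : Z u -> is_derive r 1 (fun r => arc r u)
  (iint 0 (2 * pi) (fun th => 'D_(- ray th) f (u - r *: ray th) * k th)).
Proof.
move=> Zu; pose w0 : 'rV[R]_(1 + m) := row_mx (const_mx 0) u.
pose v1 : 'rV[R]_(1 + m) := row_mx (const_mx 1) 0.
have rE s : row_mx (const_mx s) u = w0 + s *: v1.
  rewrite /w0 /v1 scale_row_mx add_row_mx scaler0 addr0; congr row_mx.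
  by apply/rowP => j; rewrite !mxE add0r mulr1.
have -> : (fun r => arc r u) = (fun s => inner (w0 + s *: v1)).
  by apply/funext => s; rewrite -rE innerE.
have Zr : Z1 (w0 + r *: v1) by rewrite -rE /Z1 /= row_mxKr.
apply: DeriveDef.
  exact: (derivable_line inner w0 v1 r).1 (smooth_derivable smooth_inner Zr).
apply: etrans (derive_line inner w0 v1 r) _; apply: etrans (derive_inner _ _ Zr) _.
by apply: iint_eq => th _; rewrite -rE row_mxKr row_mxEl mxE scale1r sub0r.
Qed.

Lemma continuous_arc u : Z u -> continuous (fun r => arc r u).
Proof.
move=> Zu r; apply: differentiable_continuous; apply/derivable1_diffP.
by have [] := is_derive_arc r Zu.
Qed.

Lemma polarE u : polar rho k f u = iint 0 rho (fun r => arc r u).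
Proof. by []. Qed.

Lemma is_derive_curve (g : R -> V) (t : R) dg : Z (g t) ->
  is_derive t 1 g dg -> is_derive t 1 (fun s => f (g s)) ('D_dg f (g t)).
Proof.
move=> Zg [dg1 dg2]; have dgt : differentiable g t by apply/derivable1_diffP.
have dfg : differentiable f (g t) by apply: smooth_differentiable oZ Zg sf.
apply: DeriveDef; first exact/diff_derivable/(differentiable_comp dgt dfg).
rewrite deriveE; last exact: (differentiable_comp dgt dfg).
have := diff_comp dgt dfg => /(congr1 (fun h => h 1)) /= ->.
by rewrite -!deriveE // dg2.
Qed.

Lemma is_derive_ray u r th : is_derive th 1 (fun th => u - r *: ray th)
  (- (r *: (cos th *: ey - sin th *: ex))).
Proof.
have d1 : is_derive th 1 (fun th => cos th *: ex) (- sin th *: ex).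
  have [c1 c2] := is_derive_cos th; have /= E := @derivable1_diffP _ _ (cos : R -> R) th.
  have dc : differentiable (cos : R -> R) th by apply/E.
  apply: DeriveDef; first exact/diff_derivable/differentiableZl.
  rewrite deriveE; last exact: differentiableZl.
  by rewrite diffZl //= -deriveE // c2.
have d2 : is_derive th 1 (fun th => sin th *: ey) (cos th *: ey).
  have [c1 c2] := is_derive_sin th; have /= E := @derivable1_diffP _ _ (sin : R -> R) th.
  have dc : differentiable (sin : R -> R) th by apply/E.
  apply: DeriveDef; first exact/diff_derivable/differentiableZl.
  rewrite deriveE; last exact: differentiableZl.
  by rewrite diffZl //= -deriveE // c2.
have d3 := is_deriveB (is_derive_cst u th 1) (is_deriveZ r (is_deriveD d1 d2)).
by apply: (is_derive_eq d3); rewrite sub0r scaleNr addrC.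
Qed.

Lemma continuous_ray u r : Z u -> continuous (fun th => f (u - r *: ray th)).
Proof.
move=> Zu th; apply: differentiable_continuous; apply/derivable1_diffP.
by have [] := is_derive_curve (Z_ray r th Zu) (is_derive_ray u r th).
Qed.

Lemma cont_on_ray u r : Z u ->
  cont_on `[0, 2 * pi]%classic (fun th => f (u - r *: ray th) * k th).
Proof.
move=> Zu th _.
have c1 : {for th, continuous (fun th => f (u - r *: ray th))} by exact: continuous_ray.
by apply: cvgM; [exact: c1|exact: smooth_continuous sk _].
Qed.

End kernel.

Variable f : V -> R.
Hypotheses (sf : smooth_on Z f).

Let scos : smooth_on setT (cos : R -> R). Proof. by have [] := @smooth_sin_cos R. Qed.
Let ssin : smooth_on setT (sin : R -> R). Proof. by have [] := @smooth_sin_cos R. Qed.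
Let sone : smooth_on (setT : set R) (fun=> 1 : R). Proof. exact: smooth_cst. Qed.

(** On each ray, cos f_x + sin f_y is minus the radial derivative of [f (u - r *: ray th)]. The
    radial integral therefore leaves the value at the center, counted 2 pi times, the outer circle
    contributing 0. *)
Lemma polar_radial u : Z u -> (forall th, f (u - rho *: ray th) = 0) ->
  polar rho cos ('D_ex f) u + polar rho sin ('D_ey f) u = 2 * pi * f u.
Proof.
move=> Zu f0; have sfx := smooth_derive ex sf; have sfy := smooth_derive ey sf.
have c1 := continuous_arc sfx scos Zu; have c2 := continuous_arc sfy ssin Zu.
have c3 := continuous_arc sf sone Zu.
rewrite !polarE -(meanD (iint_mean rho0)); last 2 first.
- by move=> r _; exact: c1.
- by move=> r _; exact: c2.
have dE r : is_derive r 1 (fun r => -1 * arc f (fun=> 1) r u)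
    (arc ('D_ex f) cos r u + arc ('D_ey f) sin r u).
  have D := is_deriveZ (-1) (is_derive_arc sf sone r Zu).
  apply: (is_derive_eq D); rewrite {D} /arc -(meanD (iint_mean pi2)); last 2 first.
  - exact: (cont_on_ray sfx scos Zu).
  - exact: (cont_on_ray sfy ssin Zu).
  rewrite -[LHS](meanZ (iint_mean pi2)).
    apply: iint_eq => th _; have Zr := Z_ray r th Zu.
    have df : differentiable f (u - r *: ray th) by exact: smooth_differentiable sf.
    rewrite derive_dirN // derive_dirD // !derive_dirZ // /GRing.scale /=.
    by ring.
  have -> : (fun th => 'D_(- ray th) f (u - r *: ray th) * 1) =
    (fun th => -1 * ('D_ex f (u - r *: ray th) * cos th + 'D_ey f (u - r *: ray th) * sin th)).
    apply/funext => th; have Zr := Z_ray r th Zu.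
    have df : differentiable f (u - r *: ray th) by exact: smooth_differentiable sf.
    rewrite derive_dirN // derive_dirD // !derive_dirZ // /GRing.scale /=.
    by ring.
  move=> th ti; apply: cvgMl_tmp; apply: cvgD.
    exact: (cont_on_ray sfx scos Zu ti).
  exact: (cont_on_ray sfy ssin Zu ti).
rewrite (iint_FTC rho0 _ _ (fun r _ => dE r)); last 2 first.
- by move=> r _; apply: cvgD; [exact: c1|exact: c2].
- by move=> r _; apply: cvgMl_tmp; exact: c3.
have -> : arc f (fun=> 1) rho u = 0.
  rewrite /arc; under eq_fun do rewrite f0 mul0r.
  by rewrite iint_cst // mul0r.
have -> : arc f (fun=> 1) 0 u = f u * (2 * pi).
  rewrite /arc; under eq_fun do rewrite scale0r subr0 mulr1.
  by rewrite iint_cst // subr0.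
by ring.
Qed.

(** The product of [r] with the integrand is the angular derivative of the periodic function
    [f (u - r *: ray th)]. At [r = 0], where this factor is lost, the integrand is a combination of
    [sin] and [cos]. *)
Lemma arc_angular r u : Z u -> arc ('D_ex f) sin r u - arc ('D_ey f) cos r u = 0.
Proof.
move=> Zu; have sfx := smooth_derive ex sf; have sfy := smooth_derive ey sf.
have k1 := cont_on_ray (r := r) sfx ssin Zu; have k2 := cont_on_ray (r := r) sfy scos Zu.
rewrite /arc -(meanB (iint_mean pi2)) //.
have c2p : cos (2 * pi) = 1 :> R by rewrite mulr_natl cos2pi.
have s2p : sin (2 * pi) = 0 :> R by rewrite mulr_natl sin2pi.
have kB : cont_on `[0, 2 * pi]%classic (fun th => 'D_ex f (u - r *: ray th) * sin th
   - 'D_ey f (u - r *: ray th) * cos th).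
  by move=> th ti; apply: cvgB; [exact: k1|exact: k2].
have [r0|r0] := eqVneq r 0.
  pose a := 'D_ex f u; pose b := 'D_ey f u.
  have E : (fun th => 'D_ex f (u - r *: ray th) * sin th
     - 'D_ey f (u - r *: ray th) * cos th) = (fun th => a * sin th - b * cos th).
    by apply/funext => th; rewrite r0 scale0r subr0.
  rewrite E in kB; rewrite E.
  apply: etrans (iint_FTC (F := fun th => - a * cos th - b * sin th) pi2 kB _ _) _.
  - move=> th _; apply: cvgB; apply: cvgMl_tmp; [exact: continuous_cos|exact: continuous_sin].
  - move=> th _; have d1 := is_deriveZ (- a) (is_derive_cos th).
    have d2 := is_deriveZ b (is_derive_sin th).
    by apply: (is_derive_eq (is_deriveB d1 d2)); rewrite /GRing.scale /=; ring.
  - by rewrite c2p s2p cos0 sin0; ring.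
apply: (mulfI r0); rewrite mulr0 -(meanZ (iint_mean pi2)) //.
apply: etrans (iint_FTC (F := fun th => f (u - r *: ray th)) pi2 _ _ _) _.
- by move=> th ti; apply: cvgMl_tmp; exact: kB.
- by move=> th _; apply: continuous_ray.
- move=> th _; have Zr := Z_ray r th Zu.
  apply: (is_derive_eq (is_derive_curve sf Zr (is_derive_ray u r th))).
  have df : differentiable f (u - r *: ray th) by exact: smooth_differentiable sf.
  rewrite derive_dirN // derive_dirZ // derive_dirD // derive_dirN // !derive_dirZ //.
  by rewrite /GRing.scale /=; ring.
by rewrite /ray c2p s2p cos0 sin0 subrr.
Qed.

Lemma polar_angular u : Z u ->
  polar rho sin ('D_ex f) u - polar rho cos ('D_ey f) u = 0.
Proof.
move=> Zu; have sfx := smooth_derive ex sf; have sfy := smooth_derive ey sf.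
have c1 := continuous_arc sfx ssin Zu; have c2 := continuous_arc sfy scos Zu.
rewrite !polarE -(meanB (iint_mean rho0)); last 2 first.
- by move=> r _; exact: c1.
- by move=> r _; exact: c2.
under eq_fun do rewrite arc_angular //.
by rewrite iint_cst // mul0r.
Qed.

Lemma polar_eq k g u : (forall y, Z y -> f y = g y) -> Z u ->
  polar rho k f u = polar rho k g u.
Proof.
move=> fg Zu; apply: iint_eq => r _; apply: iint_eq => th _.
by rewrite fg //; apply: Z_ray.
Qed.

Lemma polarN k u : smooth_on setT k -> Z u ->
  polar rho k (fun y => - f y) u = - polar rho k f u.
Proof.
move=> sk Zu; rewrite -mulN1r !polarE -(meanZ (iint_mean rho0)).
  apply: iint_eq => r _; rewrite /arc -(meanZ (iint_mean pi2)).
    by apply: iint_eq => th _; rewrite mulN1r mulNr.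
  exact: cont_on_ray.
by move=> r _; exact: (continuous_arc sf sk Zu).
Qed.

End polar.

(** In the sup norm, a ray of length rho displaces one of the two coordinates by at least rho/2. *)
Lemma cos_or_sin_ge {R : realType} (th : R) : 1 <= 2 * `|cos th| \/ 1 <= 2 * `|sin th|.
Proof.
have [h|h] := leP 1 (2 * `|cos th|); first by left.
right; have [//|h2] := leP 1 (2 * `|sin th|); exfalso.
have := cos2Dsin2 th; rewrite -[cos th ^+ 2]real_normK ?num_real //.
rewrite -[sin th ^+ 2]real_normK ?num_real //.
have := normr_ge0 (cos th); have := normr_ge0 (sin th).
by move: (`|cos th|) (`|sin th|) h h2 => a b; nra.
Qed.

(** * The dbar-equation in one variable *)

Section dbar_step.
Context {R : realType} {n : nat}.
Local Notation V := 'rV[R]_(n + n).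
Local Notation ee i := (delta_mx 0 (lshift n i) : V).
Local Notation ff i := (delta_mx 0 (rshift n i) : V).
Variables (j : 'I_n) (u0 : V) (e : R).
Hypothesis e0 : 0 < e.
Local Notation B := (ball u0 e).

(** Only the coordinates other than those of z_j are confined. The slab is stable under translations
    in the plane of z_j, as [polar] demands, and functions cut off in z_j extend to it by 0. *)
Let slab : set V := [set u : V |
  B (\row_i (if (i == lshift n j) || (i == rshift n j) then u0 0 i else u 0 i))].

Let slabP (u : V) : slab u <->
  forall i, i != lshift n j -> i != rshift n j -> `|u0 0 i - u 0 i| < e.
Proof.
rewrite /slab /= ball_rVP //; split=> [H i il ir|H i].
  by have := H i; rewrite !mxE (negbTE il) (negbTE ir).
rewrite !mxE; case: ifPn => [_|]; first by rewrite subrr normr0.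
by rewrite negb_or => /andP[]; apply: H.
Qed.

Let open_slab : open slab.
Proof.
apply: (open_smooth_preimage (ball_open _ _)); apply/(smooth_coordP _ openT) => i.
have [c|c] := boolP ((i == lshift n j) || (i == rshift n j)).
  by apply: smooth_eq openT _ (smooth_cst _ (u0 0 i)) => u _; rewrite mxE c.
by apply: smooth_eq openT _ (smooth_coord _ i) => u _; rewrite mxE (negbTE c).
Qed.

Let ball_slab u : B u -> slab u.
Proof. by move/(ball_rVP _ _ e0) => Bu; apply/slabP => i _ _. Qed.

Let slab_ball u : slab u -> `|u0 0 (lshift n j) - u 0 (lshift n j)| < e ->
  `|u0 0 (rshift n j) - u 0 (rshift n j)| < e -> B u.
Proof.
move=> /slabP su ul ur; apply/ball_rVP => // i.
by have [->//|il] := eqVneq i (lshift n j); have [->//|ir] := eqVneq i (rshift n j); apply: su.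
Qed.

Let slab_inv u a b : slab u -> slab (u + a *: ee j + b *: ff j).
Proof.
move=> /slabP su; apply/slabP => i il ir.
by rewrite !mxE eqxx (negbTE il) (negbTE ir) /= !mulr0 !addr0; apply: su.
Qed.

(** The scale [4 / e] makes the cutoff 1 within distance [e / 4] and 0 from distance [e / 2] on,
    hence well inside the ball. *)
Let cut (u : V) : R := plateau (4 / e * (u 0 (lshift n j) - u0 0 (lshift n j)))
  * plateau (4 / e * (u 0 (rshift n j) - u0 0 (rshift n j))).

Let smooth_cut : smooth_on setT cut.
Proof.
have H i : smooth_on setT (fun u : V => plateau (4 / e * (u 0 i - u0 0 i))).
  apply: (smooth_comp1 openT (B := setT)) => //; first exact: smooth_plateau.
  apply: smoothM; [exact: openT|exact: smooth_cst|].
  by apply: smoothB; [exact: openT|exact: smooth_coord|exact: smooth_cst].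
by apply: smoothM; [exact: openT|exact: H|exact: H].
Qed.

Let cut1 u : ball u0 (e / 4) u -> cut u = 1.
Proof.
have e4 : 0 < e / 4 by rewrite divr_gt0.
move=> /(ball_rVP _ _ e4) Bu; rewrite /cut !plateau1 ?mulr1 // normrM gtr0_norm ?divr_gt0 //;
  rewrite distrC -ler_pdivlMl ?divr_gt0 // mulr1 invf_div ltW //.
Qed.

Let cut0 (u : V) (i : 'I_(n + n)) : (i == lshift n j) || (i == rshift n j) -> e / 2 <= `|u0 0 i - u 0 i| ->
  cut u = 0.
Proof.
have H k : e / 2 <= `|u0 0 k - u 0 k| -> plateau (4 / e * (u 0 k - u0 0 k)) = 0.
  move=> h; apply: plateau0; rewrite normrM gtr0_norm ?divr_gt0 // distrC.
  rewrite -ler_pdivrMl ?divr_gt0 // invf_div (le_trans _ h) //.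
  by rewrite le_eqVlt; apply/orP; left; apply/eqP; field.
by move=> /orP[]/eqP -> /H h; rewrite /cut h ?mul0r ?mulr0.
Qed.

Let far i : set V := [set u : V | e / 2 < `|u0 0 i - u 0 i|].

Let open_far i : open (far i).
Proof.
apply: (@open_comp _ _ (fun u : V => `|u0 0 i - u 0 i|) [set x | e / 2 < x]); last exact: open_gt.
move=> u _; have c1 : {for u, continuous (fun u : V => u0 0 i - u 0 i)}.
  exact: (smooth_continuous (smoothB openT (smooth_cst _ (u0 0 i)) (smooth_coord setT i)) I).
exact: (cvg_norm c1).
Qed.

Let slab_cases u : slab u -> B u \/
  exists2 i, (i == lshift n j) || (i == rshift n j) & far i u.
Proof.
move=> su; have e2 : e / 2 < e by rewrite ltr_pdivrMr // ltr_pMr // ltr1n.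
have [h|h] := ltP (`|u0 0 (lshift n j) - u 0 (lshift n j)|) e; last first.
  by right; exists (lshift n j); rewrite ?eqxx //; apply: lt_le_trans e2 h.
have [h'|h'] := ltP (`|u0 0 (rshift n j) - u 0 (rshift n j)|) e; last first.
  by right; exists (rshift n j); rewrite ?eqxx ?orbT //; apply: lt_le_trans e2 h'.
by left; apply: slab_ball.
Qed.

Section cutoff.
Variable f : V -> R.
Hypothesis sf : smooth_on B f.

Let cf u := cut u * f u.

Let cf_far (i : 'I_(n + n)) (u : V) : (i == lshift n j) || (i == rshift n j) -> far i u -> cf u = 0.
Proof. by move=> il /ltW fu; rewrite /cf (cut0 il fu) mul0r. Qed.

Lemma smooth_cutoff : smooth_on slab cf.
Proof.
apply: smooth_local => u /slab_cases[Bu|[i il fu]].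
  exists B; split=> //; apply: smoothM; [exact: ball_open| |exact: sf].
  exact: smooth_sub smooth_cut.
exists (far i); split=> //; apply: (smooth_eq (@open_far i) (f := fun=> 0)).
  by move=> y fy; rewrite (cf_far il fy).
exact: smooth_cst.
Qed.

Lemma derive_cutoff_ball (v u : V) : v 0 (lshift n j) = 0 -> v 0 (rshift n j) = 0 -> B u ->
  'D_v cf u = cut u * 'D_v f u.
Proof.
move=> vl vr Bu; have dc : derivable cut u v by exact: smooth_derivable smooth_cut I.
have df : derivable f u v by exact: smooth_derivable sf Bu.
have := deriveM dc df; rewrite (_ : 'D_v cut u = 0).
  by rewrite scaler0 addr0.
have E (h : R) : cut (h *: v + u) = cut u.
  by rewrite /cut !mxE vl vr !mulr0 !add0r.
apply/lim_near_cst => //=; near=> h.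
by rewrite E subrr scaler0.
Unshelve. all: by end_near.
Qed.

Lemma derive_cutoff_far (v u : V) (i : 'I_(n + n)) : (i == lshift n j) || (i == rshift n j) -> far i u ->
  'D_v cf u = 0.
Proof.
move=> il fu; rewrite (@near_eq_derive _ _ _ cf (cst 0)) ?derive_cst //.
by apply: filterS (open_nbhs_nbhs (conj (@open_far i) fu)) => y fy; exact: cf_far il fy.
Qed.

End cutoff.

Variables (al ga : V -> R).
Hypotheses (sal : smooth_on B al) (sga : smooth_on B ga).

Let al' u := cut u * al u.
Let ga' u := cut u * ga u.
Let sal' : smooth_on slab al'. Proof. exact: smooth_cutoff. Qed.
Let sga' : smooth_on slab ga'. Proof. exact: smooth_cutoff. Qed.
(** At this radius one coordinate of [u - rho *: ray th] lies at distance at least 2e from that of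
    [u], hence at least e from that of [u0]: the cutoff vanishes there, as [polar_radial]
    requires. *)
Let rho := 4 * e.
Let rho0 : 0 < rho. Proof. by rewrite mulr_gt0. Qed.
Let scos : smooth_on setT (cos : R -> R). Proof. by have [] := @smooth_sin_cos R. Qed.
Let ssin : smooth_on setT (sin : R -> R). Proof. by have [] := @smooth_sin_cos R. Qed.

Let P := polar (ee j) (ff j) rho.
Let c : R := (2 * pi)^-1.
(** S + iT is the convolution of [cut] (al + i ga) with 1/(2 pi zeta) over a disc in the variable
    z_j. *)
Let S u := c * (P cos al' u + P sin ga' u).
Let T u := c * (P cos ga' u - P sin al' u).

Let sP k f : smooth_on setT k -> smooth_on slab f -> smooth_on slab (P k f).
Proof. by move=> sk sf; exact: (smooth_polar open_slab rho0 slab_inv sf sk). Qed.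

Let dP k f u v : smooth_on setT k -> smooth_on slab f -> slab u ->
  'D_v (P k f) u = P k ('D_v f) u.
Proof. by move=> sk sf; exact: (derive_polar open_slab rho0 slab_inv sf sk). Qed.

Let sS : smooth_on slab S.
Proof.
apply: smoothM => //; first exact: smooth_cst.
by apply: smoothD => //; apply: sP.
Qed.

Let sT : smooth_on slab T.
Proof.
apply: smoothM => //; first exact: smooth_cst.
by apply: smoothB => //; apply: sP.
Qed.

Let dS u v : slab u -> 'D_v S u = c * (P cos ('D_v al') u + P sin ('D_v ga') u).
Proof.
move=> su; have d1 := smooth_derivable (v := v) (sP scos sal') su.
have d2 := smooth_derivable (v := v) (sP ssin sga') su.
have := deriveZ c (derivableD d1 d2); rewrite (deriveD d1 d2) !dP //; apply.
Qed.

Let dT u v : slab u -> 'D_v T u = c * (P cos ('D_v ga') u - P sin ('D_v al') u).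
Proof.
move=> su; have d1 := smooth_derivable (v := v) (sP scos sga') su.
have d2 := smooth_derivable (v := v) (sP ssin sal') su.
have := deriveZ c (derivableB d1 d2); rewrite (deriveB d1 d2) !dP //; apply.
Qed.

Let vanish (f : V -> R) u th : B u ->
  (fun y => cut y * f y) (u - rho *: ray (ee j) (ff j) th) = 0.
Proof.
move=> /(ball_rVP _ _ e0) Bu; rewrite /=.
have L (p q s : R) : s < e -> 4 * p <= q + s -> e * 1 <= 2 * p -> e / 2 <= q.
  by move: e0 => e1 h1 h2 h3; lra.
have H (a b x : R) : 1 <= 2 * `|x| -> `|a - b| < e -> e / 2 <= `|a - (b - rho * x)|.
  move=> x1 ab; have h : rho * `|x| <= `|a - (b - rho * x)| + `|a - b|.
    have := ler_normB (a - (b - rho * x)) (a - b).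
    rewrite (_ : a - (b - rho * x) - (a - b) = rho * x); last by ring.
    by rewrite normrM (gtr0_norm rho0).
  have : e * 1 <= e * (2 * `|x|) by rewrite ler_wpM2l // ltW.
  move: h ab; rewrite -/rho {1}/rho -mulrA [e * (2 * _)]mulrCA.
  by move=> h ab h1; exact: L ab h h1.
have lr : (lshift n j == rshift n j) = false by rewrite eq_lrshift.
have rl : (rshift n j == lshift n j) = false by rewrite eq_rlshift.
case: (cos_or_sin_ge th) => h.
  rewrite (@cut0 _ (lshift n j)) ?mul0r ?eqxx //.
  by rewrite !mxE !eqxx lr /= mulr1 mulr0 addr0; apply: H.
rewrite (@cut0 _ (rshift n j)) ?mul0r ?eqxx ?orbT //.
by rewrite !mxE !eqxx rl /= mulr1 mulr0 add0r; apply: H.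
Qed.

Let c2pi : c * (2 * pi) = 1.
Proof. by rewrite mulVf // gt_eqF // mulr_gt0 // pi_gt0. Qed.

(** The equations say that S_x - T_y + i (S_y + T_x), twice the derivative of S + iT in the
    conjugate of z_j, equals al + i ga. Holomorphy of al + i ga in another variable z_i passes to S
    + iT, because derivatives enter the convolution and the cutoff depends on z_j alone. *)
Lemma dbar_step : exists S T : V -> R, [/\ smooth_on B S, smooth_on B T,
  forall u, ball u0 (e / 4) u -> 'D_(ee j) S u - 'D_(ff j) T u = al u /\
     'D_(ff j) S u + 'D_(ee j) T u = ga u &
  forall i, i != j -> (forall u, B u -> 'D_(ee i) al u = 'D_(ff i) ga u /\
       'D_(ff i) al u = - 'D_(ee i) ga u) ->
    forall u, B u -> 'D_(ee i) S u = 'D_(ff i) T u /\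
       'D_(ff i) S u = - 'D_(ee i) T u].
Proof.
exists S, T; split.
- exact: smooth_sub ball_slab sS.
- exact: smooth_sub ball_slab sT.
- move=> u Bu; have Bu' : B u by apply: le_ball Bu; rewrite ler_pdivrMr // ler_pMr // ler1n.
  have su := ball_slab Bu'; have al1 : al' u = al u by rewrite /al' cut1 // mul1r.
  have ga1 : ga' u = ga u by rewrite /ga' cut1 // mul1r.
  have ra := polar_radial open_slab rho0 slab_inv sal' su (fun th => vanish al th Bu').
  have rg := polar_radial open_slab rho0 slab_inv sga' su (fun th => vanish ga th Bu').
  have aa := polar_angular open_slab rho0 slab_inv sal' su.
  have ag := polar_angular open_slab rho0 slab_inv sga' su.
  rewrite !dS // !dT // -/P in ra rg aa ag *; split.
    have C1 (A1 A2 A3 A4 : R) : c * (A1 + A2) - c * (A3 - A4) =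
      c * ((A1 + A4) + (A2 - A3)) by ring.
    by rewrite C1 ra ag addr0 mulrA c2pi mul1r.
  have C2 (A1 A2 A3 A4 : R) : c * (A1 + A2) + c * (A3 - A4) =
    c * ((A3 + A2) - (A4 - A1)) by ring.
  by rewrite C2 rg aa subr0 mulrA c2pi mul1r.
move=> i ij H u Bu; have su := ball_slab Bu.
have coordE k : k = ee i \/ k = ff i -> k 0 (lshift n j) = 0 /\ k 0 (rshift n j) = 0.
  by case=> ->; rewrite !mxE !eqxx /= !(eq_lshift, eq_rshift, eq_lrshift, eq_rlshift)
    ![j == i]eq_sym !(negbTE ij).
have dE f (sf : smooth_on B f) y k : k = ee i \/ k = ff i -> B y ->
    'D_k (fun u => cut u * f u) y = cut y * 'D_k f y.
  by move=> /coordE[kl kr]; apply: derive_cutoff_ball.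
have E1 y : slab y -> 'D_(ee i) al' y = 'D_(ff i) ga' y.
  move=> /slab_cases[By|[l il fy]].
    by rewrite !dE //; [have [-> _] := H y By|right|left].
  by rewrite (@derive_cutoff_far al _ _ _ il fy) (@derive_cutoff_far ga _ _ _ il fy).
have E2 y : slab y -> 'D_(ff i) al' y = - 'D_(ee i) ga' y.
  move=> /slab_cases[By|[l il fy]].
    by rewrite !dE ?mulrN //; [have [_ ->] := H y By; rewrite mulrN|left|right].
  by rewrite (@derive_cutoff_far al _ _ _ il fy) (@derive_cutoff_far ga _ _ _ il fy) oppr0.
have pe k f g : (forall y, slab y -> f y = g y) -> P k f u = P k g u.
  by move=> fg; exact: (polar_eq rho slab_inv k fg su).
have pN k f : smooth_on setT k -> smooth_on slab f -> P k (fun y => - f y) u = - P k f u.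
  by move=> sk sf; exact: (polarN open_slab rho0 slab_inv sf sk su).
rewrite !dS // !dT //; split.
  rewrite (pe cos _ _ E1) (pe sin ('D_(ee i) ga') (fun y => - 'D_(ff i) al' y)).
    by rewrite pN //; exact: smooth_derive.
  by move=> y sy; rewrite E2 // opprK.
rewrite (pe cos _ _ E2) pN //; last exact: smooth_derive.
by rewrite (pe sin _ _ E1) -mulrN opprB addrC.
Qed.

End dbar_step.

(** * The local dd^c-lemma *)

Section smooth_derivatives.
Context {R : realType} {V : normedModType R} (A : set V).
Implicit Types (f g : V -> R) (v u : V).

Lemma smooth_deriveD f g v u : smooth_on A f -> smooth_on A g -> A u ->
  'D_v (fun y => f y + g y) u = 'D_v f u + 'D_v g u.
Proof.
by move=> sf sg Au; exact: deriveD (smooth_derivable sf Au) (smooth_derivable sg Au).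
Qed.

Lemma smooth_deriveZ c f v u : smooth_on A f -> A u ->
  'D_v (fun y => c * f y) u = c * 'D_v f u.
Proof. by move=> sf Au; exact: deriveZ (smooth_derivable sf Au). Qed.

Lemma smooth_deriveN f v u : smooth_on A f -> A u ->
  'D_v (fun y => - f y) u = - 'D_v f u.
Proof. by move=> sf Au; exact: deriveN (smooth_derivable sf Au). Qed.

Lemma smooth_deriveB f g v u : smooth_on A f -> smooth_on A g -> A u ->
  'D_v (fun y => f y - g y) u = 'D_v f u - 'D_v g u.
Proof.
by move=> sf sg Au; exact: deriveB (smooth_derivable sf Au) (smooth_derivable sg Au).
Qed.

Lemma smooth_deriveM f g v u : smooth_on A f -> smooth_on A g -> A u ->
  'D_v (fun y => f y * g y) u = 'D_v f u * g u + f u * 'D_v g u.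
Proof.
move=> sf sg Au; apply: etrans (deriveM (smooth_derivable sf Au) (smooth_derivable sg Au)) _.
by rewrite addrC; congr (_ + _); exact: mulrC.
Qed.

Lemma smooth_derive_sum (I : Type) (r : seq I) (f : I -> V -> R) v u : open A ->
  (forall i, smooth_on A (f i)) -> A u ->
  'D_v (fun y => \sum_(i <- r) f i y) u = \sum_(i <- r) 'D_v (f i) u.
Proof.
move=> oA sf Au; elim: r => [|i r IH].
  by rewrite big_nil (_ : (fun y => _) = cst 0) ?derive_cst //; apply/funext => y; rewrite big_nil.
rewrite big_cons -IH -(smooth_deriveD _ (sf i) _ Au); last exact: smooth_sum.
by congr ('D_v _ u); apply/funext => y; rewrite big_cons.
Qed.

Lemma smoothMc c f : open A -> smooth_on A f -> smooth_on A (fun y => c * f y).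
Proof. by move=> oA sf; apply: smoothM => //; exact: smooth_cst. Qed.

Lemma near_derive f g v u : open A -> (forall y, A y -> f y = g y) -> A u ->
  'D_v f u = 'D_v g u.
Proof. by move=> oA fg Au; apply: near_eq_derive; exact: (open_near oA Au). Qed.

Lemma derive_comb3 f g h c v u : open A -> A u ->
  smooth_on A f -> smooth_on A g -> smooth_on A h ->
  'D_v (fun y => f y + c * g y + h y) u = 'D_v f u + c * 'D_v g u + 'D_v h u.
Proof.
move=> oA Au sf sg sh; have sc := smoothMc c oA sg.
by rewrite (smooth_deriveD v (smoothD oA sf sc) sh Au) (smooth_deriveD v sf sc Au) smooth_deriveZ.
Qed.

End smooth_derivatives.

Section dolbeault.
Context {R : realType} {n : nat}.
Local Notation V := 'rV[R]_(n + n).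
Local Notation ee i := (delta_mx 0 (lshift n i) : V).
Local Notation ff i := (delta_mx 0 (rshift n i) : V).
Variables (u0 : V) (e : R).
Hypothesis e0 : 0 < e.
Local Notation B := (ball u0 e).
Variables (a b : 'I_n -> V -> R).
Hypotheses (sa : forall i, smooth_on B (a i)) (sb : forall i, smooth_on B (b i)).
Hypothesis ab1 : forall i k u, B u ->
  'D_(ee i) (b k) u - 'D_(ff k) (a i) u = 'D_(ee k) (b i) u - 'D_(ff i) (a k) u.
Hypothesis ab2 : forall i k u, B u ->
  'D_(ee i) (a k) u - 'D_(ee k) (a i) u = 'D_(ff i) (b k) u - 'D_(ff k) (b i) u.

(** The [a i] and [b i] are the dx_i and dy_i components of a 1-form, and [ab1], [ab2] express that
    its (0,1)-part is dbar-closed. The conclusion is that the form is d^c rho + d sigma near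
    [u0]. *)
Lemma dolbeault : exists d (rho sigma : V -> R),
  [/\ 0 < d, d <= e, smooth_on (ball u0 d) rho, smooth_on (ball u0 d) sigma &
  forall i u, ball u0 d u ->
   a i u = - (2^-1 * 'D_(ff i) rho u) + 'D_(ee i) sigma u /\
   b i u = 2^-1 * 'D_(ee i) rho u + 'D_(ff i) sigma u].
Proof.
(* The variables are treated one at a time, the ball shrinking by the factor 4 of [dbar_step] each
   time. *)
suff: forall k, (k <= n)%N -> exists d (rho sigma : V -> R),
  [/\ 0 < d, d <= e, smooth_on (ball u0 d) rho, smooth_on (ball u0 d) sigma &
  forall i : 'I_n, (i < k)%N -> forall u, ball u0 d u ->
   a i u = - (2^-1 * 'D_(ff i) rho u) + 'D_(ee i) sigma u /\
   b i u = 2^-1 * 'D_(ee i) rho u + 'D_(ff i) sigma u].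
  by move=> /(_ n (leqnn n)) [d [r [s [d0 de sr ss H]]]]; exists d, r, s; split=> // i u Bu; exact: H.
elim=> [_|k IH kn].
  by exists e, (fun=> 0), (fun=> 0); split=> //; exact: smooth_cst.
have [d [r [s [d0 de sr ss H]]]] := IH (ltnW kn).
pose K := Ordinal kn; have oB : open (ball u0 d) by exact: ball_open.
have dB u : ball u0 d u -> B u by apply: le_ball.
have sa' i : smooth_on (ball u0 d) (a i) by exact: smooth_sub dB (sa i).
have sb' i : smooth_on (ball u0 d) (b i) by exact: smooth_sub dB (sb i).
(* al + i ga is what remains of the component in the variable K; by closedness it is holomorphic in
   the variables already treated, so correcting it does not spoil the earlier equations. *)
pose al u := a K u + 2^-1 * 'D_(ff K) r u + (- 1 * 'D_(ee K) s u).
pose ga u := b K u + - 2^-1 * 'D_(ee K) r u + (- 1 * 'D_(ff K) s u).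
have sZ (f : V -> R) (c : R) : smooth_on (ball u0 d) f -> smooth_on (ball u0 d) (fun u => c * f u).
  exact: smoothMc.
have sal : smooth_on (ball u0 d) al.
  by apply: smoothD => //; [apply: smoothD => //|]; apply: sZ; exact: smooth_derive.
have sga : smooth_on (ball u0 d) ga.
  by apply: smoothD => //; [apply: smoothD => //|]; apply: sZ; exact: smooth_derive.
have dN (f : V -> R) v u : smooth_on (ball u0 d) f -> ball u0 d u ->
    'D_v (fun y => -1 * f y) u = - 'D_v f u.
  by move=> sf Bu; rewrite (smooth_deriveZ _ _ sf) // mulN1r.
have dal v u : ball u0 d u ->
    'D_v al u = 'D_v (a K) u + 2^-1 * 'D_v ('D_(ff K) r) u - 'D_v ('D_(ee K) s) u.
  move=> Bu; rewrite /al (derive_comb3 _ _ oB Bu) ?dN //; try exact: smooth_derive.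
  by apply: sZ; exact: smooth_derive.
have dga v u : ball u0 d u ->
    'D_v ga u = 'D_v (b K) u + - 2^-1 * 'D_v ('D_(ee K) r) u - 'D_v ('D_(ff K) s) u.
  move=> Bu; rewrite /ga (derive_comb3 _ _ oB Bu) ?dN //; try exact: smooth_derive.
  by apply: sZ; exact: smooth_derive.
have [S [T [sS sT ST pST]]] := dbar_step K d0 sal sga.
have d4 : d / 4 <= d by rewrite ler_pdivrMr // ler_pMr // ler1n.
have ddB u : ball u0 (d / 4) u -> ball u0 d u by apply: le_ball.
have oB4 : open (ball u0 (d / 4)) by exact: ball_open.
have s4 (f : V -> R) : smooth_on (ball u0 d) f -> smooth_on (ball u0 (d / 4)) f.
  exact: smooth_sub.
(* The factor 2 compensates the [2^-1] of d^c: with it the corrections are S_x - T_y and S_y +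
   T_x. *)
exists (d / 4), (fun u => r u + 2 * T u), (fun u => s u + S u).
have dr v u : ball u0 d u -> 'D_v (fun u => r u + 2 * T u) u = 'D_v r u + 2 * 'D_v T u.
  by move=> Bu; rewrite (smooth_deriveD _ sr (sZ _ 2 sT) Bu) (smooth_deriveZ _ _ sT).
have ds v u : ball u0 d u -> 'D_v (fun u => s u + S u) u = 'D_v s u + 'D_v S u.
  by move=> Bu; rewrite (smooth_deriveD _ ss sS Bu).
split.
- by rewrite divr_gt0.
- exact: le_trans de.
- by apply: smoothD => //; [exact: s4|apply: s4; exact: sZ].
- by apply: smoothD => //; exact: s4.
move=> i; rewrite ltnS leq_eqVlt => /orP[/eqP iK|ik] u Bu; have Bu' := ddB _ Bu.
  have -> : i = K by apply: val_inj.
  have [] := ST u Bu; rewrite !dr // !ds // /al /ga.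
  move: (a K u) (b K u) ('D_(ff K) r u) ('D_(ee K) r u) ('D_(ff K) s u) ('D_(ee K) s u).
  move: ('D_(ff K) S u) ('D_(ee K) S u) ('D_(ff K) T u) ('D_(ee K) T u).
  by move=> *; split; lra.
have [Ea Eb] := H i ik u Bu'.
have iK : i != K by apply/eqP => iK; move: ik; rewrite iK ltnn.
have L1 v y : ball u0 d y -> 'D_v (a i) y = - (2^-1 * 'D_v ('D_(ff i) r) y) +
    'D_v ('D_(ee i) s) y.
  move=> By.
  rewrite (@near_derive _ _ _ _ (fun u => 0 + - 2^-1 * 'D_(ff i) r u + 'D_(ee i) s u) v y oB _ By); last first.
    by move=> z Bz; have [-> _] := H i ik z Bz; rewrite mulNr add0r.
  rewrite (derive_comb3 _ _ oB By) ?derive_cst ?add0r ?mulNr //;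
    [exact: smooth_cst|exact: smooth_derive|exact: smooth_derive].
have L2 v y : ball u0 d y -> 'D_v (b i) y = 2^-1 * 'D_v ('D_(ee i) r) y +
    'D_v ('D_(ff i) s) y.
  move=> By.
  rewrite (@near_derive _ _ _ _ (fun u => 0 + 2^-1 * 'D_(ee i) r u + 'D_(ff i) s u) v y oB _ By); last first.
    by move=> z Bz; have [_ ->] := H i ik z Bz; rewrite add0r.
  rewrite (derive_comb3 _ _ oB By) ?derive_cst ?add0r //;
    [exact: smooth_cst|exact: smooth_derive|exact: smooth_derive].
have [] := pST i iK _ u Bu'.
  move=> y By; have By' := dB y By.
  have := ab1 i K By'; have := ab2 i K By'.
  have A1 (x x' y1 z1 t1 t2 t3 t4 t5 t6 : R) : y1 - t1 = z1 - t2 ->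
      t1 = - (2^-1 * t3) + t4 -> t2 = 2^-1 * t5 + t6 ->
      x = y1 + 2^-1 * t5 - t4 -> x' = z1 + - 2^-1 * t3 - t6 -> x = x' by lra.
  have A2 (x x' y1 z1 t1 t2 t3 t4 t5 t6 : R) : z1 - t1 = t2 - y1 ->
      t1 = - (2^-1 * t3) + t4 -> t2 = 2^-1 * t5 + t6 ->
      x = y1 + 2^-1 * t3 - t6 -> x' = z1 + - 2^-1 * t5 - t4 -> x = - x' by lra.
  have S1 (v w : V) := schwarz v w oB By sr.
  have S2 (v w : V) := schwarz v w oB By ss.
  move=> h2 h1; split.
    refine (A1 _ _ _ _ _ _ _ _ _ _ h2 (L1 _ y By) (L2 _ y By) _ _).
      by rewrite (dal (ee i) y By) (S1 (ee i) (ff K)) (S2 (ee i) (ee K)).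
    by rewrite (dga (ff i) y By) (S1 (ff i) (ee K)) (S2 (ff i) (ff K)).
  refine (A2 _ _ _ _ _ _ _ _ _ _ h1 (L1 _ y By) (L2 _ y By) _ _).
    by rewrite (dal (ff i) y By) (S1 (ff i) (ff K)) (S2 (ff i) (ee K)).
  by rewrite (dga (ee i) y By) (S1 (ee i) (ee K)) (S2 (ee i) (ff K)).
rewrite !dr // !ds // Ea Eb.
move: ('D_(ff i) r u) ('D_(ee i) r u) ('D_(ff i) s u) ('D_(ee i) s u).
move: ('D_(ff i) S u) ('D_(ee i) S u) ('D_(ff i) T u) ('D_(ee i) T u).
by move=> *; split; lra.
Qed.

End dolbeault.

Section levi.
Context {R : realType} {n : nat}.
Local Notation V := 'rV[R]_(n + n).
Implicit Types (f : V -> R) (u v w : V).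

(** The form dd^c f, evaluated on the constant vector fields [v] and [w]. *)
Definition levi f u v w : R :=
  - 2^-1 * ('D_v ('D_(mul_i w) f) u - 'D_w ('D_(mul_i v) f) u).

Lemma leviA f u v w : levi f u v w = - levi f u w v.
Proof. by rewrite /levi -mulrN opprB. Qed.

Lemma mul_i_delta v : mul_i v = \sum_i v 0 i *: mul_i ('e_i : V).
Proof. by rewrite {1}(row_sum_delta v) linear_sum; apply: eq_bigr => i _; rewrite linearZ. Qed.

Variables (A : set V) (f : V -> R).
Hypotheses (oA : open A) (sf : smooth_on A f).

Lemma levi_coord u v w : A u -> levi f u v w = \sum_i v 0 i * levi f u 'e_i w.
Proof.
move=> Au; have d1 x := smooth_differentiable oA Au (smooth_derive x sf).
rewrite /levi (derive_coord _ (d1 (mul_i w))) (schwarz w _ oA Au sf) (mul_i_delta v).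
rewrite derive_dir_sum // -sumrB mulr_sumr; apply: eq_bigr => i _.
rewrite derive_dirZ // [X in _ * X](_ : _ = v 0 i * ('D_'e_i ('D_(mul_i w) f) u
   - 'D_(mul_i 'e_i) ('D_w f) u)); last by rewrite mulrBr.
by rewrite mulrCA (schwarz w _ oA Au sf).
Qed.

End levi.

Section local_potential.
Context {R : realType} {n : nat}.
Local Notation V := 'rV[R]_(n + n).
Variables (u0 : V) (e : R) (Om : V -> V -> V -> R).
Local Notation B := (ball u0 e).
Hypothesis e0 : 0 < e.
Hypothesis OmS : forall v w, smooth_on B (fun u => Om u v w).
Hypothesis OmL : forall u v, B u -> linear (Om u v : V -> R^o).
Hypothesis OmA : forall u v w, B u -> Om u w v = - Om u v w.
Hypothesis OmC : forall u v1 v2 v3, B u ->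
  'D_v1 (fun u => Om u v2 v3) u - 'D_v2 (fun u => Om u v1 v3) u
  + 'D_v3 (fun u => Om u v1 v2) u = 0.
Hypothesis OmJ : forall u v w, B u -> Om u (mul_i v) (mul_i w) = Om u v w.

(** For a primitive of [Om], the invariance [OmJ] is precisely the compatibility asked by
    [dolbeault]. In the resulting decomposition d^c rho + d sigma the second summand disappears
    under d, by symmetry of second derivatives. *)
Lemma local_potential : exists d (rho : V -> R),
  [/\ 0 < d, d <= e, smooth_on (ball u0 d) rho &
  forall u v w, ball u0 d u -> Om u v w = levi rho u v w].
Proof.
have OmA' u v w : B u -> Om u v w = - Om u w v by move=> Bu; exact: OmA.
pose be w u := cone u0 Om u w.
have dbe u v w : B u -> 'D_v (be w) u - 'D_w (be v) u = Om u v w.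
  by move=> Bu; exact: (cone_primitive OmS OmL OmA OmC v w Bu).
have sbe w : smooth_on B (be w) by exact: smooth_cone.
have OmN u v w : B u -> Om u v (- w) = - Om u v w.
  move=> Bu; have L0 : Om u v 0 = 0.
    by have := OmL v Bu (-1) 0 0; rewrite !scaleN1r oppr0 addr0 => ->; exact: addNr.
  by have := OmL v Bu (-1) w 0; rewrite !scaleN1r !addr0 L0 addr0.
have [] := @dolbeault R n u0 e e0 (fun i => be (delta_mx 0 (lshift n i)))
  (fun i => be (delta_mx 0 (rshift n i))) (fun i => sbe _) (fun i => sbe _).
- move=> i k u Bu; apply: etrans (dbe _ _ _ Bu) (etrans _ (esym (dbe _ _ _ Bu))).
  rewrite -[RHS]OmJ // mul_i_lshift mul_i_rshift OmN //.
  by rewrite -OmA'.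
- by move=> i k u Bu; apply: etrans (dbe _ _ _ Bu) (etrans _ (esym (dbe _ _ _ Bu)));
  rewrite -[LHS]OmJ // !mul_i_lshift.
move=> d [rho [sig [d0 de sr ss H]]]; exists d, rho; split=> //.
have oB : open (ball u0 d) by exact: ball_open.
have dB u : ball u0 d u -> B u by apply: le_ball.
have beE i u : ball u0 d u ->
    be 'e_i u = - 2^-1 * 'D_(mul_i 'e_i) rho u + 'D_'e_i sig u.
  move=> Bu; rewrite mulNr; case: (split_ordP i) => l ->.
    by rewrite mul_i_lshift; have [] := H l u Bu.
  rewrite mul_i_rshift derive_dirN; last exact: smooth_differentiable sr.
  by rewrite mulrN opprK; have [] := H l u Bu.
have dbeE i v u : ball u0 d u ->
    'D_v (be 'e_i) u = - 2^-1 * 'D_v ('D_(mul_i 'e_i) rho) u + 'D_v ('D_'e_i sig) u.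
  move=> Bu; rewrite (near_derive v oB (beE i) Bu).
  have s1 := smooth_derive (mul_i 'e_i) sr.
  rewrite (smooth_deriveD v (smoothMc (- 2^-1) oB s1) (smooth_derive 'e_i ss) Bu).
  by rewrite (smooth_deriveZ _ _ s1).
have basis i k u : ball u0 d u -> Om u 'e_i 'e_k = levi rho u 'e_i 'e_k.
  move=> Bu; rewrite -dbe; last exact: dB.
  rewrite !dbeE // (schwarz 'e_k 'e_i oB Bu ss) /levi.
  have A1 (a b c x : R) : a * b + c - (a * x + c) = a * (b - x) by ring.
  exact: A1.
move=> u v w Bu; have Bu' := dB u Bu.
rewrite (form2_coord OmL OmA) // (levi_coord oB sr) //; apply: eq_bigr => i _.
congr (_ * _); rewrite OmA' // leviA; congr (- _).
rewrite (form2_coord OmL OmA) // (levi_coord oB sr) //; apply: eq_bigr => k _.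
by rewrite basis.
Qed.

End local_potential.

(** * Holomorphic functions: Cauchy estimates and the identity theorem *)

Section along.
Context {R : realType} {m : nat}.
Local Notation V := 'rV[R]_m.
Variables (A : set V) (T : V -> V) (f : V -> R).
Hypotheses (oA : open A) (sT : smooth_on A T) (sf : smooth_on A f).

Lemma along_coord u : A u -> 'D_(T u) f u = \sum_i T u 0 i * 'D_'e_i f u.
Proof. by move=> Au; exact: (derive_coord (T u) (smooth_differentiable oA Au sf)). Qed.

Let sTi i : smooth_on A (fun u => T u 0 i).
Proof. exact: (smooth_coordP T oA).1. Qed.

Let s1 i : smooth_on A (fun u => T u 0 i * 'D_'e_i f u).
Proof. by apply: smoothM => //; exact: smooth_derive. Qed.

Lemma smooth_along : smooth_on A (fun u => 'D_(T u) f u).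
Proof.
apply: smooth_eq oA _ (smooth_sum (index_enum _) (P := xpredT) oA (fun i _ => s1 i)) => u Au.
by rewrite along_coord.
Qed.

(** The product rule for a direction that varies with the point: the second term differentiates the
    coefficients of [T], and [schwarz] commutes the derivatives in the first. *)
Lemma derive_along v u : A u -> 'D_v (fun y => 'D_(T y) f y) u =
  'D_(T u) ('D_v f) u + 'D_('D_v T u) f u.
Proof.
move=> Au; rewrite (near_derive v oA along_coord Au) (smooth_derive_sum _ v oA s1 Au).
rewrite (derive_coord _ (smooth_differentiable oA Au sf)).
rewrite (derive_coord _ (smooth_differentiable oA Au (smooth_derive v sf))) -big_split /=.
apply: eq_bigr => i _; rewrite (smooth_deriveM v (sTi i) (smooth_derive 'e_i sf) Au).
rewrite (schwarz v 'e_i oA Au sf) (derive_coordE i (smooth_derivable sT Au)).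
by rewrite addrC.
Qed.

End along.

Section CR.
Context {R : realType} {m : nat}.
Local Notation V := 'rV[R]_m.
Variable J : V -> V.
Implicit Types (A : set V) (p q : V -> R) (T : V -> V).

(* [p + i q] is holomorphic for the complex structure [J]. *)
Definition CR A p q : Prop := [/\ smooth_on A p, smooth_on A q &
  forall u w, A u -> 'D_(J w) p u = - 'D_w q u /\ 'D_(J w) q u = 'D_w p u].

Definition hol A T : Prop := smooth_on A T /\
  forall u w, A u -> 'D_(J w) T u = J ('D_w T u).

Lemma CR_sub A B p q : A `<=` B -> CR B p q -> CR A p q.
Proof.
move=> AB [sp sq H]; split; [exact: smooth_sub sp|exact: smooth_sub sq|].
by move=> u w /AB; exact: H.
Qed.

Lemma hol_sub A B T : A `<=` B -> hol B T -> hol A T.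
Proof. by move=> AB [sT H]; split=> [|u w /AB]; [exact: smooth_sub sT|exact: H]. Qed.

Lemma CR_cst A (a b : R) : CR A (fun=> a) (fun=> b).
Proof.
split; [exact: smooth_cst|exact: smooth_cst|move=> u w _].
by rewrite !derive_cst oppr0.
Qed.

Variable A : set V.
Hypothesis oA : open A.

Lemma CR_eq p q p' q' : (forall u, A u -> p u = p' u) -> (forall u, A u -> q u = q' u) ->
  CR A p q -> CR A p' q'.
Proof.
move=> pp qq [sp sq H]; split; [exact: smooth_eq sp|exact: smooth_eq sq|].
move=> u w Au; rewrite -!(near_derive _ oA pp Au) -!(near_derive _ oA qq Au).
exact: H.
Qed.

Lemma CR_conj p q : CR A p q -> CR A q (fun u => - p u).
Proof.
move=> [sp sq H]; split=> //; first exact: smoothN.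
move=> u w Au; rewrite !(smooth_deriveN _ sp Au); have [-> ->] := H u w Au.
by rewrite !opprK.
Qed.

Lemma CRD p q p' q' : CR A p q -> CR A p' q' ->
  CR A (fun u => p u + p' u) (fun u => q u + q' u).
Proof.
move=> [sp sq H] [sp' sq' H']; split; [exact: smoothD|exact: smoothD|].
move=> u w Au; rewrite !(smooth_deriveD _ sp sp' Au) !(smooth_deriveD _ sq sq' Au).
by have [-> ->] := H u w Au; have [-> ->] := H' u w Au; rewrite opprD.
Qed.

Lemma CRM p q p' q' : CR A p q -> CR A p' q' ->
  CR A (fun u => p u * p' u - q u * q' u) (fun u => p u * q' u + q u * p' u).
Proof.
move=> [sp sq H] [sp' sq' H']; have [M1 M2 M3 M4] := And4 (smoothM oA sp sp')
  (smoothM oA sq sq') (smoothM oA sp sq') (smoothM oA sq sp').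
split; [exact: smoothB|exact: smoothD|move=> u w Au].
rewrite !(smooth_deriveB _ M1 M2 Au) !(smooth_deriveD _ M3 M4 Au).
rewrite !(smooth_deriveM _ sp sp' Au) !(smooth_deriveM _ sq sq' Au).
rewrite !(smooth_deriveM _ sp sq' Au) !(smooth_deriveM _ sq sp' Au).
have [-> ->] := H u w Au; have [-> ->] := H' u w Au.
move: ('D_w p u) ('D_w q u) ('D_w p' u) ('D_w q' u) (p u) (q u) (p' u) (q' u) => *.
by split; ring.
Qed.

Lemma CR_derive p q v : CR A p q -> CR A ('D_v p) ('D_v q).
Proof.
move=> [sp sq H]; split; [exact: smooth_derive|exact: smooth_derive|move=> u w Au].
rewrite (schwarz (J w) v oA Au sp) (schwarz (J w) v oA Au sq).
rewrite (near_derive v oA (fun y Ay => (H y w Ay).1) Au).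
rewrite (near_derive v oA (fun y Ay => (H y w Ay).2) Au).
rewrite (smooth_deriveN v (smooth_derive w sq) Au).
by rewrite (schwarz v w oA Au sq) (schwarz v w oA Au sp).
Qed.

(** Derivatives along a holomorphic field stay holomorphic, so Cauchy estimates remain available for
    all iterates. *)
Lemma CR_along p q T : CR A p q -> hol A T ->
  CR A (fun u => 'D_(T u) p u) (fun u => 'D_(T u) q u).
Proof.
move=> CRpq [sT hT]; have [sp sq H] := CRpq.
split; [exact: smooth_along|exact: smooth_along|move=> u w Au].
rewrite !(derive_along oA sT sp _ Au) !(derive_along oA sT sq _ Au) hT //.
have [-> ->] := H u ('D_w T u) Au.
rewrite (near_derive (T u) oA (fun y Ay => (H y w Ay).1) Au).
rewrite (near_derive (T u) oA (fun y Ay => (H y w Ay).2) Au).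
by rewrite (smooth_deriveN (T u) (smooth_derive w sq) Au) opprD.
Qed.

End CR.

(** * Cauchy estimates *)

Section cauchy_plane.
Context {R : realType}.
Local Notation E := 'rV[R]_2.
Variables (P Q : E -> R) (M : R).
Let D : set E := [set w : E | `|w 0 0| < 1 /\ `|w 0 1| < 1].
Hypotheses (sP : smooth_on setT P) (sQ : smooth_on setT Q).
Hypothesis PQ : forall w, D w -> 'D_('e_1 : E) P w = - 'D_('e_0 : E) Q w /\
  'D_('e_1 : E) Q w = 'D_('e_0 : E) P w.
Hypothesis PQM : forall w, D w -> `|P w| <= M /\ `|Q w| <= M.

Let oD : open D.
Proof.
have H (i : 'I_2) : open [set w : E | `|w 0 i| < 1].
  apply: (@open_comp _ _ (fun u : E => `|u 0 i|) [set x | x < 1]); last exact: open_lt.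
  move=> u _; have c1 : {for u, continuous (fun u : E => u 0 i)}.
    exact: (smooth_continuous (smooth_coord setT i) I).
  exact: (cvg_norm c1).
by rewrite (_ : D = [set w : E | `|w 0 0| < 1] `&` [set w : E | `|w 0 1| < 1]) //; apply: openI.
Qed.

Let scos : smooth_on setT (cos : R -> R). Proof. by have [] := @smooth_sin_cos R. Qed.
Let ssin : smooth_on setT (sin : R -> R). Proof. by have [] := @smooth_sin_cos R. Qed.
Let sone : smooth_on (setT : set R) (fun=> 1 : R). Proof. exact: smooth_cst. Qed.
Let pi2 : 0 < 2 * pi :> R. Proof. by rewrite mulr_gt0 // pi_gt0. Qed.
Let oT : open (setT : set E). Proof. exact: openT. Qed.
Let Tinv (u : E) (a b : R) : setT u -> setT (u + a *: 'e_0 + b *: 'e_1). Proof. by []. Qed.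
Let I0 : setT (0 : E). Proof. by []. Qed.

Let Dray (r th : R) : 0 <= r <= 2^-1 -> D (0 - r *: ray 'e_0 'e_1 th : E).
Proof.
move=> /andP[r0 r1]; have H (x : R) : `|x| <= 1 -> `|0 - r * x| < 1.
  move=> x1; rewrite sub0r normrN normrM (ger0_norm r0).
  by apply: le_lt_trans (ler_pM _ _ r1 x1) _ => //; rewrite mulr1 invf_lt1 // ltr1n.
rewrite /D /=; split.
  rewrite !mxE /= mulr1 mulr0 addr0; apply: H.
  by rewrite ler_norml cos_geN1 cos_le1.
rewrite !mxE /= mulr1 mulr0 [0 + sin th]add0r; apply: H.
by rewrite ler_norml sin_geN1 sin_le1.
Qed.

(** The mean value property of the harmonic function P_x: the Cauchy-Riemann equations rewrite its
    radial derivative as the angular derivative of Q_x, whose integral over a circle is 0. *)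
Let dPx (r : R) : 0 <= r <= 2^-1 ->
  is_derive r 1 (fun r => arc 'e_0 'e_1 ('D_'e_0 P) (fun=> 1) r 0) 0.
Proof.
move=> ri; have sPx := smooth_derive 'e_0 sP; have sQx := smooth_derive 'e_0 sQ.
apply: (is_derive_eq (is_derive_arc oT Tinv sPx sone r I0)).
rewrite -[RHS](arc_angular oT Tinv sQx r I0) /arc.
rewrite -(meanB (iint_mean pi2)); last 2 first.
- exact: (cont_on_ray oT Tinv (smooth_derive 'e_0 sQx) ssin).
- exact: (cont_on_ray oT Tinv (smooth_derive 'e_1 sQx) scos).
apply: iint_eq => th _; have Dr := Dray th ri.
have df := smooth_differentiable oT I sPx (u := 0 - r *: ray 'e_0 'e_1 th).
rewrite derive_dirN // derive_dirD // !derive_dirZ //.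
have E1 : 'D_'e_1 ('D_'e_0 P) (0 - r *: ray 'e_0 'e_1 th) =
    - 'D_'e_0 ('D_'e_0 Q) (0 - r *: ray 'e_0 'e_1 th).
  rewrite (schwarz 'e_1 'e_0 oT I sP) (near_derive 'e_0 oD (fun y Dy => (PQ Dy).1) Dr).
  by rewrite (smooth_deriveN 'e_0 sQx I).
have E2 : 'D_'e_0 ('D_'e_0 P) (0 - r *: ray 'e_0 'e_1 th) =
    'D_'e_1 ('D_'e_0 Q) (0 - r *: ray 'e_0 'e_1 th).
  rewrite -(near_derive 'e_0 oD (fun y Dy => (PQ Dy).2) Dr).
  exact: (schwarz 'e_0 'e_1 oT I sQ).
rewrite E1 E2; move: ('D_'e_1 ('D_'e_0 Q) _) ('D_'e_0 ('D_'e_0 Q) _) => x y.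
by rewrite /GRing.scale /=; ring.
Qed.

Let arcPx (r : R) : 0 <= r <= 2^-1 ->
  arc 'e_0 'e_1 ('D_'e_0 P) (fun=> 1) r 0 = 2 * pi * 'D_('e_0 : E) P 0.
Proof.
have E0 : arc 'e_0 'e_1 ('D_'e_0 P) (fun=> 1) 0 0 = 2 * pi * 'D_('e_0 : E) P 0.
  rewrite /arc; under eq_fun do rewrite scale0r subr0 mulr1.
  by rewrite iint_cst // subr0 mulrC.
move=> /andP[]; rewrite le_eqVlt => /orP[/eqP<-//|r0 r1].
have H := @iint_FTC R 0 r (fun=> 0) (fun r => arc 'e_0 'e_1 ('D_'e_0 P) (fun=> 1) r 0) r0.
have : iint 0 r (fun=> 0 : R) = arc 'e_0 'e_1 ('D_'e_0 P) (fun=> 1) r 0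
     - arc 'e_0 'e_1 ('D_'e_0 P) (fun=> 1) 0 0.
  apply: H => [t _|t _|t /andP[t0 t1]].
  - exact: cst_continuous.
  - exact: (continuous_arc oT Tinv (smooth_derive 'e_0 sP) sone I0).
  - by apply: dPx; rewrite !ltW // (lt_le_trans t1).
have Z : iint 0 r (fun=> 0 : R) = 0 by exact: etrans (iint_cst 0 r0) (mul0r _).
by move=> h; exact: etrans (subr0_eq (etrans (esym h) Z)) E0.
Qed.

Let mE (r : R) := arc ('e_0 : E) 'e_1 P cos r 0 + arc ('e_0 : E) 'e_1 Q sin r 0.

Let dm (r : R) : 0 <= r <= 2^-1 -> is_derive r 1 mE (- (2 * pi * 'D_('e_0 : E) P 0)).
Proof.
move=> ri; have d1 := is_derive_arc oT Tinv sP scos r I0.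
have d2 := is_derive_arc oT Tinv sQ ssin r I0.
apply: (is_derive_eq (is_deriveD d1 d2)); rewrite -(arcPx ri) /arc.
have sPx := smooth_derive 'e_0 sP.
have cN (f : E -> R) (k : R -> R) : smooth_on setT f -> smooth_on setT k ->
  cont_on `[0, 2 * pi]%classic
    (fun th => 'D_(- ray ('e_0 : E) 'e_1 th) f (0 - r *: ray 'e_0 'e_1 th) * k th).
  move=> sf sk.
  have c1 := cont_on_ray oT Tinv (smooth_derive 'e_0 sf) scos (r := r) I0.
  have c2 := cont_on_ray oT Tinv (smooth_derive 'e_1 sf) ssin (r := r) I0.
  rewrite (_ : (fun th => _) = (fun th => (-1 *
    ('D_'e_0 f (0 - r *: ray 'e_0 'e_1 th) * cos th + 'D_'e_1 f (0 - r *: ray 'e_0 'e_1 th) * sin th)) * k th)).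
    move=> th ti; apply: cvgM; last exact: smooth_continuous sk _.
    by apply: cvgMl_tmp; apply: cvgD; [exact: c1|exact: c2].
  apply/funext => th.
  have df := smooth_differentiable oT I sf (u := 0 - r *: ray 'e_0 'e_1 th).
  rewrite derive_dirN // derive_dirD // !derive_dirZ // /GRing.scale /=.
  by congr (_ * _); ring.
rewrite -(meanD (iint_mean pi2)); last 2 first.
- exact: cN.
- exact: cN.
rewrite -mulN1r -(meanZ (iint_mean pi2)); last exact: (cont_on_ray oT Tinv sPx sone).
apply: iint_eq => th _; have Dr := Dray th ri; have [E1 E2] := PQ Dr.
have dP := smooth_differentiable oT I sP (u := 0 - r *: ray 'e_0 'e_1 th).
have dQ := smooth_differentiable oT I sQ (u := 0 - r *: ray 'e_0 'e_1 th).
rewrite !derive_dirN // !derive_dirD // !derive_dirZ // E1 E2.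
have := cos2Dsin2 th.
move: ('D_'e_0 P _) ('D_'e_0 Q _) (cos th) (sin th) => x y c s cs.
rewrite /GRing.scale /= mulN1r mulr1 -[x in RHS]mul1r -cs; ring.
Qed.

(** The circle integral [mE] of P cos + Q sin vanishes at radius 0 and has constant derivative - 2
    pi P_x(0). At radius 1/2 it is bounded by 4 pi M, whence the constant 4. *)
Lemma cauchy_plane : `|'D_('e_0 : E) P 0| <= 4 * M.
Proof.
have h0 : (0 : R) < 2^-1 by [].
pose d := 'D_('e_0 : E) P 0.
have m0 : mE 0 = 0.
  rewrite /mE /arc; under eq_fun do rewrite scale0r subr0.
  under [X in _ + iint _ _ X]eq_fun do rewrite scale0r subr0.
  have H (k K : R -> R) : (forall t : R, is_derive t 1 K (k t)) -> smooth_on setT k ->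
      iint 0 (2 * pi) k = K (2 * pi) - K 0.
    move=> dK sk; apply: iint_FTC => //.
    - by move=> t _; exact: smooth_continuous sk _.
    - by move=> t _; apply/differentiable_continuous/derivable1_diffP; have [] := dK t.
  rewrite (meanZ (iint_mean pi2)); last by move=> t _; exact: continuous_cos.
  rewrite (meanZ (iint_mean pi2)); last by move=> t _; exact: continuous_sin.
  have dN (t : R) : is_derive t 1 (fun t => - cos t) (sin t).
    by apply: (is_derive_eq (is_deriveN (is_derive_cos t))); rewrite opprK.
  rewrite (H cos sin (fun t => is_derive_sin t) scos) (H sin (fun t => - cos t) dN ssin).
  by rewrite mulr_natl sin2pi cos2pi sin0 cos0 opprK subr0 mulr0 addNr mulr0 addr0.
have cm : cont_on (`[0, 2^-1]%classic : set R) mE.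
  move=> t _; apply: cvgD.
    exact: (continuous_arc oT Tinv sP scos I0).
  exact: (continuous_arc oT Tinv sQ ssin I0).
have cc : cont_on (`[0, 2^-1]%classic : set R) (fun=> - (2 * pi * d)).
  by move=> t _; exact: cst_continuous.
have E1 : iint 0 2^-1 (fun=> - (2 * pi * d)) = mE 2^-1 - mE 0.
  by apply: iint_FTC => // t /andP[t0 t1]; apply: dm; rewrite !ltW.
rewrite iint_cst // m0 !subr0 in E1.
have mb : `|mE 2^-1| <= 2 * pi * M + 2 * pi * M.
  have h1 : 0 <= (2^-1 : R) <= 2^-1 by lra.
  have HM (f : E -> R) (k : R -> R) : (forall th, `|f (0 - 2^-1 *: ray 'e_0 'e_1 th)| <= M) ->
      (forall th, `|k th| <= 1) -> smooth_on setT f -> smooth_on setT k ->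
      `|arc ('e_0 : E) 'e_1 f k 2^-1 0| <= 2 * pi * M.
    move=> fM k1 sf sk; have := mean_bound (iint_mean pi2) (e := M)
      (cont_on_ray oT Tinv sf sk (r := 2^-1) I0).
    rewrite subr0; apply => th _; rewrite normrM -[M]mulr1.
    by apply: ler_pM.
  apply: le_trans (ler_normD _ _) (lerD _ _); apply: HM => //.
  - by move=> th; have [] := PQM (Dray th h1).
  - by move=> th; rewrite ler_norml cos_geN1 cos_le1.
  - by move=> th; have [] := PQM (Dray th h1).
  - by move=> th; rewrite ler_norml sin_geN1 sin_le1.
move: mb; rewrite -E1 normrM normrN normrM (gtr0_norm pi2) (gtr0_norm h0) -/d.
by have := pi2; move: (2 * pi) `|d| => x y x0 h; nra.
Qed.

End cauchy_plane.

Section clamp.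
Context {R : realType}.
Implicit Types t : R.

Lemma plateau_le1 t : `|plateau t| <= 1.
Proof.
have H : 0 <= plateau t <= 1; last first.
  by case/andP: H => h1 h2; rewrite ger0_norm.
rewrite /plateau /step; have d0 := step_den (2 - t * t).
apply/andP; split; first by rewrite divr_ge0 ?flat_ge0 // ltW.
by rewrite ler_pdivrMr // mul1r lerDl flat_ge0.
Qed.

(** A bounded smooth function that is the identity on [-1, 1]. Composing with it makes a function
    known on a bidisc smooth on the whole plane, as [cauchy_plane] asks. *)
Definition clamp t : R := t * plateau t.

Lemma clamp1 t : `|t| <= 1 -> clamp t = t.
Proof. by move=> t1; rewrite /clamp plateau1 // mulr1. Qed.

Lemma clamp_le2 t : `|clamp t| <= 2.
Proof.
rewrite /clamp; have [t2|t2] := leP 2 `|t|; first by rewrite plateau0 // mulr0 normr0.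
by rewrite normrM -[leRHS]mulr1 ler_pM ?plateau_le1 // ltW.
Qed.

Lemma smooth_clamp : smooth_on setT (clamp : R -> R).
Proof.
by apply: smoothM; [exact: openT|exact: smooth_id|exact: smooth_plateau].
Qed.

End clamp.

Section cauchy.
Context {R : realType} {m : nat}.
Local Notation V := 'rV[R]_m.
Variables (J : V -> V) (A : set V) (p q : V -> R).
Hypotheses (oA : open A) (CRpq : CR J A p q).

(** The complex line through [u] is parametrized at scale [h / 2], because [clamp] takes values up
    to 2; this turns the constant 4 of [cauchy_plane] into 8. *)
Lemma cauchy_estimate (u v : V) (h M : R) : 0 < h ->
  (forall a b : R, `|a| <= h -> `|b| <= h ->
     [/\ A (u + a *: v + b *: J v), `|p (u + a *: v + b *: J v)| <= M &
      `|q (u + a *: v + b *: J v)| <= M]) ->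
  `|'D_v p u| <= 8 * M / h.
Proof.
move=> h0 H; have [sp sq C] := CRpq.
pose E := 'rV[R]_2; pose k := h / 2; have k0 : 0 < k by rewrite divr_gt0.
pose g (w : E) : V := u + (k * clamp (w 0 0)) *: v + (k * clamp (w 0 1)) *: J v.
pose L (w : E) : V := u + (k * w 0 0) *: v + (k * w 0 1) *: J v.
have kc (t : R) : `|k * clamp t| <= h.
  by rewrite normrM (gtr0_norm k0) -[leRHS](@divfK _ 2) // ler_pM2l // clamp_le2.
have gA w : A (g w) by have [] := H _ _ (kc (w 0 0)) (kc (w 0 1)).
have oE : open (setT : set E) by exact: openT.
have sg : smooth_on setT g.
  apply/(smooth_coordP _ oE) => i.
  have sk j : smooth_on setT (fun w : E => k * clamp (w 0 j)).
    apply: smoothMc => //; apply: (smooth_comp1 oE (B := setT)) => //.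
      exact: smooth_clamp.
    exact: smooth_coord.
  apply: smooth_eq oE _ (smoothD oE (smoothD oE (smooth_cst _ (u 0 i))
    (smoothM oE (sk 0) (smooth_cst _ (v 0 i)))) (smoothM oE (sk 1) (smooth_cst _ (J v 0 i)))).
  by move=> w _; rewrite /g !mxE.
pose D : set E := [set w : E | `|w 0 0| < 1 /\ `|w 0 1| < 1].
have oD : open D.
  have oi (i : 'I_2) : open [set w : E | `|w 0 i| < 1].
    apply: (@open_comp _ _ (fun u : E => `|u 0 i|) [set x | x < 1]); last exact: open_lt.
    move=> w _; have c1 : {for w, continuous (fun u : E => u 0 i)}.
      exact: (smooth_continuous (smooth_coord setT i) I).
    exact: (cvg_norm c1).
  by rewrite (_ : D = [set w : E | `|w 0 0| < 1] `&` [set w : E | `|w 0 1| < 1]) //; apply: openI.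
have gL w : D w -> g w = L w by move=> [w0 w1]; rewrite /g !clamp1 // ltW.
have L0 w a : L (a *: 'e_0 + w) = a *: (k *: v) + L w.
  rewrite /L !mxE /= mulr1 mulr0 add0r mulrDr scalerDl scalerA [a * k]mulrC.
  by rewrite [u + (_ + _)]addrCA -addrA.
have L1 w a : L (a *: 'e_1 + w) = a *: (k *: J v) + L w.
  rewrite /L !mxE /= mulr1 mulr0 add0r mulrDr scalerDl scalerA [a * k]mulrC.
  by rewrite addrCA.
have dg f w : smooth_on A f -> D w ->
    'D_('e_0 : E) (fun w => f (g w)) w = k * 'D_v f (L w) /\
    'D_('e_1 : E) (fun w => f (g w)) w = k * 'D_(J v) f (L w).
  move=> sf Dw; have df : differentiable f (L w).
    by apply: smooth_differentiable oA _ sf; rewrite -gL.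
  have E0 z : 'D_z (fun w => f (g w)) w = 'D_z (fun w => f (L w)) w.
    by apply: (near_derive z oD _ Dw) => y Dy; rewrite gL.
  rewrite !E0 (derive_affine f (L0 w)) (derive_affine f (L1 w)).
  by rewrite !derive_dirZ.
have := @cauchy_plane R (fun w => p (g w)) (fun w => q (g w)) M.
have Dz : D 0 by rewrite /D /= !mxE normr0.
have [-> _] := dg p 0 sp Dz.
have -> : L 0 = u by rewrite /L !mxE !mulr0 !scale0r !addr0.
rewrite normrM (gtr0_norm k0) => bnd.
have {}bnd : k * `|'D_v p u| <= 4 * M.
  apply: bnd.
  - exact: smooth_comp oE oA (fun w _ => gA w) sp sg.
  - exact: smooth_comp oE oA (fun w _ => gA w) sq sg.
  - move=> w Dw; have [-> ->] := dg p w sp Dw; have [-> ->] := dg q w sq Dw.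
    by have [|-> ->] := C (L w) v; [rewrite -gL|rewrite mulrN].
  - by move=> w _; have [] := H _ _ (kc (w 0 0)) (kc (w 0 1)).
rewrite ler_pdivlMr // mulrC; move: bnd; rewrite /k.
by move: `|_| => x; lra.
Qed.

End cauchy.

(** * Series of holomorphic functions with geometric bounds *)

Section geometric_bound.
Context {R : realType}.
Implicit Types (a b : nat -> R) (M q x : R).

Definition ssum a : R := limn (series a).

Definition geo_bound M q a := forall m, `|a m| <= M * q ^+ m.

Lemma geo_bound_ge0 M q a : geo_bound M q a -> 0 <= M.
Proof. by move=> /(_ 0%N); rewrite expr0 mulr1; apply: le_trans. Qed.

Lemma geo_sum_le M q n : 0 <= M -> 0 <= q < 1 ->
  \sum_(0 <= m < n) M * q ^+ m <= M / (1 - q).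
Proof.
move=> M0 /andP[q0 q1]; have d0 : 0 < 1 - q by rewrite subr_gt0.
rewrite -mulr_sumr ler_wpM2l // -[leRHS]mul1r ler_pdivlMr // mulrC big_mkord.
by rewrite -[X in X * _]opprB mulNr -subrX1 opprB lerBlDr lerDl exprn_ge0.
Qed.

Lemma geo_cvg M q a : 0 <= q < 1 -> geo_bound M q a -> series a @ \oo --> ssum a.
Proof.
move=> /andP[q0 q1] H; apply: normed_cvg.
apply: (@series_le_cvg _ _ (geometric M q)) => [n|n|n|].
- exact: normr_ge0.
- by rewrite /= mulr_ge0 ?exprn_ge0 // (geo_bound_ge0 H).
- exact: H.
- by apply: is_cvg_geometric_series; rewrite ger0_norm.
Qed.

Lemma geo_tail M q a N : 0 <= q < 1 -> geo_bound M q a ->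
  `|ssum a - \sum_(0 <= m < N) a m| <= M * q ^+ N / (1 - q).
Proof.
move=> qi H; have M0 := geo_bound_ge0 H; have cva := geo_cvg qi H.
have c : (fun n => `|series a n - series a N|) @ \oo --> `|ssum a - series a N|.
  by apply: cvg_norm; apply: cvgB => //; exact: cvg_cst.
have d0 : 0 < 1 - q by rewrite subr_gt0; case/andP: qi.
rewrite -[leLHS](cvg_lim _ c) //; apply: limr_le; first by apply/cvg_ex; eexists; exact: c.
near=> n; have Nn : (N <= n)%N by near: n; exact: nbhs_infty_ge.
have -> : series a n - series a N = \sum_(N <= k < n) a k.
  by have := sub_series_geq a Nn => /= <-.
apply: le_trans (ler_norm_sum _ _ _) _.
apply: le_trans (_ : \sum_(N <= k < n) M * q ^+ k <= _).
  by apply: ler_sum => k _; exact: H.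
rewrite -{1}[N]add0n big_addn; under eq_bigr => i _ do rewrite exprD [_ ^+ i * _]mulrC mulrA.
by apply: geo_sum_le => //; rewrite mulr_ge0 // exprn_ge0 //; case/andP: qi.
Unshelve. all: by end_near. Qed.

Lemma geo_bound_lin M q N a b x : geo_bound M q a -> geo_bound N q b ->
  geo_bound (`|x| * M + N) q (fun m => x * a m + b m).
Proof.
move=> ha hb m; rewrite mulrDl; apply: le_trans (ler_normD _ _) (lerD _ (hb m)).
by rewrite normrM -mulrA ler_wpM2l.
Qed.

Lemma ssum_lin M q N a b x : 0 <= q < 1 -> geo_bound M q a -> geo_bound N q b ->
  ssum (fun m => x * a m + b m) = x * ssum a + ssum b.
Proof.
move=> qi ha hb; have ca := geo_cvg qi ha; have cb := geo_cvg qi hb.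
apply: cvg_lim => //.
have -> : series (fun m => x * a m + b m) = (fun n => x * series a n + series b n).
  by apply/funext => n; rewrite /series /= big_split -mulr_sumr.
by apply: cvgD => //; apply: cvgMl_tmp.
Qed.

Lemma ssum0 : ssum (fun=> 0) = 0.
Proof.
have z : geo_bound 0 0 (fun=> 0) by move=> k; rewrite normr0 mul0r.
have i0 : 0 <= (0 : R) < 1 by rewrite lexx ltr01.
have E := ssum_lin (-1) i0 z z; move: E.
by rewrite (_ : (fun _ => _) = fun=> 0) ?mulN1r ?addNr // (_ : (fun _ => _) = fun=> 0) //; apply/funext => k; rewrite mulr0 addr0.
Qed.

Lemma ssumS M q a : 0 <= q < 1 -> geo_bound M q a -> ssum a = a 0%N + ssum (fun m => a m.+1).
Proof.
move=> qi ha; have ca := geo_cvg qi ha.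
have hs : geo_bound (M * q) q (fun m => a m.+1).
  by move=> m; rewrite -mulrA -exprS; exact: ha.
have cs := geo_cvg qi hs.
have c1 : (fun n => series a n.+1) @ \oo --> ssum a by rewrite cvg_shiftS.
have c2 : (fun n => series a n.+1) @ \oo --> a 0%N + ssum (fun m => a m.+1).
  rewrite (_ : (fun n => _) = fun n => a 0%N + series (fun m => a m.+1) n).
    by apply: cvgD => //; exact: cvg_cst.
  by apply/funext => n; rewrite /series /= big_nat_recl.
exact: (cvg_unique (@Rhausdorff R) c1 c2).
Qed.

(** Dominated convergence for series: the tail is small uniformly by the geometric bound, and
    finitely many terms tend to 0. *)
Lemma ssum_dominated {T : Type} (F : set_system T) (FF : Filter F) (a : nat -> T -> R) M q :
  0 <= q < 1 -> (\forall t \near F, geo_bound M q (a^~ t)) ->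
  (forall m, a m @ F --> (0 : R)) -> (fun t => ssum (a^~ t)) @ F --> (0 : R).
Proof.
move=> qi aM a0; apply/cvgrPdist_le => e e0.
have d0 : 0 < 1 - q by rewrite subr_gt0; case/andP: qi.
have cg : (fun N => M * q ^+ N / (1 - q)) @ \oo --> (0 : R).
  rewrite -[X in _ --> X](mul0r (1 - q)^-1); apply: cvgMr_tmp.
  by apply: cvg_geometric; rewrite ger0_norm; case/andP: qi.
have e2 : 0 < e / 2 by rewrite divr_gt0.
have /cvgrPdist_le/(_ _ e2)[N _ /(_ N (leqnn N)) hN] := cg.
have cS : (fun t => \sum_(0 <= m < N) a m t) @ F --> (0 : R).
  elim: (N) => [|k IH].
    by under eq_fun do rewrite big_nil; exact: cvg_cst.
  under eq_fun do rewrite big_nat_recr //=.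
  by have H := cvgD IH (a0 k); rewrite addr0 in H; exact: H.
near=> t; rewrite sub0r normrN.
have -> : ssum (a^~ t) = (ssum (a^~ t) - \sum_(0 <= m < N) a m t) + \sum_(0 <= m < N) a m t.
  by rewrite subrK.
have ht : geo_bound M q (a^~ t) by near: t.
apply: le_trans (ler_normD _ _) _; rewrite (splitr e); apply: lerD.
  apply: le_trans (geo_tail N qi ht) _; move: hN; rewrite sub0r normrN.
  by apply: le_trans; exact: ler_norm.
near: t; have /cvgrPdist_le/(_ _ e2) := cS; apply: filterS => t.
by rewrite sub0r normrN.
Unshelve. all: by end_near. Qed.

End geometric_bound.

Section series_functions.
Context {R : realType} {m : nat}.
Local Notation V := 'rV[R]_m.
Implicit Types (f p q : nat -> V -> R) (A : set V).

Definition geo_on A f := forall u, A u -> exists e M x,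
  [/\ 0 < e, 0 <= x < 1 & forall y, ball u e y -> A y /\ geo_bound M x (f^~ y)].

Definition fsum f u : R := ssum (f^~ u).

Variables (A : set V) (f : nat -> V -> R).
Hypotheses (sf : forall k, smooth_on A (f k)) (gf : geo_on A f).

Lemma fsum_continuous u : A u -> {for u, continuous (fsum f)}.
Proof.
move=> Au; have [e [M [x [e0 xi H]]]] := gf Au.
apply: cont_at_dist => d d0.
have [_ bu] := H u (ballxx u e0).
have near_u : \forall y \near u, ball u e y by apply: nbhsx_ballx.
have K : (fun y => ssum (fun k => -1 * f k u + f k y)) @ u --> (0 : R).
  apply: (@ssum_dominated _ _ _ (nbhs_filter u) _ (`|-1| * M + M) x xi).
    by apply: filterS near_u => y /H[_ by_]; exact: geo_bound_lin.
  move=> k; rewrite -[X in _ --> X](addNr (f k u)) mulN1r.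
  apply: (@cvgD _ _ _ _ (nbhs_filter u)); first exact: cvg_cst.
  exact: (smooth_continuous (sf k) Au).
have := (@cvgrPdist_le _ _ _ _ (nbhs_filter u) _ _).1 K d d0.
have FF := nbhs_filter u; move=> K'; apply: filterS (@filterI _ _ FF _ _ K' near_u).
move=> y [] /=; rewrite sub0r normrN => Ky /H[_ by_].
by rewrite distrC -[fsum f y - _]addrC -mulN1r -(ssum_lin (-1) xi bu by_).
Qed.

Variable v : V.
Hypothesis gd : geo_on A (fun k => 'D_v (f k)).

(** The mean value theorem replaces each difference quotient by a derivative at a nearby point, so
    the errors of all terms share one geometric bound and [ssum_dominated] applies. *)
Lemma fsum_derive u : A u -> is_derive u v (fsum f) (fsum (fun k => 'D_v (f k)) u).
Proof.
move=> Au; have [e [M [x [e0 xi H]]]] := gf Au.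
have [e' [M' [x' [e0' xi' H']]]] := gd Au.
have [_ bu] := H u (ballxx u e0); have [_ bu'] := H' u (ballxx u e0').
pose d (k : nat) (h : R) := h^-1 * (-1 * f k u + f k (h *: v + u)) - 'D_v (f k) u.
have near_h (r : R) : 0 < r -> \forall h \near (0 : R)^', forall s : R, `|s| <= `|h| ->
    ball u r (u + s *: v).
  move=> r0; have v1 : 0 < `|v| + 1 by rewrite ltr_wpDl.
  near=> h => s sh; rewrite -ball_normE /= opprD addrA subrr sub0r normrN normrZ.
  apply: le_lt_trans (_ : `|h| * (`|v| + 1) < r).
    by apply: ler_pM => //; rewrite lerDl.
  rewrite -ltr_pdivlMr //; near: h; apply: dnbhs0_lt; exact: divr_gt0.
have K : (fun h => ssum (d^~ h)) @ 0^' --> (0 : R).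
  apply: (@ssum_dominated _ _ _ _ _ (M' + `|-1| * M') x' xi').
    near=> h => k.
    have hr : forall s : R, `|s| <= `|h| -> ball u e' (u + s *: v).
      by near: h; exact: near_h.
    have [|s sh E] := @mvt_line_abs _ _ (f k) u v h.
      by move=> s sh; apply: smooth_derivable (sf k) _; have [] := H' _ (hr s sh).
    have h0 : h != 0 by near: h; exact: nbhs_dnbhs_neq.
    rewrite /d mulN1r [h *: v + u]addrC [- _ + _]addrC E mulKf //.
    rewrite mulrDl; apply: le_trans (ler_normB _ _) _; apply: lerD.
      by have [_ /(_ k)] := H' _ (hr s sh).
    by rewrite normrN1 mul1r; exact: bu'.
  move=> k; have dk := smooth_derivable (v := v) (sf k) Au.
  have {}dk : (fun h : R => h^-1 *: ((f k \o shift u) (h *: v) - f k u)) @ 0^' --> 'D_v (f k) u.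
    exact: dk.
  rewrite -[X in _ --> X](subrr ('D_v (f k) u)); apply: cvgB; last exact: cvg_cst.
  rewrite (_ : (fun h => _) = (fun h : R => h^-1 *: ((f k \o shift u) (h *: v) - f k u))) //.
  by apply/funext => h; rewrite /= mulN1r addrC.
have G : (fun h : R => h^-1 *: ((fsum f \o shift u) (h *: v) - fsum f u)) @ 0^' -->
    fsum (fun k => 'D_v (f k)) u.
  apply/cvgrPdist_le => r r0; have /cvgrPdist_le/(_ r r0) K' := K.
  near=> h.
  have hb : `|0 - ssum (d^~ h)| <= r by near: h.
  have hr : forall s : R, `|s| <= `|h| -> ball u e (u + s *: v).
    by near: h; exact: near_h.
  have [_ bh] := H _ (hr h (lexx _)).
  move: hb; rewrite sub0r normrN.
  have -> : ssum (d^~ h) = h^-1 * (-1 * ssum (f^~ u) + ssum (f^~ (u + h *: v)))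
      - ssum (fun k => 'D_v (f k) u).
    pose y := Num.max x x'.
    have yi : 0 <= y < 1.
      by rewrite le_max gt_max; case/andP: xi => -> ->; case/andP: xi' => _ ->.
    have up (N z : R) (a : nat -> R) : 0 <= z <= y -> geo_bound N z a -> geo_bound N y a.
      move=> /andP[z0 zy] hz k; apply: le_trans (hz k) _; rewrite ler_wpM2l ?(geo_bound_ge0 hz) //.
      by rewrite lerXn2r // nnegrE (le_trans z0).
    have xy : 0 <= x <= y by case/andP: xi => -> _; rewrite le_max lexx.
    have xy' : 0 <= x' <= y by case/andP: xi' => -> _; rewrite le_max lexx orbT.
    have l1 := geo_bound_lin (-1) (up _ _ _ xy bu) (up _ _ _ xy bh).
    have z0 : geo_bound 0 y (fun=> 0) by move=> k; rewrite normr0 mul0r.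
    have l3 := geo_bound_lin h^-1 l1 z0.
    have E1 := ssum_lin (-1) yi (up _ _ _ xy bu) (up _ _ _ xy bh).
    have E2 := ssum_lin h^-1 yi l1 z0.
    have E3 := ssum_lin (-1) yi (up _ _ _ xy' bu') l3.
    rewrite -E1 addrC -[X in X + _]mulN1r -[h^-1 * _]addr0 -(ssum0 (R := R)) -E2 -E3.
    congr ssum; apply/funext => k; rewrite /d [h *: v + u]addrC addr0 [LHS]addrC.
    by congr (_ + _); rewrite mulN1r.
  rewrite distrC /= mulN1r [- _ + _]addrC [h *: v + u]addrC; exact.
by split; [apply/cvg_ex; eexists; exact: G|exact: cvg_lim G].
Unshelve. all: by end_near. Qed.

End series_functions.

Section CR_series.
Context {R : realType} {m : nat}.
Local Notation V := 'rV[R]_m.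
Variables (J : V -> V) (A : set V).
Hypothesis oA : open A.
Implicit Types p q : nat -> V -> R.

(** Cauchy estimates bound the derivatives of the terms on a smaller ball with a common ratio, only
    the constant being multiplied by [8 / h]. *)
Lemma geo_derive p q v : (forall k, CR J A (p k) (q k)) -> geo_on A p -> geo_on A q ->
  geo_on A (fun k => 'D_v (p k)).
Proof.
move=> C gp gq u Au; have [e [M [x [e0 xi H]]]] := gp u Au.
have [e' [M' [x' [e0' xi' H']]]] := gq u Au.
pose d := Num.min e e'; have d0 : 0 < d by rewrite lt_min e0 e0'.
pose y := Num.max x x'; pose N := Num.max M M'.
have yi : 0 <= y < 1.
  by rewrite le_max gt_max; case/andP: xi => -> ->; case/andP: xi' => _ ->.
pose c := `|v| + `|J v| + 1; have c0 : 0 < c by rewrite ltr_wpDl // addr_ge0.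
(* A displacement by at most [h] along [v] and along [J v], from a point of the half ball, stays in
   the ball of radius [d]. *)
pose h : R := d / 2 / c; have h0 : 0 < h by rewrite !divr_gt0.
have up (z P : R) (a : nat -> R) : 0 <= z <= y -> P <= N -> geo_bound P z a -> geo_bound N y a.
  move=> /andP[z0 zy] PN hz k; apply: le_trans (hz k) _.
  by rewrite ler_pM ?(geo_bound_ge0 hz) ?exprn_ge0 // lerXn2r // nnegrE (le_trans z0).
have xy : 0 <= x <= y by case/andP: xi => -> _; rewrite le_max lexx.
have xy' : 0 <= x' <= y by case/andP: xi' => -> _; rewrite le_max lexx orbT.
have MN : M <= N by rewrite le_max lexx.
have MN' : M' <= N by rewrite le_max lexx orbT.
exists (d / 2), (8 * N / h), y; split=> //; first by rewrite divr_gt0.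
move=> z Bz; have dd : d / 2 <= d by rewrite ler_pdivrMr // ler_pMr // ler1n.
have /H[Az _] : ball u e z.
  by apply: le_ball Bz; apply: le_trans dd _; rewrite ge_min lexx.
split=> // k; rewrite mulrAC -[8 * N * _]mulrA.
apply: (@cauchy_estimate _ _ J A (p k) (q k) oA (C k) z v h (N * y ^+ k) h0) => a b ah bh; set w := _ + b *: _.
have Bw : ball u d w.
  have : ball z (d / 2) w.
    rewrite -ball_normE /= /w opprD opprD !addrA subrr sub0r -opprD normrN.
    apply: le_lt_trans (ler_normD _ _) _; rewrite !normrZ.
    apply: le_lt_trans (_ : h * (`|v| + `|J v|) < _).
      by rewrite mulrDr lerD // ler_wpM2r.
    by rewrite /h mulrAC ltr_pdivrMr // ltr_pM2l ?divr_gt0 // ltrDl.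
  by move=> Bzw; have := ball_triangle Bz Bzw; rewrite -splitr.
have /H[Aw Hw] : ball u e w by apply: le_ball Bw; rewrite ge_min lexx.
have /H'[_ Hw'] : ball u e' w by apply: le_ball Bw; rewrite ge_min lexx orbT.
by split=> //; [apply: (up _ _ _ xy MN Hw)|apply: (up _ _ _ xy' MN' Hw')].
Qed.

Variables (p q : nat -> V -> R).
Hypotheses (C : forall k, CR J A (p k) (q k)) (gp : geo_on A p) (gq : geo_on A q).

Lemma derive_fsum u v : A u -> is_derive u v (fsum p) (fsum (fun k => 'D_v (p k)) u).
Proof.
move=> Au; apply: fsum_derive Au => //; first by move=> k; have [] := C k.
exact: geo_derive gq.
Qed.
End CR_series.

Section CR_fsum.
Context {R : realType} {m : nat}.
Local Notation V := 'rV[R]_m.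
Variables (J : V -> V) (A : set V).
Hypothesis oA : open A.
Implicit Types p q : nat -> V -> R.

Lemma geo_conj p q v : (forall k, CR J A (p k) (q k)) -> geo_on A p -> geo_on A q ->
  geo_on A (fun k => 'D_v (q k)).
Proof.
move=> C gp gq; apply: (geo_derive oA v (fun k => CR_conj oA (C k)) gq) => u Au.
have [e [M [x [e0 xi H]]]] := gp u Au; exists e, M, x; split=> //.
by move=> y /H[Ay Hy]; split=> // k; rewrite normrN; exact: Hy.
Qed.

Lemma smooth_fsum p q : (forall k, CR J A (p k) (q k)) -> geo_on A p -> geo_on A q ->
  smooth_on A (fsum p).
Proof.
move=> C gp gq k; elim: k p q C gp gq => [|k IH] p q C gp gq.
  split=> // u Au; apply: fsum_continuous Au => //; by move=> j; have [] := C j.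
split=> [u Au|v]; first by apply: fsum_continuous Au => //; move=> j; have [] := C j.
split=> [u Au|]; first by have [] := derive_fsum oA C gp gq v Au.
apply: (@C_k_eq _ _ _ k A (fsum (fun k => 'D_v (p k)))) => //.
  by move=> u Au; have [_ ->] := derive_fsum oA C gp gq v Au.
apply: (IH _ (fun k => 'D_v (q k))).
- by move=> j; exact: CR_derive.
- exact: geo_derive gq.
- exact: geo_conj gq.
Qed.

Lemma CR_fsum p q : (forall k, CR J A (p k) (q k)) -> geo_on A p -> geo_on A q ->
  CR J A (fsum p) (fsum q).
Proof.
move=> C gp gq; have C' k := CR_conj oA (C k).
have gN f : geo_on A f -> geo_on A (fun k u => - f k u).
  move=> gf u Au; have [e [M [x [e0 xi H]]]] := gf u Au; exists e, M, x; split=> //.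
  by move=> y /H[Ay Hy]; split=> // k; rewrite normrN; exact: Hy.
split; [exact: smooth_fsum gq|exact: (smooth_fsum C' gq (gN _ gp))|move=> u w Au].
have [_ ->] := derive_fsum oA C gp gq (J w) Au.
have [_ ->] := derive_fsum oA C gp gq w Au.
have [_ ->] := derive_fsum oA C' gq (gN _ gp) (J w) Au.
have [_ ->] := derive_fsum oA C' gq (gN _ gp) w Au.
have [e [M [x [e0 xi H]]]] := geo_conj w C gp gq Au.
have [_ b] := H u (ballxx u e0).
split; last first.
  by congr ssum; apply/funext => k; have [_ _ /(_ u w Au)[_ ->]] := C k.
have z : geo_bound 0 x (fun=> 0) by move=> k; rewrite normr0 mul0r.
have E : (fun k => 'D_(J w) (p k) u) = (fun k => -1 * 'D_w (q k) u + 0).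
  by apply/funext => k; have [_ _ /(_ u w Au)[-> _]] := C k; rewrite mulN1r addr0.
rewrite /fsum E; apply: etrans (ssum_lin (-1) xi b z) _.
by rewrite ssum0 mulN1r addr0.
Qed.

End CR_fsum.

(** A weak Stirling bound, by induction from (1 + 1/n)^n <= e. It absorbs the n^n produced by n
    successive Cauchy estimates on radii proportional to 1/n. *)
Lemma powM_le_fact {R : realType} (n : nat) : (n%:R : R) ^+ n <= expR 1 ^+ n * n`!%:R.
Proof.
elim: n => [|n IH]; first by rewrite !expr0 fact0 mulr1.
have -> : (n.+1%:R : R) ^+ n.+1 = n.+1%:R * n.+1%:R ^+ n by rewrite exprS.
rewrite factS natrM mulrCA ler_wpM2l // exprS mulrAC -mulrA.
have [->|n0] := eqVneq n 0%N.
  by rewrite !expr0 fact0 !mulr1; apply: le_trans (expR_ge1Dx 1); rewrite lerDl.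
have n1 : (0 : R) < n%:R by rewrite ltr0n lt0n.
apply: le_trans (_ : expR 1 * n%:R ^+ n <= _).
  have -> : (n.+1%:R : R) = n%:R * (1 + n%:R^-1) by rewrite mulrDr mulr1 divff ?gt_eqF // natr1.
  rewrite exprMn mulrC ler_wpM2r ?exprn_ge0 //.
  apply: le_trans (_ : expR n%:R^-1 ^+ n <= _).
    by rewrite lerXn2r ?nnegrE ?expR_ge0 ?expR_ge1Dx // addr_ge0 // invr_ge0 ltW.
  by rewrite -expRM_natl divff // gt_eqF.
by rewrite ler_wpM2l ?expR_ge0 // mulrC.
Qed.

Section iterate.
Context {R : realType} {m : nat}.
Local Notation V := 'rV[R]_m.
Variables (J : V -> V) (A : set V) (T : V -> V).
Hypotheses (oA : open A) (hT : hol J A T).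

Definition along_iter n (p : V -> R) : V -> R := iter n (fun f u => 'D_(T u) f u) p.

Lemma CR_along_iter p q n : CR J A p q -> CR J A (along_iter n p) (along_iter n q).
Proof. by move=> C; elim: n => [|n IH]; [exact: C|exact: (CR_along oA IH hT)]. Qed.

Variables (D : R -> set V) (S : R).
Hypothesis DA : forall s, s <= S -> D s `<=` A.
Hypothesis DD : forall s h u a b, 0 <= s -> 0 < h -> s + h <= S -> D s u -> `|a| <= h -> `|b| <= h ->
  D (s + h) (u + a *: T u + b *: J (T u)).

(** The sets [D s] record the room already spent. Each derivative uses a complex disc of size [h],
    passes from level [s] to [s + h], and costs the factor [8 / h]. *)
Lemma along_iter_bound p q M h n s u : CR J A p q ->
  (forall u, D S u -> `|p u| <= M /\ `|q u| <= M) ->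
  (forall s s', s <= s' -> s' <= S -> D s `<=` D s') ->
  0 < h -> 0 <= s -> s + n%:R * h <= S -> D s u ->
  `|along_iter n p u| <= (8 / h) ^+ n * M /\ `|along_iter n q u| <= (8 / h) ^+ n * M.
Proof.
move=> C pq mono h0; elim: n s u => [|n IH] s u s0 sn Du.
  by rewrite mul0r addr0 in sn; rewrite expr0 mul1r; apply: pq; apply: mono Du.
have C' := CR_along_iter n C.
have sh : s + h + n%:R * h <= S by move: sn; rewrite -natr1 mulrDl mul1r addrA addrAC.
have sh' : s + h <= S by apply: le_trans sh; rewrite lerDl mulr_ge0 // ltW.
have sh0 : 0 <= s + h by rewrite addr_ge0 // ltW.
have B a b (ah : `|a| <= h) (bh : `|b| <= h) := DD s0 h0 sh' Du ah bh.
have E : (8 / h) ^+ n.+1 * M = 8 * ((8 / h) ^+ n * M) / h by rewrite exprS; ring.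
rewrite E; split.
  apply: (cauchy_estimate oA C' h0) => a b ah bh; have Db := B a b ah bh.
  by have [b1 b2] := IH _ _ sh0 sh Db; split=> //; apply: DA Db.
apply: (cauchy_estimate oA (CR_conj oA C') h0) => a b ah bh; have Db := B a b ah bh.
by have [b1 b2] := IH _ _ sh0 sh Db; split=> //; [apply: DA Db|rewrite normrN].
Qed.

End iterate.

(** * The identity theorem *)

Section identity.
Context {R : realType} {m : nat}.
Local Notation V := 'rV[R]_m.

(** Induction on [n]: the bound for ['D_v f] is integrated along the segment, in the form that K
    s^(n+1)/(n+1)! minus or plus f is nondecreasing. *)
Lemma taylor_vanish n (A : set V) (f : V -> R) x v K : open A -> smooth_on A f ->
  (forall s : R, 0 <= s <= 1 -> A (x + s *: v)) ->
  (forall k, (k < n)%N -> iter k (fun g => 'D_v g) f x = 0) ->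
  (forall s : R, 0 <= s <= 1 -> `|iter n (fun g => 'D_v g) f (x + s *: v)| <= K) ->
  forall s : R, 0 <= s <= 1 -> `|f (x + s *: v)| <= K * s ^+ n / n`!%:R.
Proof.
move=> oA + Ax; elim: n f => [|n IH] f sf f0 fK s si.
  by rewrite expr0 fact0 mulr1 divr1; exact: fK.
have {}IH : forall s : R, 0 <= s <= 1 -> `|'D_v f (x + s *: v)| <= K * s ^+ n / n`!%:R.
  move=> t0 ti0; apply: (IH ('D_v f) (smooth_derive v sf) _ _ t0 ti0).
    by move=> k kn; rewrite -iterSr; exact: f0.
  by move=> t ti; rewrite -iterSr; exact: fK.
have fx : f x = 0 by have := f0 0%N isT.
have dp (t : R) : is_derive t 1 (fun t => K * t ^+ n.+1 / n.+1`!%:R) (K * t ^+ n / n`!%:R).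
  have d0 : is_derive t 1 (fun t : R => t ^+ n.+1) (n.+1%:R * t ^+ n).
    apply: DeriveDef; first exact: exprn_derivable.
    by rewrite exp_derive [_ *: 1]mulr1.
  have d1 := is_deriveZ (K / n.+1`!%:R) d0.
  rewrite (_ : (fun t => _) = (K / n.+1`!%:R) \*: (fun t => t ^+ n.+1)); last first.
    by apply/funext => y; rewrite [LHS]mulrAC.
  apply: (is_derive_eq d1); rewrite /GRing.scale /= factS natrM.
  have a0 : (n.+1%:R : R) != 0 by rewrite pnatr_eq0.
  have b0 : (n`!%:R : R) != 0 by rewrite pnatr_eq0 -lt0n fact_gt0.
  by move: (n.+1%:R : R) (n`!%:R : R) a0 b0 => a b a0 b0; field; rewrite a0 b0.
have df (t : R) : 0 <= t <= 1 -> is_derive t 1 (fun t => f (x + t *: v)) ('D_v f (x + t *: v)).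
  move=> ti; apply: DeriveDef; last exact: derive_line.
  by apply/derivable_line; exact: smooth_derivable sf (Ax t ti).
have H (g dg : R -> R) : (forall t : R, 0 <= t <= 1 -> is_derive t 1 g (dg t)) -> g 0 = 0 ->
    (forall t : R, 0 <= t <= 1 -> dg t <= K * t ^+ n / n`!%:R) -> g s <= K * s ^+ n.+1 / n.+1`!%:R.
  move=> dgd g0 dgle; pose F (t : R) := K * t ^+ n.+1 / n.+1`!%:R - g t.
  have dF (t : R) : 0 <= t <= 1 -> is_derive t 1 F (K * t ^+ n / n`!%:R - dg t).
    by move=> ti; exact: is_deriveB (dp t) (dgd t ti).
  have incr := @ger0_derive1_le_cc R F 0 1.
  have : F 0 <= F s.
    case/andP: (si) => s0 s1; apply: incr => //.
    - move=> t; rewrite in_itv /= => /andP[t0 t1]; have ti : 0 <= t <= 1 by rewrite !ltW.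
      by have [] := dF t ti.
    - move=> t; rewrite in_itv /= => /andP[t0 t1]; have ti : 0 <= t <= 1 by rewrite !ltW.
      by rewrite derive1E; have [_ ->] := dF t ti; rewrite subr_ge0; exact: dgle.
    - apply: derivable_within_continuous => t; rewrite in_itv /= => ti.
      by have [] := dF t ti.
    - by rewrite in_itv /= lexx ler01.
  by rewrite /F g0 exprS !mul0r mulr0 mul0r subr0 subr_ge0.
rewrite ler_norml lerNl; apply/andP; split.
  apply: (H (fun t => - f (x + t *: v)) (fun t => - 'D_v f (x + t *: v))).
  - by move=> t ti; exact: is_deriveN (df t ti).
  - by rewrite scale0r addr0 fx oppr0.
  - by move=> t ti; have := IH t ti; rewrite ler_norml lerNl => /andP[].
apply: (H (fun t => f (x + t *: v)) (fun t => 'D_v f (x + t *: v))) => //.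
- by rewrite scale0r addr0.
- by move=> t ti; have := IH t ti; rewrite ler_norml => /andP[].
Qed.

Variables (J : V -> V) (x : V) (e : R) (p q : V -> R).
Hypotheses (e0 : 0 < e) (JN : forall v, `|J v| <= `|v|).
Hypothesis C : CR J (ball x e) p q.
Hypothesis p0 : forall n v, iter n (fun g => 'D_v g) p x = 0.

(** At order n the Taylor remainder is at most (8n/S)^n M / n!, by [along_iter_bound] with steps
    S/n. This tends to 0 once S is large against e, which is arranged by taking y close to x. *)
Lemma CR_identity : exists2 d, 0 < d & forall y, ball x d y -> p y = 0.
Proof.
have [sp sq _] := C; have oB : open (ball x e) by exact: ball_open.
pose c := expR 1 * 8 : R; have c0 : 0 < c by rewrite mulr_gt0 ?expR_gt0.
have bnd : exists M r, 0 < r /\ forall y, ball x r y -> ball x e y /\ `|p y| <= M /\ `|q y| <= M.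
  have H (f : V -> R) : smooth_on (ball x e) f -> \forall y \near x, `|f y| <= `|f x| + 1.
    move=> sf; have c1 : {for x, continuous f} by exact: smooth_continuous sf (ballxx x e0).
    have /(_ _ ltr01) := (@cvgrPdist_le _ _ _ _ (nbhs_filter x) _ _).1 c1.
    apply: filterS => y h; rewrite -[f y](subrK (f x)) addrC.
    by rewrite (le_trans (ler_normD _ _)) // lerD2l distrC.
  have /nbhs_ballP[r r0 Hr] : \forall y \near x, `|p y| <= `|p x| + 1 /\ `|q y| <= `|q x| + 1.
    exact: (@filterI _ _ (nbhs_filter x) _ _ (H p sp) (H q sq)).
  exists (Num.max (`|p x| + 1) (`|q x| + 1)), (Num.min r e).
  split; first by rewrite lt_min r0 e0.
  move=> y By; have /Hr[h1 h2] : ball x r y by apply: le_ball By; rewrite ge_min lexx.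
  split; first by apply: le_ball By; rewrite ge_min lexx orbT.
  by rewrite !le_max h1 h2 orbT.
have [M [r [r0 Hr]]] := bnd.
have M0 : 0 <= M by have [_ [h _]] := Hr x (ballxx x r0); apply: le_trans h.
(* With S = 16 e one has 8n/S = n/(2e), so that [powM_le_fact] yields the bound 2^(-n) M. The radius
   [d] keeps displacements by 1 + S times y - x in the ball of radius [r]. *)
pose S : R := 2 * c; pose d := r / (2 * (1 + S)) / 2.
have S1 : 0 < 1 + S by rewrite addr_gt0 // mulr_gt0.
exists d => [|y By]; first by rewrite !divr_gt0 // mulr_gt0.
pose v := y - x; have vd : `|v| < d.
  by move: By; rewrite -ball_normE /= distrC.
(* The 1 covers the segment from [x] to [y], and [s] the successive Cauchy discs. *)
pose D (s : R) : set V := [set u | exists a b : R,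
  [/\ `|a| <= 1 + s, `|b| <= 1 + s & u = x + a *: v + b *: J v]].
have DB s : s <= S -> D s `<=` ball x r.
  move=> sS u [a [b [ha hb ->]]]; rewrite -ball_normE /= opprD opprD !addrA subrr sub0r -opprD normrN.
  apply: le_lt_trans (ler_normD _ _) _; rewrite !normrZ.
  apply: le_lt_trans (_ : (1 + S) * `|v| + (1 + S) * `|v| < _).
    apply: lerD; first by apply: ler_pM => //; apply: le_trans ha _; rewrite lerD2l.
    by apply: ler_pM => //; apply: le_trans hb _; rewrite lerD2l.
  have : (1 + S) * `|v| < (1 + S) * d by rewrite ltr_pM2l.
  have -> : (1 + S) * d = r / 4 by rewrite /d; field; rewrite gt_eqF.
  by move: ((1 + S) * `|v|) r0 => t; lra.
have DA s : s <= S -> D s `<=` ball x e by move=> sS u /(DB s sS)/Hr[].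
have hv : hol J (ball x e) (fun=> v).
  split; first exact: smooth_cst.
  move=> u w _; rewrite !derive_cst; apply/esym/eqP.
  by rewrite -normr_le0 (le_trans (JN _)) // normr0.
have DD s h u a b : 0 <= s -> 0 < h -> s + h <= S -> D s u -> `|a| <= h -> `|b| <= h ->
    D (s + h) (u + a *: v + b *: J v).
  move=> s0 h0 sS [a' [b' [ha' hb' ->]]] ha hb; exists (a' + a), (b' + b); split.
  - by rewrite addrA (le_trans (ler_normD _ _)) // lerD.
  - by rewrite addrA (le_trans (ler_normD _ _)) // lerD.
  - by rewrite !scalerDl !addrA; congr (_ + _); rewrite addrAC.
have mono s s' : s <= s' -> s' <= S -> D s `<=` D s'.
  move=> ss _ u [a [b [ha hb ->]]]; exists a, b; split=> //.
    by apply: le_trans ha _; rewrite lerD2l.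
  by apply: le_trans hb _; rewrite lerD2l.
have pM u : D S u -> `|p u| <= M /\ `|q u| <= M by move=> /(DB _ (lexx S))/Hr[].
have iterE n f : along_iter (fun=> v) n f = iter n (fun g => 'D_v g) f.
  by elim: n => //= n ->.
have est n : `|p y| <= 2^-1 ^+ n * M.
  have [->|n0] := eqVneq n 0%N.
    have : ball x r y; last by move=> /Hr[_ []]; rewrite expr0 mul1r.
    have S0 : 0 < S by rewrite mulr_gt0.
    apply: le_ball By; rewrite /d !ler_pdivrMr ?mulr_gt0 //; move: r0 S0; nra.
  have n1 : (0 : R) < n%:R by rewrite ltr0n lt0n.
  have := @taylor_vanish n _ p x v ((8 / (S / n%:R)) ^+ n * M) oB sp.
  move=> /(_ _ _ _ 1); rewrite ler01 lexx => /(_ _ _ _ isT).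
  have -> : x + 1 *: v = y by rewrite scale1r /v addrC subrK.
  rewrite expr1n mulr1 => h.
  apply: le_trans (h _ _ _) _.
  - move=> s /andP[s0 s1]; apply: (DA 0); first by rewrite ltW // mulr_gt0.
    exists s, 0; split; first by rewrite addr0 ger0_norm.
      by rewrite normr0 addr0.
    by rewrite scale0r addr0.
  - by move=> k _; exact: p0.
  - move=> s /andP[s0 s1]; rewrite -iterE.
    have := along_iter_bound oB hv DA DD (h := S / n%:R) (n := n) (s := 0) C pM mono.
    move=> /(_ (x + s *: v)) [] //.
    + by rewrite divr_gt0 // mulr_gt0.
    + by rewrite add0r mulrC divfK // gt_eqF.
    exists s, 0; split; first by rewrite addr0 ger0_norm.
      by rewrite normr0 addr0.
    by rewrite scale0r addr0.
  have f0 : (0 : R) < n`!%:R by rewrite ltr0n fact_gt0.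
  rewrite ler_pdivrMr // [leRHS]mulrAC ler_wpM2r //.
  have -> : 8 / (S / n%:R) = 2^-1 / expR 1 * n%:R.
    rewrite /S /c; field; rewrite !gt_eqF ?expR_gt0 //.
  rewrite exprMn expr_div_n -!mulrA ler_wpM2l ?exprn_ge0 //.
  by rewrite ler_pdivrMl ?exprn_gt0 ?expR_gt0 // powM_le_fact.
have c1 : (fun n => 2^-1 ^+ n * M) @ \oo --> (0 : R).
  rewrite -[X in _ --> X](mul0r M); apply: cvgMr_tmp.
  have := @cvg_geometric R 1 2^-1; rewrite ger0_norm // invf_lt1 // ltr1n => /(_ isT).
  by rewrite (_ : geometric 1 2^-1 = fun n => 2^-1 ^+ n) //; apply/funext => n; rewrite /= mul1r.
apply/eqP; rewrite -normr_le0; have <- := cvg_lim (@Rhausdorff R) c1.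
apply: limr_ge; first by apply/cvg_ex; eexists; exact: c1.
by apply: nearW => n; exact: est.
Qed.

End identity.

(** * Families of fields and functions *)

Section lie_derivative.
Context {R : realType} {m : nat}.
Local Notation V := 'rV[R]_m.
Variables (A : set V) (X Y : V -> V) (f : V -> R).
Hypotheses (oA : open A) (sX : smooth_on A X) (sY : smooth_on A Y) (sf : smooth_on A f).

Lemma lie_derivative u : A u ->
  'D_(X u) (fun y => 'D_(Y y) f y) u - 'D_(Y u) (fun y => 'D_(X y) f y) u =
  'D_('D_(X u) Y u) f u - 'D_('D_(Y u) X u) f u.
Proof.
move=> Au; rewrite (derive_along oA sY sf (X u) Au) (derive_along oA sX sf (Y u) Au).
rewrite (schwarz (Y u) (X u) oA Au sf).
by move: ('D_(X u) ('D_(Y u) f) u) ('D_('D_(X u) Y u) f u) => a b; ring.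
Qed.

End lie_derivative.

Section family.
Context {R : realType} {p q m : nat}.
Local Notation U := 'rV[R]_p.
Local Notation L := 'rV[R]_q.
Local Notation V := 'rV[R]_m.
Variables (A : set U) (B : set V) (phi : U -> V) (c : U -> L).
Hypotheses (oA : open A) (oB : open B) (AB : forall t, A t -> B (phi t)).
Hypotheses (sphi : smooth_on A phi) (sc : smooth_on A c).

Let sci l : smooth_on A (fun t => c t 0 l).
Proof. exact: (smooth_coordP c oA).1. Qed.

Section scalar.
Variable F : L -> V -> R.
Hypothesis FL : forall d u, F d u = \sum_l d 0 l * F 'e_l u.
Hypothesis sF : forall d, smooth_on B (F d).

Let sFi l : smooth_on A (fun t => F 'e_l (phi t)).
Proof. exact: smooth_comp oA oB AB (sF _) sphi. Qed.

Let s1 l : smooth_on A (fun t => c t 0 l * F 'e_l (phi t)).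
Proof. exact: smoothM. Qed.

Lemma smooth_family : smooth_on A (fun t => F (c t) (phi t)).
Proof.
apply: smooth_eq oA _ (smooth_sum (index_enum _) (P := xpredT) oA (fun i _ => s1 i)) => t At.
by rewrite [RHS]FL.
Qed.

Lemma derive_index d w u : B u -> 'D_w (F d) u = \sum_l d 0 l * 'D_w (F 'e_l) u.
Proof.
move=> Bu; rewrite (near_derive w oB (fun y _ => FL d y) Bu).
rewrite (smooth_derive_sum _ w oB (fun l => smoothMc (d 0 l) oB (sF 'e_l)) Bu).
by apply: eq_bigr => l _; rewrite (smooth_deriveZ _ _ (sF 'e_l) Bu).
Qed.

Lemma derive_family w t : A t -> 'D_w (fun t => F (c t) (phi t)) t =
  F ('D_w c t) (phi t) + 'D_('D_w phi t) (F (c t)) (phi t).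
Proof.
move=> At; rewrite (near_derive w oA (fun y _ => FL (c y) (phi y)) At).
rewrite (smooth_derive_sum _ w oA s1 At) FL (derive_index _ _ (AB At)) -big_split /=.
apply: eq_bigr => l _; rewrite (smooth_deriveM w (sci l) (sFi l) At).
rewrite (derive_coordE l (smooth_derivable sc At)); congr (_ + _ * _).
apply: derive_compE; first exact: smooth_differentiableV oA At sphi.
exact: smooth_differentiable oB (AB At) (sF _).
Qed.

End scalar.

Section vector.
Context {m' : nat}.
Variable F : L -> V -> 'rV[R]_m'.
Hypothesis FL : forall d u, F d u = \sum_l d 0 l *: F 'e_l u.
Hypothesis sF : forall d, smooth_on B (F d).

Let FLi i d u : F d u 0 i = \sum_l d 0 l * F 'e_l u 0 i.
Proof. by rewrite FL summxE; apply: eq_bigr => l _; rewrite mxE. Qed.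

Let sFi i d : smooth_on B (fun u => F d u 0 i).
Proof. exact: (smooth_coordP (F d) oB).1. Qed.

Lemma smooth_familyV : smooth_on A (fun t => F (c t) (phi t)).
Proof.
by apply/(smooth_coordP _ oA) => i; apply: (smooth_family (F := fun d u => F d u 0 i)).
Qed.

Lemma derive_familyV w t : A t -> 'D_w (fun t => F (c t) (phi t)) t =
  F ('D_w c t) (phi t) + 'D_('D_w phi t) (F (c t)) (phi t).
Proof.
move=> At; apply/rowP => i.
rewrite -(derive_coordE i (smooth_derivable smooth_familyV At)).
rewrite (derive_family (FLi i) (sFi i) w At) mxE; congr (_ + _).
by rewrite (derive_coordE i (smooth_derivable (sF _) (AB At))).
Qed.

End vector.
End family.

Section smooth_matrix.
Context {R : realType} {m s : nat}.
Local Notation V := 'rV[R]_m.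
Variable A : set V.
Hypothesis oA : open A.

Lemma smooth_det r (F : V -> 'M[R]_r) : (forall i j, smooth_on A (fun u => F u i j)) ->
  smooth_on A (fun u => \det (F u)).
Proof.
move=> sF; apply: smooth_sum => // sg _; apply: smoothMc => //.
by apply: smooth_prod => // i _; exact: sF.
Qed.

Lemma smooth_invmx (F : V -> 'M[R]_s) : (forall i j, smooth_on A (fun u => F u i j)) ->
  (forall u, A u -> \det (F u) != 0) -> forall i j, smooth_on A (fun u => invmx (F u) i j).
Proof.
move=> sF F0 i j.
have sadj : smooth_on A (fun u => (\adj (F u)) i j).
  have : smooth_on A (fun u => (-1) ^+ (j + i) * \det (row' j (col' i (F u)))).
    apply: smoothMc => //; apply: smooth_det => k l.
    have := sF (lift j k) (lift i l).
    by apply: smooth_eq oA _ => u _; rewrite !mxE.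
  by apply: smooth_eq oA _ => u _; rewrite !mxE.
have sd := smooth_det sF; have sV := smoothV oA F0 sd.
apply: smooth_eq oA _ (smoothM oA sV sadj) => u Au.
by rewrite /invmx unitmxE unitfE F0 // [RHS]mxE.
Qed.

(** Obtained by differentiating the entries of [invmx (F u) *m F u = 1]. *)
Lemma derive_invmx (F : V -> 'M[R]_s) w u : (forall i j, smooth_on A (fun u => F u i j)) ->
  (forall u, A u -> \det (F u) != 0) -> A u ->
  \matrix_(i, j) 'D_w (fun u => invmx (F u) i j) u =
  - (invmx (F u) *m (\matrix_(i, j) 'D_w (fun u => F u i j) u) *m invmx (F u)).
Proof.
move=> sF F0 Au; have sN := smooth_invmx sF F0.
have uF y : A y -> F y \in unitmx by move=> Ay; rewrite unitmxE unitfE F0.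
set dN := \matrix_(i, j) _; set dF := \matrix_(i, j) _.
suff : dN *m F u + invmx (F u) *m dF = 0.
  move/eqP; rewrite addr_eq0 => /eqP E.
  by rewrite -[LHS](mulmxK (uF u Au)) E mulNmx.
apply/matrixP => i j; rewrite [RHS]mxE !mxE -big_split /=.
have E : 'D_w (fun y => \sum_l invmx (F y) i l * F y l j) u = 0.
  rewrite (near_derive w oA (g := fun=> (1%:M : 'M[R]_s) i j) _ Au) ?derive_cst //.
  by move=> y Ay; rewrite -(mulVmx (uF y Ay)) mxE.
apply: etrans _ E; rewrite (smooth_derive_sum _ w oA (fun l => smoothM oA (sN i l) (sF l j)) Au).
apply: eq_bigr => l _; rewrite (smooth_deriveM w (sN i l) (sF l j) Au) !mxE.
by [].
Qed.

End smooth_matrix.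

Lemma mul_i_norm {R : realType} {n : nat} (v : 'rV[R]_(n + n)) : `|mul_i v| <= `|v|.
Proof.
apply/rV_norm_le => // i; case: (split_ordP i) => l ->.
  by rewrite mul_i_lE normrN; exact: rV_norm_coord.
by rewrite mul_i_rE; exact: rV_norm_coord.
Qed.

Section derive_mulmx.
Context {R : realType} {m a b : nat}.
Local Notation U := 'rV[R]_m.
Variables (A : set U) (f : U -> 'rV[R]_a) (M : U -> 'M[R]_(a, b)).
Hypotheses (oA : open A) (sf : smooth_on A f)
  (sM : forall i j, smooth_on A (fun u => M u i j)).

Let sfi i : smooth_on A (fun t => f t 0 i).
Proof. exact: (smooth_coordP f oA).1. Qed.

Let s1 j i : smooth_on A (fun u => f u 0 i * M u i j).
Proof. exact: smoothM. Qed.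

Lemma smooth_mulmx : smooth_on A (fun u => f u *m M u).
Proof.
apply/(smooth_coordP _ oA) => j.
apply: smooth_eq oA _ (smooth_sum (index_enum _) (P := xpredT) oA (fun i _ => s1 j i)) => t At.
by rewrite mxE.
Qed.

Lemma derive_mulmx w u : A u -> 'D_w (fun u => f u *m M u) u =
  'D_w f u *m M u + f u *m \matrix_(i, j) 'D_w (fun u => M u i j) u.
Proof.
move=> Au; apply/rowP => j.
rewrite -(derive_coordE j (smooth_derivable smooth_mulmx Au)).
have E y : A y -> (f y *m M y) 0 j = \sum_i f y 0 i * M y i j by rewrite mxE.
rewrite (near_derive w oA E Au) (smooth_derive_sum _ w oA (s1 j) Au) !mxE -big_split /=.
apply: eq_bigr => i _; rewrite (smooth_deriveM w (sfi i) (sM i j) Au) mxE.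
by rewrite (derive_coordE i (smooth_derivable sf Au)).
Qed.

End derive_mulmx.

Section derive_mulmx_const.
Context {R : realType} {m a b : nat}.
Local Notation U := 'rV[R]_m.
Variables (A : set U) (f : U -> 'rV[R]_a) (P : 'M[R]_(a, b)).
Hypotheses (oA : open A) (sf : smooth_on A f).

Lemma smooth_mulmx_const : smooth_on A (fun u => f u *m P).
Proof. by apply: (smooth_mulmx (M := fun=> P)) => // i j; exact: smooth_cst. Qed.

Lemma derive_mulmx_const w u : A u -> 'D_w (fun u => f u *m P) u = 'D_w f u *m P.
Proof.
move=> Au; rewrite (derive_mulmx (M := fun=> P) oA sf _ w Au); last first.
  by move=> i j; exact: smooth_cst.
rewrite (_ : \matrix_(i, j) _ = 0) ?mulmx0 ?addr0 //.
by apply/matrixP => i j; rewrite !mxE derive_cst.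
Qed.

End derive_mulmx_const.

Section frame.
Context {R : realType} {n k r : nat}.
Local Notation V := 'rV[R]_(n + n).
Local Notation L := 'rV[R]_(k + k).
Local Notation W := 'rV[R]_(r + r).
Variables (B : set V) (Vf : L -> V -> V) (h : L -> V -> R)
  (P : 'M[R]_(r + r, k + k)).

Definition frame_mx u : 'M[R]_(r + r) :=
  \matrix_(i, j) 'D_(Vf (row i P) u) (h (row j P)) u.

Definition transverse u : W := \row_j h (row j P) u.

(* A holomorphic family of vector fields [Vf] and a conjugate family of functions
   [h], such that the fields indexed by the rows of [P] are transverse to the
   common zeros of the corresponding functions. *)
Record hol_frame : Prop := {
  frame_open : open B;
  frame_fieldL : forall d u, Vf d u = \sum_l d 0 l *: Vf 'e_l u;
  frame_funL : forall d u, h d u = \sum_l d 0 l * h 'e_l u;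
  frame_hol : forall d, hol (@mul_i R n) B (Vf d);
  frame_fieldJ : forall d u, Vf (mul_i d) u = mul_i (Vf d u);
  frame_CR : forall d, CR (@mul_i R n) B (h d) (fun u => - h (mul_i d) u);
  frame_indexJ : forall y : W, mul_i (y *m P) = mul_i y *m P;
  frame_det : forall u, B u -> \det (frame_mx u) != 0 }.

Lemma family_lin (F : L -> V -> R) : (forall d u, F d u = \sum_l d 0 l * F 'e_l u) ->
  forall a d d' u, F (a *: d + d') u = a * F d u + F d' u.
Proof.
move=> FL a d d' u; rewrite FL (FL d) (FL d') mulr_sumr -big_split /=.
by apply: eq_bigr => l _; rewrite !mxE mulrDl mulrA.
Qed.

Lemma family_mulmx (F : L -> V -> R) : (forall d u, F d u = \sum_l d 0 l * F 'e_l u) ->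
  forall (a : nat) (y : 'rV[R]_a) (M : 'M[R]_(a, k + k)) u,
  F (y *m M) u = \sum_j y 0 j * F (row j M) u.
Proof.
move=> FL a y M u; rewrite FL.
under [RHS]eq_bigr => j _ do rewrite FL mulr_sumr.
rewrite exchange_big /=; apply: eq_bigr => l _; rewrite mxE mulr_suml.
by apply: eq_bigr => j _; rewrite mxE mulrA.
Qed.

Hypothesis H : hol_frame.

Let oB := frame_open H.
Let VL := frame_fieldL H.
Let hL := frame_funL H.
Let VH := frame_hol H.
Let VJ := frame_fieldJ H.
Let hCR := frame_CR H.
Let PJ := frame_indexJ H.
Let F0 := frame_det H.

Let sV d : smooth_on B (Vf d). Proof. by case: (VH d). Qed.
Let sh d : smooth_on B (h d). Proof. by case: (hCR d). Qed.

Lemma h_mulP y u : h (y *m P) u = \sum_j y 0 j * transverse u 0 j.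
Proof. by rewrite (family_mulmx hL); apply: eq_bigr => j _; rewrite mxE. Qed.

Lemma hN d u : h (- d) u = - h d u.
Proof.
have h0 : h 0 u = 0 by rewrite hL big1 // => l _; rewrite mxE mul0r.
by have := family_lin hL (-1) d 0 u; rewrite scaleN1r addr0 h0 addr0 mulN1r.
Qed.

Lemma row_mulJ (j : 'I_r) : row (lshift r j) P = 'e_(lshift r j) *m P /\
  mul_i (row (lshift r j) P) = row (rshift r j) P /\
  mul_i (row (rshift r j) P) = - row (lshift r j) P.
Proof. by rewrite !rowE !PJ mul_i_lshift mul_i_rshift mulNmx. Qed.

Lemma smooth_transverse : smooth_on B transverse.
Proof.
apply/(smooth_coordP _ oB) => j; apply: smooth_eq oB _ (sh (row j P)) => u _.
by rewrite mxE.
Qed.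

Lemma smooth_frame i j : smooth_on B (fun u => frame_mx u i j).
Proof.
by apply: smooth_eq oB _ (smooth_along oB (sV (row i P)) (sh (row j P))) => u _; rewrite mxE.
Qed.

Lemma derive_transverse w u : B u -> ('D_w transverse u) = \row_j 'D_w (h (row j P)) u.
Proof.
move=> Bu; apply/rowP => j; rewrite mxE.
rewrite -(derive_coordE j (smooth_derivable smooth_transverse Bu)).
by congr ('D_w _ u); apply/funext => y; rewrite mxE.
Qed.

(* The components of [transverse] are conjugates of holomorphic functions. *)
Lemma derive_transverseJ w u : B u -> 'D_(mul_i w) transverse u = - mul_i ('D_w transverse u).
Proof.
move=> Bu; rewrite !derive_transverse //; apply/rowP => j; rewrite [RHS]mxE mxE.
have C d : 'D_(mul_i w) (h d) u = 'D_w (h (mul_i d)) u.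
  have [_ s1 /(_ u w Bu)[-> _]] := hCR d; have s2 := sh (mul_i d).
  by rewrite (smooth_deriveN w s2 Bu) opprK.
case: (split_ordP j) => l ->; have [_ [E1 E2]] := row_mulJ l.
  by rewrite C E1 mul_i_lE mxE opprK.
rewrite C E2 mul_i_rE mxE -(smooth_deriveN w (sh _) Bu).
by congr ('D_w _ u); apply/funext => y; rewrite hN.
Qed.

Lemma frame_mulE y u : B u -> y *m frame_mx u = 'D_(Vf (y *m P) u) transverse u.
Proof.
move=> Bu; rewrite derive_transverse //; apply/rowP => j; rewrite !mxE.
have dj := smooth_differentiable oB Bu (sh (row j P)).
have -> : Vf (y *m P) u = \sum_i y 0 i *: Vf (row i P) u.
  apply/rowP => l; rewrite summxE (family_mulmx (F := fun d u => Vf d u 0 l)).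
    by apply: eq_bigr => i _; rewrite mxE.
  by move=> d u'; rewrite VL summxE; apply: eq_bigr => i _; rewrite mxE.
rewrite derive_dir_sum //; apply: eq_bigr => i _.
by rewrite derive_dirZ // mxE.
Qed.

(** The frame matrix is antilinear because the fields are complex linear in their index while
    [transverse] is antiholomorphic. *)
Lemma frame_mulJ y u : B u -> mul_i (y *m frame_mx u) = - (mul_i y *m frame_mx u).
Proof. by move=> Bu; rewrite !frame_mulE // -PJ VJ derive_transverseJ // opprK. Qed.

Let dF w u := \matrix_(i, j) 'D_w (fun u => frame_mx u i j) u.

Let dF_mul y v u j : B u ->
  (y *m dF v u) 0 j = 'D_v (fun u => 'D_(Vf (y *m P) u) (h (row j P)) u) u.
Proof.
move=> Bu; have E u' : B u' -> 'D_(Vf (y *m P) u') (h (row j P)) u' =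
    \sum_i y 0 i * frame_mx u' i j.
  by move=> Bu'; have := frame_mulE y Bu'; rewrite derive_transverse // => /rowP/(_ j); rewrite !mxE.
rewrite (near_derive v oB E Bu).
rewrite (smooth_derive_sum _ v oB (fun i => smoothMc (y 0 i) oB (smooth_frame i j)) Bu) mxE.
by apply: eq_bigr => i _; rewrite (smooth_deriveZ _ _ (smooth_frame i j) Bu) mxE.
Qed.

Lemma derive_frameJ y w u : B u -> y *m dF (mul_i w) u = - mul_i (y *m dF w u).
Proof.
move=> Bu; apply/rowP => j; rewrite [RHS]mxE dF_mul //.
have C d : 'D_(mul_i w) (fun u => 'D_(Vf (y *m P) u) (h d) u) u =
    'D_w (fun u => 'D_(Vf (y *m P) u) (h (mul_i d)) u) u.
  have [_ _ /(_ u w Bu)[-> _]] := CR_along oB (hCR d) (VH (y *m P)).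
  rewrite (near_derive w oB (g := fun u => - 'D_(Vf (y *m P) u) (h (mul_i d)) u) _ Bu).
    by rewrite (smooth_deriveN w (smooth_along oB (sV _) (sh _)) Bu) opprK.
  by move=> u' Bu'; rewrite (smooth_deriveN _ (sh _) Bu').
rewrite C; case: (split_ordP j) => l ->; have [_ [E1 E2]] := row_mulJ l.
  by rewrite E1 -dF_mul // mul_i_lE opprK.
rewrite E2 mul_i_rE dF_mul // -(smooth_deriveN w (smooth_along oB (sV _) (sh _)) Bu).
apply: (near_derive w oB _ Bu) => u' Bu'.
rewrite -(smooth_deriveN _ (sh _) Bu').
by congr ('D_ _ _ u'); apply/funext => y'; rewrite hN.
Qed.

Definition coframe u := invmx (frame_mx u).

Lemma smooth_coframe i j : smooth_on B (fun u => coframe u i j).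
Proof. exact: (smooth_invmx oB smooth_frame F0). Qed.

Lemma frameV u : B u -> frame_mx u *m coframe u = 1%:M /\ coframe u *m frame_mx u = 1%:M.
Proof.
move=> Bu; have uF : frame_mx u \in unitmx by rewrite unitmxE unitfE F0.
by split; [exact: mulmxV|exact: mulVmx].
Qed.

Lemma coframe_mulJ y u : B u -> mul_i (y *m coframe u) = - (mul_i y *m coframe u).
Proof.
move=> Bu; have [E1 E2] := frameV Bu.
rewrite -[LHS]mulmx1 -E1 mulmxA -[X in X *m _]opprK -frame_mulJ // -mulmxA.
by rewrite E2 mulmx1 mulNmx.
Qed.

Definition dcoframe w u := \matrix_(i, j) 'D_w (fun u => coframe u i j) u.

Lemma dcoframe_mulJ y w u : B u -> y *m dcoframe (mul_i w) u = mul_i (y *m dcoframe w u).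
Proof.
move=> Bu; have E v : dcoframe v u = - (coframe u *m dF v u *m coframe u).
  exact: (derive_invmx oB v smooth_frame F0 Bu).
pose a := y *m coframe u.
have E3 v : y *m dcoframe v u = - (a *m dF v u *m coframe u).
  by rewrite E mulmxN !mulmxA.
apply: etrans (E3 (mul_i w)) (etrans _ (esym (congr1 _ (E3 w)))).
apply: etrans (congr1 (fun z => - (z *m coframe u)) (derive_frameJ a w Bu)) _.
move: (a *m dF w u) => X; have {}E3 : mul_i (- (X *m coframe u)) = - mul_i (X *m coframe u).
  exact: linearN.
by rewrite E3 (coframe_mulJ X Bu) mulNmx !opprK.
Qed.

End frame.

Lemma derive_dir0 {R : realType} {V W : normedModType R} (f : V -> W) u : 'D_0 f u = 0.
Proof.
apply/lim_near_cst => //=; near=> h.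
by rewrite scaler0 add0r subrr scaler0.
Unshelve. all: by end_near. Qed.

Section submx.
Context {R : realType} {a b : nat}.
Local Notation U := 'rV[R]_(a + b).

Lemma smooth_lsubmx A : smooth_on A (lsubmx : U -> 'rV[R]_a).
Proof.
apply: smooth_sub (subsetT _) _; apply/(smooth_coordP _ openT) => i.
by apply: smooth_eq openT _ (smooth_coord _ (lshift b i)) => w _; rewrite mxE.
Qed.

Lemma smooth_rsubmx A : smooth_on A (rsubmx : U -> 'rV[R]_b).
Proof.
apply: smooth_sub (subsetT _) _; apply/(smooth_coordP _ openT) => i.
by apply: smooth_eq openT _ (smooth_coord _ (rshift a i)) => w _; rewrite mxE.
Qed.

Lemma derive_lsubmx w u : 'D_w (lsubmx : U -> 'rV[R]_a) u = lsubmx w.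
Proof.
have H (h : R) : (lsubmx : U -> 'rV[R]_a) (h *: w + u) = h *: lsubmx w + lsubmx u.
  by rewrite linearD linearZ.
by have := derive_affine (id : 'rV[R]_a -> 'rV[R]_a) H; rewrite derive_id.
Qed.

Lemma derive_rsubmx w u : 'D_w (rsubmx : U -> 'rV[R]_b) u = rsubmx w.
Proof.
have H (h : R) : (rsubmx : U -> 'rV[R]_b) (h *: w + u) = h *: rsubmx w + rsubmx u.
  by rewrite linearD linearZ.
by have := derive_affine (id : 'rV[R]_b -> 'rV[R]_b) H; rewrite derive_id.
Qed.

Context {m : nat}.
Variables (A : set 'rV[R]_m) (f : 'rV[R]_m -> 'rV[R]_a) (g : 'rV[R]_m -> 'rV[R]_b).
Hypotheses (oA : open A) (sf : smooth_on A f) (sg : smooth_on A g).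

Lemma smooth_row_mx : smooth_on A (fun u => row_mx (f u) (g u)).
Proof.
apply/(smooth_coordP _ oA) => i; case: (split_ordP i) => j ->.
  by apply: smooth_eq oA _ ((smooth_coordP f oA).1 sf j) => u _; rewrite row_mxEl.
by apply: smooth_eq oA _ ((smooth_coordP g oA).1 sg j) => u _; rewrite row_mxEr.
Qed.

Lemma derive_row_mx2 w u : A u ->
  'D_w (fun u => row_mx (f u) (g u)) u = row_mx ('D_w f u) ('D_w g u).
Proof.
move=> Au; apply/rowP => i.
rewrite -(derive_coordE i (smooth_derivable smooth_row_mx Au)).
case: (split_ordP i) => j ->.
  rewrite row_mxEl -(derive_coordE j (smooth_derivable sf Au)).
  by congr ('D_w _ u); apply/funext => y; rewrite row_mxEl.
rewrite row_mxEr -(derive_coordE j (smooth_derivable sg Au)).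
by congr ('D_w _ u); apply/funext => y; rewrite row_mxEr.
Qed.

End submx.

Lemma local_bound {R : realType} {m : nat} (I : finType) (x : 'rV[R]_m) (e : R)
  (f : I -> 'rV[R]_m -> R) : 0 < e -> (forall i, smooth_on (ball x e) (f i)) ->
  exists M d, [/\ 0 <= M, 0 < d, d <= e & forall u, ball x d u -> forall i, `|f i u| <= M].
Proof.
move=> e0 sf; pose M := \sum_i (`|f i x| + 1).
have Mi i : `|f i x| + 1 <= M.
  by rewrite /M (bigD1 i) //= lerDl sumr_ge0 // => j _; rewrite addr_ge0.
have H i : \forall y \near x, `|f i y| <= `|f i x| + 1.
  have c1 : {for x, continuous (f i)} by exact: smooth_continuous (sf i) (ballxx x e0).
  have /(_ _ ltr01) := (@cvgrPdist_le _ _ _ _ (nbhs_filter x) _ _).1 c1.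
  apply: filterS => y h; rewrite -[f i y](subrK (f i x)) addrC.
  by rewrite (le_trans (ler_normD _ _)) // lerD2l distrC.
have /nbhs_ballP[d d0 Hd] := @filter_forall _ _ _ (nbhs x) (nbhs_filter x) H.
exists M, (Num.min d e); split=> //.
- by rewrite sumr_ge0 // => j _; rewrite addr_ge0.
- by rewrite lt_min d0 e0.
- by rewrite ge_min lexx orbT.
move=> u Bu i; apply: le_trans (Mi i); apply: (Hd u _ i).
by apply: le_ball Bu; rewrite ge_min lexx.
Qed.

(** * Freezing the coefficients: the product with the space of the variables y *)

Section product_space.
Context {R : realType} {n k r : nat}.
Local Notation V := 'rV[R]_(n + n).
Local Notation L := 'rV[R]_(k + k).
Local Notation W := 'rV[R]_(r + r).
Local Notation Z := 'rV[R]_((r + r) + (n + n)).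
Variables (x : V) (e : R) (Vf : L -> V -> V) (h : L -> V -> R)
  (P : 'M[R]_(r + r, k + k)).
Local Notation B := (ball x e).
Hypothesis e0 : 0 < e.
Hypothesis H : hol_frame B Vf h P.
Let oB := frame_open H.
Let VL := frame_fieldL H.
Let hL := frame_funL H.
Let VH := frame_hol H.
Let VJ := frame_fieldJ H.
Let hCR := frame_CR H.
Let PJ := frame_indexJ H.
Let F0 := frame_det H.
Local Notation N := (coframe Vf h P).
Let sV d : smooth_on B (Vf d). Proof. by case: (VH d). Qed.
Let sh d : smooth_on B (h d). Proof. by case: (hCR d). Qed.
Let sN i j : smooth_on B (fun u => N u i j).
Proof. exact: (smooth_coframe H). Qed.

(** The conjugate structure on the first factor: this variable is later replaced by the
    antiholomorphic [transverse], and then u -> (z(u), u) intertwines [mul_i] with [JP]. *)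
Definition JP (t : Z) : Z := row_mx (- mul_i (lsubmx t)) (mul_i (rsubmx t)).

Let A0 : set Z := [set t : Z | B (rsubmx t)].
Let oA0 : open A0.
Proof. exact: open_smooth_preimage oB (smooth_rsubmx _). Qed.

Definition pidx (ym : Z -> W) (t : Z) : L := ym t *m N (rsubmx t) *m P.

Section index.
Variable ym : Z -> W.
Hypotheses (sym : smooth_on A0 ym)
  (yJ : forall t w, A0 t -> 'D_(JP w) ym t = - mul_i ('D_w ym t)).

Let sNr i j : smooth_on A0 (fun t => N (rsubmx t) i j).
Proof. exact: (smooth_comp oA0 oB (fun t At => At) (sN i j) (smooth_rsubmx _)). Qed.

Let syN : smooth_on A0 (fun t => ym t *m N (rsubmx t)).
Proof. exact: smooth_mulmx. Qed.

Lemma smooth_pidx : smooth_on A0 (pidx ym).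
Proof. exact: smooth_mulmx_const. Qed.

Lemma derive_pidx w t : A0 t -> 'D_w (pidx ym) t =
  ('D_w ym t *m N (rsubmx t) + ym t *m dcoframe Vf h P (rsubmx w) (rsubmx t)) *m P.
Proof.
move=> At; apply: etrans (derive_mulmx_const P oA0 syN w At) (congr1 (fun z => z *m P) _).
apply: etrans (derive_mulmx oA0 sym sNr w At) (congr1 (fun z => _ + ym t *m z) _).
apply/matrixP => i j; apply: etrans (mxE _ _ _ _) (etrans _ (esym (mxE _ _ _ _))).
apply: etrans (derive_compE (f := fun u => N u i j) w _ _) _.
- exact: smooth_differentiableV oA0 At (smooth_rsubmx _).
- exact: smooth_differentiable oB At (sN i j).
by rewrite derive_rsubmx.
Qed.

(** Two antilinear ingredients, the coframe and the conjugate variable, compose to a holomorphic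
    index. *)
Lemma pidxJ w t : A0 t -> 'D_(JP w) (pidx ym) t = mul_i ('D_w (pidx ym) t).
Proof.
move=> At; apply: etrans (derive_pidx (JP w) At) (etrans _ (esym (congr1 _ (derive_pidx w At)))).
have Bt : B (rsubmx t) by [].
rewrite PJ; congr (_ *m P); rewrite yJ // /JP row_mxKr; set a := 'D_w ym t.
have E1 := dcoframe_mulJ H (ym t) (rsubmx w) Bt.
have E2 := coframe_mulJ H a Bt.
apply: etrans (congr2 +%R (mulNmx _ _) E1) (etrans _ (esym (linearD _ _ _))).
by congr (_ + _); exact: esym.
Qed.

Lemma derive_Vpidx w t : A0 t -> 'D_w (fun t => Vf (pidx ym t) (rsubmx t)) t =
  Vf ('D_w (pidx ym) t) (rsubmx t) + 'D_(rsubmx w) (Vf (pidx ym t)) (rsubmx t).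
Proof.
move=> At; rewrite (derive_familyV oA0 oB (fun t At => At) (smooth_rsubmx _) smooth_pidx VL sV w At).
by rewrite derive_rsubmx.
Qed.

Lemma smooth_Vpidx : smooth_on A0 (fun t => Vf (pidx ym t) (rsubmx t)).
Proof. exact: (smooth_familyV oA0 oB (fun t At => At) (smooth_rsubmx _) smooth_pidx VL sV). Qed.

Lemma derive_hpidx (M : 'M[R]_(k + k)) w t : A0 t ->
  'D_w (fun t => h (pidx ym t *m M) (rsubmx t)) t =
  h ('D_w (pidx ym) t *m M) (rsubmx t) + 'D_(rsubmx w) (h (pidx ym t *m M)) (rsubmx t).
Proof.
move=> At; have sc := smooth_mulmx_const M oA0 smooth_pidx.
rewrite (derive_family oA0 oB (fun t At => At) (smooth_rsubmx _) sc hL sh w At).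
by rewrite derive_rsubmx (derive_mulmx_const M oA0 smooth_pidx w At).
Qed.

Lemma CR_hpidx : CR JP A0 (fun t => h (pidx ym t) (rsubmx t))
  (fun t => - h (mul_i (pidx ym t)) (rsubmx t)).
Proof.
have [JM JE] : exists M : 'M[R]_(k + k), forall d : L, mul_i d = d *m M.
  by exists (lin1_mx (@mul_i R k)) => d; rewrite mul_rV_lin1.
have s1 : smooth_on A0 (fun t => h (pidx ym t) (rsubmx t)).
  exact: (smooth_family oA0 oB (fun t At => At) (smooth_rsubmx _) smooth_pidx hL sh).
have s2 : smooth_on A0 (fun t => h (mul_i (pidx ym t)) (rsubmx t)).
  have sc := smooth_mulmx_const JM oA0 smooth_pidx.
  apply: smooth_eq oA0 _ (smooth_family oA0 oB (fun t At => At) (smooth_rsubmx _) sc hL sh).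
  by move=> t _; rewrite JE.
have d1 w t : A0 t -> 'D_w (fun t => h (pidx ym t) (rsubmx t)) t =
    h ('D_w (pidx ym) t) (rsubmx t) + 'D_(rsubmx w) (h (pidx ym t)) (rsubmx t).
  by move=> At; have := derive_hpidx 1%:M w At; under eq_fun do rewrite mulmx1; rewrite !mulmx1.
have d2 w t : A0 t -> 'D_w (fun t => h (mul_i (pidx ym t)) (rsubmx t)) t =
    h (mul_i ('D_w (pidx ym) t)) (rsubmx t) + 'D_(rsubmx w) (h (mul_i (pidx ym t))) (rsubmx t).
  by move=> At; have := derive_hpidx JM w At; rewrite !JE => <-; under eq_fun do rewrite JE.
have C d w u : B u -> 'D_(mul_i w) (h d) u = 'D_w (h (mul_i d)) u.
  move=> Bu; have [_ _ /(_ u w Bu)[-> _]] := hCR d.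
  by rewrite (smooth_deriveN w (sh _) Bu) opprK.
have hNd d u := hN H d u.
split; [exact: s1|exact: smoothN|move=> t w At].
rewrite !(smooth_deriveN _ s2 At) !d1 // !d2 // !pidxJ // /JP row_mxKr !C // !opprK.
split=> //; rewrite !mul_iK !hNd.
have -> : 'D_(rsubmx w) (h (- pidx ym t)) (rsubmx t) = - 'D_(rsubmx w) (h (pidx ym t)) (rsubmx t).
  rewrite -(smooth_deriveN _ (sh _) At); congr ('D__ _ _).
  by apply/funext => u; rewrite hNd.
by rewrite -opprD opprK.
Qed.

End index.
End product_space.

(** * Lie series *)

Section lie_series.
Context {R : realType} {n k r : nat}.
Local Notation V := 'rV[R]_(n + n).
Local Notation L := 'rV[R]_(k + k).
Local Notation W := 'rV[R]_(r + r).
Local Notation Z := 'rV[R]_((r + r) + (n + n)).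
Variables (x : V) (e : R) (Vf : L -> V -> V) (h : L -> V -> R)
  (P : 'M[R]_(r + r, k + k)).
Local Notation B := (ball x e).
Hypothesis e0 : 0 < e.
Hypothesis H : hol_frame B Vf h P.
Let oB := frame_open H.
Let VL := frame_fieldL H.
Let hL := frame_funL H.
Let VH := frame_hol H.
Let VJ := frame_fieldJ H.
Let hCR := frame_CR H.
Let PJ := frame_indexJ H.
Let F0 := frame_det H.
Local Notation N := (coframe Vf h P).
Let sV d : smooth_on B (Vf d). Proof. by case: (VH d). Qed.
Let sh d : smooth_on B (h d). Proof. by case: (hCR d). Qed.
Let A0 : set Z := [set t : Z | B (rsubmx t)].
Let oA0 : open A0.
Proof. exact: open_smooth_preimage oB (smooth_rsubmx _). Qed.
Local Notation J := (@JP R n r).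
Local Notation cy := (pidx Vf h P (lsubmx : Z -> W)).
Local Notation ci i := (pidx Vf h P (fun=> 'e_i : W)).

Let cyJ (t w : Z) : A0 t -> 'D_(J w) (lsubmx : Z -> W) t = - mul_i ('D_w (lsubmx : Z -> W) t).
Proof. by move=> _; rewrite !derive_lsubmx /JP row_mxKl. Qed.

Let ciJ i (t w : Z) : A0 t ->
  'D_(J w) ((fun=> 'e_i) : Z -> W) t = - mul_i ('D_w ((fun=> 'e_i) : Z -> W) t).
Proof. by move=> _; rewrite !derive_cst; apply/esym/eqP; rewrite oppr_eq0; apply/eqP; exact: linear0. Qed.

Let sl : smooth_on A0 (lsubmx : Z -> W). Proof. exact: smooth_lsubmx. Qed.
Let sci i : smooth_on A0 ((fun=> 'e_i) : Z -> W). Proof. exact: smooth_cst. Qed.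

Let JP0 (a : V) : J (row_mx 0 a) = row_mx 0 (mul_i a).
Proof.
rewrite /JP row_mxKl row_mxKr; congr row_mx.
by apply/eqP; rewrite oppr_eq0; apply/eqP; exact: linear0.
Qed.

(** The field that becomes E when y = z(u). As y is an independent variable, constant along it, the
    field is linear in y and its bracket with [euler] is itself. *)
Definition lift_field (t : Z) : Z := row_mx 0 (Vf (cy t) (rsubmx t)).

Lemma smooth_lift_field : smooth_on A0 lift_field.
Proof.
apply: smooth_row_mx => //; first exact: smooth_cst.
exact: (smooth_Vpidx H sl).
Qed.

Lemma hol_lift_field : hol J A0 lift_field.
Proof.
split=> [|t w At]; first exact: smooth_lift_field.
have s1 : smooth_on A0 (fun t => Vf (cy t) (rsubmx t)).
  exact: (smooth_Vpidx H sl).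
have E v : 'D_v lift_field t = row_mx 0 (Vf ('D_v cy t) (rsubmx t) + 'D_(rsubmx v) (Vf (cy t)) (rsubmx t)).
  apply: etrans (derive_row_mx2 oA0 (smooth_cst _ _) s1 v At) _; rewrite derive_cst.
  by congr row_mx; exact: (derive_Vpidx H sl).
apply: etrans (E (J w)) (etrans _ (esym (congr1 J (E w)))); rewrite JP0.
congr row_mx; apply: etrans _ (esym (linearD _ _ _)); congr (_ + _).
  by rewrite (pidxJ H sl cyJ w At) VJ.
by rewrite /JP row_mxKr; have [_ ->] := VH (cy t).
Qed.

Definition series0 i (t : Z) : R := h (ci i t) (rsubmx t).

Lemma CR_series0 (l : 'I_r) : CR J A0 (series0 (lshift r l)) (series0 (rshift r l)).
Proof.
have C := CR_hpidx H (sci (lshift r l)) (@ciJ (lshift r l)).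
apply: (CR_eq oA0 _ _ C).
  by [].
move=> t At; rewrite /series0 -(hN H); congr (h _ _).
rewrite /pidx PJ (coframe_mulJ H) // mul_i_lshift mulNmx.
exact: opprK.
Qed.

Definition lie_term i m : Z -> R := along_iter lift_field m (series0 i).

Lemma CR_lie_term l m : CR J A0 (lie_term (lshift r l) m) (lie_term (rshift r l) m).
Proof. exact: (CR_along_iter oA0 hol_lift_field m (CR_series0 l)). Qed.

Lemma smooth_lie_term i m : smooth_on A0 (lie_term i m).
Proof. by case: (split_ordP i) => l ->; have [] := CR_lie_term l m. Qed.

Definition euler (t : Z) : Z := row_mx (lsubmx t) 0.

Let smooth_euler : smooth_on A0 euler.
Proof. by apply: smooth_row_mx => //; exact: smooth_cst. Qed.

Lemma VZ a d u : Vf (a *: d) u = a *: Vf d u.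
Proof. by rewrite VL (VL d) scaler_sumr; apply: eq_bigr => l _; rewrite mxE scalerA. Qed.

Lemma derive_euler_field t : 'D_(euler t) lift_field t = lift_field t.
Proof.
have HH (a : R) : lift_field (a *: euler t + t) = a *: lift_field t + lift_field t.
  rewrite -[X in _ = _ + X]scale1r -scalerDl {2}/lift_field [RHS]scale_row_mx scaler0.
  rewrite /lift_field; congr row_mx.
  have -> : rsubmx (a *: euler t + t) = rsubmx t.
    by rewrite linearD linearZ /= /euler row_mxKr scaler0 add0r.
  have -> : cy (a *: euler t + t) = (a + 1) *: cy t.
    rewrite /pidx; have -> : rsubmx (a *: euler t + t) = rsubmx t.
      by rewrite linearD linearZ /= /euler row_mxKr scaler0 add0r.
    have -> : lsubmx (a *: euler t + t) = (a + 1) *: lsubmx t.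
      by rewrite linearD linearZ /= /euler row_mxKl scalerDl scale1r.
    by rewrite -!scalemxAl.
  exact: VZ.
by have := derive_affine (id : Z -> Z) HH; rewrite derive_id.
Qed.

Lemma derive_field_euler t : 'D_(lift_field t) euler t = 0.
Proof.
have HH (a : R) : euler (a *: lift_field t + t) = a *: 0 + euler t.
  rewrite /euler linearD linearZ /= /lift_field row_mxKl scaler0 add0r.
  by rewrite scaler0 add0r.
by have := derive_affine (id : Z -> Z) HH; rewrite derive_id.
Qed.

(** Homogeneity of degree [m] in y: the commutator of [euler] and [lift_field] is [lift_field], so
    each application raises the degree by one. *)
Lemma derive_euler_term i m t : A0 t ->
  'D_(euler t) (lie_term i m) t = m%:R * lie_term i m t.
Proof.
elim: m t => [|m IH] t At.
  rewrite mul0r; pose F (u : V) := h ('e_i *m N u *m P) u.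
  have HH (a : R) : (rsubmx : Z -> V) (a *: euler t + t) = a *: 0 + rsubmx t.
    by rewrite linearD linearZ /= /euler row_mxKr.
  by have := derive_affine F HH; rewrite derive_dir0.
have sm := smooth_lie_term i m.
have := lie_derivative oA0 smooth_euler smooth_lift_field sm At.
rewrite derive_euler_field derive_field_euler derive_dir0 subr0.
rewrite (near_derive (lift_field t) oA0 IH At) (smooth_deriveZ _ _ sm At).
move=> /eqP; rewrite subr_eq => /eqP E.
by apply: etrans E _; rewrite -natr1 mulrDl mul1r addrC.
Qed.

(** For small y the field is small, so that m Cauchy discs with parameter c8/m move the base point
    by a bounded amount only. The resulting factor (8m/c8)^m is at most 2^(-m) m!. *)
Lemma lie_term_region : exists eta d M, [/\ 0 < eta, 0 < d, d <= e, 0 <= M &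
  forall t : Z, `|lsubmx t| < eta -> ball x d (rsubmx t) ->
  forall i m, `|lie_term i m t| <= 2^-1 ^+ m * m`!%:R * M].
Proof.
pose fV (ij : 'I_(r + r) * 'I_(n + n)) u := Vf ('e_ij.1 *m N u *m P) u 0 ij.2.
have sc i : smooth_on B (fun u => 'e_i *m N u *m P : L).
  apply: smooth_mulmx_const => //; apply: smooth_mulmx => //; first exact: smooth_cst.
  exact: (smooth_coframe H).
have sid : smooth_on B (id : V -> V).
  by apply/(smooth_coordP _ oB) => i; exact: smooth_coord.
have sfV ij : smooth_on B (fV ij).
  have HH := smooth_familyV oB oB (fun u Bu => Bu) sid (sc ij.1) VL sV.
  exact: (smooth_coordP _ oB).1 HH ij.2.
have sfh i : smooth_on B (fun u => h ('e_i *m N u *m P) u).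
  exact: (smooth_family oB oB (fun u Bu => Bu) sid (sc i) hL sh).
have [C [d1 [C0 d10 d1e HC]]] := local_bound e0 sfV.
have [M [d2 [M0 d20 d2e HM]]] := local_bound e0 sfh.
pose d := Num.min d1 d2.
have d0 : 0 < d by rewrite lt_min d10 d20.
have dd1 u : ball x d u -> ball x d1 u by apply: le_ball; rewrite ge_min lexx.
have dd2 u : ball x d u -> ball x d2 u by apply: le_ball; rewrite ge_min lexx orbT.
have de u : ball x d u -> B u by move=> /dd1; apply: le_ball.
pose K := (r + r)%:R * C + 1; have K0 : 0 < K by rewrite ltr_wpDl // mulr_ge0.
have TC (t : Z) : ball x d (rsubmx t) -> `|Vf (cy t) (rsubmx t)| <= K * `|lsubmx t|.
  move=> Bt; apply: rV_norm_le; first by rewrite mulr_ge0 // ltW.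
  move=> l; pose G (c : L) u := Vf c u 0 l.
  have GL c u : G c u = \sum_l c 0 l * G 'e_l u.
    by rewrite /G VL summxE; apply: eq_bigr => i _; rewrite mxE.
  rewrite -[Vf _ _ 0 l]/(G (cy t) (rsubmx t)) /pidx -mulmxA (family_mulmx GL).
  apply: le_trans (ler_norm_sum _ _ _) _.
  apply: le_trans (_ : \sum_(i < r + r) C * `|lsubmx t| <= _).
    apply: ler_sum => i _; rewrite normrM mulrC ler_pM //; last exact: rV_norm_coord.
    by have := HC _ (dd1 _ Bt) (i, l); rewrite /fV /= -mulmxA -rowE.
  by rewrite sumr_const card_ord -mulr_natl mulrA ler_wpM2r // /K lerDl.
(* Chosen so that 8m/c8 = m/(2e). *)
pose c8 := 16 * expR 1 : R; have c80 : 0 < c8 by rewrite mulr_gt0 ?expR_gt0.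
(* The field has size at most [tau] for [|y| < eta], and the total displacement 2 tau c8 equals d/2:
   a point of the half ball stays in the ball. *)
pose eta := d / 4 / (K * c8); have eta0 : 0 < eta by rewrite !divr_gt0 // mulr_gt0.
pose tau := K * eta; have tau0 : 0 < tau by rewrite mulr_gt0.
have tc : tau * c8 = d / 4 by rewrite /tau /eta; field; rewrite !gt_eqF.
pose D (s : R) : set Z := [set t : Z | `|lsubmx t| < eta /\
  ball x (d / 2 + 2 * tau * s) (rsubmx t)].
have DB s : s <= c8 -> D s `<=` [set t : Z | ball x d (rsubmx t)].
  move=> sc8 t [_]; apply: le_ball; have : tau * s <= tau * c8 by rewrite ler_wpM2l // ltW.
  by rewrite tc -mulrA; move: (tau * s) => y; lra.
have DA s : s <= c8 -> D s `<=` A0 by move=> sS t /(DB _ sS)/de.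
have DD s g t a b : 0 <= s -> 0 < g -> s + g <= c8 -> D s t -> `|a| <= g -> `|b| <= g ->
    D (s + g) (t + a *: lift_field t + b *: J (lift_field t)).
  move=> s0 g0 sg Dt ag bg; have [Dt1 Dt2] := Dt.
  have sc8 : s <= c8 by apply: le_trans sg; rewrite lerDl ltW.
  have Bt := DB s sc8 t Dt.
  set T := Vf (cy t) (rsubmx t).
  have El : lsubmx (t + a *: lift_field t + b *: J (lift_field t)) = lsubmx t.
    rewrite !linearD !linearZ /= /JP !row_mxKl scaler0 addr0.
    have -> : mul_i (0 : W) = 0 by exact: linear0.
    by rewrite oppr0 scaler0 addr0.
  have Er : rsubmx (t + a *: lift_field t + b *: J (lift_field t)) = rsubmx t + (a *: T + b *: mul_i T).
    by rewrite !linearD !linearZ /= /JP !row_mxKr addrA.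
  split; first by rewrite El.
  rewrite Er; have Tt : `|T| <= tau.
    by apply: le_trans (TC t Bt) _; rewrite ler_wpM2l ?ltW.
  move: Dt2; rewrite -!ball_normE /= opprD addrA => Dt2.
  apply: le_lt_trans (ler_normB _ _) _.
  rewrite [X in _ < X](_ : _ = d / 2 + 2 * tau * s + 2 * tau * g); last by ring.
  apply: ltr_leD => //; apply: le_trans (ler_normD _ _) _; rewrite !normrZ.
  have -> : 2 * tau * g = g * tau + g * tau by ring.
  apply: lerD; apply: ler_pM => //; apply: le_trans (mul_i_norm _) Tt.
have mono s s' : s <= s' -> s' <= c8 -> D s `<=` D s'.
  move=> ss _ t [t1 t2]; split=> //; apply: le_ball t2.
  by rewrite lerD2l ler_wpM2l // mulr_ge0 // ltW.
exists eta, (d / 2), M; split=> //; first by rewrite divr_gt0.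
  by apply: le_trans (_ : d <= _); [rewrite ler_pdivrMr // ler_pMr // ler1n|
    rewrite (le_trans _ d1e) // ge_min lexx].
move=> t t1 t2 i m.
have D0 : D 0 t by split; rewrite ?mulr0 ?addr0.
have sM j t' : D c8 t' -> `|series0 j t'| <= M.
  by move=> /(DB _ (lexx _)) /dd2 Bt; have := HM _ Bt j.
have [->|m0] := eqVneq m 0%N.
  rewrite expr0 fact0 !mul1r; apply: sM; apply: mono D0 => //; exact: ltW.
have m1 : (0 : R) < m%:R by rewrite ltr0n lt0n.
have bnd : `|lie_term i m t| <= (8 / (c8 / m%:R)) ^+ m * M.
  have g0 : 0 < c8 / m%:R by rewrite divr_gt0.
  have gm : 0 + m%:R * (c8 / m%:R) <= c8 by rewrite add0r mulrC divfK // gt_eqF.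
  have qM l t' : D c8 t' -> `|series0 (lshift r l) t'| <= M /\ `|series0 (rshift r l) t'| <= M.
    by move=> Dt'; split; exact: sM.
  by case: (split_ordP i) => l ->; have [] := along_iter_bound oA0 hol_lift_field DA DD
    (CR_series0 l) (qM l) mono g0 (lexx 0) gm D0.
apply: le_trans bnd _; rewrite ler_wpM2r //.
have -> : 8 / (c8 / m%:R) = 2^-1 / expR 1 * m%:R.
  by rewrite /c8; field; rewrite !gt_eqF ?expR_gt0.
rewrite exprMn expr_div_n -!mulrA ler_wpM2l ?exprn_ge0 //.
by rewrite ler_pdivrMl ?exprn_gt0 ?expR_gt0 // powM_le_fact.
Qed.

End lie_series.

Section lie_series_sum.
Context {R : realType} {n k r : nat}.
Local Notation V := 'rV[R]_(n + n).
Local Notation L := 'rV[R]_(k + k).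
Local Notation W := 'rV[R]_(r + r).
Local Notation Z := 'rV[R]_((r + r) + (n + n)).
Variables (x : V) (e : R) (Vf : L -> V -> V) (h : L -> V -> R)
  (P : 'M[R]_(r + r, k + k)).
Local Notation B := (ball x e).
Hypothesis e0 : 0 < e.
Hypothesis H : hol_frame B Vf h P.
Local Notation term := (lie_term Vf h P).
Local Notation J := (@JP R n r).

Definition tube (eta d : R) : set Z :=
  [set t : Z | `|lsubmx t| < eta /\ ball x d (rsubmx t)].

Lemma open_tube eta d : open (tube eta d).
Proof.
have o1 : open [set t : Z | `|lsubmx t| < eta].
  apply: (@open_comp _ _ (fun t : Z => `|lsubmx t|) [set y | y < eta]); last exact: open_lt.
  move=> t _; have c1 : {for t, continuous (lsubmx : Z -> W)}.
    exact: (smooth_continuous (smooth_lsubmx setT) I).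
  exact: (cvg_norm c1).
have o2 : open [set t : Z | ball x d (rsubmx t)].
  exact: open_smooth_preimage (ball_open _ _) (smooth_rsubmx _).
exact: openI o1 o2.
Qed.

(** [Rf i] is the sum of (-1)^m/(m+1)! T^m h_i, with T the field [lift_field] and h_i the function
    [series0]; formally it is the integral of exp(- s T) h_i over [0, 1]. *)
Lemma lie_series_solution : exists eta d (Rf : 'I_(r + r) -> Z -> R),
  [/\ 0 < eta, 0 < d, d <= e,
  forall l, CR J (tube eta d) (Rf (lshift r l)) (Rf (rshift r l)) &
  forall i t, tube eta d t ->
    Rf i t + 'D_(euler t + lift_field Vf h P t) (Rf i) t = series0 Vf h P i t].
Proof.
have [eta [d [M [eta0 d0 de M0 HM]]]] := lie_term_region e0 H.
have oT := @open_tube eta d.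
pose A0 : set Z := [set t : Z | B (rsubmx t)].
have oA0 : open A0 by exact: open_smooth_preimage (ball_open _ _) (smooth_rsubmx _).
have TA : tube eta d `<=` A0 by move=> t [_]; exact: le_ball.
pose cf (m : nat) : R := (-1) ^+ m / m.+1`!%:R.
pose f i m (t : Z) := cf m * term i m t.
have q1 : 0 <= (2^-1 : R) < 1 by rewrite invf_lt1 // ltr1n invr_ge0 ler0n.
have factn0 m : (m`!%:R : R) != 0 by rewrite pnatr_eq0 -lt0n fact_gt0.
have nrm (m j : nat) (X : R) : `|(-1) ^+ m / j`!%:R * X| = j`!%:R^-1 * `|X|.
  by rewrite normrM normrM normrX normrN1 expr1n mul1r normfV normr_nat.
have est (F F' q X : R) : 0 < F -> F' <= F -> 0 <= q -> `|X| <= q * F' * M -> F^-1 * `|X| <= M * q.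
  move=> F0 FF q0 h1; rewrite ler_pdivrMl //; apply: le_trans h1 _.
  have -> : q * F' * M = F' * (M * q) by ring.
  by rewrite ler_wpM2r // mulr_ge0.
have fact0 m : (0 : R) < m`!%:R by rewrite ltr0n fact_gt0.
have bf i t : tube eta d t -> geo_bound M 2^-1 (fun m => f i m t).
  move=> [t1 t2] m; rewrite /f /cf nrm; apply: est (HM t t1 t2 i m) => //.
  by rewrite ler_nat factS leq_pmull.
have ba i t : tube eta d t -> geo_bound M 2^-1 (fun m => (-1) ^+ m / m`!%:R * term i m t).
  by move=> [t1 t2] m; rewrite nrm; apply: est (HM t t1 t2 i m) => //; rewrite exprn_ge0.
have gf i : geo_on (tube eta d) (f i).
  move=> t Tt; have /nbhs_ballP[eps eps0 He] := open_nbhs_nbhs (conj oT Tt).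
  by exists eps, M, 2^-1; split=> // y /He Ty; split=> //; exact: bf.
have CRf l m : CR J (tube eta d) (f (lshift r l) m) (f (rshift r l) m).
  have C := CRM oA0 (CR_cst J A0 (cf m) 0) (CR_lie_term H l m).
  apply: CR_sub TA _; apply: (CR_eq oA0 _ _ C) => t _; first by rewrite mul0r subr0.
  by rewrite mul0r addr0.
exists eta, d, (fun i => fsum (f i)); split; [exact: eta0|exact: d0|exact: de| |].
  by move=> l; exact: (CR_fsum oT (CRf l) (gf _) (gf _)).
move=> i t Tt.
have CRi : exists g, (forall m, CR J (tube eta d) (f i m) (g m)) /\ geo_on (tube eta d) g.
  case: (split_ordP i) => l ->; first by exists (f (rshift r l)).
  exists (fun m u => - f (lshift r l) m u); split=> [m|]; first exact: CR_conj.
  move=> y Ty; have [eps [N [q [eps0 qi Hy]]]] := gf (lshift r l) y Ty.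
  by exists eps, N, q; split=> // z /Hy[Tz bz]; split=> // m; rewrite normrN; exact: bz.
have [g [CRg gg]] := CRi; have At := TA t Tt.
have [_ ->] := derive_fsum oT CRg (gf i) gg (euler t + lift_field Vf h P t) Tt.
pose a m := (-1) ^+ m / m`!%:R * term i m t.
(* [euler] multiplies the term by [m] and the field shifts it. With the summand [Rf i t] itself,
   only the differences of consecutive [a m] remain, and they telescope to [a 0]. *)
have E m : 'D_(euler t + lift_field Vf h P t) (f i m) t =
    -1 * f i m t + (-1 * a m.+1 + a m).
  have sm := smooth_lie_term H i m; have dm := smooth_differentiable oA0 At sm.
  rewrite /f (smooth_deriveZ _ _ sm At) (derive_dirD _ _ dm).
  rewrite (derive_euler_term H i m At) -[X in _ + X]/(term i m.+1 t) /a /cf.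
  rewrite exprS factS natrM -natr1; move: (factn0 m) (term i m t) (term i m.+1 t) => f0 X Y.
  have m1 : (m%:R + 1 : R) != 0 by rewrite natr1 pnatr_eq0.
  move: m1 f0; move: (m%:R : R) (m`!%:R : R) ((-1) ^+ m) => m' F s m1 F0.
  by field; rewrite ?m1 ?F0.
have bS : geo_bound (M * 2^-1) 2^-1 (fun m => a m.+1).
  by move=> m; rewrite -mulrA -exprS; exact: ba.
have bS' : geo_bound M 2^-1 (fun m => a m.+1).
  move=> m; apply: le_trans (bS m) _; rewrite ler_wpM2r ?exprn_ge0 // ler_piMr //.
  by case/andP: q1 => _ /ltW.
have b1 := geo_bound_lin (-1) bS' (ba i t Tt).
rewrite /fsum (_ : (fun m => 'D_(_) (f i m) t) = fun m => -1 * f i m t + (-1 * a m.+1 + a m)).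
  rewrite (ssum_lin (-1) q1 (bf i t Tt) b1) (ssum_lin (-1) q1 bS' (ba i t Tt)).
  rewrite (ssumS q1 (ba i t Tt)) /a expr0 divr1 mul1r.
  have A1 (y z w : R) : y + (-1 * y + (-1 * z + (w + z))) = w by ring.
  exact: A1.
by apply/funext => m; exact: E.
Qed.

End lie_series_sum.

(** * Holomorphic primitives along a Lie algebra of fields *)

Section CR_operations.
Context {R : realType} {m p : nat}.
Local Notation V := 'rV[R]_m.
Local Notation U := 'rV[R]_p.
Variables (J : V -> V) (J' : U -> U) (A : set V) (B : set U) (S : V -> U).
Hypotheses (oA : open A) (oB : open B) (AB : forall u, A u -> B (S u)).
Hypotheses (sS : smooth_on A S) (SJ : forall w u, A u -> 'D_(J w) S u = J' ('D_w S u)).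

Lemma CR_comp f g : CR J' B f g -> CR J A (fun u => f (S u)) (fun u => g (S u)).
Proof.
move=> [sf sg C]; split; [exact: smooth_comp sf sS|exact: smooth_comp sg sS|move=> u w Au].
have dS := smooth_differentiableV oA Au sS.
have df := smooth_differentiable oB (AB Au) sf; have dg := smooth_differentiable oB (AB Au) sg.
by rewrite !(derive_compE _ dS df) !(derive_compE _ dS dg) SJ //; apply: C; exact: AB.
Qed.

Lemma CR_sum (I : Type) (s : seq I) (f g : I -> V -> R) : (forall i, CR J A (f i) (g i)) ->
  CR J A (fun u => \sum_(i <- s) f i u) (fun u => \sum_(i <- s) g i u).
Proof.
move=> C; elim: s => [|i s IH].
  by apply: (CR_eq oA _ _ (CR_cst J A 0 0)) => u _; rewrite big_nil.
by apply: (CR_eq oA _ _ (CRD oA (C i) IH)) => u _; rewrite big_cons.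
Qed.

End CR_operations.

(** * Powers of an ideal and its Euler field *)

Section vanishing_ideal.
Context {R : realType} {m s : nat}.
Local Notation V := 'rV[R]_m.
Variables (A : set V) (z : V -> 'rV[R]_s) (E : V -> V) (F : 'I_s -> V -> V).
Hypotheses (oA : open A) (sz : smooth_on A z) (sF : forall i, smooth_on A (F i)) (sE : smooth_on A E).
Hypothesis EF : forall u, A u -> E u = \sum_i z u 0 i *: F i u.
Hypothesis Ez : forall u, A u -> 'D_(E u) z u = z u.

(* The [n]-th power of the ideal generated by the components of [z]. *)
Fixpoint ideal_pow n (f : V -> R) : Prop := if n is n'.+1 then
  exists2 g : 'I_s -> V -> R, (forall j, ideal_pow n' (g j)) &
    forall u, A u -> f u = \sum_j z u 0 j * g j u
  else smooth_on A f.

Let idealSP n f : ideal_pow n.+1 f <->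
  exists2 g : 'I_s -> V -> R, (forall j, ideal_pow n (g j)) &
    forall u, A u -> f u = \sum_j z u 0 j * g j u.
Proof. by []. Qed.

Let szi i : smooth_on A (fun u => z u 0 i).
Proof. exact: (smooth_coordP z oA).1. Qed.

Lemma ideal_eq n f f' : (forall u, A u -> f u = f' u) -> ideal_pow n f -> ideal_pow n f'.
Proof.
case: n => [|n] ff' /=; first exact: smooth_eq.
by move=> [g Ig fg]; exists g => // u Au; rewrite -ff' // fg.
Qed.

Lemma ideal_smooth n f : ideal_pow n f -> smooth_on A f.
Proof.
elim: n f => // n IH f /idealSP[g Ig fg].
apply: smooth_eq oA (fun u Au => esym (fg u Au)) _.
by apply: smooth_sum => // j _; apply: smoothM => //; apply: IH.
Qed.

Lemma idealD n f g : ideal_pow n f -> ideal_pow n g -> ideal_pow n (fun u => f u + g u).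
Proof.
elim: n f g => [|n IH] f g; first exact: smoothD.
move=> /idealSP[a Ia fa] /idealSP[b Ib gb]; exists (fun j u => a j u + b j u); first by move=> j; apply: IH.
by move=> u Au; rewrite fa // gb // -big_split; apply: eq_bigr => j _; rewrite mulrDr.
Qed.

Lemma idealM n (f a : V -> R) : smooth_on A a -> ideal_pow n f -> ideal_pow n (fun u => a u * f u).
Proof.
move=> sa; elim: n f => [|n IH] f; first exact: smoothM.
move=> /idealSP[g Ig fg]; exists (fun j u => a u * g j u); first by move=> j; apply: IH.
by move=> u Au; rewrite fg // mulr_sumr; apply: eq_bigr => j _; rewrite mulrCA.
Qed.

Lemma idealZ n f c : ideal_pow n f -> ideal_pow n (fun u => c * f u).
Proof. by apply: idealM; exact: smooth_cst. Qed.

Lemma ideal0 n : ideal_pow n (fun=> 0).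
Proof.
elim: n => [|n IH] /=; first exact: smooth_cst.
by exists (fun _ _ => 0) => // u _; rewrite big1 // => j _; rewrite mulr0.
Qed.

Lemma ideal_sum n (I : Type) (t : seq I) (f : I -> V -> R) : (forall i, ideal_pow n (f i)) ->
  ideal_pow n (fun u => \sum_(i <- t) f i u).
Proof.
move=> If; elim: t => [|i t IH].
  by apply: (ideal_eq _ (ideal0 n)) => u _; rewrite big_nil.
by apply: (ideal_eq _ (idealD (If i) IH)) => u _; rewrite big_cons.
Qed.

Lemma ideal_z n j f : ideal_pow n f -> ideal_pow n.+1 (fun u => z u 0 j * f u).
Proof.
move=> If; exists (fun l u => (l == j)%:R * f u); first by move=> l; exact: idealZ.
move=> u _; rewrite (bigD1 j) //= eqxx mul1r big1 ?addr0 // => l lj.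
by rewrite (negbTE lj) mul0r mulr0.
Qed.

Lemma ideal1M n f g : ideal_pow 1 f -> ideal_pow n g -> ideal_pow n.+1 (fun u => f u * g u).
Proof.
move=> /idealSP[a sa fa] Ig; exists (fun j u => a j u * g u); first by move=> j; exact: (idealM (sa j) Ig).
by move=> u Au; rewrite fa // mulr_suml; apply: eq_bigr => j _; rewrite mulrA.
Qed.

(* On the [n]-th power the Euler field acts as multiplication by [n], modulo the next power. *)
Lemma ideal_euler n f : ideal_pow n f -> ideal_pow n.+1 (fun u => 'D_(E u) f u - n%:R * f u).
Proof.
elim: n f => [|n IH] f If.
  exists (fun i u => 'D_(F i u) f u); first by move=> j; exact: (smooth_along oA (sF j) If).
  move=> u Au; rewrite mul0r subr0 EF // derive_dir_sum; last exact: smooth_differentiable If.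
  by apply: eq_bigr => i _; rewrite derive_dirZ //; exact: smooth_differentiable If.
have /idealSP[g Ig fg] := If.
exists (fun j u => 'D_(E u) (g j) u - n%:R * g j u); first by move=> j; exact: IH.
have sg j := ideal_smooth (Ig j).
move=> u Au; rewrite (near_derive (E u) oA fg Au) fg //.
rewrite (smooth_derive_sum _ (E u) oA (fun j => smoothM oA (szi j) (sg j)) Au).
rewrite mulr_sumr -sumrB; apply: eq_bigr => j _.
rewrite (smooth_deriveM (E u) (szi j) (sg j) Au) (derive_coordE j (smooth_derivable sz Au)) Ez //.
rewrite -natr1; move: (z u 0 j) (g j u) ('D_(E u) (g j) u) (n%:R : R) => a b c d.
by ring.
Qed.

Lemma ideal_derive n f v : ideal_pow n.+1 f -> ideal_pow n ('D_v f).
Proof.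
elim: n f => [|n IH] f; first by move=> /ideal_smooth sf; exact: smooth_derive.
move=> /idealSP[g Ig fg]; have sg j := ideal_smooth (Ig j).
have E1 u : A u -> \sum_j ('D_v (fun u => z u 0 j) u * g j u + z u 0 j * 'D_v (g j) u) = 'D_v f u.
  move=> Au; rewrite (near_derive v oA fg Au).
  rewrite (smooth_derive_sum _ v oA (fun j => smoothM oA (szi j) (sg j)) Au).
  by apply: eq_bigr => j _; rewrite (smooth_deriveM v (szi j) (sg j) Au).
apply: (ideal_eq E1); apply: ideal_sum => j; apply: idealD.
  by apply: idealM => //; exact: smooth_derive.
by apply: ideal_z; exact: IH.
Qed.

(** A derivative lowers the power by at most one, so any iterated derivative of an element of all
    powers still lies in the ideal, whose elements vanish where [z] does. *)
Lemma ideal_vanish x f : A x -> z x = 0 -> (forall n, ideal_pow n f) ->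
  forall n v, iter n (fun g => 'D_v g) f x = 0.
Proof.
move=> Ax zx If n v.
have : ideal_pow 1 (iter n (fun g => 'D_v g) f).
  suff : forall j, ideal_pow j (iter n (fun g => 'D_v g) f) by apply.
  by elim: n => [|n IH] j; [exact: If|exact: ideal_derive].
by move=> [g _ ->] //; rewrite big1 // => j _; rewrite zx mxE mul0r.
Qed.

End vanishing_ideal.

(** * Solving the equations of all fields simultaneously *)

Section solve.
Context {R : realType} {n k r : nat}.
Local Notation V := 'rV[R]_(n + n).
Local Notation L := 'rV[R]_(k + k).
Local Notation W := 'rV[R]_(r + r).
Local Notation Z := 'rV[R]_((r + r) + (n + n)).
Variables (x : V) (e : R) (Vf : L -> V -> V) (h : L -> V -> R) (br : L -> L -> L)
  (P : 'M[R]_(r + r, k + k)) (Q : 'M[R]_(k + k, r + r)).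
Local Notation B := (ball x e).
Hypothesis e0 : 0 < e.
Hypothesis H : hol_frame B Vf h P.
Hypothesis brL : forall a b, br a b = \sum_l a 0 l *: br 'e_l b.
Hypothesis Vbr : forall a b u, B u ->
  'D_(Vf a u) (Vf b) u - 'D_(Vf b u) (Vf a) u = Vf (br a b) u.
Hypothesis hbr : forall a b u, B u ->
  'D_(Vf a u) (h b) u - 'D_(Vf b u) (h a) u = h (br a b) u.
Hypothesis hQ : forall c u, B u -> h c u = h (c *m Q *m P) u.
Hypothesis hx : forall c, h c x = 0.

Let oB := frame_open H.
Let VL := frame_fieldL H.
Let hL := frame_funL H.
Let VH := frame_hol H.
Let hCR := frame_CR H.
Let sV d : smooth_on B (Vf d). Proof. by case: (VH d). Qed.
Let sh d : smooth_on B (h d). Proof. by case: (hCR d). Qed.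
Local Notation N := (coframe Vf h P).
Local Notation z := (transverse h P).

Let sz : smooth_on B z. Proof. exact: (smooth_transverse H). Qed.
Let sid : smooth_on B (id : V -> V).
Proof. by apply/(smooth_coordP _ oB) => i; exact: smooth_coord. Qed.

Let cf (y : W) u : L := y *m N u *m P.
Let c u : L := cf (z u) u.
(** The coefficients [c u] are those for which the inverse frame matrix gives E z = z; as they are
    linear in z, the field also has the form of a sum of z_i F_i. *)
Let E u := Vf (c u) u.

Let scf y : smooth_on B (cf y).
Proof.
apply: smooth_mulmx_const => //; apply: smooth_mulmx => //; first exact: smooth_cst.
exact: (smooth_coframe H).
Qed.

Let sc : smooth_on B c.
Proof.
apply: smooth_mulmx_const => //; apply: smooth_mulmx => //.
exact: (smooth_coframe H).
Qed.

Let sE : smooth_on B E.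
Proof. exact: (smooth_familyV oB oB (fun u Bu => Bu) sid sc VL sV). Qed.

Let Fi i u := Vf (cf 'e_i u) u.
Let sFi i : smooth_on B (Fi i).
Proof. exact: (smooth_familyV oB oB (fun u Bu => Bu) sid (scf 'e_i) VL sV). Qed.

Lemma Vf_mulmx (a : nat) (y : 'rV[R]_a) (M : 'M[R]_(a, k + k)) u :
  Vf (y *m M) u = \sum_j y 0 j *: Vf (row j M) u.
Proof.
apply/rowP => l; rewrite summxE (family_mulmx (F := fun d u => Vf d u 0 l)).
  by apply: eq_bigr => i _; rewrite mxE.
by move=> d u'; rewrite VL summxE; apply: eq_bigr => i _; rewrite mxE.
Qed.

Let EF u : B u -> E u = \sum_i z u 0 i *: Fi i u.
Proof.
move=> Bu; rewrite /E /c /cf -mulmxA Vf_mulmx; apply: eq_bigr => i _.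
by rewrite /Fi /cf -mulmxA -rowE.
Qed.

Let Ez u : B u -> 'D_(E u) z u = z u.
Proof.
move=> Bu; rewrite -(frame_mulE H _ Bu) -mulmxA.
by have [_ ->] := frameV H Bu; rewrite mulmx1.
Qed.

Section near_zero.
Variables (eta d d1 : R) (Rf : 'I_(r + r) -> Z -> R).
Hypotheses (d10 : 0 < d1) (dd : d1 <= d) (de : d <= e).
Hypothesis zeta : forall u, ball x d1 u -> `|z u| < eta.
Hypothesis RfCR : forall l, CR (@JP R n r) (tube x eta d) (Rf (lshift r l)) (Rf (rshift r l)).
Hypothesis RfE : forall i t, tube x eta d t ->
    Rf i t + 'D_(euler t + lift_field Vf h P t) (Rf i) t = series0 Vf h P i t.

Local Notation A := (ball x d1).
Let oA : open A. Proof. exact: ball_open. Qed.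
Let AB u : A u -> B u. Proof. by apply: le_ball; apply: le_trans de. Qed.
Let S u : Z := row_mx (z u) u.
Let oT : open (tube x eta d : set Z). Proof. exact: open_tube. Qed.
Let ST u : A u -> tube x eta d (S u).
Proof.
move=> Au; split; first by rewrite row_mxKl; exact: zeta.
by rewrite row_mxKr; apply: le_ball Au.
Qed.

Let sub f : smooth_on B f -> smooth_on A (f : V -> R). Proof. by apply: smooth_sub. Qed.
Let subV p f : smooth_on B f -> smooth_on A (f : V -> 'rV[R]_p). Proof. by apply: smooth_sub. Qed.

Let sS : smooth_on A S.
Proof. by apply: smooth_row_mx => //; apply: subV. Qed.

Let dS w u : A u -> 'D_w S u = row_mx ('D_w z u) w.
Proof. by move=> Au; rewrite (derive_row_mx2 oA (subV sz) (subV sid) w Au) derive_id. Qed.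

Let SJ w u : A u -> 'D_(mul_i w) S u = JP ('D_w S u).
Proof.
move=> Au; rewrite !dS // /JP row_mxKl row_mxKr.
by rewrite (derive_transverseJ H _ (AB Au)).
Qed.

(** Since E z = z, the derivative of [S] along E is [euler + lift_field] at y = z(u), so the
    equations [RfE] become E p = h (c u) u. *)
Definition series_pot u : R := \sum_i z u 0 i * Rf i (S u).

Let sRf i : smooth_on (tube x eta d) (Rf i).
Proof. by case: (split_ordP i) => l ->; case: (RfCR l). Qed.
Let sRS i : smooth_on A (fun u => Rf i (S u)).
Proof. exact: smooth_comp oA oT ST (sRf i) sS. Qed.
Let szi i : smooth_on A (fun u => z u 0 i).
Proof. by apply: sub; exact: (smooth_coordP z oB).1. Qed.

(** The real sum over both halves of the index is the real part of a complex sum over ['I_r], of the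
    conjugate of each pair of components of z times the corresponding holomorphic pair of [Rf]. *)
Lemma CR_series_pot : exists q, CR (@mul_i R n) A series_pot q.
Proof.
have Cz l : CR (@mul_i R n) A (fun u => z u 0 (lshift r l)) (fun u => - z u 0 (rshift r l)).
  apply: CR_sub AB _; apply: (CR_eq oB _ _ (hCR (row (lshift r l) P))) => u _.
    by rewrite mxE.
  by rewrite mxE; have [_ [-> _]] := row_mulJ H l.
have CR1 l := CRM oA (Cz l) (CR_comp oA oT ST sS SJ (RfCR l)).
have C := CR_sum oA (index_enum 'I_r) CR1.
eexists; apply: (CR_eq oA _ (fun u _ => erefl) C) => u _.
rewrite /series_pot big_split_ord /= -big_split; apply: eq_bigr => l _.
by rewrite mulNr opprK.
Qed.

Let sp : smooth_on A series_pot. Proof. by have [q []] := CR_series_pot. Qed.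

Let Epot u : A u -> 'D_(E u) series_pot u = h (c u) u.
Proof.
move=> Au; have Bu := AB Au.
rewrite /series_pot (smooth_derive_sum _ (E u) oA (fun i => smoothM oA (szi i) (sRS i)) Au).
rewrite /c /cf -mulmxA (family_mulmx hL); apply: eq_bigr => i _.
rewrite (smooth_deriveM (E u) (szi i) (sRS i) Au).
rewrite (derive_coordE i (smooth_derivable sz Bu)) Ez // -mulrDr; congr (_ * _).
have dRi := smooth_differentiable oT (ST Au) (sRf i).
rewrite (derive_compE _ (smooth_differentiableV oA Au sS) dRi) dS // Ez //.
have := RfE i (ST Au); rewrite /series0 /pidx row_mxKr -mulmxA -rowE => <-.
congr (_ + 'D__ _ _); rewrite /euler /lift_field /pidx row_mxKl row_mxKr.
by rewrite add_row_mx addr0 add0r.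
Qed.

Let G b u := 'D_(Vf b u) series_pot u - h b u.
Let sG b : smooth_on A (G b).
Proof. by apply: smoothB => //; [apply: smooth_along => //; apply: subV|exact: sub]. Qed.

Let dpot u : A u -> differentiable series_pot u.
Proof. by move=> Au; exact: smooth_differentiable sp. Qed.

Let G_mulmx (a : nat) (y : 'rV[R]_a) (M : 'M[R]_(a, k + k)) u : A u ->
  G (y *m M) u = \sum_j y 0 j * G (row j M) u.
Proof.
move=> Au; rewrite /G Vf_mulmx (family_mulmx hL) derive_dir_sum; last exact: dpot.
rewrite -sumrB; apply: eq_bigr => j _; rewrite derive_dirZ; last exact: dpot.
by rewrite -mulrBr.
Qed.

Let GL b u : A u -> G b u = \sum_l b 0 l * G 'e_l u.
Proof.
move=> Au; rewrite -{1}[b]mulmx1 G_mulmx //; apply: eq_bigr => l _.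
by rewrite rowE mulmx1.
Qed.

(* The defect [G] of the equations satisfies a linear equation along the Euler field. *)
Let EG b u : A u -> 'D_(E u) (G b) u =
  - G ('D_(Vf b u) c u) u + \sum_l c u 0 l * G (br 'e_l b) u.
Proof.
have A1 (X X' Y Y' t1 t3 t4 t6 t7 t8 h1 : R) : h1 + t6 = X' + Y' -> X = X' ->
    Y' = t3 + t4 -> Y = t1 + t4 -> t7 - t6 = t8 -> X + Y - t7 = - (t3 - h1) + (t1 - t8).
  by lra.
move=> Au; have Bu := AB Au; set w := Vf b u; set a := c u.
have s1 : smooth_on A (fun u => 'D_(Vf b u) series_pot u).
  by apply: smooth_along => //; exact: subV.
(* The equation along E is differentiated along the field of index [b]; the bracket relations for
   fields and functions then exchange the two derivatives. *)
have E1 : 'D_w (fun u => 'D_(E u) series_pot u) u = h ('D_w c u) u + 'D_w (h a) u.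
  rewrite (near_derive w oA Epot Au).
  rewrite (derive_family oB oB (fun u Bu => Bu) sid sc hL sh w Bu).
  by rewrite derive_id.
have E2 : 'D_w E u = Vf ('D_w c u) u + 'D_w (Vf a) u.
  by rewrite (derive_familyV oB oB (fun u Bu => Bu) sid sc VL sV w Bu) derive_id.
have E5 := etrans (esym E1) (derive_along oA (subV sE) sp w Au).
have E6 : 'D_w ('D_(E u) series_pot) u = 'D_(E u) ('D_w series_pot) u.
  exact: (schwarz w (E u) oA Au sp).
have E7 := etrans (congr1 (fun v => 'D_v series_pot u) E2) (derive_dirD _ _ (dpot Au)).
have E3 : 'D_('D_(E u) (Vf b) u) series_pot u =
    'D_(Vf (br a b) u) series_pot u + 'D_('D_w (Vf a) u) series_pot u.
  rewrite -(Vbr a b Bu) -derive_dirD; last exact: dpot.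
  by rewrite subrK.
have E4 : \sum_l a 0 l * G (br 'e_l b) u = G (br a b) u.
  rewrite [br a b]brL (_ : \sum_l _ = a *m (\matrix_l br 'e_l b)).
    apply: etrans _ (esym (G_mulmx a _ Au)); apply: eq_bigr => l _.
    by have -> : row l (\matrix_l' br 'e_l' b) = br 'e_l b by exact: rowK.
  by apply/rowP => j; rewrite summxE [RHS]mxE; apply: eq_bigr => l _; rewrite !mxE.
rewrite E4; apply: etrans (smooth_deriveB (E u) s1 (sub (sh b)) Au) _.
apply: etrans (congr1 (fun y => y - _) (derive_along oA (subV (sV b)) sp (E u) Au)) _.
exact: (A1 _ _ _ _ _ _ _ _ _ _ _ E5 E6 E7 E3 (hbr a b Bu)).
Qed.

Local Notation ideal := (ideal_pow A z).
Let Ieuler := @ideal_euler R _ _ A z E Fi oA (subV sz) (fun i => subV (sFi i)) (fun u Au => EF (AB Au)) (fun u Au => Ez (AB Au)).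

Let sN i j : smooth_on A (fun u => N u i j).
Proof. by apply: sub; exact: (smooth_coframe H). Qed.

Let sM (M : V -> 'M[R]_(r + r)) l j : (forall i j, smooth_on A (fun u => M u i j)) ->
  smooth_on A (fun u => (M u *m P) j l).
Proof.
move=> sM.
have s1 : smooth_on A (fun u => \sum_i M u j i * P i l).
  by apply: smooth_sum => // i _; apply: smoothM => //; exact: smooth_cst.
by apply: smooth_eq oA _ s1 => u _; rewrite [RHS]mxE.
Qed.

Let Imul (y : V -> W) (M : V -> 'M[R]_(r + r)) m (f : 'I_(k + k) -> V -> R) :
  (forall i j, smooth_on A (fun u => M u i j)) ->
  (forall j, ideal 1 (fun u => y u 0 j)) -> (forall l, ideal m (f l)) ->
  ideal m.+1 (fun u => \sum_l (y u *m M u *m P) 0 l * f l u).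
Proof.
move=> sMM Iy If; apply: ideal_sum => // l.
have E1 u : A u -> \sum_j y u 0 j * ((M u *m P) j l * f l u) = (y u *m M u *m P) 0 l * f l u.
  by move=> Au; rewrite -mulmxA [in RHS]mxE mulr_suml; apply: eq_bigr => j _; rewrite mulrA.
apply: (ideal_eq oA E1); apply: ideal_sum => // j; apply: ideal1M => //.
by apply: idealM => //; exact: sM.
Qed.

Let Iz j : ideal 1 (fun u => z u 0 j).
Proof.
have s1 : ideal 0 (fun=> 1) by exact: smooth_cst.
by apply: (ideal_eq oA _ (ideal_z oA j s1)) => u _; rewrite mulr1.
Qed.

Let Ih b : ideal 1 (h b).
Proof.
have E1 u : A u -> \sum_j (b *m Q) 0 j * z u 0 j = h b u.
  by move=> Au; rewrite hQ ?(h_mulP H) //; exact: AB.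
by apply: (ideal_eq oA E1); apply: ideal_sum => // j; apply: idealZ.
Qed.

Let GD a b u : A u -> G (a + b) u = G a u + G b u.
Proof.
move=> Au; rewrite !(GL _ Au) -big_split; apply: eq_bigr => l _.
by rewrite mxE mulrDl.
Qed.

Let Dc b u : A u -> 'D_(Vf b u) c u =
  'D_(Vf b u) z u *m N u *m P + z u *m dcoframe Vf h P (Vf b u) u *m P.
Proof.
move=> Au; have Bu := AB Au; have sNB := smooth_coframe H.
rewrite (derive_mulmx_const P oB (smooth_mulmx oB sz sNB) _ Bu).
by rewrite (derive_mulmx oB sz sNB _ Bu) mulmxDl.
Qed.

Let sdN b i j : smooth_on A (fun u => dcoframe Vf h P (Vf b u) u i j).
Proof.
apply: smooth_eq oA _ (smooth_along oA (subV (sV b)) (sN i j)) => u _.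
by rewrite mxE.
Qed.

(** In the relation for E (G b), the terms carrying a factor z lie in the next power of the ideal.
    What remains of the derivative of [c] is the index in which z itself is differentiated. *)
Let IEG m b : (forall b, ideal m (G b)) ->
  ideal m.+1 (fun u => 'D_(E u) (G b) u + G ('D_(Vf b u) z u *m N u *m P) u).
Proof.
move=> IG.
have E1 u : A u -> -1 * (\sum_l (z u *m dcoframe Vf h P (Vf b u) u *m P) 0 l * G 'e_l u) +
    \sum_l (z u *m N u *m P) 0 l * G (br 'e_l b) u =
    'D_(E u) (G b) u + G ('D_(Vf b u) z u *m N u *m P) u.
  move=> Au; rewrite (EG b Au) Dc // GD // [G (z u *m _ *m P) u]GL // opprD mulN1r.
  rewrite addrAC; congr (_ + _).
  by rewrite [in RHS]addrC addrA subrr add0r.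
apply: (ideal_eq oA E1); apply: idealD => //; last by apply: Imul => // l; exact: IG.
by apply: idealZ => //; apply: Imul => // i j; exact: sdN.
Qed.

(** Two values for E (G b) are compared modulo the power m+1: the Euler property gives m G b, and
    the brackets give - G b for the rows of [P] and 0 for the indices on which [h] vanishes. Hence
    (m+1) G b, respectively m G b, lies in the next power. *)
Lemma ideal_defect m b : ideal m (G b).
Proof.
elim: m b => [b|m IH b]; first exact: sG.
have Irow i : ideal m.+1 (G (row i P)).
  have E1 u : A u -> G ('D_(Vf (row i P) u) z u *m N u *m P) u = G (row i P) u.
    move=> Au; have Bu := AB Au; congr (G _ u); rewrite {1}rowE -(frame_mulE H _ Bu).
    by rewrite -!mulmxA [frame_mx _ _ _ _ *m _]mulmxA; have [-> _] := frameV H Bu; rewrite mul1mx -rowE.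
  have I1 := idealD oA (IEG (row i P) IH) (idealZ oA (-1) (Ieuler (IH (row i P)))).
  have m0 : (m.+1%:R : R) != 0 by rewrite pnatr_eq0.
  apply: (ideal_eq oA _ (idealZ oA m.+1%:R^-1 I1)) => u Au; rewrite E1 //.
  rewrite -natr1 in m0 *; move: ('D_(E u) (G (row i P)) u) (G (row i P) u) (m%:R : R) m0 => s g t m0.
  by field.
have Ibase : ideal m.+1 (G (b *m Q *m P)).
  have E1 u : A u -> \sum_j (b *m Q) 0 j * G (row j P) u = G (b *m Q *m P) u.
    by move=> Au; rewrite G_mulmx.
  by apply: (ideal_eq oA E1); apply: ideal_sum => // j; apply: idealZ.
(* The component of [b] on which all functions vanish. By the bracket relation the derivative of z
   along its field is made of functions [h], hence lies in the ideal. *)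
pose kap := b - b *m Q *m P.
have hk u : B u -> h kap u = 0.
  move=> Bu; rewrite /kap; have := family_lin hL (-1) (b *m Q *m P) b u.
  by rewrite scaleN1r addrC => ->; rewrite mulN1r addrC -hQ // subrr.
have Ikz j : ideal 1 (fun u => 'D_(Vf kap u) z u 0 j).
  apply: (ideal_eq oA _ (Ih (br kap (row j P)))) => u Au; have Bu := AB Au.
  rewrite (derive_transverse H _ Bu) mxE -hbr //.
  by rewrite (near_derive _ oB hk Bu) derive_cst subr0.
suff Ik : ideal m.+1 (G kap).
  apply: (ideal_eq oA _ (idealD oA Ik Ibase)) => u Au; rewrite -GD //.
  by rewrite /kap subrK.
(* The comparison divides by the exponent, so exponent 0 is treated directly: there [G kap] is the
   derivative of the potential, where either z_i remains or its derivative lies in the ideal. *)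
case: m IH Irow Ibase => [|m] IH _ _.
  have E1 u : A u -> \sum_i (('D_(Vf kap u) z u) 0 i * Rf i (S u) +
      z u 0 i * 'D_(Vf kap u) (fun u => Rf i (S u)) u) = G kap u.
    move=> Au; have Bu := AB Au; rewrite /G hk // subr0.
    rewrite /series_pot (smooth_derive_sum _ _ oA (fun i => smoothM oA (szi i) (sRS i)) Au).
    apply: eq_bigr => i _; rewrite (smooth_deriveM _ (szi i) (sRS i) Au).
    by rewrite (derive_coordE i (smooth_derivable sz Bu)).
  apply: (ideal_eq oA E1); apply: ideal_sum => // i; apply: idealD => //.
    by apply: (ideal1M oA (Ikz i)); exact: sRS.
  by apply: ideal_z => //; apply: smooth_along => //; exact: subV.
have I1 := IEG kap IH; have I2 := Ieuler (IH kap).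
have I3 : ideal m.+2 (fun u => \sum_l ('D_(Vf kap u) z u *m N u *m P) 0 l * G 'e_l u).
  by apply: Imul => // l; exact: IH.
have m0 : (m.+1%:R : R) != 0 by rewrite pnatr_eq0.
apply: (ideal_eq oA _ (idealZ oA m.+1%:R^-1 (idealD oA I1
  (idealZ oA (-1) (idealD oA I2 I3))))) => u Au.
rewrite -GL //; move: ('D_(E u) (G kap) u) (G kap u) (G _ u) (m.+1%:R : R) m0 => s g t y m0.
by field.
Qed.

Let zx : z x = 0.
Proof. by apply/rowP => j; rewrite !mxE hx. Qed.

(** Each [G 'e_l] is the real part of a holomorphic function and vanishes to infinite order at [x].
    Finitely many indices suffice, since [G] is linear in its index. *)
Lemma defect_near : exists2 dl, 0 < dl & forall b u, ball x dl u -> G b u = 0.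
Proof.
have [q Cp] := CR_series_pot.
have Gnear l : \forall u \near x, G 'e_l u = 0.
  have C1 := CR_along oA Cp (hol_sub AB (VH 'e_l)).
  have C2 := CR_conj oA (CR_conj oA (CR_sub AB (hCR 'e_l))).
  have [dl dl0 Hd] := CR_identity d10 (@mul_i_norm R n) (CRD oA C1 C2)
    (ideal_vanish oA (subV sz) (ballxx x d10) zx (fun m => ideal_defect m 'e_l)).
  by apply/nbhs_ballP; exists dl => // u /Hd.
have /nbhs_ballP[dl dl0 Hd] := @filter_forall _ _ _ (nbhs x) (nbhs_filter x) Gnear.
exists (Num.min dl d1); first by rewrite lt_min dl0 d10.
move=> b u Bu; have Au : A u by apply: le_ball Bu; rewrite ge_min lexx orbT.
rewrite GL // big1 // => l _; rewrite (Hd u _ l) ?mulr0 //.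
by apply: le_ball Bu; rewrite ge_min lexx.
Qed.

End near_zero.

Theorem solve_fields : exists dl (p q : V -> R), [/\ 0 < dl, dl <= e,
  CR (@mul_i R n) (ball x dl) p q &
  forall c u, ball x dl u -> 'D_(Vf c u) p u = h c u].
Proof.
have [eta [d [Rf [eta0 d0 de RfCR RfE]]]] := lie_series_solution e0 H.
have zx : z x = 0 by apply/rowP => j; rewrite !mxE hx.
have : \forall u \near x, `|z u| < eta.
  have c1 : {for x, continuous z} by exact: smooth_continuous sz (ballxx x e0).
  have := (@cvgrPdist_lt _ _ _ _ (nbhs_filter x) _ _).1 c1 _ eta0.
  by apply: filterS => u; rewrite zx sub0r normrN.
move=> /nbhs_ballP[d2 d20 Hd2]; pose d1 := Num.min d2 d.
have d10 : 0 < d1 by rewrite lt_min d20 d0.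
have dd : d1 <= d by rewrite ge_min lexx orbT.
have zeta u : ball x d1 u -> `|z u| < eta.
  by move=> Bu; apply: Hd2; apply: le_ball Bu; rewrite ge_min lexx.
have [q C] := CR_series_pot dd de zeta RfCR.
have [dl dl0 Hd] := defect_near d10 dd de zeta RfCR RfE.
exists (Num.min dl d1), (series_pot Rf), q; split.
- by rewrite lt_min dl0 d10.
- by rewrite ge_min (le_trans dd de) orbT.
- by apply: CR_sub C; apply: le_ball; rewrite ge_min lexx orbT.
move=> b u Bu; apply/eqP; rewrite -subr_eq0; apply/eqP; apply: Hd.
by apply: le_ball Bu; rewrite ge_min lexx.
Qed.

End solve.

(** * Local potentials inducing the momentum map *)

Lemma sum_delta {R : realType} {W : lmodType R} (k : nat) (f : 'I_k -> W) j :
  \sum_l ('e_j : 'rV[R]_k) 0 l *: f l = f j.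
Proof.
rewrite (bigD1 j) //= mxE !eqxx scale1r big1 ?addr0 // => l lj.
by rewrite mxE (negbTE lj) andbF scale0r.
Qed.

Lemma family_mulmxV {R : realType} (k m : nat) (U : lmodType R) (V : Type) (F : 'rV[R]_k -> V -> U) :
  (forall d u, F d u = \sum_l d 0 l *: F 'e_l u) -> forall (y : 'rV[R]_m) P u,
  F (y *m P) u = \sum_i y 0 i *: F (row i P) u.
Proof.
move=> FL y P u; rewrite FL.
have E i : F (row i P) u = \sum_l P i l *: F 'e_l u.
  by rewrite FL; apply: eq_bigr => l _; rewrite mxE.
under [RHS]eq_bigr do rewrite E scaler_sumr.
rewrite exchange_big; apply: eq_bigr => l _; rewrite mxE scaler_suml.
by apply: eq_bigr => i _; rewrite scalerA.
Qed.

Section local_moment.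
Context {R : realType} {n k : nat}.
Local Notation V := 'rV[R]_(n + n).
Local Notation G := 'rV[R]_k.
Local Notation L := 'rV[R]_(k + k).
Variables (x : V) (e : R) (Om : V -> V -> V -> R) (Xi : G -> V -> V) (mu : G -> V -> R)
  (bt : G -> G -> G) (rho : V -> R).
Local Notation B := (ball x e).
Record moment_data : Prop := {
  radius_gt0 : 0 < e;
  fieldL : forall v u, Xi v u = \sum_l v 0 l *: Xi 'e_l u;
  field_hol : forall v, hol (@mul_i R n) B (Xi v);
  momentL : forall v u, mu v u = \sum_l v 0 l * mu 'e_l u;
  moment_smooth : forall v, smooth_on B (mu v);
  bracketL : forall a v, bt a v = \sum_l a 0 l *: bt 'e_l v;
  moment_derive : forall v w u, B u -> 'D_w (mu v) u = Om u (Xi v u) w;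
  field_bracket : forall a v u, B u ->
  'D_(Xi a u) (Xi v) u - 'D_(Xi v u) (Xi a) u = Xi (bt a v) u;
  moment_bracket : forall a v u, B u -> 'D_(Xi a u) (mu v) u = mu (bt a v) u;
  moment0 : forall v, mu v x = 0;
  form_gt0 : forall u v, B u -> v != 0 -> 0 < Om u v (mul_i v);
  pot_smooth : smooth_on B rho;
  pot_form : forall u v w, B u -> Om u v w = levi rho u v w;
  pot_derive0 : forall v, 'D_v rho x = 0;
  pot_hessianJ : forall v w, 'D_(mul_i v) ('D_(mul_i w) rho) x = 'D_v ('D_w rho) x;
  pot_isotropy : forall v, Xi v x = 0 -> forall u, B u -> 'D_(Xi v u) rho u = 0 }.
Hypothesis H : moment_data.
Let e0 := radius_gt0 H.
Let XiL := fieldL H.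
Let XiH := field_hol H.
Let muL := momentL H.
Let smu := moment_smooth H.
Let btL := bracketL H.
Let dmu := moment_derive H.
Let Xibt := field_bracket H.
Let mubt := moment_bracket H.
Let mux := moment0 H.
Let Ompos := form_gt0 H.
Let srho := pot_smooth H.
Let rhoOm := pot_form H.
Let drho := pot_derive0 H.
Let ddrho := pot_hessianJ H.
Let rhoK := pot_isotropy H.

Let oB : open B. Proof. exact: ball_open. Qed.
Let Bx : B x. Proof. exact: ballxx. Qed.
Let sXi v : smooth_on B (Xi v). Proof. by case: (XiH v). Qed.
Let sJXi v : smooth_on B (fun u => mul_i (Xi v u)).
Proof.
apply/(smooth_coordP _ oB) => i; have sc := (smooth_coordP _ oB).1 (sXi v).
case: (split_ordP i) => j ->.
  by apply: smooth_eq oB _ (smoothN oB (sc (rshift n j))) => u _; rewrite mul_i_lE.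
by apply: smooth_eq oB _ (sc (lshift n j)) => u _; rewrite mul_i_rE.
Qed.

Let dJ (T : V -> V) w u : B u -> smooth_on B T -> smooth_on B (fun u => mul_i (T u)) ->
  'D_w (fun u => mul_i (T u)) u = mul_i ('D_w T u).
Proof.
move=> Bu sT sJT; apply/rowP => i.
rewrite -(derive_coordE i (smooth_derivable sJT Bu)).
have sc j : smooth_on B (fun u => T u 0 j) by exact: (smooth_coordP T oB).1.
have dc j := derive_coordE j (smooth_derivable (v := w) sT Bu).
case: (split_ordP i) => j ->.
  rewrite mul_i_lE -dc -(smooth_deriveN w (sc _) Bu).
  by congr ('D_w _ u); apply/funext => y; rewrite mul_i_lE.
rewrite mul_i_rE -dc.
by congr ('D_w _ u); apply/funext => y; rewrite mul_i_rE.
Qed.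

Let drh u : B u -> differentiable rho u.
Proof. by move=> Bu; exact: smooth_differentiable srho. Qed.

Definition pfun v u := - 'D_(Xi v u) rho u.
Definition qfun v u := 2 * mu v u - 'D_(mul_i (Xi v u)) rho u.

Let s1 v : smooth_on B (fun u => 'D_(Xi v u) rho u). Proof. exact: smooth_along. Qed.
Let s2 v : smooth_on B (fun u => 'D_(mul_i (Xi v u)) rho u). Proof. exact: smooth_along. Qed.

Let sp v : smooth_on B (pfun v). Proof. exact: smoothN. Qed.
Let sq v : smooth_on B (qfun v). Proof. by apply: smoothB => //; exact: smoothMc. Qed.

Let dp v w u : B u -> 'D_w (pfun v) u = - ('D_(Xi v u) ('D_w rho) u + 'D_('D_w (Xi v) u) rho u).
Proof.
move=> Bu; apply: etrans (smooth_deriveN w (s1 v) Bu) (congr1 -%R _).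
exact: (derive_along oB (sXi v) srho w Bu).
Qed.

Let dq v w u : B u -> 'D_w (qfun v) u = 2 * Om u (Xi v u) w -
  ('D_(mul_i (Xi v u)) ('D_w rho) u + 'D_(mul_i ('D_w (Xi v) u)) rho u).
Proof.
move=> Bu; have s3 := smoothMc 2 oB (smu v).
apply: etrans (smooth_deriveB w s3 (s2 v) Bu) _.
have E1 : 'D_w (fun u => 2 * mu v u) u = 2 * Om u (Xi v u) w.
  by rewrite (smooth_deriveZ _ _ (smu v)) // dmu.
have E2 := derive_along oB (sJXi v) srho w Bu.
rewrite dJ // in E2.
by apply: etrans (congr2 (fun a b => a - b) E1 E2) _.
Qed.

(* [p - i q] is holomorphic. *)
Let CRpq v : CR (@mul_i R n) B (pfun v) (fun u => - qfun v u).
Proof.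
split=> // [|u w Bu]; first exact: smoothN.
rewrite !(smooth_deriveN _ (sq v) Bu) opprK.
have HJ w' : 'D_(mul_i w') (Xi v) u = mul_i ('D_w' (Xi v) u) by have [_ ->] := XiH v.
have A1 (a b c O : R) : O = - 2^-1 * (a - c) -> - (a + b) = 2 * O - (c + b) by lra.
have A2 (a b c O s t : R) : O = - 2^-1 * (s - t) -> s = - a -> t = c ->
    - (2 * O - (c - b)) = - (a + b) by lra.
have O1 : Om u (Xi v u) w = - 2^-1 * ('D_(Xi v u) ('D_(mul_i w) rho) u -
    'D_(mul_i (Xi v u)) ('D_w rho) u).
  have S := schwarz w (mul_i (Xi v u)) oB Bu srho.
  exact: etrans (rhoOm (Xi v u) w Bu) (congr1 (fun t => - 2^-1 * (_ - t)) S).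
have S := schwarz (mul_i w) (mul_i (Xi v u)) oB Bu srho.
have S' : 'D_(Xi v u) ('D_(mul_i (mul_i w)) rho) u = - 'D_(Xi v u) ('D_w rho) u.
    rewrite -(smooth_deriveN _ (smooth_derive w srho) Bu) mul_iK.
    by apply: (near_derive _ oB _ Bu) => y By; exact/derive_dirN/drh.
split.
  by apply: etrans (dp v (mul_i w) Bu) (etrans _ (esym (dq v w Bu))); rewrite HJ; exact: (A1 _ _ _ _ O1).
apply: etrans (congr1 -%R (dq v (mul_i w) Bu)) (etrans _ (esym (dp v w Bu))); rewrite HJ mul_iK.
have -> : 'D_(- 'D_w (Xi v) u) rho u = - 'D_('D_w (Xi v) u) rho u by exact/derive_dirN/drh.
exact: (A2 _ _ _ _ _ _ (rhoOm (Xi v u) (mul_i w) Bu) S' S).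
Qed.

Let XiD a b u : Xi (a + b) u = Xi a u + Xi b u.
Proof.
rewrite XiL (XiL a) (XiL b) -big_split; apply: eq_bigr => l _.
by rewrite mxE scalerDl.
Qed.

Let XiZ a b u : Xi (a *: b) u = a *: Xi b u.
Proof. by rewrite XiL (XiL b) scaler_sumr; apply: eq_bigr => l _; rewrite mxE scalerA. Qed.

Let pL v u : B u -> pfun v u = \sum_l v 0 l * pfun 'e_l u.
Proof.
move=> Bu; rewrite /pfun XiL derive_dir_sum; last exact: drh.
rewrite -sumrN; apply: eq_bigr => l _; rewrite derive_dirZ ?mulrN //; exact: drh.
Qed.

Let mulJ_sum (I : finType) (c : I -> R) (f : I -> V) :
  mul_i (\sum_i c i *: f i) = \sum_i c i *: mul_i (f i).
Proof. by rewrite linear_sum; apply: eq_bigr => i _; rewrite linearZ. Qed.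

Let qL v u : B u -> qfun v u = \sum_l v 0 l * qfun 'e_l u.
Proof.
move=> Bu; rewrite /qfun XiL muL mulJ_sum derive_dir_sum; last exact: drh.
rewrite mulr_sumr -sumrB; apply: eq_bigr => l _; rewrite derive_dirZ; last exact: drh.
by rewrite mulrBr mulrCA.
Qed.

(** The complexified infinitesimal action: [c] stands for a + ib, with the halves of [c] as a and
    b. *)
Definition cfield (c : L) u := Xi (lsubmx c) u + mul_i (Xi (rsubmx c) u).
(** [hfun] is built from coordinates so that it is linear in its index at every point, as
    [hol_frame] demands; on the ball it is [pfun] plus [qfun] of the two halves. *)
Definition hbasis (l : 'I_(k + k)) u :=
  match fintype.split l with inl i => pfun 'e_i u | inr i => qfun 'e_i u end.
Definition hfun (c : L) u := \sum_l c 0 l * hbasis l u.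

Let hE c u : B u -> hfun c u = pfun (lsubmx c) u + qfun (rsubmx c) u.
Proof.
move=> Bu; rewrite /hfun big_split_ord /= pL // qL //; congr (_ + _).
  by apply: eq_bigr => l _; rewrite /hbasis (unsplitK (inl l)) mxE.
by apply: eq_bigr => l _; rewrite /hbasis (unsplitK (inr l)) mxE.
Qed.

Let hL d u : hfun d u = \sum_l d 0 l * hfun 'e_l u.
Proof. apply: eq_bigr => l _; congr (_ * _).
exact: esym (sum_delta (W := R^o) (fun l => hbasis l u) l). Qed.

Let XiN a u : Xi (- a) u = - Xi a u.
Proof. by rewrite -scaleN1r XiZ scaleN1r. Qed.

Let VL d u : cfield d u = \sum_l d 0 l *: cfield 'e_l u.
Proof.
have D a b : cfield (a + b) u = cfield a u + cfield b u.
  rewrite /cfield !linearD /= !XiD.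
  have -> : mul_i (Xi (rsubmx a) u + Xi (rsubmx b) u) = mul_i (Xi (rsubmx a) u) + mul_i (Xi (rsubmx b) u).
    exact: linearD.
  by rewrite addrACA.
have Z a b : cfield (a *: b) u = a *: cfield b u.
  rewrite /cfield !linearZ /= !XiZ scalerDr.
  by have -> : mul_i (a *: Xi (rsubmx b) u) = a *: mul_i (Xi (rsubmx b) u) by exact: linearZ.
have z : cfield 0 u = 0 by rewrite -(scale0r (0 : L)) Z scale0r.
rewrite {1}(row_sum_delta d); elim/big_ind2 : _ => [|a a' b b' <- <-|l _]; rewrite ?D ?Z //.
Qed.

Let VJ d u : cfield (mul_i d) u = mul_i (cfield d u).
Proof.
rewrite /cfield /mul_i row_mxKl row_mxKr -/(mul_i _) -/(mul_i _) XiN.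
have -> : mul_i (Xi (lsubmx d) u + mul_i (Xi (rsubmx d) u)) =
  mul_i (Xi (lsubmx d) u) + mul_i (mul_i (Xi (rsubmx d) u)) by exact: linearD.
by rewrite mul_iK addrC.
Qed.

Let VH d : hol (@mul_i R n) B (cfield d).
Proof.
have sV : smooth_on B (cfield d) by apply: smoothD.
split=> // u w Bu.
have D w' : 'D_w' (cfield d) u = 'D_w' (Xi (lsubmx d)) u + mul_i ('D_w' (Xi (rsubmx d)) u).
  rewrite -dJ //; apply: deriveD; exact: smooth_derivable Bu.
rewrite !D; have [_ ->] := XiH (lsubmx d) => //; have [_ ->] := XiH (rsubmx d) => //.
by apply/esym; exact: linearD.
Qed.

Let hCR d : CR (@mul_i R n) B (hfun d) (fun u => - hfun (mul_i d) u).
Proof.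
have C2 := CR_conj oB (CR_conj oB (CR_conj oB (CRpq (rsubmx d)))).
apply: (CR_eq oB _ _ (CRD oB (CRpq (lsubmx d)) C2)) => u Bu.
  by rewrite hE // !opprK.
have E1 : pfun (- rsubmx d) u = - pfun (rsubmx d) u.
  by rewrite /pfun XiN derive_dirN //; exact: drh.
have -> : hfun (mul_i d) u = - pfun (rsubmx d) u + qfun (lsubmx d) u.
  by apply: etrans (hE (mul_i d) Bu) _; rewrite /mul_i row_mxKl row_mxKr E1.
have A1 (s t : R) : - s - - t = - (- t + s) by ring.
exact: A1.
Qed.

(** The complex bilinear extension of [bt]. *)
Definition cbr (a b : L) : L := row_mx (bt (lsubmx a) (lsubmx b) - bt (rsubmx a) (rsubmx b))
  (bt (rsubmx a) (lsubmx b) + bt (lsubmx a) (rsubmx b)).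

Let cbrL a b : cbr a b = \sum_l a 0 l *: cbr 'e_l b.
Proof.
have btD a1 a2 v : bt (a1 + a2) v = bt a1 v + bt a2 v.
  rewrite btL (btL a1) (btL a2) -big_split; apply: eq_bigr => l _.
  by rewrite mxE scalerDl.
have btZ t a1 v : bt (t *: a1) v = t *: bt a1 v.
  by rewrite btL (btL a1) scaler_sumr; apply: eq_bigr => l _; rewrite mxE scalerA.
have D a1 a2 : cbr (a1 + a2) b = cbr a1 b + cbr a2 b.
  rewrite /cbr !linearD /= !btD add_row_mx; congr row_mx.
    by rewrite opprD addrACA.
  by rewrite addrACA.
have Z t a1 : cbr (t *: a1) b = t *: cbr a1 b.
  by rewrite /cbr !linearZ /= !btZ scale_row_mx scalerBr scalerDr.
have z : cbr 0 b = 0 by have := Z 0 0; rewrite !scale0r.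
rewrite {1}(row_sum_delta a); elim/big_ind2 : _ => [|a1 a1' b1 b1' <- <-|l _]; rewrite ?D ?Z //.
Qed.

Let JD (a b : V) : mul_i (a + b) = mul_i a + mul_i b. Proof. exact: linearD. Qed.
Let JB (a b : V) : mul_i (a - b) = mul_i a - mul_i b. Proof. exact: linearB. Qed.

Let JN (a : V) : mul_i (- a) = - mul_i a. Proof. exact: linearN. Qed.

Let cbrV a b u : B u ->
  'D_(cfield a u) (cfield b) u - 'D_(cfield b u) (cfield a) u = cfield (cbr a b) u.
Proof.
move=> Bu; pose D v w := 'D_(Xi v u) (Xi w) u.
have E c d : 'D_(cfield c u) (cfield d) u = D (lsubmx c) (lsubmx d) - D (rsubmx c) (rsubmx d) +
    mul_i (D (rsubmx c) (lsubmx d) + D (lsubmx c) (rsubmx d)).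
  have dX w : 'D_(cfield c u) (Xi w) u = D (lsubmx c) w + mul_i (D (rsubmx c) w).
    rewrite /cfield derive_dirD; last exact: smooth_differentiableV oB Bu (sXi w).
    by have [_ ->] := XiH w.
  have -> : 'D_(cfield c u) (cfield d) u = 'D_(cfield c u) (Xi (lsubmx d)) u +
      mul_i ('D_(cfield c u) (Xi (rsubmx d)) u).
    by rewrite -dJ //; apply: deriveD; exact: smooth_derivable Bu.
  rewrite !dX // !JD mul_iK.
  move: (D (lsubmx c) (lsubmx d)) (D (rsubmx c) (rsubmx d)) (mul_i _) (mul_i _) => x1 x2 x3 x4.
  by apply/rowP => i; rewrite !mxE; ring.
have BT v w : D v w - D w v = Xi (bt v w) u by exact: Xibt.
have A1 (x1 x2 p q y1 y2 r s : V) : (x1 - x2 + mul_i (p + q)) - (y1 - y2 + mul_i (r + s)) =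
    (x1 - y1) - (x2 - y2) + mul_i ((p - s) + (q - r)).
  rewrite !JD !JN; move: (mul_i p) (mul_i q) (mul_i r) (mul_i s) => *.
  by apply/rowP => i; rewrite !mxE; ring.
apply: etrans (congr2 (fun s t : V => s - t) (E a b) (E b a)) (etrans (A1 _ _ _ _ _ _ _ _) _).
by rewrite /cfield row_mxKl row_mxKr !XiD XiN !BT.
Qed.

Let pbr a b u : B u ->
  'D_(Xi a u) (pfun b) u - 'D_(Xi b u) (pfun a) u = pfun (bt a b) u.
Proof.
move=> Bu; rewrite !(smooth_deriveN _ (s1 _) Bu) -opprD; congr (- _).
rewrite (lie_derivative oB (sXi a) (sXi b) srho Bu) -Xibt // derive_dirD; last exact: drh.
by rewrite derive_dirN //; exact: drh.
Qed.

Let CRE v w u : B u -> 'D_(mul_i w) (pfun v) u = 'D_w (qfun v) u /\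
  'D_(mul_i w) (qfun v) u = - 'D_w (pfun v) u.
Proof.
move=> Bu; have [_ _ /(_ u w Bu)[E1 E2]] := CRpq v.
have N1 := smooth_deriveN w (sq v) Bu; have N2 := smooth_deriveN (mul_i w) (sq v) Bu.
split; first by apply: etrans E1 _; rewrite N1 opprK.
by rewrite -E2 N2 opprK.
Qed.

(** The Cauchy-Riemann equations replace the derivative of q_a along [Xi b] by that of p_a along J
    [Xi b]. What remains is the bracket of [Xi a] with J [Xi b], equal to J [Xi (bt a b)] because
    [Xi a] is holomorphic. *)
Let qbr a b u : B u ->
  'D_(Xi a u) (qfun b) u - 'D_(Xi b u) (qfun a) u = qfun (bt a b) u.
Proof.
move=> Bu; have [<- _] := CRE a (Xi b u) Bu.
have E1 : 'D_(mul_i (Xi b u)) (pfun a) u = - 'D_(mul_i (Xi b u)) (fun u => 'D_(Xi a u) rho u) u.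
  exact: smooth_deriveN (s1 a) Bu.
have E2 : 'D_(Xi a u) (qfun b) u = 2 * mu (bt a b) u -
    'D_(Xi a u) (fun u => 'D_(mul_i (Xi b u)) rho u) u.
  apply: etrans (smooth_deriveB _ (smoothMc 2 oB (smu b)) (s2 b) Bu) _.
  by rewrite (smooth_deriveZ _ _ (smu b)) // mubt.
have E3 := lie_derivative oB (sXi a) (sJXi b) srho Bu.
have E4 : 'D_(mul_i (Xi (bt a b) u)) rho u =
  'D_('D_(Xi a u) (fun u => mul_i (Xi b u)) u) rho u - 'D_('D_(mul_i (Xi b u)) (Xi a) u) rho u.
  rewrite dJ //; have [_ ->] := XiH a => //.
  by rewrite -Xibt // JB derive_dirD ?derive_dirN //; exact: drh.
rewrite E1 E2 /qfun E4 -E3.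
move: (2 * mu _ _) ('D_(Xi a u) _ u) ('D_(mul_i _) _ u) => t1 t2 t3.
by ring.
Qed.

Let cbrh a b u : B u ->
  'D_(cfield a u) (hfun b) u - 'D_(cfield b u) (hfun a) u = hfun (cbr a b) u.
Proof.
move=> Bu; pose P v w := 'D_(Xi v u) (pfun w) u; pose C v w := 'D_(Xi v u) (qfun w) u.
have E c d : 'D_(cfield c u) (hfun d) u = P (lsubmx c) (lsubmx d) - P (rsubmx c) (rsubmx d) +
    (C (rsubmx c) (lsubmx d) + C (lsubmx c) (rsubmx d)).
  rewrite (near_derive _ oB (hE d) Bu) (smooth_deriveD _ (sp _) (sq _) Bu) /cfield.
  have dfp := smooth_differentiable oB Bu (sp (lsubmx d)).
  have dfq := smooth_differentiable oB Bu (sq (rsubmx d)).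
  rewrite (derive_dirD _ _ dfp) (derive_dirD _ _ dfq).
  have [-> _] := CRE (lsubmx d) (Xi (rsubmx c) u) Bu.
  have [_ ->] := CRE (rsubmx d) (Xi (rsubmx c) u) Bu.
  rewrite -!/(P _ _) -!/(C _ _); move: (P _ _) (P _ _) (C _ _) (C _ _) => y1 y2 y3 y4.
  by ring.
have BP v w : P v w - P w v = pfun (bt v w) u by exact: pbr.
have BC v w : C v w - C w v = qfun (bt v w) u by exact: qbr.
rewrite !E hE // /cbr row_mxKl row_mxKr.
have pD v w : pfun (v - w) u = pfun v u - pfun w u.
  rewrite (pL (v - w)) // (pL v) // (pL w) // -sumrB; apply: eq_bigr => l _; by rewrite !mxE mulrBl.
have qD v w : qfun (v + w) u = qfun v u + qfun w u.
  rewrite (qL (v + w)) // (qL v) // (qL w) // -big_split; apply: eq_bigr => l _; by rewrite mxE mulrDl.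
rewrite pD qD -!BP -!BC.
move: (P _ _) (P _ _) (P _ _) (P _ _) (C _ _) (C _ _) (C _ _) (C _ _) => *.
by ring.
Qed.

Section transversal.
Variables (r : nat) (P0 : 'M[R]_(r, k)) (Q0 : 'M[R]_(k, r)).
Hypothesis P0free : forall y, Xi (y *m P0) x = 0 -> y = 0.
Hypothesis Q0P0 : forall v, Xi v x = Xi (v *m Q0 *m P0) x.
Let P : 'M[R]_(r + r, k + k) := block_mx P0 0 0 P0.
Let Q : 'M[R]_(k + k, r + r) := block_mx Q0 0 0 Q0.

Let mulP (y : 'rV[R]_(r + r)) : y *m P = row_mx (lsubmx y *m P0) (rsubmx y *m P0).
Proof. by rewrite -{1}(hsubmxK y) mul_row_block !mulmx0 addr0 add0r. Qed.

Let PJ y : mul_i (y *m P) = mul_i y *m P.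
Proof. by rewrite !mulP /mul_i !row_mxKl !row_mxKr mulNmx. Qed.

Let QP (c : L) : c *m Q *m P = row_mx (lsubmx c *m Q0 *m P0) (rsubmx c *m Q0 *m P0).
Proof.
have -> : c *m Q = row_mx (lsubmx c *m Q0) (rsubmx c *m Q0).
  by rewrite -{1}(hsubmxK c) mul_row_block !mulmx0 addr0 add0r.
by rewrite mulP row_mxKl row_mxKr.
Qed.

Let qx v : qfun v x = 0.
Proof. by rewrite /qfun mux drho mulr0 subr0. Qed.

Let pker v u : Xi v x = 0 -> B u -> pfun v u = 0.
Proof. by move=> v0 Bu; rewrite /pfun rhoK ?oppr0. Qed.

(** Every derivative of q_v is a derivative of p_v, which vanishes identically; so q_v is constant,
    equal to its value 0 at [x]. *)
Let qker v u : Xi v x = 0 -> B u -> qfun v u = 0.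
Proof.
move=> v0 Bu; rewrite (@constant_ball _ _ (qfun v) x e) ?qx // => y w By.
  exact: smooth_derivable (sq v) By.
have [<- _] := CRE v w By.
have E (z : V) : B z -> pfun v z = 0 by exact: pker.
by rewrite (near_derive _ oB E By) derive_cst.
Qed.

Let hQ (c : L) u : B u -> hfun c u = hfun (c *m Q *m P) u.
Proof.
move=> Bu; rewrite QP.
rewrite (hE c Bu) (hE (row_mx _ _) Bu) row_mxKl row_mxKr.
have X0 v : Xi (v - v *m Q0 *m P0) x = 0 by rewrite XiD XiN -Q0P0 subrr.
have Ep v : pfun v u = pfun (v *m Q0 *m P0) u.
  apply/eqP; rewrite -subr_eq0; apply/eqP; rewrite -[RHS](pker (X0 v) Bu).
  rewrite !(pL _ Bu) -sumrB; apply: eq_bigr => l _; by rewrite [in RHS]mxE [X in _ = (_ + X) * _]mxE mulrBl.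
have Eq v : qfun v u = qfun (v *m Q0 *m P0) u.
  apply/eqP; rewrite -subr_eq0; apply/eqP; rewrite -[RHS](qker (X0 v) Bu).
  rewrite !(qL _ Bu) -sumrB; apply: eq_bigr => l _; by rewrite [in RHS]mxE [X in _ = (_ + X) * _]mxE mulrBl.
by rewrite -Ep -Eq.
Qed.

Let hx c : hfun c x = 0.
Proof. by rewrite hE // qx /pfun drho oppr0 addr0. Qed.

Let sh c : smooth_on B (hfun c). Proof. by case: (hCR c). Qed.

Lemma smooth_frame_mx i j : smooth_on B (fun u => frame_mx cfield hfun P u i j).
Proof.
have [sV _] := VH (row i P).
apply: smooth_eq oB _ (smooth_along oB sV (sh (row j P))) => u _.
by rewrite /frame_mx [RHS]mxE.
Qed.

Let Hd v w := 'D_v ('D_w rho) x.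

Let HdJ v w : Hd (mul_i v) (mul_i w) = Hd v w. Proof. exact: ddrho. Qed.

Let HdC v w : Hd v w = Hd w v. Proof. exact: schwarz oB Bx srho. Qed.

Let HdD v v' w : Hd (v + v') w = Hd v w + Hd v' w.
Proof. apply: derive_dirD; exact: smooth_differentiable oB Bx (smooth_derive w srho). Qed.

Let HdN v w : Hd (- v) w = - Hd v w.
Proof. apply: derive_dirN; exact: smooth_differentiable oB Bx (smooth_derive w srho). Qed.

Let OmHd v w : Om x v w = Hd (mul_i v) w.
Proof.
have A1 (a b : R) : a = - b -> - 2^-1 * (a - b) = b by lra.
apply: etrans (rhoOm v w Bx) _; rewrite /levi -!/(Hd _ _) (HdC w).
by apply: A1; rewrite -HdJ mul_iK HdC HdN HdC.
Qed.

(** The sign of [a] is chosen so that the derivative is the squared length of [w] for the Kahler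
    metric; positivity then detects [w = 0]. *)
Let hd_field (a b : 'rV[R]_k) : let w := cfield (row_mx a b) x in
  'D_w (hfun (row_mx (- a) b)) x = Om x w (mul_i w).
Proof.
have A1 (s s' u1 u2 o t c : R) : u1 = 0 -> u2 = 0 -> s = - s' -> o = t -> c = s' + t ->
  - (s + u1) + (2 * o - (t + u2)) = c by move=> -> -> -> -> ->; ring.
move=> w; rewrite (near_derive _ oB (hE _) Bx) row_mxKl row_mxKr.
apply: etrans (smooth_deriveD _ (sp _) (sq _) Bx) _.
apply: etrans (congr2 +%R (dp (- a) w Bx) (dq b w Bx)) _.
have S1 : 'D_(Xi (- a) x) ('D_w rho) x = - Hd (Xi a x) w by rewrite XiN; exact: HdN.
have S2 : Om x w (mul_i w) = Hd (Xi a x) w + Hd (mul_i (Xi b x)) w.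
  by rewrite OmHd HdJ -HdD /w /cfield row_mxKl row_mxKr.
exact: (A1 _ _ _ _ _ _ _ (drho _) (drho _) S1 (OmHd _ _) S2).
Qed.

(** A vector in the kernel gives a [w] of length 0, so [Xi a] = - J [Xi b] at [x]. The squared
    length of [Xi b] is then a value of [Om] on two orbit directions, which vanishes since [mu] does
    at [x]; freeness of [P0] concludes. *)
Lemma det_frame_mx : \det (frame_mx cfield hfun P x) != 0.
Proof.
apply/negP => /det0P[y y0 yF]; case/negP: y0; apply/eqP.
set a := lsubmx y *m P0; set b := rsubmx y *m P0.
set w := cfield (row_mx a b) x.
have w0 : w = 0.
  have [//|wn] := eqVneq w 0; have := Ompos Bx wn; rewrite -hd_field.
  have -> : row_mx (- a) b = row_mx (- lsubmx y) (rsubmx y) *m P.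
    by rewrite mulP row_mxKl row_mxKr mulNmx.
  set z := row_mx (- lsubmx y) _.
  have Eh u : B u -> hfun (z *m P) u = \sum_j z 0 j * hfun (row j P) u.
    by move=> _; rewrite (family_mulmx hL).
  rewrite (near_derive _ oB Eh Bx).
  rewrite (smooth_derive_sum _ w oB (fun j => smoothMc (z 0 j) oB (sh (row j P))) Bx).
  rewrite big1 ?ltxx // => j _; rewrite (smooth_deriveZ _ _ (sh _) Bx).
  suff -> : 'D_w (hfun (row j P)) x = 0 by rewrite mulr0.
  transitivity ((y *m frame_mx cfield hfun P x) 0 j); last by rewrite yF mxE.
  rewrite mxE; have dj := smooth_differentiable oB Bx (sh (row j P)).
  have -> : w = \sum_i y 0 i *: cfield (row i P) x.
    by rewrite /w -mulP; exact: (family_mulmxV VL).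
  rewrite (derive_dir_sum _ _ dj); apply: eq_bigr => i _.
  by rewrite (derive_dirZ _ _ dj) /frame_mx mxE.
have Ea : Xi a x = - mul_i (Xi b x).
  by apply/eqP; rewrite -addr_eq0 -[X in X == 0]/(Xi a x + mul_i (Xi b x)); move/eqP: w0; rewrite /w /cfield row_mxKl row_mxKr.
have b0 : Xi b x = 0.
  have [//|bn] := eqVneq (Xi b x) 0; have := Ompos Bx bn.
  have -> : mul_i (Xi b x) = - Xi a x by rewrite Ea opprK.
  have -> : Om x (Xi b x) (- Xi a x) = - Om x (Xi b x) (Xi a x) by rewrite !OmHd HdC HdN HdC.
  by rewrite -dmu // mubt // mux oppr0 ltxx.
have J0 : mul_i (0 : V) = 0 by exact: linear0.
have y1 := P0free (etrans Ea (etrans (congr1 (fun t => - mul_i t) b0) (etrans (congr1 -%R J0) (oppr0 _)))).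
have y2 := P0free b0.
by apply: etrans (esym (hsubmxK y)) (etrans (congr2 _ y1 y2) (row_mx0 _ _ _ _)).
Qed.

(** The correction [p] is the real part of a holomorphic function, so it leaves [levi] unchanged,
    and its derivatives along the complexified fields supply exactly [pfun] and [qfun]. *)
Lemma moment_potential : (forall u, B u -> \det (frame_mx cfield hfun P u) != 0) ->
  exists d (f : V -> R), [/\ 0 < d, d <= e, smooth_on (ball x d) f &
  [/\ forall u v w, ball x d u -> Om u v w = levi f u v w,
      forall v u, ball x d u -> 'D_(Xi v u) f u = 0 &
      forall v u, ball x d u -> 'D_(mul_i (Xi v u)) f u = 2 * mu v u]].
Proof.
move=> dt; have fr : hol_frame B cfield hfun P.
  exact: Build_hol_frame oB VL hL VH VJ hCR PJ dt.
have [d [p [q [d0 de pq pV]]]] := solve_fields e0 fr cbrL cbrV cbrh hQ hx.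
have dB : ball x d `<=` B by exact: le_ball.
have oD : open (ball x d) by exact: ball_open.
have [spp sqq CRp] := pq; have srho' := smooth_sub dB srho.
exists d, (fun u => rho u + p u); split=> //; first exact: smoothD.
have DE w u : ball x d u -> 'D_w (fun u => rho u + p u) u = 'D_w rho u + 'D_w p u.
  by move=> Du; exact: smooth_deriveD _ srho' spp Du.
have X0 u : Xi 0 u = 0 by rewrite -(scale0r 0) XiZ scale0r.
have J0 : mul_i (0 : V) = 0 by exact: linear0.
split=> [u v w Du|v u Du|v u Du].
- rewrite rhoOm; last exact: dB.
  have E a b : 'D_a ('D_b (fun u => rho u + p u)) u = 'D_a ('D_b rho) u + 'D_a ('D_b p) u.
    rewrite (near_derive _ oD (DE b) Du).
    exact: smooth_deriveD _ (smooth_derive b srho') (smooth_derive b spp) Du.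
  have Z a b : 'D_a ('D_(mul_i b) p) u = - 'D_a ('D_b q) u.
    rewrite -(smooth_deriveN _ (smooth_derive b sqq) Du).
    by apply: (near_derive _ oD _ Du) => y Dy; have [] := CRp y b Dy.
  have A1 (s m a t m' b : R) : a = s + - m -> b = t + - m' -> m = m' ->
    - 2^-1 * (s - t) = - 2^-1 * (a - b) by move=> -> -> ->; ring.
  exact: A1 (etrans (E _ _) (congr2 +%R erefl (Z v w))) (etrans (E _ _) (congr2 +%R erefl (Z w v)))
    (schwarz v w oD Du sqq).
- have A1 (s t : R) : t = 0 -> s + (- s + t) = 0 by move=> ->; ring.
  apply: etrans (DE _ u Du) _.
  have E : Xi v u = cfield (row_mx v 0) u by rewrite /cfield row_mxKl row_mxKr X0 J0 addr0.
  apply: etrans (congr2 +%R erefl (etrans (congr1 (fun z => 'D_z p u) E) (pV _ _ Du))) _.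
  apply: etrans (congr2 +%R erefl (hE _ (dB _ Du))) _; rewrite row_mxKl row_mxKr.
  by apply: A1; rewrite /qfun X0 J0 derive_dir0 muL big1 ?mulr0 ?subr0 // => l _; rewrite mxE mul0r.
- have A1 (s m : R) : s + (m - s) = m by ring.
  apply: etrans (DE _ u Du) _.
  have E : mul_i (Xi v u) = cfield (row_mx 0 v) u by rewrite /cfield row_mxKl row_mxKr X0 add0r.
  apply: etrans (congr2 +%R erefl (etrans (congr1 (fun z => 'D_z p u) E) (pV _ _ Du))) _.
  apply: etrans (congr2 +%R erefl (hE _ (dB _ Du))) _; rewrite row_mxKl row_mxKr.
  by rewrite /pfun X0 derive_dir0 oppr0 add0r; exact: A1.
Qed.

End transversal.

End local_moment.

Lemma moment_data_sub {R : realType} {n k : nat} (x : 'rV[R]_(n + n)) (e d : R) Om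
  (Xi : 'rV[R]_k -> _) mu bt rho : 0 < d -> d <= e ->
  moment_data x e Om Xi mu bt rho -> moment_data x d Om Xi mu bt rho.
Proof.
move=> d0 de [H0 H1 H2 H3 H4 H5 H6 H7 H8 H9 H10 H11 H12 H13 H14 H15].
have dB : ball x d `<=` ball x e by exact: le_ball.
split => //.
- by move=> v; exact: hol_sub (H2 v).
- by move=> v; exact: smooth_sub (H4 v).
- by move=> v w u /dB; exact: H6.
- by move=> a v u /dB; exact: H7.
- by move=> a v u /dB; exact: H8.
- by move=> u v /dB; exact: H10.
- exact: smooth_sub H11.
- by move=> u v w /dB; exact: H12.
- by move=> v v0 u /dB; exact: H15.
Qed.

Theorem local_moment {R : realType} {n k : nat} (x : 'rV[R]_(n + n)) (e : R) Om
  (Xi : 'rV[R]_k -> _) mu bt rho : moment_data x e Om Xi mu bt rho ->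
  exists d (f : 'rV[R]_(n + n) -> R), [/\ 0 < d, d <= e, smooth_on (ball x d) f &
  [/\ forall u v w, ball x d u -> Om u v w = levi f u v w,
      forall v u, ball x d u -> 'D_(Xi v u) f u = 0 &
      forall v u, ball x d u -> 'D_(mul_i (Xi v u)) f u = 2 * mu v u]].
Proof.
move=> H; pose Mx := \matrix_l Xi 'e_l x.
have XM v : v *m Mx = Xi v x.
  rewrite (fieldL H) mulmx_sum_row; apply: eq_bigr => l _; by rewrite rowK.
(* The rows of [P0] are indices whose fields form a basis of the tangent space of the orbit at [x];
   [Q0] gives the coordinates of an arbitrary field at [x] in this basis. *)
pose P0 := row_base Mx *m pinvmx Mx; pose Q0 := Mx *m pinvmx (row_base Mx).
have P0M : P0 *m Mx = row_base Mx by apply: mulmxKpV; rewrite eq_row_base.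
have Q0M : Q0 *m row_base Mx = Mx by apply: mulmxKpV; rewrite eq_row_base.
have P0free (y : 'rV_(\rank Mx)) : Xi (y *m P0) x = 0 -> y = 0.
  rewrite -XM -mulmxA P0M => y0; apply: (row_free_inj (row_base_free Mx)).
  by rewrite /= y0 mul0mx.
have Q0P0 v : Xi v x = Xi (v *m Q0 *m P0) x.
  by apply: etrans (esym (XM v)) (etrans _ (XM _)); rewrite -(mulmxA _ P0) P0M -(mulmxA v) Q0M.
have e0 := radius_gt0 H; have Bx : ball x e x by exact: ballxx.
have oB : open (ball x e) by exact: ball_open.
pose F := frame_mx (cfield Xi) (hfun Xi mu rho) (block_mx P0 0 0 P0).
have sF : smooth_on (ball x e) (fun u => \det (F u)).
  by apply: (smooth_det oB) => i j; exact: (smooth_frame_mx H).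
have F0 : \det (F x) != 0 by exact: (det_frame_mx H P0free).
have [d [d0 de dF]] : exists d, [/\ 0 < d, d <= e & forall u, ball x d u -> \det (F u) != 0].
  have [ct _] := sF 0%N; have := ct _ Bx => cx.
  have F1 : 0 < `|\det (F x)| by rewrite normr_gt0.
  have /nbhs_ballP[d0 /= d00 Hd] := (@cvgrPdist_lt _ _ _ _ (nbhs_filter x) _ _).1 cx _ F1.
  exists (Num.min d0 e); split; [by rewrite lt_min d00|by rewrite ge_min lexx orbT|].
  have A1 (a b : R) : `|a - b| < `|a| -> b != 0.
    by move=> h; apply: contraTneq h => ->; rewrite subr0 ltxx.
  move=> u Bu; apply: A1 (Hd u (le_ball _ Bu)); by rewrite ge_min lexx.
have [dl [f [dl0 dld sf Hf]]] := moment_potential (moment_data_sub d0 de H) Q0P0 dF.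
by exists dl, f; split=> //; exact: le_trans de.
Qed.

(** * Smooth maps in charts *)

Lemma smooth_compV {R : realType} {m p q : nat} (A : set 'rV[R]_m) (B : set 'rV[R]_p)
  (f : 'rV[R]_p -> 'rV[R]_q) (g : 'rV[R]_m -> 'rV[R]_p) : open A -> open B ->
  (forall u, A u -> B (g u)) -> smooth_on B f -> smooth_on A g ->
  smooth_on A (fun u => f (g u)).
Proof.
move=> oA oB AB /(smooth_coordP f oB) sf sg; apply/(smooth_coordP _ oA) => i.
exact: smooth_comp AB (sf i) sg.
Qed.

Lemma near_deriveV {R : realType} {m p : nat} (A : set 'rV[R]_m) (f g : 'rV[R]_m -> 'rV[R]_p) v u :
  open A -> (forall y, A y -> f y = g y) -> A u -> 'D_v f u = 'D_v g u.
Proof. by move=> oA fg Au; apply: near_eq_derive; exact: (open_near oA Au). Qed.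

(** The local axioms of [is_manifold]; they pass to [prod_charts] and carry the calculus in
    charts. *)
Record atlas {R : realType} {m : nat} {X : topologicalType} (M : charts R m X) : Prop := {
  atlas_center : forall a, chart_dom M a a;
  atlas_open : forall a, open (chart_dom M a);
  atlas_im_open : forall a, open (chart_im M a);
  atlasK : forall a x, chart_dom M a x -> ichart M a (chart M a x) = x;
  atlas_continuous : forall a x, chart_dom M a x -> {for x, continuous (chart M a)};
  atlas_icontinuous : forall a u, chart_im M a u -> {for u, continuous (ichart M a)};
  atlas_transition : forall a b,
    smooth_on (chart M a @` (chart_dom M a `&` chart_dom M b)) (chart M b \o ichart M a) }.

Lemma manifold_atlas {R : realType} {m : nat} {X : topologicalType} (M : charts R m X) :
  is_manifold M -> atlas M.
Proof. by case=> _ _ *; split. Qed.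

Lemma open_preim {T U : topologicalType} (f : T -> U) (D : set U) :
  continuous f -> open D -> open [set t | D (f t)].
Proof. by move=> cf oD; apply: (open_comp (f := f)) oD => t _; exact: cf. Qed.

Lemma continuous_id {T : topologicalType} : continuous (@id T).
Proof. by move=> x; exact: cvg_id. Qed.

Section rep.
Context {R : realType} {m p : nat} {X Y : topologicalType}.
Variables (M : charts R m X) (N : charts R p Y).
Hypotheses (aM : atlas M) (aN : atlas N).

Definition rep (F : X -> Y) a b (u : 'rV[R]_m) : 'rV[R]_p := chart N b (F (ichart M a u)).

Definition rdom (F : X -> Y) a b : set 'rV[R]_m :=
  [set u | chart_im M a u /\ chart_dom N b (F (ichart M a u))].

Lemma im_chart a y : chart_dom M a y -> chart_im M a (chart M a y).
Proof. by exists y. Qed.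

Lemma ichart_dom a u : chart_im M a u -> chart_dom M a (ichart M a u).
Proof. by case=> y ay <-; rewrite (atlasK aM). Qed.

Lemma ichartK a u : chart_im M a u -> chart M a (ichart M a u) = u.
Proof. by case=> y ay <-; rewrite (atlasK aM). Qed.

Lemma rdomE F a b : chart M a @` (chart_dom M a `&` F @^-1` chart_dom N b) = rdom F a b.
Proof.
apply/seteqP; split=> u /=.
  by case=> y [ay by_] <-; split; [exact: im_chart|rewrite (atlasK aM)].
case=> ua ub; exists (ichart M a u); last exact: ichartK.
by split=> //; exact: ichart_dom.
Qed.

Lemma open_rdom F a b : continuous F -> open (rdom F a b).
Proof.
move=> cF; rewrite openE => u [ua ub].
have c1 : {for u, continuous (F \o ichart M a)}.
  by apply: continuous_comp; [exact: (atlas_icontinuous aM)|exact: cF].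
have n1 : nbhs u (chart_im M a) by apply: open_nbhs_nbhs; split=> //; exact: (atlas_im_open aM).
have n2 := c1 _ (open_nbhs_nbhs (conj (atlas_open aN b) ub)).
by apply: filterS (filterI n1 n2) => v [].
Qed.

Arguments open_rdom {F} a b.

Lemma smooth_rep F a b : smooth_map M N F -> smooth_on (rdom F a b) (rep F a b).
Proof. by rewrite -rdomE => -[_]; apply. Qed.

Arguments smooth_rep {F} a b.

Lemma rdom_chart F a b y : chart_dom M a y -> chart_dom N b (F y) -> rdom F a b (chart M a y).
Proof. by move=> ay by_; split; [exact: im_chart|rewrite (atlasK aM)]. Qed.

Lemma rep_ichart F a b u : rdom F a b u -> ichart N b (rep F a b u) = F (ichart M a u).
Proof. by case=> _ ub; rewrite /rep (atlasK aN). Qed.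

Lemma rep_im F a b u : rdom F a b u -> chart_im N b (rep F a b u).
Proof. by case=> _ ub; exists (F (ichart M a u)). Qed.

Lemma smooth_map_rep F : continuous F ->
  (forall a b u, rdom F a b u -> exists A, [/\ open A, A u & smooth_on A (rep F a b)]) ->
  smooth_map M N F.
Proof.
move=> cF H; split=> // a b; rewrite rdomE; apply: smooth_local => u /H[A [oA Au sA]].
by exists A.
Qed.

Lemma derive_fun_rep (W : nat) F a b u v (A : set 'rV[R]_p) (f : Y -> 'rV[R]_W) :
  smooth_map M N F -> rdom F a b u -> open A -> A (rep F a b u) ->
  smooth_on A (f \o ichart N b) ->
  'D_v (f \o F \o ichart M a) u = 'D_('D_v (rep F a b) u) (f \o ichart N b) (rep F a b u).
Proof.
move=> sF ru oA Au sf; have or := open_rdom a b (proj1 sF).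
have dr := smooth_differentiableV or ru (smooth_rep a b sF).
have df := smooth_differentiableV oA Au sf.
rewrite -(derive_compE _ dr df); apply: (near_deriveV _ or _ ru) => w rw /=.
by rewrite rep_ichart.
Qed.

Lemma derive_real_rep F a b u v (A : set 'rV[R]_p) (f : Y -> R) :
  smooth_map M N F -> rdom F a b u -> open A -> A (rep F a b u) ->
  smooth_on A (f \o ichart N b) ->
  'D_v (f \o F \o ichart M a) u = 'D_('D_v (rep F a b) u) (f \o ichart N b) (rep F a b u).
Proof.
move=> sF ru oA Au sf; have or := open_rdom a b (proj1 sF).
have dr := smooth_differentiableV or ru (smooth_rep a b sF).
have df := smooth_differentiable oA Au sf.
rewrite -(derive_compE _ dr df); apply: (near_derive _ or _ ru) => w rw /=.
by rewrite rep_ichart.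
Qed.

End rep.
Arguments open_rdom {R m p X Y M N} aM aN {F} a b.
Arguments smooth_rep {R m p X Y M N} aM {F} a b.

Section rep_comp.
Context {R : realType} {m p q : nat} {X Y Z : topologicalType}.
Variables (M : charts R m X) (N : charts R p Y) (P : charts R q Z).
Hypotheses (aM : atlas M) (aN : atlas N) (aP : atlas P).
Variables (F : X -> Y) (F' : Y -> Z).
Hypotheses (sF : smooth_map M N F) (sF' : smooth_map N P F').

Lemma rdom_comp a b c u : rdom M N F a b u -> rdom M P (F' \o F) a c u ->
  rdom N P F' b c (rep M N F a b u).
Proof. by move=> r1 [_ r2]; split; [exact: rep_im|rewrite rep_ichart]. Qed.

Lemma derive_rep a b c u v : rdom M N F a b u -> rdom M P (F' \o F) a c u ->
  'D_v (rep M P (F' \o F) a c) u = 'D_('D_v (rep M N F a b) u) (rep N P F' b c) (rep M N F a b u).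
Proof.
move=> r1 r2; have r3 := rdom_comp r1 r2.
exact: (derive_fun_rep (M := M) (N := N) aM aN v (f := chart P c \o F') sF r1
  (open_rdom aN aP b c (proj1 sF')) r3 (smooth_rep aN b c sF')).
Qed.

Lemma smooth_map_comp : smooth_map M P (F' \o F).
Proof.
have [cF _] := sF; have [cF' _] := sF'.
have cc : continuous (F' \o F) by move=> x; apply: continuous_comp; [exact: cF|exact: cF'].
apply: (smooth_map_rep aM) => // a c u ru; pose b := F (ichart M a u).
have ob := open_rdom aM aN a b cF.
have oc := open_rdom aM aP a c cc.
have oA : open (rdom M N F a b `&` rdom M P (F' \o F) a c) by apply: openI.
have Au : rdom M N F a b u by split; [case: ru|exact: (atlas_center aN)].
exists (rdom M N F a b `&` rdom M P (F' \o F) a c); split=> //.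
apply: (smooth_eq oA (f := fun u => rep N P F' b c (rep M N F a b u))).
  by move=> w [wb wc]; rewrite /rep -/(rep M N F a b w) rep_ichart.
apply: (smooth_compV (g := rep M N F a b) oA (open_rdom aN aP b c cF') _ (smooth_rep aN b c sF')).
  by move=> w [wb wc]; exact: rdom_comp.
by apply: smooth_sub (smooth_rep aM a b sF) => w [].
Qed.

End rep_comp.

Lemma smooth_map_id {R : realType} {m : nat} {X : topologicalType} (M : charts R m X) :
  atlas M -> smooth_map M M id.
Proof. by move=> aM; split=> [x|a b]; [exact: cvg_id|exact: (atlas_transition aM)]. Qed.

Lemma smooth_map_cst {R : realType} {m p : nat} {X Y : topologicalType} (M : charts R m X)
  (N : charts R p Y) (y : Y) : smooth_map M N (fun=> y).
Proof. by split=> [|a b]; [exact: cst_continuous|exact: smooth_cst]. Qed.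

Section prod.
Context {R : realType} {m p q : nat} {X Y Z : topologicalType}.
Variables (M : charts R m X) (N : charts R p Y) (P : charts R q Z).
Hypotheses (aM : atlas M) (aN : atlas N) (aP : atlas P).

Lemma prod_imE a : chart_im (prod_charts M N) a =
  [set u | chart_im M a.1 (lsubmx u) /\ chart_im N a.2 (rsubmx u)].
Proof.
apply/seteqP; split=> u /=.
  by case=> -[y z] /= [ay az] <-; rewrite row_mxKl row_mxKr; split; [exists y|exists z].
case=> -[y ay yu] [z az zu]; exists (y, z); first by split.
by rewrite /= yu zu hsubmxK.
Qed.

Lemma continuous_lsubmx (A B : nat) : continuous (lsubmx : 'rV[R]_(A + B) -> 'rV[R]_A).
Proof. by move=> u; have [c _] := smooth_lsubmx (b := B) (R := R) (a := A) setT 0%N; exact: c. Qed.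

Lemma continuous_rsubmx (A B : nat) : continuous (rsubmx : 'rV[R]_(A + B) -> 'rV[R]_B).
Proof. by move=> u; have [c _] := smooth_rsubmx (b := B) (R := R) (a := A) setT 0%N; exact: c. Qed.

Lemma atlas_prod : atlas (prod_charts M N).
Proof.
split=> [[a b]|[a b]|[a b]|[a b] [x y] /= [ax ay]|[a b] [x y] /= [ax ay]|[a b] u|[a b] [a' b']] /=.
- by split; exact: atlas_center.
- rewrite openE => -[x y] [/= ax ay].
  exists (chart_dom M a, chart_dom N b) => //=.
  by split; apply: open_nbhs_nbhs; split=> //; exact: atlas_open.
- have o1 : open [set u : 'rV[R]_(m + p) | chart_im M a (lsubmx u)].
    have oM : open (chart_im M a) by exact: (atlas_im_open aM).
    exact: open_preim (@continuous_lsubmx _ _) oM.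
  have o2 : open [set u : 'rV[R]_(m + p) | chart_im N b (rsubmx u)].
    have oN : open (chart_im N b) by exact: (atlas_im_open aN).
    exact: open_preim (@continuous_rsubmx _ _) oN.
  by rewrite prod_imE; exact: openI o1 o2.
- by rewrite row_mxKl row_mxKr !atlasK.
- apply: (continuous_row_mx (f := fun z => chart M a z.1) (g := fun z => chart N b z.2)).
    apply: (continuous_comp (f := fst)); [exact: cvg_fst|exact: (atlas_continuous aM)].
  apply: (continuous_comp (f := snd)); [exact: cvg_snd|exact: (atlas_continuous aN)].
- rewrite prod_imE => -[/= ua ub].
  have c1 : {for u, continuous (fun w : 'rV[R]_(m + p) => ichart M a (lsubmx w))}.
    apply: (continuous_comp (f := lsubmx)); [exact: continuous_lsubmx|exact: (atlas_icontinuous aM)].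
  have c2 : {for u, continuous (fun w : 'rV[R]_(m + p) => ichart N b (rsubmx w))}.
    apply: (continuous_comp (f := rsubmx)); [exact: continuous_rsubmx|exact: (atlas_icontinuous aN)].
  exact: (@cvg_pair _ _ _ _ _ _ (nbhs_filter u) (nbhs_filter _) (nbhs_filter _) _ _ c1 c2).
- have o1 := open_rdom aM aM a a' (F := id) (@continuous_id _).
  have o2 := open_rdom aN aN b b' (F := id) (@continuous_id _).
  pose A := [set u : 'rV[R]_(m + p) | rdom M M id a a' (lsubmx u)] `&`
    [set u : 'rV[R]_(m + p) | rdom N N id b b' (rsubmx u)].
  have oA : open A.
    apply: openI; first by exact: open_preim (@continuous_lsubmx _ _) o1.
    by exact: open_preim (@continuous_rsubmx _ _) o2.
  apply: (smooth_sub (A := A)).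
    move=> _ [[x y] [/= [ax ay] [a'x b'y]] <-]; rewrite /A /= row_mxKl row_mxKr.
    by split; exact: rdom_chart.
  apply: smooth_row_mx => //.
    apply: (smooth_compV oA o1 _ (smooth_rep aM a a' (smooth_map_id aM)) (smooth_lsubmx _)).
    by move=> u [].
  apply: (smooth_compV oA o2 _ (smooth_rep aN b b' (smooth_map_id aN)) (smooth_rsubmx _)).
  by move=> u [].
Qed.

Lemma smooth_map_pair (F : Z -> X) (F' : Z -> Y) : smooth_map P M F -> smooth_map P N F' ->
  smooth_map P (prod_charts M N) (fun z => (F z, F' z)).
Proof.
move=> sF sF'; have [cF _] := sF; have [cF' _] := sF'.
apply: (smooth_map_rep aP); first by move=> z; apply: cvg_pair; [exact: cF|exact: cF'].
move=> a [b c] u [ua [/= ub uc]].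
have oA : open (rdom P M F a b `&` rdom P N F' a c).
  by apply: openI; [exact: open_rdom cF|exact: open_rdom cF'].
exists (rdom P M F a b `&` rdom P N F' a c); split=> //; apply: smooth_row_mx => //.
  by apply: smooth_sub (smooth_rep aP a b sF) => w [].
by apply: smooth_sub (smooth_rep aP a c sF') => w [].
Qed.

Lemma smooth_map_fst : smooth_map (prod_charts M N) M fst.
Proof.
apply: (smooth_map_rep atlas_prod); first by move=> z; exact: cvg_fst.
move=> [a b] c u [ua uc].
have o1 := open_rdom aM aM a c (F := id) (@continuous_id _).
have oA : open [set u : 'rV[R]_(m + p) | rdom M M id a c (lsubmx u)].
  by exact: open_preim (@continuous_lsubmx _ _) o1.
exists [set u | rdom M M id a c (lsubmx u)]; split=> //.
  by rewrite prod_imE in ua; split=> //; case: ua.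
exact: (smooth_compV oA o1 _ (smooth_rep aM a c (smooth_map_id aM)) (smooth_lsubmx _)).
Qed.

Lemma smooth_map_snd : smooth_map (prod_charts M N) N snd.
Proof.
apply: (smooth_map_rep atlas_prod); first by move=> z; exact: cvg_snd.
move=> [a b] c u [ua uc].
have o1 := open_rdom aN aN b c (F := id) (@continuous_id _).
have oA : open [set u : 'rV[R]_(m + p) | rdom N N id b c (rsubmx u)].
  by exact: open_preim (@continuous_rsubmx _ _) o1.
exists [set u | rdom N N id b c (rsubmx u)]; split=> //.
  by rewrite prod_imE in ua; split=> //; case: ua.
exact: (smooth_compV oA o1 _ (smooth_rep aN b c (smooth_map_id aN)) (smooth_rsubmx _)).
Qed.

End prod.

(** * The action in charts *)

Section tvec.
Context {R : realType} {m p : nat} {X Y : topologicalType}.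
Variables (M : charts R m X) (N : charts R p Y).
Hypotheses (aM : atlas M) (aN : atlas N).
Variable F : X -> Y.
Hypothesis sF : smooth_map M N F.

Lemma rdom_center a u : chart_im M a u -> rdom M M id a (ichart M a u) u.
Proof. by move=> ua; split=> //; exact: atlas_center. Qed.

Lemma derive_rep_tvec a u v : chart_im M a u ->
  'D_v (rep M N F a (F (ichart M a u))) u = tdiff M N F (ichart M a u) (tvec M a u v).
Proof.
move=> ua; set y := ichart M a u.
apply: (derive_rep aM aM aN (smooth_map_id aM) sF v (rdom_center ua) (c := F y)).
by split=> //; exact: atlas_center.
Qed.

(** Forms take their arguments in the chart indexed by the base point itself; this is the chain rule
    through that chart at both ends of [F]. *)
Lemma tvec_rep a b u v : rdom M N F a b u ->
  tvec N b (rep M N F a b u) ('D_v (rep M N F a b) u) =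
  tdiff M N F (ichart M a u) (tvec M a u v).
Proof.
move=> ru; have ua := ru.1; rewrite -derive_rep_tvec // /tvec rep_ichart //.
apply: esym; apply: (derive_rep aM aN aN sF (smooth_map_id aN) v ru).
by split=> //; exact: atlas_center.
Qed.

Lemma tvec_center x v : tvec M x (chart M x x) v = v.
Proof.
have xx : chart_dom M x x := atlas_center aM x.
have o1 := open_rdom aM aM x x (@continuous_id X).
rewrite /tvec (atlasK aM) // -[RHS](derive_id (V := 'rV[R]_m) (chart M x x) v).
apply: (near_deriveV _ o1 _ (rdom_chart aM (F := id) xx xx)) => u [ux _].
exact: ichartK.
Qed.

Lemma tdiffE x v : tdiff M N F x v = 'D_v (rep M N F x (F x)) (chart M x x).
Proof. by []. Qed.

End tvec.

Section complex.
Context {R : realType} {n : nat} {X : topologicalType} (M : charts R (n + n) X).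
Hypothesis cM : is_complex_manifold M.
Let aM := manifold_atlas (complex_manifold_manifold cM).

Lemma tvecJ a u v : chart_im M a u -> tvec M a u (mul_i v) = mul_i (tvec M a u v).
Proof.
move=> ua; apply: (transition_holomorphic cM); rewrite -/(id @^-1` _) rdomE //.
exact: rdom_center.
Qed.

Lemma rep_holomorphic F a b u v : holomorphic_map M F -> rdom M M F a b u ->
  'D_(mul_i v) (rep M M F a b) u = mul_i ('D_v (rep M M F a b) u).
Proof.
move=> [sF hF] ru; have ua := ru.1; set y := ichart M a u.
have r1 : rdom M M F a (F y) u by split=> //; exact: atlas_center.
have E w : 'D_w (rep M M F a b) u =
    'D_('D_w (rep M M F a (F y)) u) (rep M M id (F y) b) (rep M M F a (F y) u).
  exact: (derive_rep aM aM aM sF (smooth_map_id aM) w r1 ru).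
rewrite !E !derive_rep_tvec // tvecJ // hF; apply: (transition_holomorphic cM).
rewrite -/(id @^-1` _) rdomE //.
split; first exact: (rep_im r1).
by rewrite rep_ichart //; exact: ru.2.
Qed.

Definition coef_at (om : form2 R (n + n) X) a u v w := coef2 M om a v w u.

Lemma coef_at_rep (om : form2 R (n + n) X) F a b u v w : smooth_map M M F ->
  (forall x v w, om (F x) (tdiff M M F x v) (tdiff M M F x w) = om x v w) ->
  rdom M M F a b u ->
  coef_at om b (rep M M F a b u) ('D_v (rep M M F a b) u) ('D_w (rep M M F a b) u) =
  coef_at om a u v w.
Proof.
move=> sF iF ru; rewrite /coef_at /coef2 !(tvec_rep aM aM sF) // rep_ichart //.
Qed.

End complex.

Section joint.
Context {R : realType} {m q : nat}.
Local Notation V := 'rV[R]_m.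

Lemma schwarzV A (f : V -> 'rV[R]_q) u v w : open A -> A u -> smooth_on A f ->
  'D_v ('D_w f) u = 'D_w ('D_v f) u.
Proof.
move=> oA Au sf; have sc := (smooth_coordP f oA).1 sf; apply/rowP => i.
have E a b : ('D_a ('D_b f) u) 0 i = 'D_a ('D_b (fun u => f u 0 i)) u.
  rewrite -(derive_coordE i (smooth_derivable (smooth_derive b sf) Au)).
  apply: (near_derive _ oA _ Au) => y Ay; rewrite -(derive_coordE i (smooth_derivable sf Ay)) //.
exact: etrans (E v w) (etrans (schwarz v w oA Au (sc i)) (esym (E w v))).
Qed.

Lemma derive_row_mxl (p : nat) (W : normedModType R) (F : 'rV[R]_(m + p) -> W) t u v :
  'D_v (fun t => F (row_mx t u)) t = 'D_(row_mx v 0) F (row_mx t u).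
Proof.
have E (h : R) : row_mx (h *: v + t) u = h *: row_mx v 0 + row_mx t u.
  by rewrite scale_row_mx add_row_mx scaler0 add0r.
exact: derive_affine E.
Qed.

Lemma derive_row_mxr (p : nat) (W : normedModType R) (F : 'rV[R]_(p + m) -> W) t u v :
  'D_v (fun u => F (row_mx t u)) u = 'D_(row_mx 0 v) F (row_mx t u).
Proof.
have E (h : R) : row_mx t (h *: v + u) = h *: row_mx 0 v + row_mx t u.
  by rewrite scale_row_mx add_row_mx scaler0 add0r.
exact: derive_affine E.
Qed.

Lemma derive_mul_i (A : set V) (T : V -> 'rV[R]_(q + q)) w u : open A -> A u -> smooth_on A T ->
  'D_w (fun u => mul_i (T u)) u = mul_i ('D_w T u).
Proof.
move=> oA Au sT; have sc := (smooth_coordP T oA).1 sT.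
have dc j := derive_coordE j (smooth_derivable (v := w) sT Au).
have sJ : smooth_on A (fun u => mul_i (T u)).
  apply/(smooth_coordP _ oA) => i; case: (split_ordP i) => j ->.
    by apply: smooth_eq oA _ (smoothN oA (sc (rshift q j))) => y _; rewrite mul_i_lE.
  by apply: smooth_eq oA _ (sc (lshift q j)) => y _; rewrite mul_i_rE.
apply/rowP => i; rewrite -(derive_coordE i (smooth_derivable sJ Au)).
case: (split_ordP i) => j ->.
  rewrite mul_i_lE -dc -(smooth_deriveN w (sc _) Au).
  by apply: (near_derive _ oA _ Au) => y _; rewrite mul_i_lE.
by rewrite mul_i_rE -dc; apply: (near_derive _ oA _ Au) => y _; rewrite mul_i_rE.
Qed.

End joint.

Lemma smooth_row_mxl {R : realType} {a b : nat} (u : 'rV[R]_b) A :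
  smooth_on A (fun t : 'rV[R]_a => row_mx t u).
Proof.
apply: smooth_sub (subsetT _) _; apply: smooth_row_mx; [exact: openT| |exact: smooth_cst].
by apply: smooth_linear => // t; exact: cvg_id.
Qed.

Lemma smooth_row_mxr {R : realType} {a b : nat} (t : 'rV[R]_a) A :
  smooth_on A (fun u : 'rV[R]_b => row_mx t u).
Proof.
apply: smooth_sub (subsetT _) _; apply: smooth_row_mx; [exact: openT|exact: smooth_cst|].
by apply: smooth_linear => // u; exact: cvg_id.
Qed.

Section action.
Context {R : realType} {n k : nat} {X : topologicalType} {M : charts R (n + n) X}
  {om : form2 R (n + n) X} {G : topGroupType} {MG : charts R k G} {act : G -> X -> X}
  {mu : X -> {linear 'rV[R]_k -> R^o}}.
Hypothesis H : hamiltonian_kahler M om MG act mu.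

Let K := hamiltonian_is_kahler H.
Let L := hamiltonian_group H.
Let cM := kahler_complex K.
Lemma ham_atlas : atlas M.
Proof. exact: manifold_atlas (complex_manifold_manifold cM). Qed.
Let aM := ham_atlas.
Lemma ham_group_atlas : atlas MG.
Proof. exact: manifold_atlas (lie_group_manifold (closed_subgroup_lie L)). Qed.
Let aG := ham_group_atlas.
Let aP := atlas_prod aG aM.

Lemma act_hol g : holomorphic_map M (act g).
Proof. by have [h _] := act_isometry L g. Qed.

Let JN (a : 'rV[R]_(n + n)) : mul_i (- a) = - mul_i a. Proof. exact: linearN. Qed.

(** An isometry preserves om(v, J w) and, being holomorphic, commutes with J; taking - J w in place
    of w recovers om. *)
Lemma act_form g x v w : om (act g x) (tdiff M M (act g) x v) (tdiff M M (act g) x w) = om x v w.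
Proof.
have [_ [_ i]] := act_isometry L g; have [_ hJ] := act_hol g.
have E : mul_i (- mul_i w) = w by rewrite JN mul_iK opprK.
by have := i x v (- mul_i w); rewrite /kahler_metric -hJ E.
Qed.

Lemma act1 y : act 1%g y = y. Proof. by rewrite (act_one L). Qed.

Lemma actM g h y : act (g * h)%g y = act g (act h y). Proof. by rewrite (act_mul L). Qed.

Lemma actK g y : act (g^-1)%g (act g y) = y. Proof. by rewrite -actM mulVg act1. Qed.

Definition act2 (z : G * X) : X := act z.1 z.2.

Lemma smooth_act2 : smooth_map (prod_charts MG M) M act2.
Proof. exact: act_smooth L. Qed.

Lemma smooth_orb y : smooth_map MG M (fun h => act h y).
Proof.
exact: (smooth_map_comp aG aP aM (smooth_map_pair aG aM aG (smooth_map_id aG) (smooth_map_cst MG M y))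
  smooth_act2).
Qed.

Let e1 := chart MG 1%g 1%g.

(** Written as a sum over the basis so that linearity in [v] holds at every [u], as [moment_data]
    demands; in the image of the chart it is the derivative of the orbit map, by [fieldE]. *)
Definition field a (v : 'rV[R]_k) (u : 'rV[R]_(n + n)) :=
  \sum_l v 0 l *: 'D_'e_l (rep MG M (fun h => act h (ichart M a u)) 1%g a) e1.

(** The action read in charts, with the group variable in the chart of the identity; its coordinate
    segments take the place of one-parameter subgroups. *)
Definition flow a := rep (prod_charts MG M) M act2 (1%g, a) a.
Definition flow_dom a := rdom (prod_charts MG M) M act2 (1%g, a) a.

Lemma open_flow a : open (flow_dom a).
Proof. refine (open_rdom aP aM (1%g, a) a smooth_act2.1). Qed.

Lemma smooth_flow a : smooth_on (flow_dom a) (flow a).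
Proof. refine (smooth_rep aP (1%g, a) a smooth_act2). Qed.

Lemma flow_dom1 a u : chart_im M a u -> flow_dom a (row_mx e1 u).
Proof.
move=> ua; split; first by rewrite prod_imE /= row_mxKl row_mxKr; split=> //; exact: im_chart (atlas_center aG _).
rewrite /act2 /= row_mxKl row_mxKr (atlasK aG) ?act1; last exact: atlas_center.
exact: ichart_dom.
Qed.

Lemma flowE a t u : flow a (row_mx t u) = rep M M (act (ichart MG 1%g t)) a a u.
Proof. by rewrite /flow /rep /act2 /= row_mxKl row_mxKr. Qed.

Lemma flow_domE a t u : flow_dom a (row_mx t u) <->
  chart_im MG 1%g t /\ rdom M M (act (ichart MG 1%g t)) a a u.
Proof.
rewrite /flow_dom /rdom prod_imE /= /act2 /= row_mxKl row_mxKr.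
by split=> [[[? ?] ?]|[? [? ?]]].
Qed.

Lemma fieldE a v u : chart_im M a u ->
  field a v u = 'D_v (rep MG M (fun h => act h (ichart M a u)) 1%g a) e1.
Proof.
move=> ua; rewrite [in RHS](row_sum_delta v) derive_dir_sum; last first.
  have o1 := open_rdom aG aM 1%g a (smooth_orb (ichart M a u)).1.
  apply: (smooth_differentiableV o1 _ (smooth_rep aG _ _ (smooth_orb _))).
  apply: rdom_chart => //; first exact: atlas_center.
  by rewrite act1; exact: ichart_dom.
apply: eq_bigr => l _; rewrite derive_dirZ //.
have o1 := open_rdom aG aM 1%g a (smooth_orb (ichart M a u)).1.
apply: (smooth_differentiableV o1 _ (smooth_rep aG _ _ (smooth_orb _))).
apply: rdom_chart => //; first exact: atlas_center.
by rewrite act1; exact: ichart_dom.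
Qed.

Lemma field_flow a v u : chart_im M a u -> field a v u = 'D_(row_mx v 0) (flow a) (row_mx e1 u).
Proof.
move=> ua; apply: etrans (fieldE v ua) (etrans _ (derive_row_mxl (flow a) e1 u v)).
have E : rep MG M (fun h => act h (ichart M a u)) 1%g a = fun t => flow a (row_mx t u).
  by apply/funext => t; rewrite /flow /rep /act2 /= row_mxKl row_mxKr.
exact: (congr1 (fun f : 'rV[R]_k -> 'rV[R]_(n + n) => 'D_v f e1) E).
Qed.

Lemma field_sum a v u : field a v u = \sum_l v 0 l *: field a 'e_l u.
Proof. by apply: eq_bigr => l _; congr (_ *: _); rewrite /field sum_delta. Qed.

Lemma smooth_field a v : smooth_on (chart_im M a) (field a v).
Proof.
have oa : open (chart_im M a) by exact: atlas_im_open.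
apply: (smooth_eq oa (f := fun u => 'D_(row_mx v 0) (flow a) (row_mx e1 u))).
  by move=> u ua; rewrite -field_flow.
exact: smooth_compV oa (@open_flow a) (@flow_dom1 a) (smooth_derive _ (@smooth_flow a)) (smooth_row_mxr _ _).
Qed.

Lemma derive_field a v w u : chart_im M a u ->
  'D_w (field a v) u = 'D_(row_mx 0 w) ('D_(row_mx v 0) (flow a)) (row_mx e1 u).
Proof.
move=> ua; have oa : open (chart_im M a) by exact: atlas_im_open.
apply: etrans (near_deriveV w oa (fun y ya => field_flow v ya) ua) _.
exact: (derive_row_mxr ('D_(row_mx v 0) (flow a)) e1 u w).
Qed.

Lemma flowJ a w z : flow_dom a z ->
  'D_(row_mx 0 (mul_i w)) (flow a) z = mul_i ('D_(row_mx 0 w) (flow a) z).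
Proof.
rewrite -(hsubmxK z) => /flow_domE[ut ru]; rewrite -!derive_row_mxr.
have -> : (fun u => flow a (row_mx (lsubmx z) u)) = rep M M (act (ichart MG 1%g (lsubmx z))) a a.
  by apply/funext => u; rewrite flowE.
exact: (rep_holomorphic cM w (act_hol _) ru).
Qed.

(** The field is the derivative of [flow] in the group variable at 1. As [flow] is holomorphic in
    the point, so is this derivative, because mixed derivatives commute. *)
Lemma hol_field a v : hol (@mul_i R n) (chart_im M a) (field a v).
Proof.
split=> [|u w ua]; first exact: smooth_field.
have od := @open_flow a; have ud := flow_dom1 ua; have sf := @smooth_flow a.
apply: etrans (derive_field v (mul_i w) ua) (etrans _ (congr1 (@mul_i R n) (esym (derive_field v w ua)))).
apply: etrans (schwarzV (row_mx 0 (mul_i w)) (row_mx v 0) od ud sf) _.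
apply: etrans _ (congr1 (@mul_i R n) (schwarzV (row_mx v 0) (row_mx 0 w) od ud sf)).
apply: etrans _ (derive_mul_i (row_mx v 0) od ud (smooth_derive (row_mx 0 w) sf)).
by apply: (near_deriveV _ od _ ud) => z; exact: flowJ.
Qed.

End action.

Section coordinates.
Context {R : realType} {n k : nat} {X : topologicalType} {M : charts R (n + n) X}
  {om : form2 R (n + n) X} {G : topGroupType} {MG : charts R k G} {act : G -> X -> X}
  {mu : X -> {linear 'rV[R]_k -> R^o}}.
Hypothesis H : hamiltonian_kahler M om MG act mu.
Let K := hamiltonian_is_kahler H.
Let L := hamiltonian_group H.
Let cM := kahler_complex K.
Let aM := ham_atlas H.
Let aG := ham_group_atlas H.
Let aP := atlas_prod aG aM.
Let aGG := atlas_prod aG aG.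
Let e1 := chart MG 1%g 1%g.
Local Notation V := 'rV[R]_(n + n).
Local Notation field := (@field R n k X M G MG act).

(** The double inverse keeps this convertible with the map differentiated in [Ad (g^-1)]. *)
Definition conjV (p : G * G) : G := (p.1^-1 * p.2 * p.1^-1^-1)%g.

Lemma smooth_conjV : smooth_map (prod_charts MG MG) MG conjV.
Proof.
have [_ sm si] := closed_subgroup_lie L.
have s1 := smooth_map_comp aGG aG aG (smooth_map_fst aG aG) si.
have s2 := smooth_map_comp aGG aG aG s1 si.
have s3 := smooth_map_comp aGG aGG aG (smooth_map_pair aG aG aGG s1 (smooth_map_snd aG aG)) sm.
by have := smooth_map_comp aGG aGG aG (smooth_map_pair aG aG aGG s3 s2) sm.
Qed.

Lemma smooth_conjg g : smooth_map MG MG (fun h => conjV (g, h)).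
Proof.
exact: (smooth_map_comp aG aGG aG (smooth_map_pair aG aG aG (smooth_map_cst MG MG g)
  (smooth_map_id aG)) smooth_conjV).
Qed.

Lemma conjV1 g : conjV (g, 1%g) = 1%g.
Proof. by rewrite /conjV /= mulg1 mulgV. Qed.

Lemma e1_im : chart_im MG 1%g e1.
Proof. exact/im_chart/(atlas_center aG). Qed.

Lemma e1K : ichart MG 1%g e1 = 1%g.
Proof. exact/(atlasK aG)/(atlas_center aG). Qed.

Lemma conj_dom g : rdom MG MG (fun h => conjV (g, h)) 1%g 1%g e1.
Proof. by split; [exact: e1_im|rewrite e1K conjV1; exact: atlas_center]. Qed.

Lemma orb_dom a u : chart_im M a u -> rdom MG M (fun h => act h (ichart M a u)) 1%g a e1.
Proof. by move=> ua; split; [exact: e1_im|rewrite e1K (act1 H); exact: ichart_dom]. Qed.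

Lemma orb_e1 a u : chart_im M a u -> rep MG M (fun h => act h (ichart M a u)) 1%g a e1 = u.
Proof. by move=> ua; rewrite /rep e1K (act1 H) (ichartK aM). Qed.

Lemma AdE g v : Ad MG (g^-1)%g v = 'D_v (rep MG MG (fun h => conjV (g, h)) 1%g 1%g) e1.
Proof.
(* [Ad] uses the chart indexed by the conjugate of 1, which equals 1 only propositionally; hence the
   generalization over [b]. *)
have E b : b = 1%g -> 'D_v (rep MG MG (fun h => conjV (g, h)) 1%g b) e1 =
    'D_v (rep MG MG (fun h => conjV (g, h)) 1%g 1%g) e1 by move=> ->.
exact: E (conjV1 g).
Qed.

(** From h g = g (g^-1 h g), differentiated in h at 1. *)
Lemma field_act g a b v u : rdom M M (act g) a b u ->
  field b v (rep M M (act g) a b u) = 'D_(field a (Ad MG (g^-1)%g v) u) (rep M M (act g) a b) u.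
Proof.
move=> ru; have ua := ru.1; set y := ichart M a u.
rewrite (fieldE H) ?(fieldE H) //; last exact: rep_im ru.
rewrite rep_ichart // -/y.
have -> : (fun h => act h (act g y)) = act g \o ((fun h => act h y) \o (fun h => conjV (g, h))).
  by apply/funext => h; rewrite /conjV /= -!(actM H) invgK !mulgA mulgV mul1g.
have so := smooth_orb H y; have sc := smooth_conjg g; have [sg _] := act_hol H g.
have r2 : rdom MG M ((fun h => act h y) \o (fun h => conjV (g, h))) 1%g a e1.
  by split; [exact: e1_im|rewrite /= e1K conjV1 (act1 H); exact: ichart_dom].
have E2 : rep MG M ((fun h => act h y) \o (fun h => conjV (g, h))) 1%g a e1 = u.
  by rewrite /rep /= e1K conjV1 (act1 H) /y (ichartK aM).
have r3 : rdom MG M (act g \o ((fun h => act h y) \o (fun h => conjV (g, h)))) 1%g b e1.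
  by split; [exact: e1_im|rewrite /= e1K conjV1 (act1 H); exact: ru.2].
apply: etrans (derive_rep aG aM aM (smooth_map_comp aG aG aM sc so) sg v r2 r3) _.
have D2 : 'D_v (rep MG M ((fun h => act h y) \o (fun h => conjV (g, h))) 1%g a) e1 =
    'D_(Ad MG (g^-1)%g v) (rep MG M (fun h => act h y) 1%g a) e1.
  apply: etrans (derive_rep aG aG aM sc so v (conj_dom g) r2) _.
  have A w w' z z' (f : 'rV[R]_k -> V) : w = w' -> z = z' -> 'D_w f z = 'D_w' f z' by move=> -> ->.
  apply: A (esym (AdE g v)) _; by rewrite /rep e1K conjV1.
by rewrite E2 D2.
Qed.

Lemma tvec_field a v u : chart_im M a u ->
  tvec M a u (field a v u) = induced_field M MG act v (ichart M a u).
Proof.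
move=> ua; set y := ichart M a u; rewrite /induced_field tdiffE (act1 H) (fieldE H) //.
have so := smooth_orb H y.
apply: esym; apply: etrans (derive_rep aG aM aM so (smooth_map_id aM) v (orb_dom ua) (c := y) _) _.
  by split; [exact: e1_im|rewrite /= e1K (act1 H); exact: atlas_center].
by rewrite orb_e1.
Qed.

Lemma smooth_moment a v : smooth_on (chart_im M a) (fun u => mu (ichart M a u) v : R).
Proof. by have := momentum_smooth (hamiltonian_momentum H) v a; rewrite setIT. Qed.

Lemma coef_moment a v w u : chart_im M a u ->
  'D_w (fun u => mu (ichart M a u) v : R) u = coef_at M om a u (field a v u) w.
Proof.
move=> ua; set y := ichart M a u; have yy : chart_dom M y y := atlas_center aM y.
have oy : open (chart_im M y) by exact: atlas_im_open.
rewrite /coef_at /coef2 tvec_field // -/y.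
rewrite -(momentum_diff (hamiltonian_momentum H) v y).
exact: (derive_real_rep (f := fun z => mu z v : R) aM aM w (smooth_map_id aM) (rdom_center aM ua) oy (im_chart yy) (smooth_moment y v)).
Qed.

Let fom := kahler_form K.

Lemma omD y v v' w : om y (v + v') w = om y v w + om y v' w.
Proof.
have l := form2_linear fom y w; rewrite !(form2_antisym fom y w) -opprD; congr (- _).
by have /= := l 1 v v'; rewrite !scale1r.
Qed.

Lemma omZ y c v w : om y (c *: v) w = c * om y v w.
Proof.
have l := form2_linear fom y w.
have l0 : om y w 0 = 0 by have := l (-1) 0 0; rewrite scaler0 addr0 scaleN1r addNr.
rewrite !(form2_antisym fom y w).
by have := l c v 0; rewrite !addr0 l0 addr0 => -> ; rewrite mulrN.
Qed.

Lemma omA y v w : om y w v = - om y v w. Proof. exact: (form2_antisym fom y v w). Qed.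

Lemma tvec_lin a u c v w : chart_im M a u -> tvec M a u (c *: v + w) = c *: tvec M a u v + tvec M a u w.
Proof.
move=> ua; have o1 := open_rdom aM aM a (ichart M a u) (@continuous_id X).
have d1 := smooth_differentiableV o1 (rdom_center aM ua) (smooth_rep aM _ _ (smooth_map_id aM)).
apply: etrans (derive_dirD _ _ d1) _; congr (_ + _); exact: derive_dirZ d1.
Qed.

Lemma coef_atA a u v w : coef_at M om a u w v = - coef_at M om a u v w.
Proof. exact: omA. Qed.

Lemma coef_atl a u c v v' w : chart_im M a u ->
  coef_at M om a u (c *: v + v') w = c * coef_at M om a u v w + coef_at M om a u v' w.
Proof. by move=> ua; rewrite /coef_at /coef2 tvec_lin // omD omZ. Qed.

Lemma smooth_coef a v w : smooth_on (chart_im M a) (fun u => coef_at M om a u v w).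
Proof. exact: form2_smooth. Qed.

Lemma coef_atJ a u v w : chart_im M a u -> coef_at M om a u (mul_i v) (mul_i w) = coef_at M om a u v w.
Proof. by move=> ua; rewrite /coef_at /coef2 !(tvecJ cM) // (kahler_mul_i K). Qed.

Lemma tvec_inj a u v : chart_im M a u -> tvec M a u v = 0 -> v = 0.
Proof.
move=> ua v0; have o1 := open_rdom aM aM a a (@continuous_id X).
have ra : rdom M M id a a u by split=> //; exact: ichart_dom.
have := derive_rep aM aM aM (smooth_map_id aM) (smooth_map_id aM) v (rdom_center aM ua) ra.
have -> : 'D_v (rep M M (id \o id) a a) u = v.
  rewrite -[RHS](derive_id (V := V) u v); apply: (near_deriveV _ o1 _ ra) => w [wa _].
  exact: ichartK.
have -> : 'D_v (rep M M id a (id (ichart M a u))) u = 0 := v0.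
by rewrite derive_dir0.
Qed.

Lemma coef_at_pos a u v : chart_im M a u -> v != 0 -> 0 < coef_at M om a u v (mul_i v).
Proof.
move=> ua v0; rewrite /coef_at /coef2 (tvecJ cM) //; apply: (kahler_pos K).
by apply: contraNneq v0 => /(tvec_inj ua) ->.
Qed.

Lemma coef_at_center y v w : coef_at M om y (chart M y y) v w = om y v w.
Proof. by rewrite /coef_at /coef2 !tvec_center // (atlasK aM) //; exact: atlas_center. Qed.

Lemma coef_at_act g a b u v w : rdom M M (act g) a b u ->
  coef_at M om b (rep M M (act g) a b u) ('D_v (rep M M (act g) a b) u) ('D_w (rep M M (act g) a b) u) =
  coef_at M om a u v w.
Proof. by apply: (coef_at_rep cM); [case: (act_hol H g)|exact: (act_form H g)]. Qed.


Local Notation cf := (@coef_at R n X M om).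

Let coef_id a b u v w : rdom M M id a b u ->
  cf b (rep M M id a b u) ('D_v (rep M M id a b) u) ('D_w (rep M M id a b) u) = cf a u v w.
Proof.
have E z (t : V) : tdiff M M id z t = t.
  by rewrite -[RHS](tvec_center aM z t) /tvec (atlasK aM) //; exact: atlas_center.
by apply: (coef_at_rep cM v w (smooth_map_id aM)) => z t t'; rewrite !E.
Qed.

Let coef_sum b (f g z : V) : chart_im M b z -> cf b z f g = \sum_i f 0 i * cf b z 'e_i g.
Proof.
move=> zb; rewrite {1}(row_sum_delta f).
have c0 : cf b z 0 g = 0.
  by have := coef_atl (-1) 0 0 g zb; rewrite scaler0 addr0 mulN1r addNr.
elim/big_rec2 : _ => [|i c d _ <-]; [exact: c0|exact: coef_atl].
Qed.

Let coef_sumr b (f g z : V) : chart_im M b z -> cf b z f g = \sum_i g 0 i * cf b z f 'e_i.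
Proof.
move=> zb; rewrite coef_atA coef_sum // -sumrN; apply: eq_bigr => i _.
by rewrite (coef_atA b z 'e_i f) mulrN.
Qed.

(** [kahler_closed] speaks of the chart indexed by the point, so the coefficients in the chart [a]
    are rewritten through the transition map. Its second derivatives are symmetric and the form
    antisymmetric, so their contributions cancel. *)
Lemma coef_closed a u (v1 v2 v3 : V) : chart_im M a u ->
  'D_v1 (fun u => cf a u v2 v3) u - 'D_v2 (fun u => cf a u v1 v3) u +
  'D_v3 (fun u => cf a u v1 v2) u = 0.
Proof.
move=> ua; set y := ichart M a u; pose T := rep M M id a y; pose A := rdom M M id a y.
have oA : open A := open_rdom aM aM a y (@continuous_id X).
have Au : A u := rdom_center aM ua.
have sT : smooth_on A T := smooth_rep aM a y (smooth_map_id aM).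
have oy : open (chart_im M y) by exact: atlas_im_open.
have AB t : A t -> chart_im M y (T t) := @rep_im R _ _ X X M M id a y t.
pose S v w := 'D_v ('D_w T) u; have SC v w : S v w = S w v := schwarzV v w oA Au sT.
pose T1 v := 'D_v T u.
pose DO v w z := 'D_v (fun u => cf y u w z) (T u).
have sF d e : smooth_on (chart_im M y) (fun z => cf y z d e) by exact: smooth_coef.
have D v w z : 'D_v (fun u => cf a u w z) u = DO (T1 v) (T1 w) (T1 z) + cf y (T u) (S v w) (T1 z) + cf y (T u) (T1 w) (S v z).
  have E t : A t -> cf a t w z = \sum_i ('D_w T t) 0 i * \sum_j ('D_z T t) 0 j * cf y (T t) 'e_i 'e_j.
    move=> At; rewrite -(coef_id w z At) coef_sum; last exact: AB.
    apply: eq_bigr => i _; congr (_ * _); apply: coef_sumr; exact: AB.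
  rewrite (near_derive v oA E Au).
  have sD b i : smooth_on A (fun t => ('D_b T t) 0 i) := (smooth_coordP _ oA).1 (smooth_derive b sT) i.
  have sc i j : smooth_on A (fun t => cf y (T t) 'e_i 'e_j).
    exact: smooth_comp oA oy AB (sF 'e_i 'e_j) sT.
  have s1 i j : smooth_on A (fun t => ('D_z T t) 0 j * cf y (T t) 'e_i 'e_j) := smoothM oA (sD z j) (sc i j).
  have s2 i : smooth_on A (fun t => \sum_j ('D_z T t) 0 j * cf y (T t) 'e_i 'e_j).
    exact: (smooth_sum (index_enum _) (P := xpredT) oA (fun j _ => s1 i j)).
  have dD b i : 'D_v (fun t => ('D_b T t) 0 i) u = (S v b) 0 i.
    exact: derive_coordE (smooth_derivable (smooth_derive b sT) Au).
  have dc i j : 'D_v (fun t => cf y (T t) 'e_i 'e_j) u = DO (T1 v) 'e_i 'e_j.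
    apply: derive_compE; first exact: smooth_differentiableV oA Au sT.
    exact: smooth_differentiable oy (AB _ Au) (sF _ _).
  have d1 i : 'D_v (fun t => \sum_j ('D_z T t) 0 j * cf y (T t) 'e_i 'e_j) u =
      cf y (T u) 'e_i (S v z) + \sum_j T1 z 0 j * DO (T1 v) 'e_i 'e_j.
    apply: etrans (smooth_derive_sum _ v oA (s1 i) Au) _.
    rewrite coef_sumr; last exact: AB.
    rewrite -big_split; apply: eq_bigr => j _.
    apply: etrans (smooth_deriveM v (sD z j) (sc i j) Au) _.
    exact: (congr2 +%R (congr2 *%R (dD z j) erefl) (congr2 *%R erefl (dc i j))).
  apply: etrans (smooth_derive_sum _ v oA (fun i => smoothM oA (sD w i) (s2 i)) Au) _.
  have DE p q r : DO p q r = \sum_i q 0 i * \sum_j r 0 j * DO p 'e_i 'e_j.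
    have E2 t : chart_im M y t -> cf y t q r = \sum_i q 0 i * \sum_j r 0 j * cf y t 'e_i 'e_j.
      by move=> ty; rewrite coef_sum //; apply: eq_bigr => i _; congr (_ * _); exact: coef_sumr.
    apply: etrans (near_derive p oy E2 (AB _ Au)) _.
    have t1 i j := smoothMc (r 0 j) oy (sF 'e_i 'e_j).
    have t2 i := smooth_sum (index_enum _) (P := xpredT) oy (fun j _ => t1 i j).
    apply: etrans (smooth_derive_sum _ p oy (fun i => smoothMc (q 0 i) oy (t2 i)) (AB _ Au)) _.
    apply: eq_bigr => i _; apply: etrans (smooth_deriveZ _ _ (t2 i) (AB _ Au)) _; congr (_ * _).
    apply: etrans (smooth_derive_sum _ p oy (t1 i) (AB _ Au)) _.
    by apply: eq_bigr => j _; apply: etrans (smooth_deriveZ _ _ (sF _ _) (AB _ Au)) _.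
  have C1 : cf y (T u) (S v w) (T1 z) = \sum_i S v w 0 i * \sum_j T1 z 0 j * cf y (T u) 'e_i 'e_j.
    rewrite coef_sum; last exact: AB.
    by apply: eq_bigr => i _; congr (_ * _); apply: coef_sumr; exact: AB.
  have C2 : cf y (T u) (T1 w) (S v z) = \sum_i T1 w 0 i * cf y (T u) 'e_i (S v z).
    by rewrite coef_sum //; exact: AB.
  rewrite DE C1 C2 -!big_split; apply: eq_bigr => i _.
  apply: etrans (smooth_deriveM v (sD w i) (s2 i) Au) _.
  have A1 (s t p q r o : R) : s = p -> t = q + r -> s * o + p * 0 + 0 = p * o by move=> -> _; ring.
  apply: etrans (congr2 +%R (congr2 *%R (dD w i) erefl) (congr2 *%R erefl (d1 i))) _.
  have A2 (s o x c d : R) : s * o + x * (c + d) = x * d + s * o + x * c by ring.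
  exact: A2.
have c0 := kahler_closed K y (T1 v1) (T1 v2) (T1 v3).
have A1 (p q r a1 a2 b1 b2 c1 c2 : R) : p - q + r = 0 -> b1 = a1 -> c2 = b2 -> c1 = - a2 ->
  (p + a1 + a2) - (q + b1 + b2) + (r + c1 + c2) = 0.
  by move=> pqr -> -> ->; rewrite -[RHS]pqr; ring.
rewrite !D; apply: A1.
- have Ty : T u = chart M y y by [].
  rewrite /DO Ty; exact: c0.
- by rewrite SC.
- by rewrite SC.
- by rewrite SC coef_atA.
Qed.

End coordinates.

(** * Brackets of the induced fields *)

Section bracket.
Context {R : realType} {n k : nat} {X : topologicalType} {M : charts R (n + n) X}
  {om : form2 R (n + n) X} {G : topGroupType} {MG : charts R k G} {act : G -> X -> X}
  {mu : X -> {linear 'rV[R]_k -> R^o}}.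
Hypothesis H : hamiltonian_kahler M om MG act mu.
Let K := hamiltonian_is_kahler H.
Let L := hamiltonian_group H.
Let cM := kahler_complex K.
Let aM := ham_atlas H.
Let aG := ham_group_atlas H.
Let aP := atlas_prod aG aM.
Let aGG := atlas_prod aG aG.
Let e1 := chart MG 1%g 1%g.
Local Notation V := 'rV[R]_(n + n).
Local Notation W := 'rV[R]_k.
Local Notation field := (@field R n k X M G MG act).
Local Notation flow := (@flow R n k X M G MG act).
Local Notation flow_dom := (@flow_dom R n k X M G MG act).

Definition conj_flow := rep (prod_charts MG MG) MG conjV (1%g, 1%g) 1%g.
Let conj_flow_dom := rdom (prod_charts MG MG) MG conjV (1%g, 1%g) 1%g.

Let oc : open conj_flow_dom.
Proof. refine (open_rdom aGG aG (1%g, 1%g) 1%g (smooth_conjV H).1). Qed.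

Let scf : smooth_on conj_flow_dom conj_flow.
Proof. refine (smooth_rep aGG (1%g, 1%g) 1%g (smooth_conjV H)). Qed.

Let o1 : open (chart_im MG 1%g). Proof. exact: atlas_im_open. Qed.

Let e1i : chart_im MG 1%g e1. Proof. exact: e1_im H. Qed.

Let cdom t : chart_im MG 1%g t -> conj_flow_dom (row_mx t e1).
Proof.
move=> ti; split; first by rewrite prod_imE /= row_mxKl row_mxKr.
rewrite /= row_mxKl row_mxKr (e1K H) conjV1; exact: atlas_center.
Qed.

Definition AdV (v t : W) : W := 'D_(row_mx 0 v) conj_flow (row_mx t e1).

Lemma AdVE v t : AdV v t = Ad MG ((ichart MG 1%g t)^-1)%g v.
Proof.
rewrite AdE /AdV; apply: etrans (esym (derive_row_mxr conj_flow t e1 v)) _.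
have E : (fun u => conj_flow (row_mx t u)) =
    rep MG MG (fun h => conjV (ichart MG 1%g t, h)) 1%g 1%g.
  by apply/funext => u; rewrite /conj_flow /rep /= row_mxKl row_mxKr.
exact: (congr1 (fun f : W -> W => 'D_v f e1) E).
Qed.

Lemma smooth_AdV v : smooth_on (chart_im MG 1%g) (AdV v).
Proof. exact: smooth_compV o1 oc cdom (smooth_derive _ scf) (smooth_row_mxl _ _). Qed.

Lemma AdV1 v : AdV v e1 = v.
Proof.
rewrite AdVE AdE (e1K H); rewrite -[RHS](derive_id (V := W) e1 v).
apply: (near_deriveV v o1 _ e1i) => t ti; rewrite /rep /conjV /= invg1 mul1g.
by rewrite invg1 mulg1 (ichartK aG).
Qed.

(** The derivative of Ad(g^-1) v at g = 1 in direction a, which is minus the usual bracket; for a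
    left action this sign makes v -> v~ compatible with brackets of vector fields. *)
Definition lie_bracket (a v : W) : W := \sum_l a 0 l *: 'D_'e_l (AdV v) e1.

Lemma lie_bracketE a v : lie_bracket a v = 'D_a (AdV v) e1.
Proof.
have d1 := smooth_differentiableV o1 e1i (smooth_AdV v).
apply: etrans _ (congr1 (fun z => 'D_z (AdV v) e1) (esym (row_sum_delta a))).
apply: etrans _ (esym (derive_dir_sum _ _ d1)); apply: eq_bigr => l _.
exact: esym (derive_dirZ _ _ d1).
Qed.

Lemma lie_bracket_sum a v : lie_bracket a v = \sum_l a 0 l *: lie_bracket 'e_l v.
Proof. by apply: eq_bigr => l _; congr (_ *: _); rewrite /lie_bracket sum_delta. Qed.

Section at_point.
Variables (a : X) (u : V).
Hypothesis ua : chart_im M a u.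
Let A : set W := [set t | flow_dom a (row_mx t u)].

Let cont_row : continuous (fun t : W => row_mx t u : 'rV[R]_(k + (n + n))).
Proof. by move=> t; apply: continuous_row_mx; [exact: cvg_id|exact: cst_continuous]. Qed.

Let od : open (flow_dom a). Proof. exact: (open_flow H). Qed.

Let oA : open A.
Proof. exact: (open_preim cont_row od). Qed.

Let Ae : A e1. Proof. exact: (flow_dom1 H ua). Qed.

Let At1 t : A t -> chart_im MG 1%g t.
Proof. by move=> /(flow_domE (M := M) (act := act))[]. Qed.

Let sA v : smooth_on A (AdV v). Proof. by apply: smooth_sub (smooth_AdV v) => t /At1. Qed.

Let flow1 : flow a (row_mx e1 u) = u.
Proof. by rewrite /flow /rep /act2 /= row_mxKl row_mxKr (e1K H) (act1 H) (ichartK aM). Qed.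

Let oa : open (chart_im M a). Proof. exact: atlas_im_open. Qed.

Let sfu : smooth_on A (fun t => flow a (row_mx t u)).
Proof. exact: (smooth_compV (f := flow a) oA od (fun t At => At) (smooth_flow H a) (smooth_row_mxl _ _)). Qed.

Let dfu (b : W) : 'D_b (fun t => flow a (row_mx t u)) e1 = field a b u.
Proof. exact: etrans (derive_row_mxl (flow a) e1 u b) (esym (field_flow H b ua)). Qed.

(** The equivariance of [mu], differentiated in the group variable at 1. *)
Lemma moment_bracket_field (b v : W) :
  'D_(field a b u) (fun u => mu (ichart M a u) v : R) u = mu (ichart M a u) (lie_bracket b v).
Proof.
pose y := ichart M a u; pose f := fun w => mu (ichart M a w) v : R.
have sm := smooth_moment H a v.
have E t : A t -> f (flow a (row_mx t u)) = mu y (AdV v t).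
  move=> At; rewrite /f; have := rep_ichart aM (F := act2) (a := (1%g, a)) (b := a) At.
  rewrite /= row_mxKl row_mxKr => ->.
  by rewrite /act2 /= (momentum_equivariant (hamiltonian_momentum H)) AdVE.
have D1 : 'D_b (fun t => f (flow a (row_mx t u))) e1 = 'D_(field a b u) f u.
  apply: etrans (derive_compE _ (smooth_differentiableV oA Ae sfu) _) _.
    by rewrite flow1; exact: smooth_differentiable oa ua sm.
  by rewrite flow1 dfu.
rewrite -/f -D1 (near_derive _ oA E Ae) lie_bracketE.
have ML (d : W) (z : W) : (mu y d : R) = \sum_l d 0 l * mu y 'e_l.
  by rewrite {1}(row_sum_delta d) linear_sum; apply: eq_bigr => l _; rewrite linearZ.
have smu (d : W) : smooth_on A (fun=> mu y d : R) by exact: smooth_cst.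
have := derive_family oA oA (fun t _ => Ae) (smooth_cst A e1) (sA v)
  (F := fun d z => mu y d : R) ML smu b Ae.
by move=> ->; rewrite [X in _ + X](_ : _ = 0) ?addr0 //; exact: derive_cst.
Qed.

(** [field_act] is differentiated in the group variable at 1: Ad contributes the bracket, and the
    differential of the action a mixed derivative of [flow], which is the derivative of [field a b]
    along [field a v]. *)
Lemma field_bracket_act (b v : W) : 'D_(field a b u) (field a v) u - 'D_(field a v u) (field a b) u =
  field a (lie_bracket b v) u.
Proof.
have sf := smooth_flow H a; have du := flow_dom1 H ua.
pose F (d : V) z := \sum_l d 0 l *: 'D_(row_mx 0 'e_l) (flow a) z.
have FL d z : F d z = \sum_l d 0 l *: F 'e_l z.
  by apply: eq_bigr => l _; rewrite /F sum_delta.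
have FE d z : flow_dom a z -> F d z = 'D_(row_mx 0 d) (flow a) z.
  move=> dz; have d1 := smooth_differentiableV od dz sf.
  have -> : row_mx 0 d = \sum_l d 0 l *: row_mx 0 ('e_l : V) :> 'rV[R]_(k + (n + n)).
    rewrite {1}(row_sum_delta d); elim/big_rec2 : _ => [|l y z' _ <-]; first by rewrite row_mx0.
    by rewrite scale_row_mx add_row_mx scaler0 addr0.
  apply: etrans _ (esym (derive_dir_sum _ _ d1)); apply: eq_bigr => l _.
  exact: esym (derive_dirZ _ _ d1).
have sF d : smooth_on (flow_dom a) (F d).
  by apply: (smooth_eq od _ (smooth_derive (row_mx 0 d) sf)) => z dz; rewrite FE.
pose c t := field a (AdV v t) u.
have fL (d : W) z : field a d z = \sum_l d 0 l *: field a 'e_l z by exact: field_sum.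
have sfd (d : W) : smooth_on (chart_im M a) (field a d) by exact: (smooth_field H).
have cim t : A t -> chart_im M a u by [].
have sc : smooth_on A c := smooth_familyV oA oa cim (smooth_cst A u) (sA v) fL sfd.
have dc : 'D_b c e1 = field a (lie_bracket b v) u.
  apply: etrans (derive_familyV oA oa cim (smooth_cst A u) (sA v) fL sfd b Ae) _.
  have c0 : 'D_b (fun=> u : V) e1 = 0 by exact: derive_cst.
  by rewrite c0 derive_dir0 addr0 -lie_bracketE.
have E t : A t -> field a v (flow a (row_mx t u)) = F (c t) (row_mx t u).
  move=> At; have [_ ru] := (flow_domE (M := M) (act := act) _ _ _).1 At.
  rewrite FE // -(derive_row_mxr (flow a) t u (c t)) /c AdVE.
  have E2 : (fun u => flow a (row_mx t u)) = rep M M (act (ichart MG 1%g t)) a a.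
    by apply/funext => z; rewrite flowE.
  by rewrite E2 flowE; exact: (field_act H v ru).
have D1 : 'D_b (fun t => field a v (flow a (row_mx t u))) e1 = 'D_(field a b u) (field a v) u.
  apply: etrans (derive_compE _ (smooth_differentiableV oA Ae sfu) _) _.
    by rewrite flow1; exact: smooth_differentiableV oa ua (sfd v).
  by rewrite flow1 dfu.
have D2 : 'D_b (fun t => F (c t) (row_mx t u)) e1 =
    F ('D_b c e1) (row_mx e1 u) + 'D_(row_mx b 0) (F (c e1)) (row_mx e1 u).
  apply: etrans (derive_familyV oA od (fun t At => At) (smooth_row_mxl u A) sc FL sF b Ae) _.
  have E3 : 'D_b (fun t : W => row_mx t u) e1 = row_mx b 0.
    apply: etrans (derive_row_mxl (fun z : 'rV[R]_(k + (n + n)) => z) e1 u b) _; exact: derive_id.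
  exact: (congr1 (fun z => _ + 'D_z (F (c e1)) (row_mx e1 u)) E3).
have c1 : c e1 = field a v u by rewrite /c AdV1.
have F1 d : F d (row_mx e1 u) = d.
  apply: etrans (FE d _ du) (etrans (esym (derive_row_mxr (flow a) e1 u d)) _).
  apply: etrans _ (derive_id (V := V) u d); apply: (near_deriveV d oa _ ua) => z za.
  by rewrite /flow /rep /act2 /= row_mxKl row_mxKr (e1K H) (act1 H) (ichartK aM).
have D3 : 'D_(row_mx b 0) (F (c e1)) (row_mx e1 u) = 'D_(field a v u) (field a b) u.
  rewrite c1; apply: etrans (near_deriveV (row_mx b 0) od (FE (field a v u)) du) _.
  apply: etrans (schwarzV (row_mx b 0) (row_mx 0 (field a v u)) od du sf) _.
  exact: esym (derive_field H b (field a v u) ua).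
rewrite -D1 (near_deriveV b oA E Ae) D2 F1 dc D3; exact: addrK.
Qed.

End at_point.

End bracket.

(** * Invariant mean on a compact group *)

Section haar.
Context {R : realType} {G : topGroupType}.
Variable K : set G.
Hypotheses (cK : compact K) (K1 : K 1%g) (KM : forall g h, K g -> K h -> K (g * h)%g)
  (KV : forall g, K g -> K (g^-1)%g).
Hypotheses (cmul : continuous (fun p : G * G => (p.1 * p.2)%g))
  (cinv : continuous (fun g : G => (g^-1)%g)).
Implicit Types (f : G -> R) (T S : seq G).

(** A list with multiplicities, so that composing two averages is again an average, over the list of
    products. *)
Definition rav T f x := (size T)%:R^-1 * \sum_(t <- T) f (x * t)%g.
Definition lav S f x := (size S)%:R^-1 * \sum_(s <- S) f (s * x)%g.
Definition admissible T := (0 < size T)%N /\ forall t, t \in T -> K t.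

Let sz T : admissible T -> (size T)%:R != 0 :> R.
Proof. by move=> [T0 _]; rewrite pnatr_eq0 -lt0n. Qed.

Let sumr_le T (F F' : G -> R) : (forall t, t \in T -> F t <= F' t) ->
  \sum_(t <- T) F t <= \sum_(t <- T) F' t.
Proof. by move=> FF; rewrite !big_seq; apply: ler_sum. Qed.

Let avg_le T (F : G -> R) c : admissible T -> (forall t, t \in T -> F t <= c) ->
  (size T)%:R^-1 * \sum_(t <- T) F t <= c.
Proof.
move=> aT Fc; have s0 : 0 < (size T)%:R :> R by rewrite ltr0n; case: aT.
rewrite ler_pdivrMl //; apply: le_trans (sumr_le Fc) _.
by rewrite big_const_seq count_predT iter_addr_0 mulr_natl.
Qed.

Let avgN T (F : G -> R) : (size T)%:R^-1 * \sum_(t <- T) - F t =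
  - ((size T)%:R^-1 * \sum_(t <- T) F t).
Proof. by rewrite sumrN mulrN. Qed.

Let avg_ge T (F : G -> R) c : admissible T -> (forall t, t \in T -> c <= F t) ->
  c <= (size T)%:R^-1 * \sum_(t <- T) F t.
Proof.
move=> aT Fc; rewrite -[leRHS]opprK -avgN -lerN2 opprK.
by apply: avg_le => // t tT; rewrite lerN2 Fc.
Qed.

Let avg_dist T (F : G -> R) c e : admissible T -> (forall t, t \in T -> `|F t - c| <= e) ->
  `|(size T)%:R^-1 * (\sum_(t <- T) F t) - c| <= e.
Proof.
move=> aT Fc; rewrite ler_distl; apply/andP; split.
  by apply: avg_ge => // t /Fc; rewrite ler_distl => /andP[].
by apply: avg_le => // t /Fc; rewrite ler_distl => /andP[].
Qed.

Lemma rav_dist T f c e x : admissible T -> K x -> (forall y, K y -> `|f y - c| <= e) ->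
  `|rav T f x - c| <= e.
Proof. by move=> aT Kx fc; apply: avg_dist => // t tT; apply/fc/KM => //; case: aT => _; apply. Qed.

Lemma lav_dist T f c e x : admissible T -> K x -> (forall y, K y -> `|f y - c| <= e) ->
  `|lav T f x - c| <= e.
Proof. by move=> aT Kx fc; apply: avg_dist => // t tT; apply/fc/KM => //; case: aT => _; apply. Qed.

Lemma lav_rav S T f x : lav S (rav T f) x = rav T (lav S f) x.
Proof.
rewrite /lav /rav -!mulr_sumr mulrCA exchange_big; congr (_ * (_ * _)).
by apply: eq_bigr => t _; apply: eq_bigr => s _; rewrite mulgA.
Qed.

Lemma rav_rav T T' f : admissible T -> admissible T' ->
  exists2 T'', admissible T'' & forall x, rav T (rav T' f) x = rav T'' f x.
Proof.
move=> aT aT'; exists [seq (t * t')%g | t <- T, t' <- T'].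
  split; first by rewrite size_allpairs muln_gt0; case: aT => ->; case: aT'.
  by move=> _ /allpairsP[[t t'] /= [tT tT' ->]]; apply: KM; [case: aT => _; apply|case: aT' => _; apply].
move=> x; rewrite /rav size_allpairs big_allpairs_dep natrM invfM -mulrA -mulr_sumr.
congr (_ * (_ * _)); apply: eq_bigr => t _; apply: eq_bigr => t' _; by rewrite mulgA.
Qed.

Lemma lav_lav S S' f : admissible S -> admissible S' ->
  exists2 S'', admissible S'' & forall x h, lav S (lav S' h) x = lav S'' h x.
Proof.
move=> aT aT'; exists [seq (t' * t)%g | t <- S, t' <- S'].
  split; first by rewrite size_allpairs muln_gt0; case: aT => ->; case: aT'.
  by move=> _ /allpairsP[[t t'] /= [tT tT' ->]]; apply: KM; [case: aT' => _; apply|case: aT => _; apply].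
move=> x h; rewrite /lav size_allpairs big_allpairs_dep natrM invfM -mulrA -mulr_sumr.
congr (_ * (_ * _)); apply: eq_bigr => t _; apply: eq_bigr => t' _; by rewrite mulgA.
Qed.

Lemma continuous_mulg (S : topologicalType) (f g : S -> G) s : {for s, continuous f} ->
  {for s, continuous g} -> {for s, continuous (fun s => (f s * g s)%g)}.
Proof.
move=> cf cg; apply: (continuous_comp (f := fun s => (f s, g s)) (g := fun p => (p.1 * p.2)%g)).
  exact: (@cvg_pair _ _ _ _ _ _ (nbhs_filter s) (nbhs_filter _) (nbhs_filter _) _ _ cf cg).
exact: cmul.
Qed.

Let cmul3 (x v t : G) : {for (x, v, t), continuous (fun p : G * G * G => (p.1.1 * p.1.2 * p.2)%g)}.
Proof.
apply: (continuous_mulg (f := fun p : G * G * G => (p.1.1 * p.1.2)%g)); last exact: cvg_snd.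
apply: (continuous_comp (f := fst) (g := fun p : G * G => (p.1 * p.2)%g)); [exact: cvg_fst|exact: cmul].
Qed.

(* Invariance under right translations of the modulus of continuity
   [|f (x v t) - f (x t)|] keeps the length of the list below fixed when averaging again. *)
Lemma uniform_two_sided f e : cont_on K f -> 0 < e -> exists2 W : set G, nbhs 1%g W &
  forall x v t, K x -> W v -> K t -> `|f (x * v * t)%g - f (x * t)%g| <= e.
Proof.
move=> cf e0; have e2 : 0 < e / 2 by rewrite divr_gt0.
have cKK : compact (K `*` K) by exact: compact_setX.
have /compact_near_coveringP/(_ _ (nbhs (1%g : G)) (fun v (p : G * G) =>
  `|f (p.1 * v * p.2)%g - f (p.1 * p.2)%g| <= e) (nbhs_filter _)) C := cKK.
have {}C := C _; exists [set v | forall p, (K `*` K) p -> `|f (p.1 * v * p.2)%g - f (p.1 * p.2)%g| <= e].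
  apply: C => -[x t] [/= Kx Kt].
  have c3 : {for (x, 1%g, t), continuous (fun p : G * G * G => (p.1.1 * p.1.2 * p.2)%g)} by exact: cmul3.
  have cfx := cf _ (KM Kx Kt).
  have /cvgrPdist_lt/(_ _ e2) n1 := cfx.
  have n2 : \forall p \near ((x, 1%g), t), `|f (x * t)%g - f (p.1.1 * p.1.2 * p.2)%g| < e / 2.
    have c := c3; rewrite /prop_for /continuous_at /= mulg1 in c; exact: c _ n1.
  case: n2 => -[A B] /= [[[A1 A2] /= [nA1 nA2] hA] nB] hAB.
  exists ((fun p => A1 p.1 /\ B p.2), A2) => /=.
    split=> //; exists (A1, B) => //=.
  move=> [[x' t'] v] /= [[Ax Bt] Av].
  have h1 := hAB (x', v, t') (conj (hA (x', v) (conj Ax Av)) Bt).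
  have h2 := hAB (x', 1%g, t') (conj (hA (x', 1%g) (conj Ax (nbhs_singleton nA2))) Bt).
  rewrite /= mulg1 in h1 h2.
  rewrite (_ : _ - _ = (f (x * t)%g - f (x' * t')%g) - (f (x * t)%g - f (x' * v * t')%g)); last by ring.
  by apply: le_trans (ler_normB _ _) _; rewrite [leRHS]splitr; apply: lerD; exact: ltW.
by move=> x v t Kx Wv Kt; exact: (Wv (x, t)).
Qed.

Lemma finite_net (W : set G) : nbhs 1%g W ->
  exists2 T, admissible T & forall y, K y -> exists2 t, t \in T & W (t * y^-1)%g.
Proof.
(* Finite lists in [K], directed by inclusion, form a filter; compactness in its near-covering form
   then yields one list that serves every point of [K]. *)
move=> nW; pose F (P : set (seq G)) := exists2 T0 : seq G, (forall t, t \in T0 -> K t) &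
  forall T : seq G, {subset T0 <= T} -> P T.
have FF : Filter F.
  split; first by exists [::].
    move=> P Q [T0 T0K PT] [T1 T1K QT]; exists (T0 ++ T1).
      by move=> t; rewrite mem_cat => /orP[/T0K|/T1K].
    by move=> T sT; split; [apply: PT|apply: QT] => t tT; apply: sT; rewrite mem_cat tT ?orbT.
  by move=> P Q PQ [T0 T0K PT]; exists T0 => // T /PT/PQ.
have /compact_near_coveringP/(_ _ F (fun T y => exists2 t, t \in T & W (t * y^-1)%g) FF) C := cK.
have [y Ky|T0 T0K PT] := C.
  exists ([set z | W (y * z^-1)%g], [set T : seq G | y \in T]) => /=; last first.
    by move=> [z T] [/= Wz yT]; exists y.
  split; last by exists [:: y] => [t|T]; [rewrite inE => /eqP ->|apply; exact: mem_head].
  have ci : {for y, continuous (fun z : G => (z^-1)%g)} by exact: cinv.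
  have cy : {for y, continuous (fun _ : G => y)} by exact: cst_continuous.
  have c := continuous_mulg cy ci; rewrite /prop_for /continuous_at /= mulgV in c; exact: c _ nW.
(* The added 1 makes the list nonempty. *)
exists (1%g :: T0); first by split=> // t; rewrite inE => /orP[/eqP ->//|/T0K].
by apply: PT => t tT; rewrite inE tT orbT.
Qed.

Definition two_sided f (W : set G) e := forall x v t, K x -> W v -> K t -> `|f (x * v * t)%g - f (x * t)%g| <= e.

Lemma two_sided_rav f W e T : admissible T -> two_sided f W e -> two_sided (rav T f) W e.
Proof.
move=> aT fW x v t Kx Wv Kt; rewrite /rav -mulrBr -sumrB -[X in `|X|]subr0.
apply: avg_dist => // s sT; rewrite subr0 -!(mulgA _ t s).
by apply: fW => //; apply: KM => //; case: aT => _; apply.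
Qed.

(** If [f] stays below the middle value, so do its averages. Otherwise some [f p] is at least this
    value, and for every x the net provides a translate [x * t] where [f] is above [lo] by a quarter
    of the gap; one such term among [size T] raises the lower bound of the average. *)
Lemma rav_shrink f (W : set G) e T (lo hi : R) : admissible T -> 0 < e -> two_sided f W e ->
  (forall y, K y -> exists2 t, t \in T & W (t * y^-1)%g) ->
  (forall x, K x -> lo <= f x <= hi) -> 4 * e <= hi - lo ->
  exists lo' hi', (forall x, K x -> lo' <= rav T f x <= hi') /\
    hi' - lo' <= (1 - (4 * (size T)%:R)^-1) * (hi - lo).
Proof.
move=> aT e0 fW net fb gap; set N : R := (size T)%:R.
have N1 : 1 <= N by rewrite ler1n; case: aT.
have N0 : 0 < N by exact: lt_le_trans N1.
have M0 : (4 * N)^-1 <= 2^-1 by rewrite lef_pV2 ?posrE; lra.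
have g0 : 0 <= hi - lo by lra.
have [[p Kp fp]|np] := pselect (exists2 p, K p & (lo + hi) / 2 <= f p); last first.
  exists lo, ((lo + hi) / 2); split.
    move=> x Kx; apply/andP; split; [apply: avg_ge|apply: avg_le] => // t tT.
      by have /andP[] := fb (x * t)%g (KM Kx (aT.2 _ tT)).
    have := KM Kx (aT.2 _ tT); rewrite leNgt => Kt; apply/negP => h.
    by apply: np; exists (x * t)%g => //; exact: ltW.
  apply: le_trans (_ : 2^-1 * (hi - lo) <= _); first lra.
  by apply: ler_wpM2r => //; lra.
exists (lo + (hi - lo) * (4 * N)^-1), hi; split; last first.
  have -> // : hi - (lo + (hi - lo) * (4 * N)^-1) = (1 - (4 * N)^-1) * (hi - lo).
  by move: (_^-1) => b; ring.
move=> x Kx; apply/andP; split; last first.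
  by apply: avg_le => // t tT; have /andP[] := fb (x * t)%g (KM Kx (aT.2 _ tT)).
(* For y = x^-1 p one has x y = p and x (t y^-1) y = x t, so [two_sided] compares [f (x * t)] with
   [f p]. *)
have [t tT Wt] := net _ (KM (KV Kx) Kp).
have ft : (lo + hi) / 2 - e <= f (x * t)%g.
  have := fW x _ _ Kx Wt (KM (KV Kx) Kp).
  rewrite -(mulgA x) -(mulgA t) mulVg mulg1 mulgA mulgV mul1g => /ler_distlCDr; lra.
rewrite /rav -/N; have sT : lo * N + (f (x * t)%g - lo) <= \sum_(s <- T) f (x * s)%g.
  rewrite (perm_big _ (perm_to_rem tT)) /= big_cons.
  have : lo * (N - 1) <= \sum_(s <- rem t T) f (x * s)%g.
    have -> : N - 1 = (size (rem t T))%:R by rewrite size_rem // /N -[in LHS](prednK aT.1) -natr1 addrK.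
    rewrite mulr_natr -iter_addr_0 -count_predT -big_const_seq.
    by apply: sumr_le => s /mem_rem sT; have /andP[] := fb (x * s)%g (KM Kx (aT.2 _ sT)).
  move: (\sum_(_ <- _) _) => S; lra.
rewrite ler_pdivlMl //; apply: le_trans sT.
have -> : N * (lo + (hi - lo) * (4 * N)^-1) = lo * N + (hi - lo) / 4 by field; rewrite gt_eqF.
by lra.
Qed.

Lemma rav_const f e : cont_on K f -> 0 < e ->
  exists T c, admissible T /\ forall x, K x -> `|rav T f x - c| <= e.
Proof.
move=> cf e0; have e4 : 0 < e / 4 by rewrite divr_gt0.
have [W nW fW] := uniform_two_sided cf e4.
have [T aT net] := finite_net nW.
have [C fC] : exists C, forall x, K x -> `|f x| <= C.
  have /compact_near_coveringP/(_ _ +oo (fun C x => `|f x| <= C) _) H := cK.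
  have : \forall C \near +oo, K `<=` (fun x => `|f x| <= C).
    apply: H => x Kx; have /cvgrPdist_lt/(_ _ ltr01) n1 := cf x Kx.
    exists ([set y | `|f x - f y| < 1], [set C : R | `|f x| + 1 <= C]) => /=.
      by split => //; exact: nbhs_pinfty_ge (num_real _).
    move=> [y C] [/= d1 d2]; apply: le_trans d2.
    by rewrite -[f y](subrK (f x)) addrC; apply: le_trans (ler_normD _ _) _; rewrite lerD2l distrC ltW.
  by move=> /filter_ex[C HC]; exists C.
pose q : R := 1 - (4 * (size T)%:R)^-1.
have N1 : 1 <= (size T)%:R :> R by rewrite ler1n; case: aT.
have q1 : 0 <= q < 1.
  have : 0 < (4 * (size T)%:R)^-1 :> R by rewrite invr_gt0; lra.
  have : (4 * (size T)%:R)^-1 <= 4^-1 :> R by rewrite lef_pV2 ?posrE; lra.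
  rewrite /q; lra.
(* As long as the gap exceeds [e] it shrinks by the factor [q]. The same [W] and [T] serve at every
   stage, since averaging preserves [two_sided]; the maximum accounts for a gap that is already
   small. *)
have step j : exists T' lo hi, [/\ admissible T', (forall x, K x -> lo <= rav T' f x <= hi) &
    hi - lo <= Num.max e (q ^+ j * (2 * C))].
  elim: j => [|j [T' [lo [hi [aT' b gap]]]]].
    exists [:: 1%g], (- C), C; split; first by split=> // t; rewrite inE => /eqP ->.
      by move=> x Kx; rewrite /rav big_seq1 invr1 mul1r mulg1 -ler_norml fC.
    by rewrite le_max expr0 mul1r; apply/orP; right; lra.
  have [small|large] := leP (hi - lo) e.
    by exists T', lo, hi; split=> //; rewrite le_max small.
  have [|lo' [hi' [b' gap']]] := @rav_shrink (rav T' f) W (e / 4) T lo hi aT e4 (two_sided_rav aT' fW) net b.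
    by lra.
  have [T'' aT'' E] := rav_rav f aT aT'.
  exists T'', lo', hi'; split=> // [x Kx|]; first by rewrite -E b'.
  apply: le_trans gap' _; rewrite -/q le_max; apply/orP; right.
  rewrite exprS -mulrA; apply: ler_wpM2l; first by lra.
  by move: gap; rewrite le_max => /orP[|//]; lra.
have [j hj] : exists j, q ^+ j * (2 * C) <= e.
  have c0 : (fun j => q ^+ j * (2 * C)) @ \oo --> (0 : R).
    rewrite -(mul0r (2 * C)); apply: cvgMl; apply: cvg_expr; rewrite ger0_norm; lra.
  have /cvgrPdist_lt/(_ _ e0)[j _ /(_ j (leqnn j))] := c0.
  by exists j; apply: le_trans (ler_norm _) _; rewrite -normrN -sub0r ltW.
have [T' [lo [hi [aT' b gap]]]] := step j; exists T', lo; split=> // x Kx.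
have /andP[l1 l2] := b x Kx; rewrite ger0_norm ?subr_ge0 //.
have : hi - lo <= e by move: gap; rewrite le_max => /orP[|/le_trans]; [|apply].
lra.
Qed.


Lemma lav_const f e : cont_on K f -> 0 < e ->
  exists S c, admissible S /\ forall x, K x -> `|lav S f x - c| <= e.
Proof.
move=> cf e0; have cg : cont_on K (fun x => f (x^-1)%g).
  move=> x Kx; apply: (continuous_comp (f := fun x : G => (x^-1)%g)); first exact: cinv.
  exact/cf/KV.
have [T [c [[T0 TK] Tc]]] := rav_const cg e0.
exists [seq (t^-1)%g | t <- T], c; split.
  by split; [rewrite size_map|move=> _ /mapP[t tT ->]; exact/KV/TK].
move=> x Kx; have := Tc _ (KV Kx); rewrite /rav /lav size_map big_map.
congr (`|_ * _ - _| <= _); apply: eq_bigr => t _; congr f.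
by rewrite -[RHS]invgK; congr (_^-1)%g; rewrite invgM invgK.
Qed.

(* Left averages commute with right averages, which makes the constants approximated by
   either kind of average agree. *)
Definition haar f := sup [set r | exists2 T, admissible T & forall x, K x -> r <= rav T f x].

(** Evaluating [lav S (rav T f)] at 1 in both orders compares every right average with [c];
    [rav_const] shows that the supremum comes close enough from below. *)
Lemma haar_lav f S c d : cont_on K f -> admissible S -> (forall x, K x -> `|lav S f x - c| <= d) ->
  `|haar f - c| <= d.
Proof.
move=> cf aS Sc; rewrite /haar; set A := [set r | _].
have ub r : A r -> r <= c + d.
  move=> [T aT rT]; apply: le_trans (_ : lav S (rav T f) 1%g <= _).
    by apply: avg_ge => // s sS; apply/rT/KM => //; exact: aS.2.
  rewrite lav_rav; have := rav_dist aT K1 Sc; by rewrite ler_distl => /andP[].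
have lb e : 0 < e -> exists2 r, A r & c - d - e <= r.
  move=> e0; have e2 : 0 < e / 2 by rewrite divr_gt0.
  have [T [c' [aT Tc]]] := rav_const cf e2.
  exists (c' - e / 2).
    by exists T => // x /Tc; rewrite ler_distl => /andP[].
  have h1 := lav_dist aS K1 Tc; have h2 := rav_dist aT K1 Sc.
  rewrite -lav_rav in h2; move: h1 h2; rewrite !ler_distl => /andP[h1 h2] /andP[h3 h4]; lra.
have A0 : A !=set0 by have [r Ar _] := lb 1 ltr01; exists r.
rewrite ler_distl; apply/andP; split; last by apply: sup_le_ub => // r /ub.
apply/ler_addgt0Pl => e e0; have [r Ar cr] := lb e e0.
have : r <= sup A by apply: ub_le_sup => //; exists (c + d) => z /ub.
lra.
Qed.

Lemma haar_eq0 (a C : R) : (forall d, 0 < d -> `|a| <= C * d) -> a = 0.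
Proof.
move=> aC; apply/eqP; rewrite -normr_le0; apply/ler_addgt0Pl => e e0; rewrite addr0.
have := aC (e / (`|C| + 1)) _; rewrite divr_gt0 ?ltr_wpDl // => /(_ isT) /le_trans; apply.
rewrite mulrA ler_pdivrMr ?ltr_wpDl // mulrC ler_wpM2l ?ltW //.
by apply: le_lt_trans (ler_norm _) _; rewrite ltrDl.
Qed.

Lemma cont_on_lav S f : admissible S -> cont_on K f -> cont_on K (lav S f).
Proof.
move=> aS cf x Kx; apply: continuousM; first exact: cst_continuous.
have c s : s \in S -> {for x, continuous (fun x => f (s * x)%g)}.
  move=> sS; apply: (continuous_comp (f := fun x : G => (s * x)%g)).
    by apply: continuous_mulg; [exact: cst_continuous|exact: cvg_id].
  by apply/cf/KM => //; exact: aS.2.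
elim: (S) c => [|s S' IH] c.
  by rewrite (_ : (fun y => _) = fun=> 0); [exact: cst_continuous|apply/funext => y; rewrite big_nil].
rewrite (_ : (fun y => _) = fun y => f (s * y)%g + \sum_(s <- S') f (s * y)%g).
  by apply: continuousD; [apply: c; exact: mem_head|apply: IH => t tS; apply: c; rewrite inE tS orbT].
by apply/funext => y; rewrite big_cons.
Qed.

(** For additivity one list must serve two functions: after a left average making [f] almost
    constant, a second one is taken for the averaged [g]; it leaves the first almost constant. *)
Lemma is_mean_haar : is_mean K haar 1.
Proof.
split=> [a f g cf cg|f e cf fe].
  have ch : cont_on K (fun t => a * f t + g t).
    move=> t Kt; apply: (continuousD (f := fun t => a * f t)); last exact: cg.
    by apply: continuousM; [exact: cst_continuous|exact: cf].
  apply/eqP; rewrite -subr_eq0; apply/eqP/(@haar_eq0 _ (2 * `|a| + 2)) => d d0.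
  have [S [c [aS Sc]]] := lav_const cf d0.
  have [S' [c' [aS' Sc']]] := lav_const (cont_on_lav aS cg) d0.
  have [S'' aS'' E] := lav_lav f aS' aS.
  have h1 : forall x, K x -> `|lav S'' f x - c| <= d.
    by move=> x Kx; rewrite -E; exact: lav_dist.
  have h2 : forall x, K x -> `|lav S'' g x - c'| <= d by move=> x Kx; rewrite -E; exact: Sc'.
  have B x : K x -> `|lav S'' (fun t => a * f t + g t) x - (a * c + c')| <= (`|a| + 1) * d.
    move=> Kx; have -> : lav S'' (fun t => a * f t + g t) x = a * lav S'' f x + lav S'' g x.
      by rewrite /lav big_split -mulr_sumr /= mulrDr mulrCA.
    rewrite opprD addrACA -mulrBr; apply: le_trans (ler_normD _ _) _.
    by rewrite mulrDl mul1r normrM; apply: lerD; [apply: ler_wpM2l => //; exact: h1|exact: h2].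
  have H1 := haar_lav cf aS'' h1; have H2 := haar_lav cg aS'' h2.
  have H3 := haar_lav ch aS'' B.
  have -> : haar (fun t => a * f t + g t) - (a * haar f + haar g) =
    (haar (fun t => a * f t + g t) - (a * c + c')) - (a * (haar f - c) + (haar g - c')) by ring.
  apply: le_trans (ler_normB _ _) _.
  have H4 : `|a * (haar f - c) + (haar g - c')| <= (`|a| + 1) * d.
    apply: le_trans (ler_normD _ _) _; rewrite mulrDl mul1r normrM.
    by apply: lerD => //; apply: ler_wpM2l.
  move: H3 H4; lra.
rewrite mul1r; apply/ler_addgt0Pl => d d0; have d2 : 0 < d / 2 by rewrite divr_gt0.
have [S [c [aS Sc]]] := lav_const cf d2; have H1 := haar_lav cf aS Sc.
have : `|lav S f 1%g| <= e.
  rewrite -[X in `|X|]subr0; apply: lav_dist => // y Ky; rewrite subr0; exact: fe.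
by have := Sc _ K1; move: H1; rewrite !ler_distl ler_norml => *; rewrite ler_norml; lra.
Qed.

(** Left averages commute with right translations, so [f] and its translate are approximated by the
    same constant. *)
Lemma haar_mulr f k : cont_on K f -> K k -> haar (fun t => f (t * k)%g) = haar f.
Proof.
move=> cf Kk; apply/eqP; rewrite -subr_eq0; apply/eqP/(@haar_eq0 _ 2) => d d0.
have cg : cont_on K (fun t => f (t * k)%g).
  move=> t Kt; apply: (continuous_comp (f := fun t : G => (t * k)%g)).
    by apply: continuous_mulg; [exact: cvg_id|exact: cst_continuous].
  exact/cf/KM.
have [S [c [aS Sc]]] := lav_const cf d0; have H1 := haar_lav cf aS Sc.
have H2 : `|haar (fun t => f (t * k)%g) - c| <= d.
  apply: (haar_lav cg aS) => x Kx; have := Sc _ (KM Kx Kk); rewrite /lav.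
  by congr (`|_ * _ - _| <= _); apply: eq_bigr => s _; rewrite mulgA.
rewrite (_ : _ - _ = (haar (fun t => f (t * k)%g) - c) - (haar f - c)); last by ring.
by apply: le_trans (ler_normB _ _) _; rewrite mulr2n mulrDl mul1r lerD.
Qed.

End haar.

(** * The stabilizer *)

Section pullback.
Context {R : realType} {p q : nat}.
Variables (A : set 'rV[R]_p) (B : set 'rV[R]_q) (kp : 'rV[R]_p -> 'rV[R]_q) (f : 'rV[R]_q -> R).
Hypotheses (oA : open A) (oB : open B) (AB : forall u, A u -> B (kp u)).
Hypotheses (skp : smooth_on A kp) (sf : smooth_on B f).

Lemma derive_pullback v u : A u -> 'D_v (fun u => f (kp u)) u = 'D_('D_v kp u) f (kp u).
Proof.
move=> Au; apply: derive_compE; first exact: smooth_differentiableV oA Au skp.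
exact: smooth_differentiable oB (AB Au) sf.
Qed.

Lemma derive2_pullback v w u : A u -> 'D_v ('D_w (fun u => f (kp u))) u =
  'D_('D_v ('D_w kp) u) f (kp u) + 'D_('D_v kp u) ('D_('D_w kp u) f) (kp u).
Proof.
move=> Au; pose F (d : 'rV[R]_q) z := \sum_i d 0 i * 'D_'e_i f z.
have FL d z : F d z = \sum_i d 0 i * F 'e_i z.
  by apply: eq_bigr => i _; congr (_ * _); exact: esym (sum_delta (W := R^o) (fun l => 'D_'e_l f z) i).
have FE d z : B z -> F d z = 'D_d f z.
  move=> Bz; exact: esym (derive_coord d (smooth_differentiable oB Bz sf)).
have sF d : smooth_on B (F d).
  by apply: (smooth_eq oB _ (smooth_derive d sf)) => z Bz; rewrite FE.
have E t : A t -> 'D_w (fun u => f (kp u)) t = F ('D_w kp t) (kp t).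
  by move=> At; rewrite derive_pullback // FE //; exact: AB.
apply: etrans (near_derive v oA E Au) _.
apply: etrans (derive_family oA oB AB skp (smooth_derive w skp) FL sF v Au) _.
rewrite FE; last exact: AB.
by congr (_ + _); apply: (near_derive _ oB (FE _)); exact: AB.
Qed.

End pullback.

Lemma levi_pullback {R : realType} {n : nat} (A B : set 'rV[R]_(n + n)) kp f u v w :
  open A -> open B -> (forall u, A u -> B (kp u)) -> smooth_on A kp -> smooth_on B f ->
  (forall u v, A u -> 'D_(mul_i v) kp u = mul_i ('D_v kp u)) -> A u ->
  levi (fun u => f (kp u)) u v w = levi f (kp u) ('D_v kp u) ('D_w kp u).
Proof.
move=> oA oB AB sk sf hk Au.
have D2 a b : 'D_a ('D_(mul_i b) (fun u => f (kp u))) u =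
    'D_(mul_i ('D_a ('D_b kp) u)) f (kp u) + 'D_('D_a kp u) ('D_(mul_i ('D_b kp u)) f) (kp u).
  apply: etrans (derive2_pullback oA oB AB sk sf a (mul_i b) Au) _.
  have E : 'D_a ('D_(mul_i b) kp) u = mul_i ('D_a ('D_b kp) u).
    apply: etrans (near_deriveV a oA (fun y => @hk y b) Au) _.
    exact: derive_mul_i oA Au (smooth_derive b sk).
  by rewrite E hk.
have A1 (s s' t t' m m' : R) : s = m + t -> s' = m' + t' -> m = m' ->
  - 2^-1 * (s - s') = - 2^-1 * (t - t') by move=> -> -> ->; ring.
apply: A1 (D2 v w) (D2 w v) _.
exact: (congr1 (fun z => 'D_(mul_i z) f (kp u)) (schwarzV v w oA Au sk)).
Qed.

Section stabilizer.
Context {R : realType} {n k : nat} {X : topologicalType} {M : charts R (n + n) X}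
  {om : form2 R (n + n) X} {G : topGroupType} {MG : charts R k G} {act : G -> X -> X}
  {mu : X -> {linear 'rV[R]_k -> R^o}}.
Hypothesis H : hamiltonian_kahler M om MG act mu.
Let L := hamiltonian_group H.
Let aM := ham_atlas H.
Let aG := ham_group_atlas H.
Let aP := atlas_prod aG aM.
Local Notation V := 'rV[R]_(n + n).
Variable x : X.
Let x0 := chart M x x.

Definition stab : set G := [set g | act g x = x].

Lemma continuous_act : continuous (fun p : G * X => act p.1 p.2).
Proof. by have [] := act_smooth L. Qed.

Lemma continuous_mul : continuous (fun p : G * G => (p.1 * p.2)%g).
Proof. by have [_ [c _] _] := closed_subgroup_lie L. Qed.

Lemma continuous_inv : continuous (fun g : G => (g^-1)%g).
Proof. by have [_ _ [c _]] := closed_subgroup_lie L. Qed.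

(** By properness of the action, as the projection to [G] of the preimage of the point [(x, x)]. *)
Lemma stab_compact : compact stab.
Proof.
have c1 := act_proper L (@compact_set1 _ (x, x)).
rewrite (_ : stab = fst @` ((fun p : G * X => (act p.1 p.2, p.2)) @^-1` [set (x, x)])).
  by apply: continuous_compact c1; apply: continuous_subspaceT => p; exact: cvg_fst.
apply/seteqP; split=> [g gx|_ [[g y] /= [gx yx] <-]]; last by rewrite /stab /= -[in LHS]yx.
by exists (g, x) => //=; rewrite gx.
Qed.

Lemma stab1 : stab 1%g. Proof. exact: act1 H x. Qed.
Lemma stabM g h : stab g -> stab h -> stab (g * h)%g.
Proof. by rewrite /stab /= => gx hx; rewrite (actM H) hx. Qed.
Lemma stabV g : stab g -> stab (g^-1)%g.
Proof. by rewrite /stab /= => gx; rewrite -{1}gx (actK H). Qed.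

Local Notation kap g := (rep M M (act g) x x).
Local Notation kdom g := (rdom M M (act g) x x).

Lemma x0_im : chart_im M x x0. Proof. exact/im_chart/(atlas_center aM). Qed.

Lemma x0K : ichart M x x0 = x. Proof. exact/(atlasK aM)/(atlas_center aM). Qed.

Let oim : open (chart_im M x). Proof. exact: atlas_im_open. Qed.

Lemma stab_tube (d : R) : 0 < d -> exists d', [/\ 0 < d', d' <= d &
  forall g u, stab g -> ball x0 d' u -> kdom g u /\ ball x0 d (kap g u)].
Proof.
move=> d0; have C := (compact_near_coveringP stab).1 stab_compact _ (nbhs x0)
  (fun u g => kdom g u /\ ball x0 d (kap g u)) (nbhs_filter x0).
have /nbhs_ballP[d1 /= d10 D1] : \forall u \near x0, stab `<=` (fun g => kdom g u /\ ball x0 d (kap g u)).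
  apply: C => g gx.
  have c1 : {for (g, x0), continuous (fun p : G * V => act p.1 (ichart M x p.2))}.
    apply: (continuous_comp (f := fun p : G * V => (p.1, ichart M x p.2)) (g := fun p => act p.1 p.2)).
      have cs : {for (g, x0), continuous (fun p : G * V => ichart M x p.2)}.
        apply: (continuous_comp (f := snd)); [exact: cvg_snd|exact/(atlas_icontinuous aM)/x0_im].
      exact: (@cvg_pair _ _ _ _ _ _ (nbhs_filter _) (nbhs_filter _) (nbhs_filter _) _ _ cvg_fst cs).
    exact: continuous_act.
  have xx : act g (ichart M x x0) = x by rewrite x0K.
  have n1 : nbhs (act g (ichart M x x0)) (chart_dom M x `&` (chart M x @^-1` ball x0 d)).
    rewrite xx; apply: filterI.
      by apply: open_nbhs_nbhs; split; [exact: atlas_open|exact: atlas_center].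
    apply: (atlas_continuous aM (atlas_center aM x)); exact: nbhsx_ballx.
  have [[P Q] /= [nP nQ] PQ] := c1 _ n1.
  exists (P, Q `&` chart_im M x) => /=.
    by split=> //; apply: filterI => //; apply: open_nbhs_nbhs; split=> //; exact: x0_im.
  by move=> [g' u] /= [Pg [Qu iu]]; have [h1 h2] := PQ (g', u) (conj Pg Qu).
exists (Num.min d1 d); split; [by rewrite lt_min d10|by rewrite ge_min lexx orbT|].
move=> g u gx ux; apply: D1 => //; apply: le_ball ux; by rewrite ge_min lexx.
Qed.

(** The mean over the stabilizer of the translates of [f]. The conditions on derivatives are phrased
    so that a first or second order identity, satisfied by all translates with one value, is
    inherited by the mean. *)
Lemma stab_average (d : R) f : 0 < d -> ball x0 d `<=` chart_im M x -> smooth_on (ball x0 d) f ->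
  exists d' (fb : V -> R), [/\ 0 < d', d' <= d, smooth_on (ball x0 d') fb &
  [/\ forall g u, stab g -> ball x0 d' u -> kdom g u /\ ball x0 d (kap g u),
    forall v u c, ball x0 d' u -> (forall g, stab g -> 'D_v (fun u => f (kap g u)) u = c) ->
      'D_v fb u = c,
    forall v w v' w' u c, ball x0 d' u -> (forall g, stab g ->
        'D_v ('D_w (fun u => f (kap g u))) u - 'D_v' ('D_w' (fun u => f (kap g u))) u = c) ->
      'D_v ('D_w fb) u - 'D_v' ('D_w' fb) u = c &
    forall g u, stab g -> ball x0 d' u -> ball x0 d' (kap g u) -> fb (kap g u) = fb u]].
Proof.
move=> d0 dim sf; have [d' [d'0 d'd tube]] := stab_tube d0.
pose B : set V := ball x0 d'; have oB : open B by exact: ball_open.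
pose F g u := f (kap g u).
(* Near each g0 the translate depends on g through its coordinates in the chart of g0, which is the
   situation of [jC_k_smooth]. *)
have jF j : jC_k stab j B F.
  apply: jC_k_smooth => // g0 u0 g0x Bu0.
  pose r := rep (prod_charts MG M) M (@act2 X G act) (g0, x) x.
  pose D := rdom (prod_charts MG M) M (@act2 X G act) (g0, x) x.
  have oD : open D by refine (open_rdom aP aM (g0, x) x (smooth_act2 H).1).
  have sr : smooth_on D r by refine (smooth_rep aP (g0, x) x (smooth_act2 H)).
  have od : open (ball x0 d) by exact: ball_open.
  pose C := D `&` [set z | ball x0 d (r z)].
  have oC : open C.
    rewrite openE => z [Dz bz]; have [cr _] := sr 0%N.
    have n1 := cr z Dz _ (open_nbhs_nbhs (conj od bz)).
    exact: filterI (open_nbhs_nbhs (conj oD Dz)) n1.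
  have E g u : chart_dom MG g0 g -> r (row_mx (chart MG g0 g) u) = kap g u.
    by move=> gd; rewrite /r /rep /act2 /= row_mxKl row_mxKr (atlasK aG).
  exists (chart MG g0), C, (fun z => f (r z)); split=> //.
  - by apply: (atlas_continuous aG); exact: atlas_center.
  - by apply: smooth_comp oC od _ sf _; [move=> z []|apply: smooth_sub sr => z []].
  - have [[iu du] bu] := tube g0 u0 g0x Bu0.
    have gg := atlas_center aG g0.
    split; last by rewrite /= E.
    split; first by rewrite prod_imE /= row_mxKl row_mxKr; split=> //; exact: im_chart.
    by rewrite /act2 /= row_mxKl row_mxKr (atlasK aG).
  - apply: filterS (open_nbhs_nbhs (conj (atlas_open aG g0) (atlas_center aG g0))).
    by move=> g gd u _; rewrite E.
have hm := is_mean_haar stab_compact stab1 stabM stabV continuous_mul continuous_inv (R := R).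
pose hr := @haar R G stab; pose fb u := hr (fun g => F g u).
have h0 c g : cont_on stab g -> (forall t, stab t -> g t = c) -> hr g = c.
  move=> cg gc; have := haar_lav stab_compact stab1 stabM stabV continuous_mul continuous_inv
    (S := [:: 1%g]) (c := c) (d := 0) cg.
  rewrite normr_le0 subr_eq0 => E; apply/eqP/E; first by split=> // t; rewrite inE => /eqP ->; exact: stab1.
  by move=> t tx; rewrite /lav big_seq1 invr1 mul1r mul1g gc // subrr normr0.
have jD (v : V) : forall j, jC_k stab j B (fun g u => 'D_v (F g) u).
  by move=> j; have [_ /(_ v)[]] := jF j.+1.
have D1 v u : B u -> 'D_v fb u = hr (fun g => 'D_v (F g) u).
  move=> Bu; have d1 := is_derive_mean stab_compact hm ltr01 v oB (jF 1%N) Bu.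
  by apply: derive_val.
have D2 v w u : B u -> 'D_v ('D_w fb) u = hr (fun g => 'D_v ('D_w (F g)) u).
  move=> Bu; apply: etrans (near_derive v oB (D1 w) Bu) _.
  have d1 := is_derive_mean stab_compact hm ltr01 v oB (jD w 1%N) Bu.
  by apply: derive_val.
have cD v u : B u -> cont_on stab (fun g => 'D_v (F g) u).
  by move=> Bu; exact: jC_k_cont_on (jD v 0%N) Bu.
have cDD v w u : B u -> cont_on stab (fun g => 'D_v ('D_w (F g)) u).
  move=> Bu; have [_ /(_ v)[_ j1]] := jD w 1%N.
  have j0 : jC_k stab 0 B (fun g => 'D_v ('D_w (F g))) := j1.
  exact: jC_k_cont_on j0 Bu.
exists d', fb; split=> //; first exact: (smooth_mean stab_compact hm ltr01 oB jF).
split=> // [v u c Bu Fc|v w v' w' u c Bu Fc|g u gx Bu Bgu].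
- by rewrite D1 //; apply: h0 => //; exact: cD.
- have A1 (a b s t m : R) : a = s -> b = t -> m = -1 * t + s -> a - b = m by move=> -> -> ->; ring.
  have A2 (a b : R) : a - b = c -> -1 * b + a = c by move=> <-; ring.
  have c1 := cDD v w u Bu; have c2 := cDD v' w' u Bu.
  apply: etrans (A1 _ _ _ _ _ (D2 v w u Bu) (D2 v' w' u Bu) (mean_linear hm (-1) c2 c1)) _.
  apply: h0 => [t tx|t tx]; last exact/A2/Fc.
  apply: continuousD; last exact: (c1 t tx).
  by apply: continuousM; [exact: cst_continuous|exact: (c2 t tx)].
- have cu : cont_on stab (fun g => F g u) by exact: jC_k_cont_on (jF 0%N) Bu.
  apply: etrans _ (haar_mulr stab_compact stab1 stabM stabV continuous_mul continuous_inv cu gx).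
  have E : (fun h => F h (kap g u)) = (fun t => F (t * g)%g u) :> (G -> R).
    apply/funext => h; rewrite /F /rep (actM H).
    have [ru _] := tube g u gx Bu; have := rep_ichart aM ru.
    by rewrite /rep => ->.
  exact: (congr1 (@haar R G stab) E).
Qed.

End stabilizer.

(** * Discrete approximation of a flow *)

Section discrete_flow.
Context {R : realType} {m : nat}.
Local Notation V := 'rV[R]_m.
Variables (x0 : V) (r C s : R) (Psi Z : V -> V).
Hypotheses (C0 : 0 < C) (s01 : 0 <= s <= 1).
Hypothesis step : forall u, ball x0 r u -> `|Psi u - u - s *: Z u| <= C * s ^+ 2.
Hypothesis Zbound : forall u, ball x0 r u -> `|Z u| <= C.
Hypothesis Zlip : forall u u', ball x0 r u -> ball x0 r u' -> `|Z u - Z u'| <= C * `|u - u'|.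

(** [Psi] is an approximate step of time [s] along the field [Z]. The estimate depends on the total
    time js only, and so survives refining the steps; no integral curve is used. *)
Lemma discrete_flow j u rho : ball u rho `<=` ball x0 r -> 2 * C * (j%:R * s) < rho ->
  [/\ ball x0 r (iter j Psi u), `|iter j Psi u - u| <= 2 * C * (j%:R * s) &
  `|iter j Psi u - u - (j%:R * s) *: Z u| <= (2 * C ^+ 2 + C) * (j%:R * s) ^+ 2].
Proof.
move=> ub; have s0 : 0 <= s by case/andP: s01.
elim: j => [|j IH] jr.
  rewrite /= mul0r mulr0 in jr *; rewrite subrr scale0r subrr normr0 expr0n mulr0; split=> //.
  by apply: ub; exact: ballxx.
have js : j.+1%:R * s = j%:R * s + s by rewrite -natr1 mulrDl mul1r.
have C2 : 0 <= 2 * C * s by rewrite !mulr_ge0 // ltW.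
have [|ib d1 d2] := IH; first by move: jr; rewrite js mulrDr; lra.
have u0 : ball x0 r u.
  by apply/ub/ballxx; apply: le_lt_trans jr; rewrite !mulr_ge0 // ltW.
rewrite js; set t := j%:R * s in d1 d2 *; have t0 : 0 <= t by rewrite mulr_ge0.
set y := iter j Psi u in ib d1 d2 *.
have st := step ib; have zb := Zbound ib; have zl := Zlip ib u0.
have st2 : `|Psi y - y| <= 2 * C * s.
  rewrite -[Psi y - y](subrK (s *: Z y)); apply: le_trans (ler_normD _ _) _.
  rewrite normrZ ger0_norm //.
  have : s * `|Z y| <= s * C by apply: ler_wpM2l.
  have : C * s ^+ 2 <= C * s.
    by apply: ler_wpM2l; [exact: ltW|rewrite expr2 ler_piMr //; case/andP: s01].
  lra.
have d1' : `|Psi y - u| <= 2 * C * (t + s).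
  rewrite -[Psi y - u](subrKA y); apply: le_trans (ler_normD _ _) _; lra.
split=> //.
- by apply: ub; rewrite -ball_normE /= distrC; apply: le_lt_trans d1' _; rewrite -js.
- have -> : iter j.+1 Psi u - u - (t + s) *: Z u =
    (Psi y - y - s *: Z y) + (y - u - t *: Z u) + s *: (Z y - Z u).
    rewrite iterS -/y scalerDl scalerBr.
    move: (s *: Z y) (s *: Z u) (t *: Z u) (Psi y) => a b c q.
    by apply/rowP => i; rewrite !mxE; ring.
  apply: le_trans (ler_normD _ _) _; rewrite normrZ ger0_norm //.
  have n1 := ler_normD (Psi y - y - s *: Z y) (y - u - t *: Z u).
  have h1 : s * `|Z y - Z u| <= s * (C * (2 * C * t)).
    apply: ler_wpM2l => //; apply: le_trans zl _; apply: ler_wpM2l => //; exact: ltW.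
  have h2 : 0 <= C * s * t by rewrite !mulr_ge0 // ltW.
  have h3 : 0 <= C ^+ 2 * s * t by rewrite !mulr_ge0 ?sqr_ge0 // ltW.
  have h4 : 0 <= C ^+ 2 * s ^+ 2 by rewrite mulr_ge0 ?sqr_ge0 // ltW.
  have E : (2 * C ^+ 2 + C) * (t + s) ^+ 2 = (2 * C ^+ 2 + C) * t ^+ 2 + C * s ^+ 2 +
    s * (C * (2 * C * t)) + 2 * (C ^+ 2 * s * t) + 2 * (C * s * t) + 2 * (C ^+ 2 * s ^+ 2) by ring.
  rewrite E; lra.
Qed.

(** At a zero of [Z] one step adds its own error C s^2 and a drift proportional to the distance
    already covered, so the total is of order s^2 j, that is, of order s for bounded time. *)
Lemma discrete_flow0 j : Z x0 = 0 -> 2 * C * (j%:R * s) <= 1 -> 2 * C * (j%:R * s) < r ->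
  `|iter j Psi x0 - x0| <= 2 * C * s ^+ 2 * j%:R.
Proof.
move=> Z0; have s0 : 0 <= s by case/andP: s01.
elim: j => [|j IH] j1 jr; first by rewrite mulr0 subrr normr0.
have js : j.+1%:R * s = j%:R * s + s by rewrite -natr1 mulrDl mul1r.
have C2 : 0 <= 2 * C * s by rewrite !mulr_ge0 // ltW.
have j1' : 2 * C * (j%:R * s) <= 1 by move: j1; rewrite js mulrDr; lra.
have jr' : 2 * C * (j%:R * s) < r by move: jr; rewrite js mulrDr; lra.
have d := IH j1' jr'; have [ib _ _] := discrete_flow (fun u h => h) jr'.
have r0 : 0 < r by apply: le_lt_trans jr'; rewrite !mulr_ge0 // ltW.
have st := step ib; have zl := Zlip ib (ballxx x0 r0); rewrite Z0 subr0 in zl.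
set y := iter j Psi x0 in ib d st zl *.
rewrite iterS -/y (_ : Psi y - x0 = (Psi y - y - s *: Z y) + (y - x0 + s *: Z y)); last first.
  by move: (s *: Z y) (Psi y) => a b; apply/rowP => i; rewrite !mxE; ring.
apply: le_trans (ler_normD _ _) _; have n1 := ler_normD (y - x0) (s *: Z y).
rewrite normrZ ger0_norm // in n1.
have h1 : s * `|Z y| <= s * (C * (2 * C * s ^+ 2 * j%:R)).
  apply: ler_wpM2l => //; apply: le_trans zl _; apply: ler_wpM2l => //; exact: ltW.
have h2 : s * (C * (2 * C * s ^+ 2 * j%:R)) <= C * s ^+ 2.
  have -> : s * (C * (2 * C * s ^+ 2 * j%:R)) = C * s ^+ 2 * (2 * C * (j%:R * s)) by ring.
  by rewrite ler_piMr // mulr_ge0 ?sqr_ge0 // ltW.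
by rewrite -natr1; lra.
Qed.

End discrete_flow.

Section taylor.
Context {R : realType} {m : nat}.
Local Notation V := 'rV[R]_m.

Lemma taylor2 (A : set V) (f : V -> R) u v (h C : R) : open A -> smooth_on A f -> 0 <= h ->
  (forall s : R, 0 <= s <= h -> A (u + s *: v)) ->
  (forall s : R, 0 <= s <= h -> `|'D_v ('D_v f) (u + s *: v)| <= C) ->
  `|f (u + h *: v) - f u - h * 'D_v f u| <= C * h ^+ 2.
Proof.
move=> oA sf h0 Av fC.
have [|s sh ->] := @mvt_line _ _ f u v h h0.
  by move=> s /Av; exact: smooth_derivable.
have [s0 sh'] : 0 <= s /\ s <= h by case/andP: sh.
rewrite -mulrBr; have [|s' ss ->] := @mvt_line _ _ ('D_v f) u v s s0.
  move=> s' /andP[s1 s2]; apply: smooth_derivable (smooth_derive v sf) _.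
  by apply: Av; rewrite s1 (le_trans s2).
have : `|'D_v ('D_v f) (u + s' *: v)| <= C.
  by apply: fC; case/andP: ss => -> /le_trans ->.
move: ('D_v ('D_v f) _) => d dC.
rewrite normrM normrM (ger0_norm h0) (ger0_norm s0) expr2.
have C0 : 0 <= C := le_trans (normr_ge0 _) dC.
have : s * `|d| <= h * C by apply: ler_pM.
move=> /(ler_wpM2l h0); lra.
Qed.


Lemma lipschitz_ball (x : V) (e C : R) (f : V -> R) : smooth_on (ball x e) f ->
  (forall u, ball x e u -> forall j, `|'D_'e_j f u| <= C) ->
  forall u u', ball x e u -> ball x e u' -> `|f u - f u'| <= m%:R * C * `|u - u'|.
Proof.
move=> sf fC u u' Bu Bu'; have oB : open (ball x e) by exact: ball_open.
have Bs (s : R) : 0 <= s <= 1 -> ball x e (u' + s *: (u - u')).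
  move=> /andP[s0 s1]; move: Bu Bu'; rewrite -!ball_normE /= => h h'.
  have -> : x - (u' + s *: (u - u')) = s *: (x - u) + (1 - s) *: (x - u').
    by apply/rowP => i; rewrite !mxE; ring.
  apply: le_lt_trans (ler_normD _ _) _; rewrite !normrZ !ger0_norm ?subr_ge0 //.
  have [->|sn] := eqVneq s 0; first by rewrite mul0r add0r subr0 mul1r.
  have s0' : 0 < s by rewrite lt_def sn.
  have : s * `|x - u| < s * e by rewrite ltr_pM2l.
  have : (1 - s) * `|x - u'| <= (1 - s) * e by apply: ler_wpM2l; [rewrite subr_ge0|exact: ltW].
  lra.
have [|s sh] := @mvt_line _ _ f u' (u - u') 1 ler01.
  by move=> s /Bs; exact: smooth_derivable.
have -> : u' + 1 *: (u - u') = u by rewrite scale1r addrC subrK.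
rewrite mul1r => ->.
rewrite (derive_coord _ (smooth_differentiable oB (Bs s sh) sf)).
apply: le_trans (ler_norm_sum _ _ _) _.
apply: le_trans (_ : \sum_(i < m) C * `|u - u'| <= _).
  apply: ler_sum => i _; rewrite normrM mulrC; apply: ler_pM => //; first exact: fC (Bs s sh) i.
  exact: rV_norm_coord.
by rewrite sumr_const card_ord -mulrA mulr_natl.
Qed.

End taylor.

(** * Fields of isotropy vectors and limits in the stabilizer *)

Section isotropy.
Context {R : realType} {n k : nat} {X : topologicalType} {M : charts R (n + n) X}
  {om : form2 R (n + n) X} {G : topGroupType} {MG : charts R k G} {act : G -> X -> X}
  {mu : X -> {linear 'rV[R]_k -> R^o}}.
Hypothesis H : hamiltonian_kahler M om MG act mu.
Let L := hamiltonian_group H.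
Let aM := ham_atlas H.
Let aG := ham_group_atlas H.
Local Notation V := 'rV[R]_(n + n).
Variables (x : X) (v : 'rV[R]_k).
Let x0 := chart M x x.
Let e1 := chart MG 1%g 1%g.
Local Notation Z := (@field R n k X M G MG act x v).
Local Notation flow := (@flow R n k X M G MG act x).
Local Notation flow_dom := (@flow_dom R n k X M G MG act x).
Local Notation kap g := (rep M M (act g) x x).

Lemma flow_taylor (d : R) : 0 < d -> ball x0 d `<=` chart_im M x -> exists r C : R,
  [/\ 0 < r, r <= d, 0 < C &
  [/\ forall s u, 0 <= s <= r -> ball x0 r u -> flow_dom (row_mx (e1 + s *: v) u) /\
        `|flow (row_mx (e1 + s *: v) u) - u - s *: Z u| <= C * s ^+ 2,
    forall u, ball x0 r u -> `|Z u| <= C &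
    forall u u', ball x0 r u -> ball x0 r u' -> `|Z u - Z u'| <= C * `|u - u'|]].
Proof.
move=> d0 dim; have xi : chart_im M x x0 by exact/im_chart/(atlas_center aM).
have od : open flow_dom := @open_flow _ _ _ _ _ _ _ _ _ _ H x.
pose z0 := row_mx e1 x0; pose w : 'rV[R]_(k + (n + n)) := row_mx v 0.
have /nbhs_ballP[e /= e0 eD] := open_nbhs_nbhs (conj od (flow_dom1 H xi)).
have sfi i : smooth_on (ball z0 e) (fun z => flow z 0 i).
  by have := (smooth_coordP _ od).1 (smooth_flow H x) i; apply: smooth_sub.
have [M1 [d1 [M10 d10 d1e HM1]]] := local_bound e0 (fun i => smooth_derive w (smooth_derive w (sfi i))).
have oB : open (ball x0 d) by exact: ball_open.
have sZ : smooth_on (ball x0 d) Z := smooth_sub dim (smooth_field H x v).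
have sZi i := (smooth_coordP _ oB).1 sZ i.
have [M2 [d2 [M20 d20 d2e HM2]]] := local_bound d0 sZi.
have [M3 [d3 [M30 d30 d3e HM3]]] := local_bound (I := ('I_(n + n) * 'I_(n + n))%type)
  (f := fun ij => 'D_'e_ij.2 (fun u => Z u 0 ij.1)) d0 (fun ij => smooth_derive _ (sZi ij.1)).
pose r := Num.min (Num.min d2 d3) (d1 / (`|v| + 1)).
have v1 : 0 < `|v| + 1 by rewrite ltr_wpDl.
have r0 : 0 < r by rewrite !lt_min d20 d30 divr_gt0.
have r2 : r <= d2 by rewrite !ge_min lexx.
have r3 : r <= d3 by rewrite !ge_min lexx orbT.
have r1 : r * (`|v| + 1) <= d1 by rewrite -ler_pdivlMr // ge_min lexx orbT.
have rd1 : r <= d1 by apply: le_trans r1; rewrite ler_peMr ?(ltW r0) // lerDr.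
have rd : r <= d by exact: le_trans r2 d2e.
pose C := 1 + M1 + M2 + (n + n)%:R * M3.
have nM : 0 <= (n + n)%:R * M3 by rewrite mulr_ge0.
have C0 : 0 < C by rewrite /C; lra.
exists r, C; split=> //.
have zb (s : R) u : 0 <= s <= r -> ball x0 r u -> ball z0 d1 (row_mx (e1 + s *: v) u).
  move=> /andP[s0 sr]; rewrite -!ball_normE /= => ub.
  have -> : z0 - row_mx (e1 + s *: v) u = row_mx (- (s *: v)) (x0 - u).
    by rewrite opp_row_mx add_row_mx opprD addNKr.
  apply: rV_norm_lt => // i; case: (split_ordP i) => j ->; rewrite ?row_mxEl ?row_mxEr.
    apply: le_lt_trans (rV_norm_coord _ j) _; rewrite normrN normrZ ger0_norm //.
    apply: le_lt_trans (_ : r * `|v| < _); first by apply: ler_wpM2r.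
    by apply: lt_le_trans r1; rewrite mulrDr mulr1 ltrDl.
  by apply: le_lt_trans (rV_norm_coord _ j) _; exact: lt_le_trans rd1.
split=> [s u sr ub|u ub|u u' ub ub'].
- have zu := zb s u sr ub; have [s0 _] : 0 <= s /\ s <= r by case/andP: sr.
  split; first by apply: eD; exact: le_ball d1e _ zu.
  apply: le_trans (_ : M1 * s ^+ 2 <= _); last by apply: ler_wpM2r; [exact: sqr_ge0|rewrite /C; lra].
  have E (s' : R) : row_mx (e1 + s' *: v) u = row_mx e1 u + s' *: w.
    by rewrite scale_row_mx scaler0 add_row_mx addr0.
  have ui : chart_im M x u by apply: dim; exact: le_ball rd _ ub.
  have f1 : flow (row_mx e1 u) = u by rewrite flowE /rep (e1K H) (act1 H) (ichartK aM).
  apply: rV_norm_le => [|i]; first by rewrite mulr_ge0 // sqr_ge0.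
  have zu' (s' : R) : 0 <= s' <= s -> ball z0 d1 (row_mx e1 u + s' *: w).
    move=> /andP[s0' ss']; rewrite -E; apply: zb => //.
    by rewrite s0' (le_trans ss') //; case/andP: sr.
  have oz : open (ball z0 d1) by exact: ball_open.
  have := @taylor2 _ _ (ball z0 d1) (fun z => flow z 0 i) (row_mx e1 u) w s M1 oz
    (smooth_sub (le_ball d1e) (sfi i)) s0 zu' (fun s' h => HM1 _ (zu' s' h) i).
  rewrite -E f1.
  have du : ball z0 e (row_mx e1 u).
    by have := zu' 0; rewrite scale0r addr0 => h; apply: le_ball d1e _ _; apply: h; rewrite lexx.
  have -> : 'D_w (fun z => flow z 0 i) (row_mx e1 u) = Z u 0 i.
    apply: etrans (derive_coordE i (smooth_derivable (v := w) (smooth_flow H x) (eD _ du))) _.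
    by rewrite (field_flow H v ui).
  by rewrite !mxE.
- apply: le_trans (_ : M2 <= _); last by rewrite /C; lra.
  by apply: rV_norm_le => // i; apply: HM2; exact: le_ball r2 _ ub.
- apply: le_trans (_ : (n + n)%:R * M3 * `|u - u'| <= _).
    apply: rV_norm_le => [|i]; first by rewrite mulr_ge0.
    have := @lipschitz_ball R _ x0 d3 M3 (fun u => Z u 0 i) (smooth_sub (le_ball d3e) (sZi i))
      (fun u h j => HM3 u h (i, j)) u u' (le_ball r3 ub) (le_ball r3 ub').
    by rewrite !mxE.
  by apply: ler_wpM2r => //; rewrite /C; lra.
Qed.


(** Combined with properness, it extracts a cluster point from group elements whose effect on given
    points converges. *)
Lemma sequence_compact (a : nat -> X) y : a @ \oo --> y -> compact (y |` range a).
Proof.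
move=> ay; apply/compact_near_coveringP => J F P FF HP.
have [[U Q] /= [nU FQ] UQ] := HP y (or_introl erefl).
have [N _ aN] := ay _ nU.
have [Q' FQ' HQ'] : exists2 Q', F Q' & forall j, (j < N)%N -> forall i, Q' i -> P i (a j).
  elim: (N) => [|m [Q' FQ' HQ']]; first by exists setT => //; exact: filterT.
  have [[U1 Q1] /= [nU1 FQ1] UQ1] := HP (a m) (or_intror (ex_intro2 _ _ m I erefl)).
  exists (Q' `&` Q1); first exact: filterI.
  move=> j; rewrite ltnS leq_eqVlt => /orP[/eqP -> i [_ q]|jm i [q _]]; last exact: HQ'.
  by apply: (UQ1 (a m, i)); split=> //; exact: nbhs_singleton.
apply: filterS (filterI FQ FQ') => i [Qi Qi'] _ [->|[j _ <-]].
  by apply: (UQ (y, i)); split=> //; exact: nbhs_singleton.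
have [jN|Nj] := ltnP j N; first exact: HQ'.
by apply: (UQ (a j, i)); split=> //; exact: (aN j Nj).
Qed.

(* [g] is a limit of [gamma(t v / N)^N] as [N] grows: these powers move [x] by O(1/N). *)
Lemma isotropy_point (d : R) : 0 < d -> ball x0 d `<=` chart_im M x -> Z x0 = 0 ->
  exists r, [/\ 0 < r, r <= d & forall u, ball x0 r u -> exists D t0, [/\ 0 < D, 0 < t0 &
    forall t, 0 < t < t0 -> exists g, [/\ @stab X G act x g, rdom M M (act g) x x u &
      `|kap g u - u - t *: Z u| <= D * t ^+ 2]]].
Proof.
move=> d0 dim Z0; have [r [C [r0 rd C0 [step Zb Zl]]]] := flow_taylor d0 dim.
have [r1 [r10 r1r tube]] := stab_tube H x r0.
exists r1; split=> //; first exact: le_trans rd.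
move=> u ub; have [rho rho0 urho] : exists2 rho, 0 < rho & ball u rho `<=` ball x0 r.
  have := ball_open x0 r; rewrite openE => /(_ u (le_ball r1r ub)) /nbhs_ballP[e /= e0 eB].
  by exists e.
pose D := 2 * C ^+ 2 + C.
have D0 : 0 < D by rewrite ltr_wpDl // mulr_ge0 // sqr_ge0.
(* Bounding both t and 2Ct by [m] keeps the iterates started at [x0] and at [u] in the ball, and
   meets the condition of [discrete_flow0]. *)
pose m := Num.min (Num.min r rho) 1.
have m0 : 0 < m by rewrite !lt_min r0 rho0 ltr01.
exists D, (Num.min m (m / (2 * C))); split=> //.
  by rewrite lt_min m0 divr_gt0 // mulr_gt0.
move=> t /andP[t0]; rewrite lt_min => /andP[tm tc].
have [tr [trho t1]] : t <= r /\ t <= rho /\ t <= 1.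
  by move: (ltW tm); rewrite !le_min => /andP[/andP[]].
have {}tc : 2 * C * t < m by rewrite mulrC -ltr_pdivlMr // mulr_gt0.
have [cr [crho c1]] : 2 * C * t < r /\ 2 * C * t < rho /\ 2 * C * t <= 1.
  by move: tc; rewrite !lt_min => /andP[/andP[-> ->] /ltW].
(* [N.+1] steps make up the time t, and [discrete_flow0] then displaces [x0] by at most 2 C t^2 /
   (N+1). *)
pose s N : R := t / N.+1%:R.
have Ns N : N.+1%:R * s N = t by rewrite mulrC divfK // pnatr_eq0.
have s0 N : 0 <= s N by rewrite divr_ge0 // ltW.
have st N : s N <= t by rewrite ler_pdivrMr ?ltr0n // ler_peMr ?(ltW t0) // ler1n.
have s01 N : 0 <= s N <= 1 by rewrite s0 (le_trans (st N)).
have sr N : 0 <= s N <= r by rewrite s0 (le_trans (st N)).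
pose Psi N w := flow (row_mx (e1 + s N *: v) w).
pose h N := ichart MG 1%g (e1 + s N *: v).
pose g N := iter N.+1 (fun g => h N * g)%g 1%g.
have stp N w (wb : ball x0 r w) := (step (s N) w (sr N) wb).2.
have gE N j w : (forall i, (i <= j)%N -> ball x0 r (iter i (Psi N) w)) ->
    act (iter j (fun g => h N * g)%g 1%g) (ichart M x w) = ichart M x (iter j (Psi N) w).
  elim: j => [|j IH] ib; first by rewrite (act1 H).
  rewrite !iterS (actM H) IH => [|i ij]; last by apply: ib; exact: leq_trans ij _.
  have [fd _] := step (s N) _ (sr N) (ib j (leqnSn j)).
  have [_ ru] := (flow_domE (M := M) (act := act) _ _ _).1 fd.
  by rewrite /Psi flowE rep_ichart.
have mono N j (c : R) : (j <= N.+1)%N -> 2 * C * t < c -> 2 * C * (j%:R * s N) < c.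
  move=> jN; apply: le_lt_trans; rewrite -(Ns N); apply: ler_wpM2l.
    by rewrite mulr_ge0 // ltW.
  by apply: ler_wpM2r => //; rewrite ler_nat.
have DF N j w (c : R) (wc : ball w c `<=` ball x0 r) (jN : (j <= N.+1)%N) (cc : 2 * C * t < c) :=
  discrete_flow C0 (s01 N) (stp N) Zb Zl wc (mono N j c jN cc).
have gu N : act (g N) (ichart M x u) = ichart M x (iter N.+1 (Psi N) u).
  by apply: gE => i iN; have [] := DF N i u rho urho iN crho.
have kgu N : `|kap (g N) u - u - t *: Z u| <= D * t ^+ 2.
  have [ib _ b] := DF N N.+1 u rho urho (leqnn _) crho; rewrite Ns in b.
  by rewrite /rep gu (ichartK aM) //; apply: dim; exact: le_ball rd _ ib.
have x0K := x0K H x.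
have gx N : act (g N) x = ichart M x (iter N.+1 (Psi N) x0).
  by rewrite -[in LHS]x0K; apply: gE => i iN; have [] := DF N i x0 r (fun _ h => h) iN cr.
have gxc : (fun N => act (g N) x) @ \oo --> x.
  have c0 : (fun N => iter N.+1 (Psi N) x0) @ \oo --> x0.
    have sc : (fun N => 2 * C * t ^+ 2 * N.+1%:R^-1) @ \oo --> (0 : R).
      by rewrite -(mulr0 (2 * C * t ^+ 2)); apply: cvgMr; exact: cvg_harmonic.
    apply/cvgrPdist_lt => e e0; have /cvgrPdist_lt/(_ _ e0) := sc.
    apply: filterS => N; rewrite sub0r normrN ger0_norm; last first.
      by rewrite !mulr_ge0 // ?sqr_ge0 ?invr_ge0 // ltW.
    apply: le_lt_trans; rewrite distrC.
    have := discrete_flow0 C0 (s01 N) (stp N) Zb Zl Z0 (j := N.+1); rewrite Ns => /(_ c1 cr) /le_trans; apply.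
    rewrite /s expr_div_n; have : N.+1%:R != 0 :> R by rewrite pnatr_eq0.
    move: (N.+1%:R) => q q0; rewrite le_eqVlt; apply/orP; left; apply/eqP; by field.
  have ci := atlas_icontinuous aM (x0_im H x).
  rewrite -[X in _ --> X]x0K (_ : (fun N => act (g N) x) = ichart M x \o (fun N => iter N.+1 (Psi N) x0)).
    exact: cvg_comp c0 ci.
  by apply/funext => N; rewrite gx.
(* Since [act (g N) x] tends to [x], properness yields a cluster point of the [g N]; it fixes [x]
   because [X] is Hausdorff, and it inherits the estimate at [u] by continuity. *)
have cS := sequence_compact gxc.
have cP := act_proper L (compact_setX cS (@compact_set1 _ x)).
have cK : compact (fst @` ((fun p : G * X => (act p.1 p.2, p.2)) @^-1` ((x |` range (fun N => act (g N) x)) `*` [set x]))).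
  by apply: continuous_compact cP; apply: continuous_subspaceT => p; exact: cvg_fst.
have FK : (g @ \oo) (fst @` ((fun p : G * X => (act p.1 p.2, p.2)) @^-1` ((x |` range (fun N => act (g N) x)) `*` [set x]))).
  exists 0%N => // N _; exists (g N, x) => //=; split=> //; right; by exists N.
have [kk [_ kcl]] := cK (g @ \oo) _ FK.
have hX := manifold_hausdorff (complex_manifold_manifold (kahler_complex (hamiltonian_is_kahler H))).
have ca y : {for kk, continuous (fun g => act g y)}.
  by have [c _] := smooth_orb H y; exact: c.
have kx : @stab X G act x kk.
  apply/esym; apply: hX => A B nA nB.
  have [g' [gA gB]] := kcl [set g | A (act g x)] [set g | B (act g x)] (gxc A nA) (ca x B nB).
  by exists (act g' x).
have [ku _] := tube kk u kx ub.
exists kk; split=> //; apply/ler_addgt0Pl => e e0.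
have ck : {for kk, continuous (fun g => kap g u)}.
  apply: (continuous_comp (f := fun g => act g (ichart M x u)) (g := chart M x)); first exact: ca.
  by apply: (atlas_continuous aM); case: ku.
have /cvgrPdist_lt/(_ _ e0) nk := ck.
have FD : (g @ \oo) [set g | `|kap g u - u - t *: Z u| <= D * t ^+ 2].
  by exists 0%N => // N _; exact: kgu.
have [g' [/= h1 h2]] := kcl _ _ FD nk.
rewrite (_ : _ - _ - _ = (kap kk u - kap g' u) + (kap g' u - u - t *: Z u)); last first.
  by move: (t *: Z u) (kap kk u) (kap g' u) => a b c; apply/rowP => i; rewrite !mxE; ring.
by apply: le_trans (ler_normD _ _) _; apply: lerD => //; exact: ltW.
Qed.

(** Stabilizer elements moving [u] to u + t Z u + O(t^2) leave [f] unchanged, so the derivative of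
    [f] along [Z] is O(t) for all small t. *)
Lemma isotropy_derive (d : R) (f : V -> R) : 0 < d -> ball x0 d `<=` chart_im M x ->
  smooth_on (ball x0 d) f ->
  (forall g u, @stab X G act x g -> ball x0 d u -> ball x0 d (kap g u) -> f (kap g u) = f u) ->
  Z x0 = 0 -> exists r, [/\ 0 < r, r <= d & forall u, ball x0 r u -> 'D_(Z u) f u = 0].
Proof.
move=> d0 dim sf fK Z0; have [r [r0 rd iso]] := isotropy_point d0 dim Z0.
exists r; split=> // u ub; have [D [t0 [D0 t00 Dt]]] := iso u ub.
have ud : ball x0 d u by exact: le_ball rd _ ub.
have oB : open (ball x0 d) by exact: ball_open.
have [e1' /= e10 e1B] : exists2 e, 0 < e & ball u e `<=` ball x0 d.
  by have := oB; rewrite openE => /(_ u ud) /nbhs_ballP[e /= e0 eB]; exists e.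
have sfe := smooth_sub e1B sf.
have [M1 [d1 [M10 d10 d1e HM1]]] := local_bound e10 (fun j => smooth_derive 'e_j sfe).
have [M2 [d2 [M20 d20 d2e HM2]]] := local_bound (I := unit)
  (f := fun=> 'D_(Z u) ('D_(Z u) f)) e10 (fun=> smooth_derive _ (smooth_derive _ sfe)).
pose m := Num.min d1 d2; pose z := `|Z u|.
have m0 : 0 < m by rewrite lt_min d10.
(* Below this time the segment u + s Z u and the translate of [u] both stay in the ball where the
   derivatives of [f] are bounded. *)
pose T := Num.min (Num.min t0 1) (m / (D + z + 1)).
have z0 : 0 <= z by exact: normr_ge0.
have Dz : 0 < D + z + 1 by lra.
have T0 : 0 < T by rewrite !lt_min t00 ltr01 divr_gt0.
have key t : 0 < t < T -> `|'D_(Z u) f u| <= (M2 + (n + n)%:R * M1 * D) * t.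
  move=> /andP[tp]; rewrite !lt_min => /andP[/andP[tt0 t1] tm].
  have tm' : t * (D + z + 1) < m by rewrite -ltr_pdivlMr.
  have ts : t ^+ 2 <= t by rewrite expr2 ler_piMr // ltW.
  have [|g [gx ku kd]] := Dt t; first by rewrite tp.
  have tz : t * z < m by apply: le_lt_trans tm'; apply: ler_wpM2l; [exact: ltW|lra].
  have b1 (s : R) : 0 <= s <= t -> ball u m (u + s *: Z u).
    move=> /andP[s0 s1]; rewrite -ball_normE /= opprD addNKr normrN normrZ ger0_norm //.
    by apply: le_lt_trans tz; apply: ler_wpM2r.
  have b2 : ball u m (kap g u).
    rewrite -ball_normE /= distrC -[_ - u](subrK (t *: Z u)).
    apply: le_lt_trans (ler_normD _ _) _; rewrite normrZ gtr0_norm // -/z.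
    have : D * t ^+ 2 <= D * t by apply: ler_wpM2l => //; exact: ltW.
    move: tm'; rewrite !mulrDr mulr1 (mulrC t D); lra.
  have mB : ball u m `<=` ball u e1' by apply: le_ball; rewrite ge_min d1e.
  have md2 : m <= d2 by rewrite ge_min lexx orbT.
  have fk : f (kap g u) = f u by apply: fK => //; exact/e1B/mB.
  have tl := taylor2 (ball_open u e1') sfe (ltW tp) (fun s h => mB _ (b1 s h))
    (fun s h => HM2 _ (le_ball md2 (b1 s h)) tt).
  have ll : `|f (kap g u) - f (u + t *: Z u)| <= (n + n)%:R * M1 * (D * t ^+ 2).
    have b3 : ball u m (u + t *: Z u) by apply: b1; rewrite (ltW tp) lexx.
    have md : m <= d1 by rewrite ge_min lexx.
    apply: le_trans (lipschitz_ball (smooth_sub (le_ball d1e) sfe) HM1 (le_ball md b2) (le_ball md b3)) _.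
    by apply: ler_wpM2l; [rewrite mulr_ge0|rewrite opprD addrA].
  have : t * `|'D_(Z u) f u| <= t * ((M2 + (n + n)%:R * M1 * D) * t).
    rewrite -[X in X * `|_|](gtr0_norm tp) -normrM.
    have A1 (a b c p q : R) : `|b - a - c| <= p -> `|a - b| <= q -> `|c| <= p + q.
      by move=> h1 h2; rewrite -normrN; rewrite (_ : - c = (b - a - c) + (a - b)); [apply: le_trans (ler_normD _ _) (lerD h1 h2)|ring].
    rewrite fk in ll; apply: le_trans (A1 _ _ _ _ _ tl ll) _; rewrite le_eqVlt; apply/orP; left; apply/eqP; ring.
  by rewrite ler_pM2l.
apply: (@haar_eq0 R _ (M2 + (n + n)%:R * M1 * D)) => t tp.
have C0 : 0 <= M2 + (n + n)%:R * M1 * D by rewrite addr_ge0 // !mulr_ge0 // ltW.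
have [tT|Tt] := ltP t T; first by apply: key; rewrite tp.
have T2 : 0 < T / 2 < T by rewrite divr_gt0 //=; lra.
apply: le_trans (key _ T2) _; apply: ler_wpM2l => //; lra.
Qed.

End isotropy.

(** * Invariant potentials near a point *)

Section quadratic.
Context {R : realType} {m : nat}.
Local Notation V := 'rV[R]_m.
Variables (x0 : V) (a : V -> R) (c : V -> V -> R).
Hypotheses (aL : forall v, a v = \sum_i v 0 i * a 'e_i)
  (cL : forall v w, c v w = \sum_i v 0 i * c 'e_i w) (cC : forall v w, c v w = c w v).

Let smooth_lin (f : V -> R) A : (forall v, f v = \sum_i v 0 i * f 'e_i) -> smooth_on A f.
Proof.
move=> fL; apply: smooth_sub (subsetT _) _.
have s1 i : smooth_on setT (fun v : V => v 0 i * f 'e_i).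
  by apply: smoothM; [exact: openT|exact: smooth_coord|exact: smooth_cst].
apply: (smooth_eq openT _ (smooth_sum (index_enum _) (P := xpredT) openT (fun i _ => s1 i))) => v _.
by rewrite [RHS]fL.
Qed.

Let derive_lin (f : V -> R) v u : (forall v, f v = \sum_i v 0 i * f 'e_i) -> 'D_v f u = f v.
Proof.
move=> fL; have E (h : R) : f (h *: v + u) = h *: f v + f u.
  rewrite fL (fL v) (fL u) /GRing.scale /= mulr_sumr -big_split; apply: eq_bigr => i _.
  by rewrite !mxE mulrDl mulrA.
by have := derive_affine (id : R -> R) E; rewrite derive_id.
Qed.

Definition quadratic u := a (u - x0) + 2^-1 * c (u - x0) (u - x0).

Let ss A : smooth_on A (fun u : V => u - x0).
Proof.
apply: smooth_sub (subsetT _) _; apply: smoothB; first exact: openT.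
  by apply: smooth_linear => // t; exact: cvg_id.
exact: smooth_cst.
Qed.

Let ds w u : 'D_w (fun u : V => u - x0) u = w.
Proof.
have E (h : R) : (h *: w + u) - x0 = h *: w + (u - x0) by rewrite addrA.
by have := derive_affine (L := fun u : V => u - x0) (id : V -> V) E; rewrite derive_id.
Qed.

Let cLr d w : c d w = \sum_i w 0 i * c d 'e_i.
Proof. by rewrite cC cL; apply: eq_bigr => i _; rewrite cC. Qed.

Let s2 : smooth_on setT (fun u => c (u - x0) (u - x0)).
Proof.
exact: (smooth_family openT openT (fun _ _ => I) (ss setT) (ss setT) cL (fun d => smooth_lin setT (cLr d))).
Qed.

Let s1 : smooth_on setT (fun u => a (u - x0)).
Proof. exact: (smooth_comp openT openT (fun _ _ => I) (smooth_lin setT aL) (ss setT)). Qed.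

Lemma smooth_quadratic A : smooth_on A quadratic.
Proof.
apply: smooth_sub (subsetT _) _; apply: smoothD; [exact: openT|exact: s1|].
by apply: smoothMc; [exact: openT|exact: s2].
Qed.

Lemma derive_quadratic w u : 'D_w quadratic u = a w + c w (u - x0).
Proof.
have D1 : 'D_w (fun u => a (u - x0)) u = a w.
  rewrite (derive_compE w (smooth_differentiableV openT I (ss setT))).
    by rewrite derive_lin // ds.
  exact: smooth_differentiable openT I (smooth_lin setT aL).
have D2 : 'D_w (fun u => c (u - x0) (u - x0)) u = c w (u - x0) + c (u - x0) w.
  rewrite (derive_family openT openT (fun _ _ => I) (ss setT) (ss setT) cL (fun d => smooth_lin setT (cLr d)) w I).
  by rewrite !ds derive_lin.
apply: etrans (smooth_deriveD w s1 (smoothMc 2^-1 openT s2) I) _.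
rewrite D1 (smooth_deriveZ _ _ s2 I) D2 (cC (u - x0)); congr (_ + _).
by move: (c _ _) => t; lra.
Qed.

Lemma derive2_quadratic v w u : 'D_v ('D_w quadratic) u = c w v.
Proof.
have -> : 'D_w quadratic = (fun u => a w + c w (u - x0)) by apply/funext => z; exact: derive_quadratic.
have s3 : smooth_on setT (fun u => c w (u - x0)).
  exact: (smooth_comp openT openT (fun _ _ => I) (smooth_lin setT (cLr w)) (ss setT)).
apply: etrans (smooth_deriveD v (smooth_cst setT (a w)) s3 I) _.
rewrite (_ : 'D_v (fun=> a w) u = 0) ?add0r; last exact: derive_cst.
rewrite (derive_compE v (smooth_differentiableV openT I (ss setT))).
  by rewrite derive_lin // ds.
exact: smooth_differentiable openT I (smooth_lin setT (cLr w)).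
Qed.

End quadratic.

Lemma levi_sub {R : realType} {n : nat} (A : set 'rV[R]_(n + n)) f g u v w : open A ->
  smooth_on A f -> smooth_on A g -> A u ->
  levi (fun u => f u - g u) u v w = levi f u v w - levi g u v w.
Proof.
move=> oA sf sg Au.
have E a b : 'D_a ('D_b (fun u => f u - g u)) u = 'D_a ('D_b f) u - 'D_a ('D_b g) u.
  apply: etrans (near_derive a oA (fun y => smooth_deriveB b sf sg (u := y)) Au) _.
  exact: smooth_deriveB (smooth_derive b sf) (smooth_derive b sg) Au.
have A1 (a b p q r s : R) : a = p - q -> b = r - s -> - 2^-1 * (a - b) = - 2^-1 * (p - r) - - 2^-1 * (q - s).
  by move=> -> ->; ring.
exact: A1 (E _ _) (E _ _).
Qed.

(* Subtracting a pluriharmonic polynomial kills the differential and the part of type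
   (2,0) + (0,2) of the Hessian at [x0]. *)
Lemma normalize_potential {R : realType} {n : nat} (x0 : 'rV[R]_(n + n)) (d : R) rho :
  0 < d -> smooth_on (ball x0 d) rho -> exists f, [/\ smooth_on (ball x0 d) f,
    forall u v w, ball x0 d u -> levi f u v w = levi rho u v w,
    forall v, 'D_v f x0 = 0 &
    forall v w, 'D_(mul_i v) ('D_(mul_i w) f) x0 = 'D_v ('D_w f) x0].
Proof.
move=> d0 sr; have oB : open (ball x0 d) by exact: ball_open.
have B0 : ball x0 d x0 by exact: ballxx.
(* [c] is the part of the Hessian [B] that changes sign when [mul_i] is applied to both arguments; a
   quadratic polynomial with such a Hessian has zero [levi]. *)
pose B v w := 'D_v ('D_w rho) x0; pose c v w := 2^-1 * (B v w - B (mul_i v) (mul_i w)).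
have dB w : differentiable ('D_w rho) x0 := smooth_differentiable oB B0 (smooth_derive w sr).
have BC v w : B v w = B w v by exact: schwarz oB B0 sr.
have BN v w : B (- v) w = - B v w by exact: derive_dirN.
have aL v : 'D_v rho x0 = \sum_i v 0 i * 'D_'e_i rho x0 := derive_coord v (smooth_differentiable oB B0 sr).
have cC v w : c v w = c w v by rewrite /c BC (BC (mul_i v)).
have cL v w : c v w = \sum_i v 0 i * c 'e_i w.
  rewrite /c /B (derive_coord v (dB w)) (mul_i_delta v) (derive_dir_sum _ _ (dB _)).
  rewrite -sumrB mulr_sumr; apply: eq_bigr => i _.
  have A1 (s t t' a : R) : t' = a * t -> 2^-1 * (a * s - t') = a * (2^-1 * (s - t)) by move=> ->; ring.
  exact: A1 (derive_dirZ _ _ (dB _)).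
have sq := smooth_quadratic x0 aL cL cC (ball x0 d).
have sf : smooth_on (ball x0 d) (fun u => rho u - quadratic x0 (fun v => 'D_v rho x0) c u) by exact: smoothB.
have cJ v w : c (mul_i v) (mul_i w) = - c v w.
  rewrite /c !mul_iK BN (BC v) BN (BC w); move: (B _ _) (B _ _) => s t; ring.
have cN p q : c (- p) q = - c p q.
  by rewrite cL (cL p) -sumrN; apply: eq_bigr => i _; rewrite mxE mulNr.
have E v w : 'D_v ('D_w (fun u => rho u - quadratic x0 (fun v => 'D_v rho x0) c u)) x0 = B v w - c v w.
  apply: etrans (near_derive v oB (fun y => smooth_deriveB w sr sq (u := y)) B0) _.
  apply: etrans (smooth_deriveB v (smooth_derive w sr) (smooth_derive w sq) B0) _.
  by rewrite (derive2_quadratic x0 aL cL cC) cC.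
exists (fun u => rho u - quadratic x0 (fun v => 'D_v rho x0) c u); split; first exact: sf.
- move=> u v w Bu; apply: etrans (levi_sub v w oB sr sq Bu) _.
  have A1 (p p' q q' l : R) : p = q -> p' = q' -> q = q' -> l - - 2^-1 * (p - p') = l.
    by move=> -> -> ->; ring.
  apply: A1 (derive2_quadratic x0 aL cL cC _ _ u) (derive2_quadratic x0 aL cL cC _ _ u) _.
  have h := cJ w (mul_i v); rewrite mul_iK (cC _ (- v)) cN (cC v) in h.
  by rewrite (cC (mul_i v)); exact: oppr_inj.
- move=> v; apply: etrans (smooth_deriveB v sr sq B0) _.
  have A1 (p q s : R) : q = p + s -> s = 0 -> p - q = 0 by move=> -> ->; ring.
  apply: A1 (derive_quadratic x0 aL cL cC v x0) _.
  by rewrite subrr cC cL big1 // => i _; rewrite mxE mul0r.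
- move=> v w; have A1 (p q s t : R) : t = - s -> s = 2^-1 * (p - q) -> q - t = p - s by lra.
  exact: etrans (E _ _) (etrans (A1 _ _ _ _ (cJ v w) erefl) (esym (E v w))).
Qed.

Section local_invariant.
Context {R : realType} {n k : nat} {X : topologicalType} {M : charts R (n + n) X}
  {om : form2 R (n + n) X} {G : topGroupType} {MG : charts R k G} {act : G -> X -> X}
  {mu : X -> {linear 'rV[R]_k -> R^o}}.
Hypothesis H : hamiltonian_kahler M om MG act mu.
Let L := hamiltonian_group H.
Let aM := ham_atlas H.
Let aG := ham_group_atlas H.
Let cM := kahler_complex (hamiltonian_is_kahler H).
Local Notation V := 'rV[R]_(n + n).
Local Notation W := 'rV[R]_k.
Local Notation field := (@field R n k X M G MG act).
Local Notation cf := (@coef_at R n X M om).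
Let e1 := chart MG 1%g 1%g.

Lemma AdK g (w : W) : Ad MG (g^-1)%g (Ad MG g w) = w.
Proof.
have aGG := aG; have s1 := smooth_conjg H g; have s2 := smooth_conjg H (g^-1)%g.
have E1 : Ad MG g w = 'D_w (rep MG MG (fun h => conjV (g^-1, h)%g) 1%g 1%g) e1.
  by rewrite -AdE invgK.
rewrite AdE E1.
have r2 : rdom MG MG ((fun h => conjV (g, h)) \o (fun h => conjV (g^-1, h)%g)) 1%g 1%g e1.
  by split; [exact: (e1_im H)|rewrite /= (e1K H) !conjV1; exact: atlas_center].
have := derive_rep aG aG aG s2 s1 w (conj_dom H (g^-1)%g) r2.
have -> : rep MG MG (fun h => conjV (g^-1, h)%g) 1%g 1%g e1 = e1.
  by rewrite /rep (e1K H) conjV1.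
move=> <-; rewrite -[RHS](derive_id (V := W) e1 w).
have o1 : open (chart_im MG 1%g) by exact: atlas_im_open.
apply: (near_deriveV w o1 _ (e1_im H)) => t ti.
rewrite /rep /conjV /= !invgK -!mulgA mulVg mulg1 mulgA mulVg mul1g (ichartK aG) //.
Qed.

Section at_point.
Variable x : X.
Let x0 := chart M x x.
Local Notation kap g := (rep M M (act g) x x).
Local Notation kdom g := (rdom M M (act g) x x).
Local Notation stab := (@stab X G act x).

Let kap0 g : stab g -> kap g x0 = x0.
Proof. by move=> gx; rewrite /rep (x0K H x) (gx : act g x = x). Qed.

Let skap g : smooth_on (kdom g) (kap g).
Proof. by have [sg _] := act_hol H g; exact: smooth_rep. Qed.

Let Jkap g u v : kdom g u -> 'D_(mul_i v) (kap g) u = mul_i ('D_v (kap g) u).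
Proof. exact: (rep_holomorphic cM v (act_hol H g)). Qed.

Section transport.
Variables (d d' : R) (f : V -> R).
Hypothesis sf : smooth_on (ball x0 d) f.
Hypothesis tube : forall g u, stab g -> ball x0 d' u -> kdom g u /\ ball x0 d (kap g u).

Let od : open (ball x0 d). Proof. exact: ball_open. Qed.

Let B' : set V := ball x0 d'.
Let oB' : open B'. Proof. exact: ball_open. Qed.
Let skap' g : stab g -> smooth_on B' (kap g).
Proof. by move=> gx; apply: smooth_sub (skap g) => u /(tube gx)[]. Qed.
Let kB g : stab g -> forall u, B' u -> ball x0 d (kap g u).
Proof. by move=> gx u /(tube gx)[]. Qed.

Lemma levi_stab g u v w : stab g -> ball x0 d' u ->
  (forall u v w, ball x0 d u -> cf x u v w = levi f u v w) ->
  levi (fun u => f (kap g u)) u v w = cf x u v w.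
Proof.
move=> gx ub lf; have [ku kb] := tube gx ub.
rewrite (levi_pullback v w oB' od (kB gx) (skap' gx) sf _ ub) => [|y z /(tube gx)[yk _]]; last exact: Jkap.
by rewrite -lf // (coef_at_act H).
Qed.

Lemma derive_stab g v u : stab g -> ball x0 d' u ->
  'D_v (fun u => f (kap g u)) u = 'D_('D_v (kap g) u) f (kap g u).
Proof. by move=> gx ub; exact: (derive_pullback oB' od (kB gx) (skap' gx) sf). Qed.

Lemma derive2_stab g v w u : stab g -> ball x0 d' u -> 'D_v ('D_w (fun u => f (kap g u))) u =
  'D_('D_v ('D_w (kap g)) u) f (kap g u) + 'D_('D_v (kap g) u) ('D_('D_w (kap g) u) f) (kap g u).
Proof. by move=> gx ub; exact: (derive2_pullback oB' od (kB gx) (skap' gx) sf). Qed.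

End transport.

Theorem local_invariant_potential : (forall v, mu x v = 0) -> exists d (f : V -> R),
  [/\ 0 < d, ball x0 d `<=` chart_im M x, smooth_on (ball x0 d) f &
  [/\ forall u v w, ball x0 d u -> cf x u v w = levi f u v w,
      forall v u, ball x0 d u -> 'D_(field x v u) f u = 0,
      forall v u, ball x0 d u -> 'D_(mul_i (field x v u)) f u = 2 * mu (ichart M x u) v &
      forall g u, stab g -> ball x0 d u -> ball x0 d (kap g u) -> f (kap g u) = f u]].
Proof.
move=> mux; have oim : open (chart_im M x) by exact: atlas_im_open.
have /nbhs_ballP[e /= e0 eim] := open_nbhs_nbhs (conj oim (x0_im H x)).
have A3 (a b O : R) : - 2^-1 * (a - b) = O -> a - b = - 2 * O by lra.
have A4 (a b O : R) : a - b = - 2 * O -> - 2^-1 * (a - b) = O by lra.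
have [|||||d0 [f0 [d00 d0e sf0 lf0]]] := @local_potential R n x0 e (cf x) e0.
- by move=> v w; apply: smooth_sub (smooth_coef H x v w).
- move=> u v ub c w w'; have := coef_atl H c w w' v (eim _ ub).
  rewrite (coef_atA H x u (c *: w + w') v) (coef_atA H x u w v) (coef_atA H x u w' v) => ->.
  by rewrite /GRing.scale /=; ring.
- by move=> u v w _; exact: (coef_atA H x u v w).
- by move=> u v1 v2 v3 ub; exact: (coef_closed H v1 v2 v3 (eim _ ub)).
- by move=> u v w ub; exact: (coef_atJ H v w (eim _ ub)).
have [f1 [sf1 lf1 df1 ddf1]] := normalize_potential d00 sf0.
have d0im : ball x0 d0 `<=` chart_im M x by apply: subset_trans eim; exact: le_ball.
have lf1' u v w : ball x0 d0 u -> cf x u v w = levi f1 u v w by move=> ub; rewrite lf1 // lf0.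
have [d1 [f2 [d10 d1d sf2 [tube1 D1 D2 K2]]]] := stab_average H d00 d0im sf1.
have b1 : ball x0 d1 x0 by exact: ballxx.
have d1im : ball x0 d1 `<=` chart_im M x by apply: subset_trans d0im; exact: le_ball.
have lf2 u v w : ball x0 d1 u -> cf x u v w = levi f2 u v w.
  move=> ub; apply/esym/A4/D2 => // g gx; apply: A3.
  exact: (levi_stab sf1 tube1 v w gx ub lf1').
have df2 v : 'D_v f2 x0 = 0.
  by apply: D1 => // g gx; rewrite (derive_stab sf1 tube1) // kap0.
(* The second derivative of [kap g] enters only through the differential of [f1], which vanishes at
   [x0]; holomorphy of [kap g] transports the type of the Hessian. *)
have ddf2 v w : 'D_(mul_i v) ('D_(mul_i w) f2) x0 = 'D_v ('D_w f2) x0.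
  apply/eqP; rewrite -subr_eq0; apply/eqP; apply: D2 => // g gx; apply/eqP; rewrite subr_eq0; apply/eqP.
  apply: etrans (derive2_stab sf1 tube1 _ _ gx b1) (etrans _ (esym (derive2_stab sf1 tube1 _ _ gx b1))).
  have [ku _] := tube1 g x0 gx b1.
  have A1 (a b a' b' : R) : a = 0 -> a' = 0 -> b = b' -> a + b = a' + b' by move=> -> -> ->.
  have E0 z : 'D_z f1 (kap g x0) = 0 by rewrite (kap0 gx); exact: df1.
  apply: A1 (E0 _) (E0 _) _; rewrite (Jkap v ku) (Jkap w ku) (kap0 gx); exact: ddf1.
have sfd2 (y : V) : ball x0 d1 y -> differentiable f2 y.
  by move=> yb; apply: smooth_differentiable yb sf2; exact: ball_open.
(* [isotropy_derive] gives a radius for each vector separately; applying it to finitely many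
   generators of the isotropy algebra makes the radius uniform. *)
have [d2 [d20 d2d iso]] : exists d2, [/\ 0 < d2, d2 <= d1 &
    forall v, field x v x0 = 0 -> forall u, ball x0 d2 u -> 'D_(field x v u) f2 u = 0].
  pose Mx := \matrix_l field x 'e_l x0.
  have XM v : v *m Mx = field x v x0.
    by rewrite (field_sum x v) mulmx_sum_row; apply: eq_bigr => l _; rewrite rowK.
  have N i : \forall u \near x0, 'D_(field x (row i (kermx Mx)) u) f2 u = 0.
    have ki : field x (row i (kermx Mx)) x0 = 0.
      by rewrite -XM -row_mul mulmx_ker row0.
    have [r [r0 _ rD]] := isotropy_derive H d10 d1im sf2 K2 ki.
    by apply/nbhs_ballP; exists r.
  have /nbhs_ballP[r /= r0 Hr] := @filter_forall _ _ _ (nbhs x0) (nbhs_filter x0) N.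
  exists (Num.min r d1); split; [by rewrite lt_min r0|by rewrite ge_min lexx orbT|].
  move=> v v0 u ub; have ub1 : ball x0 d1 u by apply: le_ball ub; rewrite ge_min lexx orbT.
  have /submxP[D vD] : (v <= kermx Mx)%MS by apply/sub_kermxP; rewrite XM.
  rewrite vD (family_mulmxV (F := field x) (fun d u => field_sum x d u)).
  rewrite derive_dir_sum ?big1 // => [i _|]; last exact: sfd2.
  rewrite derive_dirZ; last exact: sfd2.
  have ubr : ball x0 r u by apply: le_ball ub; rewrite ge_min lexx.
  by rewrite (Hr u ubr i) scaler0.
have d2B : ball x0 d2 `<=` ball x0 d1 by exact: le_ball.
have d2im : ball x0 d2 `<=` chart_im M x by exact: subset_trans d1im.
have [|d3 [f3 [d30 d3d sf3 [lf3 pf3 qf3]]]] := @local_moment R n k x0 d2 (cf x) (field x)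
    (fun v u => mu (ichart M x u) v) (@lie_bracket R k G MG) f2.
  split=> //.
  - by move=> v u; exact: field_sum.
  - by move=> v; exact: hol_sub d2im (hol_field H x v).
  - move=> v u; rewrite {1}(row_sum_delta v) linear_sum; apply: eq_bigr => l _; by rewrite linearZ.
  - by move=> v; exact: smooth_sub d2im (smooth_moment H x v).
  - by move=> a v; exact: lie_bracket_sum.
  - by move=> v w u /d2im ui; exact: (coef_moment H v w ui).
  - by move=> a v u /d2im ui; exact: (field_bracket_act H ui a v).
  - by move=> a v u /d2im ui; exact: (moment_bracket_field H ui a v).
  - by move=> v; rewrite (x0K H x).
  - by move=> u v /d2im ui; exact: (coef_at_pos H ui).
  - exact: smooth_sub sf2.
  - by move=> u v w /d2B; exact: lf2.
have d3im : ball x0 d3 `<=` chart_im M x by apply: subset_trans d2im; exact: le_ball.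
have [d4 [f4 [d40 d4d sf4 [tube4 E1 E2 K4]]]] := stab_average H d30 d3im sf3.
have d4im : ball x0 d4 `<=` chart_im M x by apply: subset_trans d3im; exact: le_ball.
(* The second average keeps the equations for [mu]: [kap g] carries the field of [v] to that of Ad g
   v, and equivariance of [mu] undoes the change of index. *)
have fieldK g v u : stab g -> ball x0 d4 u ->
    'D_(field x v u) (kap g) u = field x (Ad MG g v) (kap g u).
  move=> gx ub; have [ku _] := tube4 g u gx ub.
  by rewrite (field_act H (Ad MG g v) ku) AdK.
exists d4, f4; split=> //; split=> // [u v w ub|v u ub|v u ub].
- apply/esym/A4/E2 => // g gx; apply: A3; exact: (levi_stab sf3 tube4 v w gx ub lf3).
- apply: E1 => // g gx; rewrite (derive_stab sf3 tube4) // fieldK //.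
  by apply: pf3; have [] := tube4 g u gx ub.
- apply: E1 => // g gx; have [ku kb] := tube4 g u gx ub.
  rewrite (derive_stab sf3 tube4) // Jkap // fieldK // qf3 // rep_ichart //.
  by rewrite (momentum_equivariant (hamiltonian_momentum H)) AdK.
Qed.

End at_point.

End local_invariant.

(** * Extension along orbits *)

Lemma nbhs_preimage {T U : topologicalType} (h : T -> U) t A : {for t, continuous h} ->
  nbhs (h t) A -> nbhs t [set y | A (h y)].
Proof. by move=> c; exact: c. Qed.

Section glue.
Context {R : realType} {n k : nat} {X : topologicalType} {M : charts R (n + n) X}
  {om : form2 R (n + n) X} {G : topGroupType} {MG : charts R k G} {act : G -> X -> X}
  {mu : X -> {linear 'rV[R]_k -> R^o}}.
Hypothesis H : hamiltonian_kahler M om MG act mu.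
Let K := hamiltonian_is_kahler H.
Let L := hamiltonian_group H.
Let aM := ham_atlas H.
Let aG := ham_group_atlas H.
Let aP := atlas_prod aG aM.
Let cM := kahler_complex K.
Let hX := manifold_hausdorff (complex_manifold_manifold cM).
Local Notation V := 'rV[R]_(n + n).
Local Notation W := 'rV[R]_k.
Local Notation field := (@field R n k X M G MG act).
Local Notation cf := (@coef_at R n X M om).
Let e1 := chart MG 1%g 1%g.
Local Notation gam t := (ichart MG 1%g t).

Variable x : X.
Let x0 := chart M x x.
Local Notation kap g := (rep M M (act g) x x).
Local Notation stab := (@stab X G act x).
Local Notation flow := (@flow R n k X M G MG act x).
Local Notation flow_dom := (@flow_dom R n k X M G MG act x).

Variables (d : R) (f : V -> R).
Hypotheses (d0 : 0 < d) (dim : ball x0 d `<=` chart_im M x) (sf : smooth_on (ball x0 d) f)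
  (lf : forall u v w, ball x0 d u -> cf x u v w = levi f u v w)
  (pf : forall v u, ball x0 d u -> 'D_(field x v u) f u = 0)
  (qf : forall v u, ball x0 d u -> 'D_(mul_i (field x v u)) f u = 2 * mu (ichart M x u) v)
  (Kf : forall g u, stab g -> ball x0 d u -> ball x0 d (kap g u) -> f (kap g u) = f u).

Let od : open (ball x0 d). Proof. exact: ball_open. Qed.

(* Differentiating in the group variable at [t]: right translation by [gam t]^-1 brings the
   curve back to the identity. *)
Lemma derive_flow_group t u a : flow_dom (row_mx t u) ->
  exists w, 'D_a (fun t => flow (row_mx t u)) t = field x w (flow (row_mx t u)).
Proof.
move=> fd; have [ti ru] := (flow_domE (M := M) (act := act) x t u).1 fd.
set h := gam t; set y := ichart M x u.
have [_ [_ sm] _] := closed_subgroup_lie L.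
have sr : smooth_map MG MG (fun g => g * h^-1)%g.
  have [_ smul _] := closed_subgroup_lie L.
  exact: (smooth_map_comp aG (atlas_prod aG aG) aG
    (smooth_map_pair aG aG aG (smooth_map_id aG) (smooth_map_cst MG MG (h^-1)%g)) smul).
have r1 : rdom MG MG (fun g => g * h^-1)%g 1%g 1%g t.
  by split=> //; rewrite -/h mulgV; exact: atlas_center.
have so := smooth_orb H (act h y).
have E : (fun g => act g (act h y)) \o (fun g => g * h^-1)%g = (fun g => act g y).
  by apply/funext => g /=; rewrite -(actM H) -mulgA mulVg mulg1.
have r2 : rdom MG M ((fun g => act g (act h y)) \o (fun g => g * h^-1)%g) 1%g x t.
  by split=> //; rewrite E; case: ru.
have ui : chart_im M x (flow (row_mx t u)) by rewrite flowE; exact: rep_im ru.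
have hy : ichart M x (flow (row_mx t u)) = act h y by rewrite flowE rep_ichart.
exists ('D_a (rep MG MG (fun g => g * h^-1)%g 1%g 1%g) t).
rewrite (fieldE H) // hy.
have E1 : (fun t => flow (row_mx t u)) = rep MG M (fun g => act g y) 1%g x.
  by apply/funext => t'; rewrite flowE.
rewrite E1 -E; apply: etrans (derive_rep aG aG aM sr so a r1 r2) _.
have E2 : rep MG MG (fun g => g * h^-1)%g 1%g 1%g t = e1 by rewrite /rep -/h mulgV.
by rewrite E2.
Qed.

(** Along the segment from [e1] to [t] in the chart of [G], the velocity of the moving point is
    again a value of some [field x w], by [derive_flow_group], and such fields annihilate [f]. *)
Lemma flow_invariant : exists eta d1, [/\ 0 < eta, 0 < d1, d1 <= d &
  forall t u, ball e1 eta t -> ball x0 d1 u -> [/\ chart_im MG 1%g t,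
    rdom M M (act (gam t)) x x u & f (flow (row_mx t u)) = f u]].
Proof.
have ofl : open flow_dom := @open_flow _ _ _ _ _ _ _ _ _ _ H x.
have sfl := smooth_flow H x.
pose A := flow_dom `&` [set z | ball x0 d (flow z)].
have fx : flow (row_mx e1 x0) = x0.
  by rewrite flowE /rep (e1K H) (act1 H) (x0K H x).
have zA : A (row_mx e1 x0).
  by split; [exact: (flow_dom1 H (x0_im H x))|rewrite /= fx; exact: ballxx].
have oA : open A.
  rewrite openE => z [zd zb]; have [cfl _] := sfl 0%N.
  exact: filterI (open_nbhs_nbhs (conj ofl zd)) (cfl z zd _ (open_nbhs_nbhs (conj od zb))).
have /nbhs_ballP[e /= e0 eA] := open_nbhs_nbhs (conj oA zA).
pose d1 := Num.min e d.
exists e, d1; split=> //; [by rewrite lt_min e0|by rewrite ge_min lexx orbT|].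
have bA t u : ball e1 e t -> ball x0 d1 u -> A (row_mx t u).
  rewrite -!ball_normE /= lt_min => te /andP[ue _]; apply: eA; rewrite -ball_normE /=.
  have -> : row_mx e1 x0 - row_mx t u = row_mx (e1 - t) (x0 - u) :> 'rV[R]_(k + (n + n)).
    by rewrite opp_row_mx add_row_mx.
  apply: rV_norm_lt => // i; case: (split_ordP i) => j ->; rewrite ?row_mxEl ?row_mxEr.
    exact: le_lt_trans (rV_norm_coord _ j) te.
  exact: le_lt_trans (rV_norm_coord _ j) ue.
move=> t u te ud; have [fd fb] := bA t u te ud.
have [ti ru] := (flow_domE (M := M) (act := act) x t u).1 fd.
have ux : chart_im M x u := ru.1.
split=> //; pose a := t - e1.
have Bs (s : R) : 0 <= s <= 1 -> A (row_mx (e1 + s *: a) u).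
  move=> /andP[s0 s1]; apply: bA => //; move: te; rewrite -!ball_normE /= opprD addNKr normrN.
  by apply: le_lt_trans; rewrite normrZ ger0_norm // -[leRHS]mul1r (distrC e1); apply: ler_wpM2r.
have sfA : smooth_on A (fun z => f (flow z)).
  by apply: smooth_comp oA od _ sf _; [move=> z []|apply: smooth_sub sfl => z []].
pose g t := f (flow (row_mx t u)); pose A' := [set t | A (row_mx t u)].
have cr : continuous (fun t : W => row_mx t u : 'rV[R]_(k + (n + n))).
  by move=> t'; apply: continuous_row_mx; [exact: cvg_id|exact: cst_continuous].
have oA' : open A' by exact: open_preim cr oA.
have sg : smooth_on A' g.
  exact: (smooth_comp (f := fun z => f (flow z)) oA' oA (fun t At => At) sfA (smooth_row_mxl _ _)).
have [|s s01 E] := @mvt_line _ _ g e1 a 1 ler01.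
  by move=> s s01; exact: smooth_derivable sg (Bs s s01).
have As : A (row_mx (e1 + s *: a) u) := Bs s s01.
have sfu : smooth_on A' (fun t => flow (row_mx t u)).
  have sflA : smooth_on A flow by apply: smooth_sub sfl => z [].
  exact: (smooth_compV (f := flow) oA' oA (fun t At => At) sflA (smooth_row_mxl _ _)).
have D0 : 'D_a g (e1 + s *: a) = 0.
  apply: etrans (derive_compE _ (smooth_differentiableV oA' As sfu) (smooth_differentiable od As.2 sf)) _.
  have [w ->] := derive_flow_group a As.1; exact: (pf w As.2).
have ta : e1 + 1 *: a = t by rewrite scale1r /a addrC subrK.
move: E; rewrite D0 mulr0 ta => /eqP; rewrite subr_eq0 => /eqP E.
by apply: etrans E _; rewrite /g flowE /rep (e1K H) (act1 H) (ichartK aM).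
Qed.

(** Otherwise some g_m and y_m, with y_m and g_m y_m tending to [x], violate it. By properness the
    g_m have a cluster point, which fixes [x], while all elements near a stabilizer element satisfy
    the conclusion. *)
Lemma near_stab (eta : R) : 0 < eta -> exists2 r, 0 < r & forall g y, chart_dom M x y ->
  chart_dom M x (act g y) -> ball x0 r (chart M x y) -> ball x0 r (chart M x (act g y)) ->
  exists h, [/\ stab h, chart_dom MG 1%g (g * h^-1)%g & ball e1 eta (chart MG 1%g (g * h^-1)%g)].
Proof.
move=> eta0; apply: contrapT => no.
pose N : set G := [set g | exists h, [/\ stab h, chart_dom MG 1%g (g * h^-1)%g &
  ball e1 eta (chart MG 1%g (g * h^-1)%g)]].
have C (m : nat) : exists gy : G * X, [/\ chart_dom M x gy.2, chart_dom M x (act gy.1 gy.2),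
    ball x0 m.+1%:R^-1 (chart M x gy.2), ball x0 m.+1%:R^-1 (chart M x (act gy.1 gy.2)) & ~ N gy.1].
  apply: contrapT => nm; apply: no; exists m.+1%:R^-1; first by rewrite invr_gt0.
  move=> g y yd gd yb gb; apply: contrapT => nh; apply: nm; exists (g, y); split=> //.
have [gy Hgy] := choice C.
have cvg_x (z : nat -> X) : (forall m, chart_dom M x (z m)) ->
    (forall m, ball x0 m.+1%:R^-1 (chart M x (z m))) -> z @ \oo --> x.
  move=> zd zb; have c0 : (fun m => chart M x (z m)) @ \oo --> x0.
    apply/cvgrPdist_lt => e e0; have /cvgrPdist_lt/(_ _ e0) := @cvg_harmonic R.
    apply: filterS => m; rewrite sub0r normrN ger0_norm ?invr_ge0 //; apply: lt_trans.
    by have := zb m; rewrite -ball_normE.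
  have ci := atlas_icontinuous aM (x0_im H x).
  rewrite -[X in _ --> X](x0K H x) (_ : z = ichart M x \o (fun m => chart M x (z m))).
    exact: cvg_comp c0 ci.
  by apply/funext => m /=; rewrite (atlasK aM).
have c1 : (fun m => (gy m).2) @ \oo --> x by apply: cvg_x => m; have [] := Hgy m.
have c2 : (fun m => act (gy m).1 (gy m).2) @ \oo --> x by apply: cvg_x => m; have [] := Hgy m.
have cS1 := sequence_compact c1; have cS2 := sequence_compact c2.
have cP := act_proper L (compact_setX cS2 cS1).
have [|[g y] [_ cl]] := cP (gy @ \oo) _.
  by exists 0%N => // m _ /=; split; right; exists m.
have yx : y = x.
  apply/esym/hX => A B nA nB.
  have n2 : nbhs (g, y) [set q : G * X | B q.2] by exact: (@cvg_snd _ _ (nbhs g) (nbhs y) _ B nB).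
  by have [q [qA qB]] := cl [set q : G * X | A q.2] _ (c1 A nA) n2; exists q.2.
have gx : act g y = x.
  apply/esym/hX => A B nA nB.
  have n2 : nbhs (g, y) [set q : G * X | B (act q.1 q.2)] by have c := continuous_act H; exact: (c (g, y) B nB).
  have [q [qA qB]] := cl [set q : G * X | A (act q.1 q.2)] _ (c2 A nA) n2.
  by exists (act q.1 q.2).
have gs : stab g by rewrite /stab /= -[in LHS]yx.
(* The stabilizer element [g] itself is the witness for all elements close to it. *)
have nN : nbhs g N.
  have cr : {for g, continuous (fun h => h * g^-1)%g}.
    by apply: (continuous_mulg (continuous_mul H)); [exact: cvg_id|exact: cst_continuous].
  have n1 : nbhs (g * g^-1)%g (chart_dom MG 1%g `&` (chart MG 1%g @^-1` ball e1 eta)).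
    rewrite mulgV; apply: filterI; first by apply: open_nbhs_nbhs; split; [exact: atlas_open|exact: atlas_center].
    by apply: (atlas_continuous aG (atlas_center aG _)); exact: nbhsx_ballx.
  apply: filterS (nbhs_preimage cr n1) => h [hd hb].
  by exists g.
have nN2 : nbhs (g, y) [set q : G * X | N q.1] by exact: (@cvg_fst _ _ (nbhs g) (nbhs y) _ N nN).
have FN : (gy @ \oo) [set q : G * X | ~ N q.1].
  by exists 0%N => // m _; have [] := Hgy m.
by have [q [qn qN]] := cl _ _ FN nN2.
Qed.

Definition nhd (r : R) : set X := [set y | chart_dom M x y /\ ball x0 r (chart M x y)].

(** Write g = (g h^-1) h with [h] in the stabilizer and g h^-1 close to 1, by [near_stab]: the first
    factor is handled by [flow_invariant], the second by [Kf]. *)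
Lemma locally_invariant : exists r, [/\ 0 < r, r <= d & forall g y, nhd r y -> nhd r (act g y) ->
  f (chart M x (act g y)) = f (chart M x y)].
Proof.
have [eta [d1 [eta0 d10 d1d inv]]] := flow_invariant.
have [d2 [d20 d2d1 tube]] := stab_tube H x d10.
have [r r0 near] := near_stab eta0.
have md : Num.min r d2 <= d2 by rewrite ge_min lexx orbT.
have mr : Num.min r d2 <= r by rewrite ge_min lexx.
exists (Num.min r d2); split; [by rewrite lt_min r0|exact: le_trans md (le_trans d2d1 d1d)|].
move=> g y [yd yb] [gd gb].
have [h [hs hd hb]] := near g y yd gd (le_ball mr yb) (le_ball mr gb).
set u := chart M x y in yb *; have yu : ichart M x u = y by rewrite (atlasK aM).
have u2 : ball x0 d2 u := le_ball md yb.
have [ku kb] := tube h u hs u2.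
have [ti rk fE] := inv _ _ hb kb.
have <- : f (kap h u) = f u.
  by apply: Kf => //; [exact: le_ball (le_trans d2d1 d1d) _ u2|exact: le_ball d1d _ kb].
rewrite -fE flowE; congr f.
rewrite /rep (atlasK aG) // -/(rep M M (act h) x x u) rep_ichart // yu -(actM H).
by rewrite -mulgA mulVg mulg1.
Qed.


(** * Extension to the saturation of a small ball *)

Section extension.
Variable r : R.
Hypotheses (r0 : 0 < r) (rd : r <= d)
  (inv : forall g y, nhd r y -> nhd r (act g y) -> f (chart M x (act g y)) = f (chart M x y)).

Definition saturation : set X := [set y | exists g, nhd r (act g y)].
(** Any [g] bringing [y] into the small neighborhood is chosen; local invariance makes the value
    independent of the choice. The default 1 is irrelevant on the saturation. *)
Definition extension y := f (chart M x (act (xget 1%g [set g | nhd r (act g y)]) y)).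

Lemma extensionE g y : nhd r (act g y) -> extension y = f (chart M x (act g y)).
Proof.
move=> gy; rewrite /extension; set h := xget _ _.
have hy : nhd r (act h y) by exact: (xgetPex 1%g (ex_intro (fun g => nhd r (act g y)) g gy)).
have E : act h y = act (h * g^-1)%g (act g y) by rewrite -(actM H) -mulgA mulVg mulg1.
by rewrite E; apply: inv => //; rewrite -E.
Qed.

Lemma saturation_act g y : saturation y -> saturation (act g y).
Proof. by case=> h hy; exists (h * g^-1)%g; rewrite -(actM H) -mulgA mulVg mulg1. Qed.

Lemma extension_act g y : saturation y -> extension (act g y) = extension y.
Proof.
case=> h hy; rewrite (extensionE hy).
have E : act h y = act (h * g^-1)%g (act g y) by rewrite -(actM H) -mulgA mulVg mulg1.
by rewrite E; apply: extensionE; rewrite -E.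
Qed.

Lemma saturation_center : saturation x.
Proof. by exists 1%g; rewrite (act1 H); split; [exact: atlas_center|exact: ballxx]. Qed.

Let od' : open (ball x0 r). Proof. exact: ball_open. Qed.

Section chart_at.
Variables (g : G) (b : X).
Let T := rep M M (act g) b x.
Let D : set V := rdom M M (act g) b x `&` [set u | ball x0 r (T u)].
Let sg := (act_hol H g).1.

Let oR : open (rdom M M (act g) b x). Proof. exact: open_rdom sg.1. Qed.

Let sT : smooth_on (rdom M M (act g) b x) T. Proof. exact: smooth_rep. Qed.

Lemma open_chart_dom : open D.
Proof.
rewrite openE => u [ur ub]; have [cT _] := sT 0%N.
exact: filterI (open_nbhs_nbhs (conj oR ur)) (cT u ur _ (open_nbhs_nbhs (conj od' ub))).
Qed.

Lemma extension_chart u : D u -> extension (ichart M b u) = f (T u).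
Proof. by case=> -[_ ud] ub; apply: extensionE. Qed.

Let TB u : D u -> ball x0 d (T u). Proof. by case=> _; exact: le_ball. Qed.

Let sTD : smooth_on D T. Proof. by apply: smooth_sub sT => u []. Qed.

Lemma smooth_extension_chart : smooth_on D (extension \o ichart M b).
Proof.
apply: (smooth_eq open_chart_dom (f := fun u => f (T u))).
  by move=> u Du; rewrite /= extension_chart.
exact: smooth_comp open_chart_dom od TB sf sTD.
Qed.

Lemma chart_dom_in y : chart_dom M b y -> nhd r (act g y) -> D (chart M b y).
Proof.
move=> yb [gd gb]; split; first exact: rdom_chart.
by rewrite /= /T /rep (atlasK aM).
Qed.

(** Near each point of the saturation the extension is [f] pulled back by a holomorphic
    transformation preserving [om]. *)
Lemma levi_extension u v w : D u -> levi (extension \o ichart M b) u v w = cf b u v w.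
Proof.
move=> Du; rewrite -(coef_at_act H v w Du.1) lf; last exact: TB.
rewrite -(levi_pullback v w open_chart_dom od TB sTD sf _ Du); last first.
  by move=> y z [yr _]; exact: (rep_holomorphic cM z (act_hol H g) yr).
have E p q : 'D_p ('D_q (extension \o ichart M b)) u = 'D_p ('D_q (fun u => f (T u))) u.
  apply: (near_derive p open_chart_dom _ Du) => y Dy.
  by apply: (near_derive q open_chart_dom _ Dy) => z; exact: extension_chart.
exact: (congr2 (fun s t => - 2^-1 * (s - t)) (E _ _) (E _ _)).
Qed.

Lemma derive_extension_field v u : D u -> 'D_(mul_i (field b v u)) (extension \o ichart M b) u =
  2 * mu (ichart M b u) v.
Proof.
move=> Du; apply: etrans (near_derive _ open_chart_dom extension_chart Du) _.
apply: etrans (derive_pullback open_chart_dom od TB sTD sf _ Du) _.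
have E : 'D_(mul_i (field b v u)) T u = mul_i (field x (Ad MG g v) (T u)).
  rewrite (rep_holomorphic cM _ (act_hol H g) Du.1); congr mul_i.
  by rewrite (field_act H (Ad MG g v) Du.1) (AdK H).
apply: etrans (congr1 (fun z => 'D_z f (T u)) E) _; rewrite qf; last exact: TB.
rewrite /T (rep_ichart aM); last exact: Du.1.
by rewrite (momentum_equivariant (hamiltonian_momentum H)) (AdK H).
Qed.

End chart_at.

Lemma open_saturation : open saturation.
Proof.
rewrite openE => y [g [gd gb]].
have c1 : {for y, continuous (act g)} by have [[cg _] _] := act_hol H g; exact: cg.
have n1 : nbhs (act g y) (chart_dom M x `&` (chart M x @^-1` ball x0 r)).
  apply: filterI; first by apply: open_nbhs_nbhs; split=> //; exact: atlas_open.
  by apply: (atlas_continuous aM gd); exact: open_nbhs_nbhs.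
by apply: filterS (nbhs_preimage c1 n1) => z gz; exists g.
Qed.

Lemma smooth_extension : smooth_fun_on M saturation extension.
Proof.
move=> b; apply: smooth_local => _ [y [yb [g gy]] <-].
exists (rdom M M (act g) b x `&` [set u | ball x0 r (rep M M (act g) b x u)]); split.
  exact: chart_dom_in.
exact: smooth_extension_chart.
Qed.

Lemma dcE_real (h : X -> R) y v : dc M h y v = - 2^-1 * 'D_(mul_i v) (h \o ichart M y) (chart M y y).
Proof. by rewrite /dc dcE /= mulNr. Qed.

Lemma ddc_extension y v w : saturation y -> ddc M extension y v w = om y v w.
Proof.
case=> g gy; have yy := atlas_center aM y.
pose D := rdom M M (act g) y x `&` [set u | ball x0 r (rep M M (act g) y x u)].
have oD : open D by exact: open_chart_dom.
have Dy : D (chart M y y) := chart_dom_in yy gy.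
have sE : smooth_on D (extension \o ichart M y) := smooth_extension_chart g y.
(* [dc] at the nearby point [q] is computed in the chart indexed by [q]; the transition to the chart
   indexed by [y] commutes with [mul_i], so the coefficients are derivatives in one fixed chart. *)
have E z u : D u -> Defs.coef1 M (dc M extension) y z u = - 2^-1 * 'D_(mul_i z) (extension \o ichart M y) u.
  move=> Du; have uy : chart_im M y u := Du.1.1.
  rewrite /Defs.coef1 dcE_real; congr (_ * _); set q := ichart M y u.
  have gq : nhd r (act g q) by split; [exact: Du.1.2|exact: Du.2].
  have := derive_real_rep aM aM (mul_i z) (smooth_map_id aM) (rdom_center aM uy)
    (@open_chart_dom g q) (chart_dom_in (atlas_center aM q) gq) (smooth_extension_chart g q).
  by move=> ->; rewrite -(tvecJ cM).
have D1 p z : 'D_p (Defs.coef1 M (dc M extension) y z) (chart M y y) =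
    - 2^-1 * 'D_p ('D_(mul_i z) (extension \o ichart M y)) (chart M y y).
  apply: etrans (near_derive p oD (E z) Dy) _.
  exact: (smooth_deriveZ (- 2^-1) p (smooth_derive (mul_i z) sE) Dy).
rewrite -(coef_at_center H y v w) -(levi_extension v w Dy) /ddc /d1.
have A1 (a b s t : R) : a = - 2^-1 * s -> b = - 2^-1 * t -> a - b = - 2^-1 * (s - t).
  by move=> -> ->; ring.
exact: A1 (D1 _ _) (D1 _ _).
Qed.

Lemma extension_potential : is_invariant_potential M om MG act mu saturation extension.
Proof.
split.
- split; first exact: smooth_extension.
  by move=> y v Yy v0; rewrite ddc_extension //; exact: (kahler_pos K).
- by move=> g y; exact: extension_act.
- by move=> y v w Yy; rewrite ddc_extension.
- move=> v y [g gy]; have yy := atlas_center aM y.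
  rewrite dcE_real; have ic : chart_im M y (chart M y y) := im_chart yy.
  have <- : field y v (chart M y y) = induced_field M MG act v y.
    by have := tvec_field H v ic; rewrite tvec_center // (atlasK aM).
  rewrite (derive_extension_field v (chart_dom_in yy gy)) (atlasK aM) //.
  by move: (mu y v : R) => t; lra.
Qed.

End extension.

End glue.

Theorem theorem3 (R : realType) (n k : nat)
    (X : topologicalType) (M : charts R (n + n) X) (om : form2 R (n + n) X)
    (G : topGroupType) (MG : charts R k G) (act : G -> X -> X)
    (mu : X -> {linear 'rV[R]_k -> R^o})
    (H : hamiltonian_kahler M om MG act mu) (x : X) (hx : zero_level mu x) :
  exists (Y : set X) (rho : X -> R),
    [/\ open Y, Y x, forall g y, Y y -> Y (act g y)
      & is_invariant_potential M om MG act mu Y rho].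
Proof.
have [d [f [d0 dim sf [lf pf qf Kf]]]] := local_invariant_potential H hx.
have [r [r0 rd inv]] := locally_invariant H d0 sf pf Kf.
exists (@saturation R n X M G act x r), (@extension R n X M G act x f r); split.
- exact: (open_saturation H).
- exact: (saturation_center H).
- exact: (saturation_act H).
- exact: (extension_potential H sf lf qf rd inv).
Qed.
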